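(* Let $m, b_0, W_0$ be positive integers with $b_0\leq W_0$ and $\gcd(b_0,W_0)=1$. Let $\psi(x)$ be a polynomial with integer coefficients and positive leading coefficient such that $$ \begin{cases} \psi(1)\text{ or }\psi(0)\text{ is even}&\quad\text{ if }2\mid W_0,\\ \psi(b_0-1)\text{ is even}&\quad\text{ if }2\nmid W_0. \end{cases} $$ Suppose that the set of all positive integers is colored with $m$ colors (i.e. partitioned into $m$ disjoint subsets). Then there exist distinct positive integers $x\neq y$ of the same color and an integer $z\in\Lambda_{b_0,W_0}$ such that $x+y=\psi(z)$.
   Context: For positive integers $b\le W$ with $\gcd(b,W)=1$, $\Lambda_{b,W}=\{x\in\mathbb Z:\ Wx+b \text{ is prime}\}$.
   Formalization: The polynomial ψ is additionally assumed to be nonconstant; for a constant such as ψ = 2 every stated condition holds, but x + y = 2 has no solution in distinct positive integers. *)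

(* Defs.v *)
From mathcomp Require Import all_boot all_order all_algebra.

Set Implicit Arguments.
Unset Strict Implicit.
Unset Printing Implicit Defensive.

Import Order.TTheory GRing.Theory Num.Theory.

Local Open Scope ring_scope.

(* The [x] of [Lambda b W] range over all integers; "prime" is a positive
   rational prime, whence the witness [p : nat]. *)
Definition Lambda (b W : nat) (x : int) : Prop :=
  exists2 p : nat, prime p & W%:Z * x + b%:Z = p%:Z.

(* Main.v *)
(** Put [psi (Q z + z0) = 2 S + 2 E phi z] with [Q] divisible by all small primes and substitute
    [x = S + E x'], [y = S + E y']: one must find [t] with [q t + n0] prime and distinct [x', y']
    of one colour with [x' + y' = 2 phi t].  If there are none, then the normalised number
    [rep n] of monochromatic solutions of [x' + y' = 2 n] is at most [1 / (4 M + 1)] at every [n = phi t] with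
    [q t + n0] prime, so [Phi n = (1 - rep n) ^+ K] is at least [1/2] there, whereas on average over
    all [n <= M] it is small for [K] large: a set of positive density contains a cube
    [a + (corner sums)] of dimension [m + 1], each corner with two directions is half the sum of two
    "edges", and among [m + 1] edges two share a colour.

    To transfer this average to primes, take a Selberg majorant [nu] of the primes [q t + n0] of mean
    value 1.  As [rep] is an absolutely convergent combination of additive characters, it suffices to
    control [nu - 1] and the sequence [phi t] against characters.  Averaging over short boxes, repeated
    Cauchy-Schwarz bounds the correlation of [nu - 1] with polynomial phases by a box norm of [nu - 1],
    which is small by a correlation estimate for linear forms (primes below a power of a logarithm are
    treated by Bonferroni's inequalities, the others by Selberg's weights).  Weyl's inequality shows that
    [phi t] and [phi t + L kk], with [kk] averaged over [kk < A], have nearly the same exponential sums,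
    and the latter sequence covers no [n] twice, hence is dominated by the uniform distribution.
    Finally [nu] has mass on the primes bounded below, infinitely often in the scale, by the
    lower bound of Dirichlet's theorem for [sum (ln p / p)] over [p = n0 mod q].  That bound is obtained
    without complex characters: on functions on [(Z / q)^*] the operator [f |-> sum f(g n) / n] is normal,
    and a nonzero kernel would contain a quadratic character [chi] with [L(1, chi) = 0]. *)
Require Import Defs.
From mathcomp Require Import all_boot all_order all_algebra all_fingroup.
From mathcomp Require Import zify ring lra.
From mathcomp Require Import Rstruct.
From mathcomp Require Import boolp reals topology normedtype derive realfun exp trigo.

Set Implicit Arguments.
Unset Strict Implicit.
Unset Printing Implicit Defensive.

Import Order.TTheory GRing.Theory Num.Theory numFieldNormedType.Exports.

Local Open Scope ring_scope.

(** * Averages over boxes *)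

Section Averages.
Variable R : realFieldType.
Implicit Types (F G : nat -> R).

(** The primes [q t + n0] have density zero, so nothing known about most integers [n] says anything
    about the values [phi t] at primes; the order of the constants decides whether the transfer
    closes. The mass [kap] that the majorant keeps on the primes fixes [del], [K] and [eps], and
    only then does [eps] fix how many small primes must divide [q]. So [kap] may depend on the
    dimension of the boxes alone. This is why [nu] is bounded below by
    [kap * (totient q / q) * harm N] and primes are counted with the inverse factor
    [totient q * harm N]: the dependence on [q] and [N] cancels exactly, and no asymptotics of
    [harm] are needed there. Divisibility of [q] by the small primes makes distinct forms nearly
    independent at every remaining prime. The bound [1 / (4 M + 1)] for [rep] is the diagonal pair
    [x' = y' = n], which [rep] counts. The factor [L] of the shifts clears every denominator that
    Weyl's inequality can produce, and injectivity of [phi] mod [L] keeps the shifted values apart.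
    A single good scale yields the contradiction, so primes need not be frequent at every scale. *)

Definition avg (n : nat) F : R := (\sum_(i < n) F i) / n%:R.

Lemma eq_avg n F G : (forall i, (i < n)%N -> F i = G i) -> avg n F = avg n G.
Proof. by move=> FG; rewrite /avg; congr (_ / _); apply: eq_bigr => i _; apply: FG. Qed.

Lemma avgD n F G : avg n (fun i => F i + G i) = avg n F + avg n G.
Proof. by rewrite /avg big_split mulrDl. Qed.

Lemma avgN n F : avg n (fun i => - F i) = - avg n F.
Proof. by rewrite /avg sumrN mulNr. Qed.

Lemma avgB n F G : avg n (fun i => F i - G i) = avg n F - avg n G.
Proof. by rewrite avgD avgN. Qed.

Lemma avgZ n c F : avg n (fun i => c * F i) = c * avg n F.
Proof. by rewrite /avg -mulr_sumr mulrA. Qed.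

Lemma avg_sum n (I : Type) (r : seq I) (P : pred I) (F : I -> nat -> R) :
  avg n (fun i => \sum_(j <- r | P j) F j i) = \sum_(j <- r | P j) avg n (F j).
Proof. by rewrite /avg exchange_big /= mulr_suml. Qed.

Lemma avg_exchange n m (F : nat -> nat -> R) :
  avg n (fun i => avg m (F i)) = avg m (fun j => avg n (fun i => F i j)).
Proof.
rewrite /avg -!mulr_suml exchange_big /= -!mulrA; congr (_ * _).
exact: mulrC.
Qed.

Lemma avg_const n c : (0 < n)%N -> avg n (fun _ => c) = c.
Proof.
by move=> n0; rewrite /avg sumr_const card_ord -[c *+ n]mulr_natr mulfK // pnatr_eq0 -lt0n.
Qed.

Lemma le_avg n F G : (forall i, (i < n)%N -> F i <= G i) -> avg n F <= avg n G.
Proof.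
by move=> FG; rewrite /avg ler_wpM2r ?invr_ge0 // ler_sum // => i _; apply: FG.
Qed.

Lemma avg_ge0 n F : (forall i, (i < n)%N -> 0 <= F i) -> 0 <= avg n F.
Proof. by move=> F0; rewrite divr_ge0 // sumr_ge0 // => i _; apply: F0. Qed.

Lemma avg_le1 n F : (forall i, (i < n)%N -> F i <= 1) -> avg n F <= 1.
Proof.
move=> F1; case: n F1 => [|n] F1; first by rewrite /avg big_ord0 mul0r.
by rewrite -[leRHS](@avg_const n.+1) //; apply: le_avg.
Qed.

Lemma ler_norm_avg n F : `|avg n F| <= avg n (fun i => `|F i|).
Proof.
by rewrite /avg normrM [`|_^-1|]ger0_norm ?invr_ge0 // ler_wpM2r ?invr_ge0 // ler_norm_sum.
Qed.

(** Nonnegativity of the variance about the mean [a]. *)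
Lemma sqr_avg n F : avg n F ^+ 2 <= avg n (fun i => F i ^+ 2).
Proof.
case: n => [|n]; first by rewrite /avg big_ord0 mul0r expr0n big_ord0 mul0r.
set a := avg _ F.
have : 0 <= avg n.+1 (fun i => (F i - a) ^+ 2) by apply: avg_ge0 => i _; rewrite sqr_ge0.
have -> : avg n.+1 (fun i => (F i - a) ^+ 2) =
   avg n.+1 (fun i => F i ^+ 2) - (2 * a) * avg n.+1 F + a ^+ 2.
  rewrite -avgZ -avgB -[X in _ + X](@avg_const n.+1) // -avgD.
  by apply: eq_avg => i _; ring.
rewrite -/a; set b := avg _ _ => h; nra.
Qed.

(** Iterated Cauchy-Schwarz: only exponents that are powers of 2 occur, one squaring per difference
    taken. *)
Lemma expn2_avg k n F : (forall i, (i < n)%N -> 0 <= F i) ->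
  avg n F ^+ (2 ^ k) <= avg n (fun i => F i ^+ (2 ^ k)).
Proof.
move=> F0; elim: k => [|k IH]; first by rewrite expn0 expr1.
rewrite expnS mulnC exprM; apply: le_trans (_ : avg n (fun i => F i ^+ (2 ^ k)) ^+ 2 <= _).
  by rewrite ler_pXn2r // nnegrE ?exprn_ge0 ?avg_ge0 // => i /F0 ?; rewrite exprn_ge0.
apply: le_trans (sqr_avg _ _) _; apply: le_avg => i _.
by rewrite -exprM.
Qed.

(** A box is its list of side lengths and its points are lists, so that boxes of any dimension, with
    unequal sides, are treated by recursion on [s]. *)
Fixpoint Avg (s : seq nat) (F : seq nat -> R) : R :=
  if s is n :: s' then avg n (fun x => Avg s' (fun l => F (x :: l))) else F [::].

Fixpoint inbox (s l : seq nat) : bool :=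
  match s, l with
  | [::], [::] => true
  | n :: s', x :: l' => (x < n)%N && inbox s' l'
  | _, _ => false
  end.

Lemma eq_Avg s (F G : seq nat -> R) : (forall l, inbox s l -> F l = G l) -> Avg s F = Avg s G.
Proof.
elim: s F G => [|n s IH] F G FG /=; first exact: FG.
by apply: eq_avg => x xn; apply: IH => l sl; apply: FG => /=; rewrite xn.
Qed.

Lemma AvgD s (F G : seq nat -> R) : Avg s (fun l => F l + G l) = Avg s F + Avg s G.
Proof. by elim: s F G => //= n s IH F G; rewrite -avgD; apply: eq_avg => i _; rewrite IH. Qed.

Lemma AvgN s (F : seq nat -> R) : Avg s (fun l => - F l) = - Avg s F.
Proof. by elim: s F => //= n s IH F; rewrite -avgN; apply: eq_avg => i _; rewrite IH. Qed.

Lemma AvgB s (F G : seq nat -> R) : Avg s (fun l => F l - G l) = Avg s F - Avg s G.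
Proof. by rewrite AvgD AvgN. Qed.

Lemma AvgZ s c (F : seq nat -> R) : Avg s (fun l => c * F l) = c * Avg s F.
Proof. by elim: s F => //= n s IH F; rewrite -avgZ; apply: eq_avg => i _; rewrite IH. Qed.

Lemma Avg_sum s (I : Type) (r : seq I) (P : pred I) (F : I -> seq nat -> R) :
  Avg s (fun l => \sum_(j <- r | P j) F j l) = \sum_(j <- r | P j) Avg s (F j).
Proof.
elim: s F => //= n s IH F; rewrite -avg_sum; apply: eq_avg => i _.
by rewrite IH.
Qed.

Lemma Avg_const s c : all (leq 1) s -> Avg s (fun _ => c) = c.
Proof.
elim: s => //= n s IH /andP[n0 /IH {}IH].
by rewrite -[RHS](@avg_const n) //; apply: eq_avg.
Qed.

Lemma le_Avg s (F G : seq nat -> R) : (forall l, inbox s l -> F l <= G l) -> Avg s F <= Avg s G.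
Proof.
elim: s F G => [|n s IH] F G FG /=; first exact: FG.
by apply: le_avg => x xn; apply: IH => l sl; apply: FG => /=; rewrite xn.
Qed.

Lemma Avg_ge0 s (F : seq nat -> R) : (forall l, inbox s l -> 0 <= F l) -> 0 <= Avg s F.
Proof.
elim: s F => [|n s IH] F FG /=; first exact: FG.
by apply: avg_ge0 => x xn; apply: IH => l sl; apply: FG => /=; rewrite xn.
Qed.

Lemma Avg_le1 s (F : seq nat -> R) : (forall l, inbox s l -> F l <= 1) -> Avg s F <= 1.
Proof.
elim: s F => [|n s IH] F FG /=; first exact: FG.
by apply: avg_le1 => x xn; apply: IH => l sl; apply: FG => /=; rewrite xn.
Qed.

Lemma ler_norm_Avg s (F : seq nat -> R) : `|Avg s F| <= Avg s (fun l => `|F l|).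
Proof.
elim: s F => //= n s IH F; apply: le_trans (ler_norm_avg _ _) _.
exact: le_avg.
Qed.

End Averages.

(** * Equidistribution of periodic functions in boxes *)

Section Equidistribution.
Variable R : realFieldType.
Implicit Types (F G : nat -> R).

Lemma coprime_prod_seq p (D : seq nat) :
  all (fun d => coprime d p) D -> coprime (\prod_(d <- D) d)%N p.
Proof.
elim: D => [|d D IH] /=; first by rewrite big_nil coprime1n.
by case/andP=> dp /IH h; rewrite big_cons coprimeMl dp.
Qed.

Lemma coprime_prod_primes p (D : seq nat) :
  prime p -> p \notin D -> all prime D -> coprime (\prod_(d <- D) d)%N p.
Proof.
move=> pp pD Dp; apply: coprime_prod_seq; apply/allP => d dD.
rewrite coprime_sym prime_coprime // dvdn_prime2 ?(allP Dp d dD) //.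
by apply: contraNneq pD => ->.
Qed.

Lemma avg_perm p a m F : (0 < p)%N -> coprime m p -> (forall x, F (x %% p)%N = F x) ->
  avg p (fun j => F (a + m * j)%N) = avg p F.
Proof.
case: p => // p _ cmp Fp; rewrite /avg; congr (_ / _).
pose h (j : 'I_p.+1) : 'I_p.+1 := inord ((a + m * j) %% p.+1)%N.
have hE j : h j = ((a + m * j) %% p.+1)%N :> nat by rewrite inordK ?ltn_pmod.
have hinj : injective h.
  move=> i j /(congr1 val); rewrite /= !hE => /eqP.
  rewrite eqn_modDl => /eqP e; apply: val_inj => /=.
  have : (i == j %[mod p.+1])%N.
    move/eqP: e; wlog le : i j / (i <= j)%N.
      by move=> W; case/orP: (leq_total i j) => [|ji]; [exact: W|rewrite eq_sym => /(W _ _ ji); rewrite eq_sym].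
    rewrite eq_sym eqn_mod_dvd ?leq_mul2l ?le ?orbT // -mulnBr Gauss_dvdr ?(coprime_sym _ m) //.
    by rewrite eq_sym eqn_mod_dvd.
  by rewrite !modn_small // => /eqP.
rewrite [RHS](reindex_inj hinj) /=; apply: eq_bigr => j _.
by rewrite hE Fp.
Qed.

(** Write the argument as [a + m j]: [F] sees only [a], while for fixed [a] the values [a + m j] run
    through all residues mod [p]. *)
Lemma avg_crt m p F G : (0 < m)%N -> (0 < p)%N -> coprime m p ->
  (forall x, F (x %% m)%N = F x) -> (forall x, G (x %% p)%N = G x) ->
  avg (m * p) (fun x => F x * G x) = avg m F * avg p G.
Proof.
move=> m0 p0 cmp Fm Gp.
have E : avg (m * p) (fun x => F x * G x) =
    avg p (fun j => avg m (fun a => F a * G (a + m * j)%N)).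
  rewrite /avg -mulr_suml -mulrA -invfM -natrM; congr (_ / _).
  rewrite -(big_mkord xpredT (fun x => F x * G x)) mulnC big_nat_mul big_mkord.
  apply: eq_bigr => j _.
  rewrite -{1}[(j * m)%N]add0n big_addn mulSn addnK big_mkord; apply: eq_bigr => a _.
  by rewrite -[F (a + _)%N]Fm addnC modnMDl Fm addnC [(m * j)%N]mulnC.
rewrite E avg_exchange.
rewrite (@eq_avg _ _ _ (fun a => avg p G * F a)) ?avgZ 1?mulrC // => a _.
by rewrite avgZ (avg_perm a p0 cmp Gp) mulrC.
Qed.

Lemma avg_prod_primes (D : seq nat) (f : nat -> nat -> R) :
  all prime D -> uniq D -> (forall p x, p \in D -> f p (x %% p)%N = f p x) ->
  avg (\prod_(p <- D) p) (fun x => \prod_(p <- D) f p x) = \prod_(p <- D) avg p (f p).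
Proof.
elim: D => [|p D IH] /=.
  by rewrite !big_nil (@eq_avg _ _ _ (fun=> 1)) ?avg_const // => i _; rewrite big_nil.
case/andP=> pp Dp /andP[pD uD] fper.
have Dper d x : d \in D -> f d (x %% d)%N = f d x by move=> dD; apply: fper; rewrite inE dD orbT.
rewrite !big_cons -IH // mulrC mulnC -avg_crt //.
- by apply: eq_avg => x _; rewrite big_cons mulrC.
- by rewrite big_seq; apply: prodn_cond_gt0 => d dD; apply: prime_gt0; apply: (allP Dp).
- exact: prime_gt0.
- exact: coprime_prod_primes.
- move=> x; apply: eq_big_seq => d dD.
  rewrite -[RHS]Dper // -[LHS]Dper // modn_dvdm //.
  by rewrite (big_rem d) //= dvdn_mulr.
- by move=> x; apply: fper; rewrite inE eqxx.
Qed.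

(** With [S = t m + r] the [t] full periods have mean exactly [avg m F]; only the last [r < m] terms
    cause an error. *)
Lemma avg_period S m F : (0 < m)%N -> (0 < S)%N ->
  (forall x, F (x %% m)%N = F x) -> (forall x, 0 <= F x <= 1) ->
  `|avg S F - avg m F| <= m%:R / S%:R.
Proof.
move=> m0 S0 Fm F01.
have sumM t r : \sum_(x < t * m + r) F x = t%:R * (\sum_(x < m) F x) + \sum_(x < r) F x.
  rewrite -(big_mkord xpredT F) (@big_cat_nat _ _ _ (t * m)) ?leq_addr //=; congr (_ + _).
    rewrite big_nat_mul big_mkord -[t%:R]mulr1 -[X in _ * X * _](@avg_const R 1 1) //.
    rewrite avg_const // mulr1 mulr_natl -[X in _ *+ X]card_ord -sumr_const.
    apply: eq_bigr => j _; rewrite -{1}[(j * m)%N]add0n big_addn mulSn addnK big_mkord.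
    by apply: eq_bigr => a _; rewrite -Fm addnC modnMDl Fm.
  rewrite -{1}[(t * m)%N]add0n big_addn addKn big_mkord.
  by apply: eq_bigr => a _; rewrite -Fm addnC modnMDl Fm.
have S0R : 0 < S%:R :> R by rewrite ltr0n.
have m0R : 0 < m%:R :> R by rewrite ltr0n.
pose r := (S %% m)%N; pose t := (S %/ m)%N.
have SE : S = (t * m + r)%N by exact: divn_eq.
set A := avg m F.
have Am : \sum_(x < m) F x = m%:R * A by rewrite /A /avg mulrCA mulfV ?mulr1 // gt_eqF.
have A01 : 0 <= A <= 1.
  by rewrite avg_ge0 ?avg_le1 // => i _; case/andP: (F01 i).
have B01 : 0 <= \sum_(x < r) F x <= r%:R.
  rewrite sumr_ge0 /=; last by move=> i _; case/andP: (F01 i).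
  rewrite -[X in _ <= X%:R]card_ord -sumr_const ler_sum // => i _; by case/andP: (F01 i).
have -> : avg S F - A = (\sum_(x < r) F x - r%:R * A) / S%:R.
  have e := sumM t r; rewrite -SE Am in e.
  have SR : S%:R = t%:R * m%:R + r%:R :> R by rewrite {1}SE natrD natrM.
  apply: (mulIf (lt0r_neq0 S0R)); rewrite /avg e mulrBl !mulfVK ?lt0r_neq0 // SR; ring.
rewrite normrM [`|_^-1|]ger0_norm ?invr_ge0 // ler_wpM2r ?invr_ge0 //.
have rm : r%:R <= m%:R :> R by rewrite ler_nat ltnW // ltn_pmod.
have r0 : 0 <= r%:R :> R by [].
by rewrite ler_norml; apply/andP; split; nra.
Qed.

Definition periodicL (p : nat) (f : seq nat -> R) :=
  forall l l', map (modn^~ p) l = map (modn^~ p) l' -> f l = f l'.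

(* Product of local densities up to [m / n_i] per side of the box. *)
Lemma Avg_prod_primes (D : seq nat) (s : seq nat) (f : nat -> seq nat -> R) :
  all prime D -> uniq D -> all (leq 1) s ->
  (forall p, p \in D -> periodicL p (f p)) -> (forall p l, 0 <= f p l <= 1) ->
  `|Avg s (fun l => \prod_(p <- D) f p l) - \prod_(p <- D) Avg (nseq (size s) p) (f p)|
  <= \sum_(n <- s) (\prod_(p <- D) p)%:R / n%:R.
Proof.
move=> Dp uD; elim: s f => [|n s IH] f /=; first by rewrite subrr normr0 big_nil.
case/andP=> n0 s1 fper f01.
set m := (\prod_(p <- D) p)%N.
have m0 : (0 < m)%N.
  by rewrite /m big_seq; apply: prodn_cond_gt0 => d dD; apply: prime_gt0; apply: (allP Dp).
(* Averaging out the other coordinates leaves a function of the first one that is still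
   [p]-periodic, so the product formula in one variable applies to it; the induction hypothesis
   treats the other coordinates for each fixed [x]. *)
pose g p x := Avg (nseq (size s) p) (fun l => f p (x :: l)).
have gper p x : p \in D -> g p (x %% p)%N = g p x.
  by move=> pD; apply: eq_Avg => l _; apply: fper => //=; rewrite modn_mod.
have g01 p x : 0 <= g p x <= 1.
  by rewrite Avg_ge0 ?Avg_le1 // => l _; case/andP: (f01 p (x :: l)).
have P01 x : 0 <= \prod_(p <- D) g p x <= 1.
  rewrite prodr_ge0 /=; last by move=> p _; case/andP: (g01 p x).
  by apply: prodr_ile1 => p _; rewrite g01.
have Pper x : \prod_(p <- D) g p (x %% m)%N = \prod_(p <- D) g p x.
  apply: eq_big_seq => d dD; rewrite -[RHS]gper // -[LHS]gper // modn_dvdm //.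
  by rewrite /m (big_rem d) //= dvdn_mulr.
rewrite big_cons -(avg_prod_primes Dp uD gper) -/m.
set A := avg n _; set B := avg m _; set C := avg n (fun x => \prod_(p <- D) g p x).
have -> : A - B = (A - C) + (C - B) by ring.
apply: le_trans (ler_normD _ _) _; rewrite addrC; apply: lerD.
  exact: avg_period.
rewrite /A /C -avgB; apply: le_trans (ler_norm_avg _ _) _.
rewrite -[leRHS](@avg_const _ n) //; apply: le_avg => x _.
apply: IH => // p; first by move=> pD l l' ll'; apply: fper => //=; rewrite ll'.
Qed.

End Equidistribution.

(** * Truncated inclusion-exclusion *)

Section SubsetSums.
Variables (R : realFieldType) (I : finType).
Implicit Types (P E S D : {set I}) (x : I -> R).

Lemma sum_subsetU1 i P (F : {set I} -> R) : i \notin P ->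
  \sum_(E : {set I} | E \subset i |: P) F E =
  \sum_(E : {set I} | E \subset P) (F E + F (i |: E)).
Proof.
move=> iP; rewrite big_split /= (bigID (fun E : {set I} => i \in E)) /= addrC; congr (_ + _).
  apply: eq_bigl => E; apply/andP/idP => [[EP iE]|EP].
    apply/subsetP => j jE; move: (subsetP EP j jE); rewrite !inE => /orP[/eqP ji|//].
    by rewrite -ji jE in iE.
  split; first by apply: subset_trans EP _; apply: subsetUr.
  by apply: contra iP => /(subsetP EP).
rewrite (reindex_onto (fun E => i |: E) (fun E => E :\ i)) /=; last first.
  by move=> E /andP[_ iE]; rewrite setD1K.
apply: eq_bigl => E; rewrite setU11 andbT.
apply/andP/idP => [[EP /eqP e]|EP].
  have iE : i \notin E by rewrite -e !inE eqxx.
  apply/subsetP => j jE; have := subsetP EP j; rewrite !inE jE orbT => /(_ isT) /orP[/eqP ji|//].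
  by rewrite -ji jE in iE.
split; first exact: setUS.
by rewrite setU1K //; apply: contra iP => /(subsetP EP).
Qed.

Lemma set_ind_U1 (K : {set I} -> Prop) :
  K set0 -> (forall i P, i \notin P -> K P -> K (i |: P)) -> forall P, K P.
Proof.
move=> K0 KU P; move: {2}#|P| (erefl #|P|) => n; elim: n P => [|n IH] P.
  by move/eqP; rewrite cards_eq0 => /eqP->.
move=> cP; have /card_gt0P [i iP] : (0 < #|P|)%N by rewrite cP.
rewrite -(setD1K iP); apply: KU; first by rewrite !inE eqxx.
by apply: IH; move: cP; rewrite (cardsD1 i) iP => -[].
Qed.

Lemma prodD1_sum x P :
  \prod_(i in P) (1 + x i) = \sum_(E : {set I} | E \subset P) \prod_(i in E) x i.
Proof.
elim/set_ind_U1: P => [|i P iP IH].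
  rewrite big_set0 (big_pred1 set0) ?big_set0 // => E.
  by rewrite subset0.
rewrite big_setU1 //= IH sum_subsetU1 // big_split /= mulrDl mul1r; congr (_ + _).
rewrite mulr_sumr; apply: eq_bigr => E EP; rewrite big_setU1 //.
by apply: contra iP => /(subsetP EP).
Qed.

Definition esymm x s P : R := \sum_(E : {set I} | (E \subset P) && (#|E| == s)) \prod_(i in E) x i.
(** Inclusion-exclusion for [\prod (1 - x i)], cut off at subsets with fewer than [s] elements. *)
Definition brun x s P : R :=
  \sum_(E : {set I} | (E \subset P) && (#|E| < s)%N) \prod_(i in E) (- x i).

Lemma esymm0 x P : esymm x 0 P = 1.
Proof.
rewrite /esymm (big_pred1 set0) ?big_set0 // => E; rewrite cards_eq0.
by apply/andP/eqP => [[_ /eqP]//|->]; rewrite sub0set.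
Qed.

Lemma esymmS x s i P : i \notin P -> esymm x s.+1 (i |: P) = esymm x s.+1 P + x i * esymm x s P.
Proof.
move=> iP; rewrite /esymm.
rewrite big_mkcondr /= !big_mkcondr sum_subsetU1 // big_split /=; congr (_ + _).
rewrite mulr_sumr; apply: eq_bigr => E EP.
have iE : i \notin E by apply: contra iP => /(subsetP EP).
by rewrite cardsU1 iE eqSS; case: ifP => _; rewrite ?mulr0 // big_setU1.
Qed.

Lemma brunS x s i P : i \notin P -> brun x s.+1 (i |: P) = brun x s.+1 P - x i * brun x s P.
Proof.
move=> iP; rewrite /brun.
rewrite big_mkcondr /= !big_mkcondr sum_subsetU1 // big_split /=; congr (_ + _).
rewrite mulr_sumr -sumrN; apply: eq_bigr => E EP.
have iE : i \notin E by apply: contra iP => /(subsetP EP).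
by rewrite cardsU1 iE ltnS; case: ifP => _; rewrite ?mulr0 ?oppr0 // big_setU1 //= mulNr.
Qed.

Lemma esymm_ge0 x s P : (forall i, 0 <= x i) -> 0 <= esymm x s P.
Proof. by move=> x0; apply: sumr_ge0 => E _; apply: prodr_ge0. Qed.

(* For [x] an indicator function this is Brun's pure sieve. *)
Lemma bonferroni x s P : (forall i, 0 <= x i <= 1) ->
  `|\prod_(i in P) (1 - x i) - brun x s P| <= esymm x s P.
Proof.
move=> x01.
have x0 i : 0 <= x i by case/andP: (x01 i).
have x1 i : x i <= 1 by case/andP: (x01 i).
(* The sign has to be carried through the induction: passing from [P] to [i |: P] adds the estimates
   at levels [s] and [s.+1], whose errors alternate in sign. *)
suff H : forall s, 0 <= (-1) ^+ s * (\prod_(i in P) (1 - x i) - brun x s P) <= esymm x s P.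
  case/andP: (H s) => h1 h2; rewrite -[X in `|X|](signrMK s) normrM.
  by rewrite normrX normrN1 expr1n mul1r ger0_norm.
have prod01 E : 0 <= \prod_(i in E) (1 - x i) <= 1.
  rewrite prodr_ge0 /=; last by move=> i _; rewrite subr_ge0.
  by apply: prodr_ile1 => i _; rewrite subr_ge0 x1 lerBlDr lerDl x0.
have B0 E : brun x 0 E = 0 by rewrite /brun big_pred0 // => E'; rewrite ltn0 andbF.
elim/set_ind_U1: P => [|i P iP IH] {}s.
  case: s => [|s]; first by rewrite B0 subr0 expr0 mul1r esymm0 prod01.
  rewrite big_set0 /brun (big_pred1 set0) ?big_set0 ?subrr ?mulr0 ?lexx ?esymm_ge0 //.
  by move=> E; rewrite subset0 /=; case: eqP => // ->; rewrite cards0.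
case: s => [|s]; first by rewrite B0 subr0 expr0 mul1r esymm0 prod01.
rewrite big_setU1 //= brunS // esymmS //.
have /andP[a1 a2] := IH s; have /andP[b1 b2] := IH s.+1.
move: a1 a2 b1 b2; set Pi := \prod_(_ in _) _; set b := brun _ _ _; set b' := brun _ _ _.
set e := esymm _ _ _; set e' := esymm _ _ _ => a1 a2 b1 b2.
have -> : (-1) ^+ s.+1 * ((1 - x i) * Pi - (b' - x i * b)) =
  (-1) ^+ s.+1 * (Pi - b') + x i * ((-1) ^+ s * (Pi - b)) by rewrite exprS; ring.
have h1 := mulr_ge0 (x0 i) a1; have h2 := ler_wpM2l (x0 i) a2.
by apply/andP; split; [exact: addr_ge0|exact: lerD].
Qed.

Lemma exprD_ge (a b : R) n : 0 <= a -> 0 <= b -> a ^+ n.+1 + n.+1%:R * b * a ^+ n <= (a + b) ^+ n.+1.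
Proof.
move=> a0 b0; elim: n => [|n IH]; first by rewrite !expr1 expr0; lra.
rewrite [leRHS]exprSr; apply: le_trans (ler_wpM2r _ IH); last exact: addr_ge0.
have h1 := exprn_ge0 n a0; rewrite !exprSr -!natr1.
have : 0 <= n%:R :> R by [].
move: (a ^+ n) h1 (n%:R) => t t0 m m0.
rewrite -subr_ge0; set X := (X in 0 <= X).
have -> : X = (m + 1) * b * b * t by rewrite /X; ring.
by rewrite !mulr_ge0 // addr_ge0.
Qed.

(** Each product over an [s]-element set occurs [s!] times in the expanded power; in the induction
    the new element is absorbed by the first two terms of the binomial expansion, [exprD_ge]. *)
Lemma esymm_le x s P : (forall i, 0 <= x i) -> esymm x s P <= (\sum_(i in P) x i) ^+ s / s`!%:R.
Proof.
move=> x0; elim/set_ind_U1: P s => [|i P iP IH] [|s].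
- by rewrite esymm0 expr0 fact0 divr1.
- rewrite big_set0 expr0n mul0r /esymm big_pred0 // => E.
  by rewrite subset0; case: eqP => // ->; rewrite cards0.
- by rewrite esymm0 expr0 fact0 divr1.
rewrite esymmS // big_setU1 //=.
apply: le_trans (lerD (IH s.+1) (ler_wpM2l (x0 i) (IH s))) _.
set a := \sum_(_ in _) _; have a0 : 0 <= a by apply: sumr_ge0.
rewrite [x i + a]addrC; have := exprD_ge s a0 (x0 i).
have f0 : 0 < (s.+1)`!%:R :> R by rewrite ltr0n fact_gt0.
have f0' : 0 < s`!%:R :> R by rewrite ltr0n fact_gt0.
move=> h; rewrite ler_pdivlMr //; apply: le_trans h.
rewrite mulrDl divfK ?gt_eqF // lerD2l factS natrM.
by rewrite le_eqVlt; apply/orP; left; apply/eqP; field; rewrite gt_eqF.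
Qed.

Lemma prod1B_ge x P : (forall i, i \in P -> 0 <= x i <= 1) ->
  1 - \sum_(i in P) x i <= \prod_(i in P) (1 - x i) .
Proof.
elim/set_ind_U1: P => [|i P iP IH] x01; first by rewrite !big_set0 subr0.
rewrite !big_setU1 //=.
have /IH h : forall i, i \in P -> 0 <= x i <= 1 by move=> j jP; apply: x01; rewrite !inE jP orbT.
have /andP[xi0 xi1] := x01 i (setU11 _ _).
have S0 : 0 <= \sum_(j in P) x j.
  by apply: sumr_ge0 => j jP; have /andP[] := x01 j (setU1r _ jP).
have P1 : \prod_(j in P) (1 - x j) <= 1.
  apply: prodr_ile1 => j jP; have /andP[y0 y1] := x01 j (setU1r _ jP).
  by rewrite subr_ge0 y1 lerBlDr lerDl.
nra.
Qed.

(** Moebius inversion in the lattice of subsets: toggling an element of [S' :\: S] cancels the terms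
    in pairs. *)
Lemma sum_sign_between S S' : S \subset S' ->
  \sum_(D : {set I} | D \subset S') (if S \subset D then (-1) ^+ #|D| else 0)
  = (if S == S' then (-1) ^+ #|S| else 0) :> R.
Proof.
move=> SS'; case: eqVneq => [<-|ne].
  rewrite (bigD1 S) //= subxx big1 ?addr0 // => D /andP[DS nD].
  by case: ifP => // SD; rewrite eqEsubset DS SD in nD.
have /subsetPn [i iS' iS] : ~~ (S' \subset S).
  by apply: contra ne => h; rewrite eqEsubset SS' h.
rewrite -(setD1K iS') sum_subsetU1 ?setD11 // big1 // => D DS.
have iD : i \notin D by apply/negP => /(subsetP DS); rewrite setD11.
have -> : (S \subset i |: D) = (S \subset D).
  apply/idP/idP => h; last by apply: subset_trans h (subsetUr _ _).
  apply/subsetP => j jS; move: (subsetP h j jS); rewrite !inE => /orP[/eqP ji|//].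
  by rewrite -ji jS in iS.
by case: ifP; rewrite ?addr0 // cardsU1 iD exprS mulN1r subrr.
Qed.

End SubsetSums.

(** * Square-free numbers as sets of primes *)

Section PrimeSets.
Variables (R : realFieldType) (Y : nat).
Implicit Types (U D E S Q : {set 'I_Y}).

Definition harm (n : nat) : R := \sum_(i < n) i.+1%:R^-1.

Lemma harm_ge0 n : 0 <= harm n.
Proof. by apply: sumr_ge0 => i _; rewrite invr_ge0. Qed.

Lemma harm_le m n : (m <= n)%N -> harm m <= harm n.
Proof.
move=> /subnKC <-; rewrite /harm big_split_ord /= lerDl.
by apply: sumr_ge0 => i _; rewrite invr_ge0.
Qed.

Lemma harm_ge1 n : (0 < n)%N -> 1 <= harm n.
Proof. by move=> /harm_le; apply: le_trans; rewrite /harm big_ord1 invr1. Qed.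

(** A square-free number is represented by the set of its prime factors below [Y]; lcm, gcd and
    divisibility become union, intersection and inclusion. *)
Definition pr U : nat := (\prod_(p in U) p)%N.

Definition prset Q := [forall p in Q, prime p].

Lemma prsetP Q p : prset Q -> p \in Q -> prime p.
Proof. by move/forall_inP; apply. Qed.

Lemma prsetS Q U : prset Q -> U \subset Q -> prset U.
Proof. by move=> /forall_inP h UQ; apply/forall_inP => p /(subsetP UQ); apply: h. Qed.

Lemma pr_gt0 U : prset U -> (0 < pr U)%N.
Proof. by move=> hU; apply: prodn_cond_gt0 => p pU; apply: prime_gt0; apply: prsetP hU pU. Qed.

Lemma prU D E : [disjoint D & E] -> pr (D :|: E) = (pr D * pr E)%N.
Proof. by move=> dDE; rewrite /pr -bigU //; apply: eq_bigl => i; rewrite !inE. Qed.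

Lemma pr0 : pr set0 = 1%N.
Proof. by rewrite /pr big_set0. Qed.

Lemma dvdn_pr U q : prset U -> prime q -> (q %| pr U)%N = [exists p in U, (p : nat) == q].
Proof.
move=> hU pq; apply/idP/exists_inP => [|[p pU /eqP<-]]; last first.
  by rewrite /pr (bigD1 p) //= dvdn_mulr.
rewrite /pr; elim/big_ind: _ => [|a b Ha Hb|p pU].
- by rewrite dvdn1 => /eqP q1; rewrite q1 in pq.
- by rewrite Euclid_dvdM // => /orP[/Ha|/Hb].
by rewrite dvdn_prime2 ?(prsetP hU) // => /eqP ->; exists p.
Qed.

Lemma pr_inj U V : prset U -> prset V -> pr U = pr V -> U = V.
Proof.
move=> hU hV e; apply/setP => p; apply/idP/idP => h.
  have pp := prsetP hU h; have : (p %| pr V)%N by rewrite -e dvdn_pr //; apply/exists_inP; exists p.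
  by rewrite dvdn_pr // => /exists_inP [p' p'V /eqP/val_inj <-].
have pp := prsetP hV h; have : (p %| pr U)%N by rewrite e dvdn_pr //; apply/exists_inP; exists p.
by rewrite dvdn_pr // => /exists_inP [p' p'U /eqP/val_inj <-].
Qed.

(** Unique factorisation: distinct sets give distinct integers [pr U <= X], so the sum is a part of
    the harmonic sum. *)
Lemma sum_inv_pr Q X : prset Q ->
  \sum_(U : {set 'I_Y} | (U \subset Q) && (pr U <= X)%N) (pr U)%:R^-1 <= harm X.
Proof.
move=> hQ; case: X => [|X].
  rewrite big_pred0 ?harm_ge0 // => U; apply/negP => /andP[UQ].
  by rewrite leqn0 => /eqP e; have := pr_gt0 (prsetS hQ UQ); rewrite e.
pose A := [set U : {set 'I_Y} | (U \subset Q) && (pr U <= X.+1)%N].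
pose h U : 'I_X.+1 := inord (pr U).-1.
have hE U : U \in A -> (h U).+1 = pr U :> nat.
  rewrite inE => /andP[UQ le]; have U0 := pr_gt0 (prsetS hQ UQ).
  by rewrite inordK prednK.
have hinj : {in A &, injective h}.
  move=> U V UA VA e; have e' : pr U = pr V by rewrite -hE // -hE // e.
  move: UA VA; rewrite !inE => /andP[UQ _] /andP[VQ _].
  by apply: pr_inj e'; apply: prsetS hQ _.
have -> : (\sum_(U : {set 'I_Y} | (U \subset Q) && (pr U <= X.+1)%N) (pr U)%:R^-1)
    = \sum_(U in A) (h U).+1%:R^-1 :> R.
  by apply: eq_big => U; [rewrite inE|move=> hU; rewrite hE // inE].
rewrite -(big_imset (fun i : 'I_X.+1 => i.+1%:R^-1)) //= /harm.
rewrite [leRHS](bigID (mem (h @: A))) /= lerDl.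
by apply: sumr_ge0 => i _; rewrite invr_ge0.
Qed.

Lemma subsetUD D U : D \subset U -> D :|: (U :\: D) = U.
Proof.
move=> DU; apply/setP => x; rewrite !inE; case: (boolP (x \in D)) => //= xD.
by rewrite (subsetP DU).
Qed.

Lemma sum_subset_pairs Q (F : {set 'I_Y} -> {set 'I_Y} -> R) :
  \sum_(U : {set 'I_Y} | U \subset Q) \sum_(D : {set 'I_Y} | D \subset U) F D (U :\: D)
  = \sum_(D : {set 'I_Y} | D \subset Q) \sum_(E : {set 'I_Y} | (E \subset Q) && [disjoint D & E]) F D E.
Proof.
rewrite (exchange_big_dep (fun D : {set 'I_Y} => D \subset Q)) /=; last first.
  by move=> U D UQ DU; apply: subset_trans UQ.
apply: eq_bigr => D DQ.
rewrite (reindex_onto (fun E => D :|: E) (fun U => U :\: D)) /=; last first.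
  by move=> U /andP[UQ DU]; rewrite subsetUD.
have E1 E : (D :|: E) :\: D = E -> [disjoint D & E].
  by move=> e; rewrite -e -setI_eq0 setIDA setDIl setDv set0I.
have E2 E : [disjoint D & E] -> (D :|: E) :\: D = E.
  by move=> d; rewrite setDUl setDv set0U; apply/setDidPl; rewrite disjoint_sym.
apply: eq_big => E; last by case/andP => _ /eqP ->.
rewrite subUset DQ /= subsetUl andbT; congr (_ && _).
by apply/eqP/idP; [apply: E1|apply: E2].
Qed.

(** [c.+1 ^ #|U|] is the sum of [c ^ #|U :\: D|] over [D \subset U]; splitting off the divisor
    [pr D], itself at most [X], costs one factor [harm X]. *)
Lemma sum_expn_pr Q X c : prset Q ->
  \sum_(U : {set 'I_Y} | (U \subset Q) && (pr U <= X)%N) c%:R ^+ #|U| / (pr U)%:R <= harm X ^+ c.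
Proof.
move=> hQ; elim: c => [|c IH].
  rewrite expr0 big_mkcondr /= (bigD1 set0) ?sub0set //= cards0 expr0 pr0 divr1.
  rewrite big1 ?addr0; last first.
    by move=> U /andP[_ U0]; rewrite expr0n cards_eq0 (negPf U0) mul0r; case: ifP.
  by case: ifP.
have -> : (\sum_(U : {set 'I_Y} | (U \subset Q) && (pr U <= X)%N) c.+1%:R ^+ #|U| / (pr U)%:R)
   = \sum_(U : {set 'I_Y} | U \subset Q) \sum_(D : {set 'I_Y} | D \subset U)
     (if (pr D * pr (U :\: D) <= X)%N then (pr D)%:R^-1 * (c%:R ^+ #|U :\: D| / (pr (U :\: D))%:R) else 0) :> R.
  rewrite big_mkcondr /=; apply: eq_bigr => U UQ.
  have split_pr D : D \subset U -> pr U = (pr D * pr (U :\: D))%N.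
    by move=> DU; rewrite -prU ?subsetUD // -setI_eq0 setIDA setDIl setDv set0I.
  under eq_bigr => D DU do rewrite -(split_pr D DU).
  case: ifP => _; last by rewrite big1.
  have := prodD1_sum (fun _ : 'I_Y => c%:R : R) U; rewrite prodr_const.
  rewrite -natr1 addrC => ->; rewrite (reindex_onto (fun D => U :\: D) (fun D => U :\: D)) /=.
    rewrite mulr_suml; apply: eq_big => D.
      rewrite subsetDl setDDr setDv set0U /=; apply/eqP/idP => [<-|]; first exact: subsetIl.
      by move/setIidPr.
    move=> /andP[_ /eqP De]; have DU : D \subset U by rewrite -De subsetDl.
    rewrite prodr_const (split_pr D DU) natrM invfM; ring.
  by move=> D DU; rewrite setDDr setDv set0U; apply/setIidPr.
rewrite (sum_subset_pairs Q (fun D E => if (pr D * pr E <= X)%N then (pr D)%:R^-1 * (c%:R ^+ #|E| / (pr E)%:R) else 0)).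
rewrite exprS.
apply: le_trans (ler_wpM2r _ (sum_inv_pr X hQ)); last by rewrite exprn_ge0 ?harm_ge0.
rewrite mulr_suml [leRHS]big_mkcondr /=; apply: ler_sum => D DQ.
have D0 := pr_gt0 (prsetS hQ DQ).
case: leqP => DX; last first.
  rewrite big1 // => E /andP[EQ _]; case: ifP => // h.
  by exfalso; have := pr_gt0 (prsetS hQ EQ); nia.
apply: le_trans (ler_wpM2l _ IH); last by rewrite invr_ge0.
rewrite mulr_sumr [leRHS]big_mkcondr [leLHS]big_mkcondr /=; apply: ler_sum => E EQ.
have E0 := pr_gt0 (prsetS hQ EQ).
have t0 : 0 <= (pr D)%:R^-1 * (c%:R ^+ #|E| / (pr E)%:R) :> R.
  by rewrite mulr_ge0 ?invr_ge0 // divr_ge0 ?exprn_ge0.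
case: ifP => _; last by case: ifP.
case: ifP => h; last by case: ifP.
by rewrite (_ : (pr E <= X)%N) //; apply: leq_trans h; rewrite leq_pmull.
Qed.

End PrimeSets.

(** * Selberg's weights *)

Section Selberg.
Variables (R : realFieldType) (Y : nat).
Implicit Types (U D E S : {set 'I_Y}).
Variables (Q : {set 'I_Y}) (z : nat).
Hypotheses (hQ : prset Q) (z0 : (0 < z)%N).

(** Euler's totient of the square-free number [pr U]. *)
Definition phiS U : R := \prod_(p in U) (p%:R - 1).

Lemma phiS_gt0 U : prset U -> 0 < phiS U.
Proof.
move=> hU; apply: prodr_gt0 => p pU; rewrite subr_gt0 ltr1n.
exact: prime_gt1 (prsetP hU pU).
Qed.

Definition selG : R := \sum_(S : {set 'I_Y} | (S \subset Q) && (pr S <= z)%N) (phiS S)^-1.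

Lemma selG_ge1 : 1 <= selG.
Proof.
rewrite /selG (bigD1 set0) /=; last by rewrite sub0set pr0.
rewrite /phiS big_set0 invr1 lerDl; apply: sumr_ge0 => S /andP[/andP[SQ _] _].
by rewrite invr_ge0 ltW // phiS_gt0 // (prsetS hQ).
Qed.

Lemma selG_gt0 : 0 < selG.
Proof. exact: lt_le_trans selG_ge1. Qed.

(* Selberg's weights: they minimise the quadratic form evaluated in [selberg_quad] under [lam set0 = 1]. *)
Definition lam D : R := (-1) ^+ #|D| * (pr D)%:R / selG *
  \sum_(S : {set 'I_Y} | [&& S \subset Q, (pr S <= z)%N & D \subset S]) (phiS S)^-1.

Lemma lam0 : lam set0 = 1.
Proof.
rewrite /lam cards0 pr0 expr0 !mul1r (eq_bigl (fun S => (S \subset Q) && (pr S <= z)%N)).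
  by rewrite mulVf // gt_eqF // selG_gt0.
by move=> S; rewrite sub0set andbT.
Qed.

Lemma pr_subset D S : D \subset S -> pr S = (pr D * pr (S :\: D))%N.
Proof.
by move=> DS; rewrite -prU ?subsetUD // -setI_eq0 setIDA setDIl setDv set0I.
Qed.

Lemma leq_pr D S : prset S -> D \subset S -> (pr D <= pr S)%N.
Proof.
move=> hS DS; rewrite (pr_subset DS) leq_pmulr // pr_gt0 //.
by apply: prsetS hS _; apply: subsetDl.
Qed.

Lemma lam_supp D : ~~ ((D \subset Q) && (pr D <= z)%N) -> lam D = 0.
Proof.
move=> h; rewrite /lam big_pred0 ?mulr0 // => S; apply/negP => /and3P[SQ Sz DS].
move/negP: h; apply; rewrite (subset_trans DS) //=.
by apply: leq_trans Sz; apply: leq_pr => //; apply: prsetS hQ _.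
Qed.

(** The sets containing [D] are the [D :|: E] with [E] disjoint from [D]; as [phiS] is
    multiplicative, the sum over them is at most [selG / phiS D]. *)
Lemma lam_le D : D \subset Q -> `|lam D| <= (pr D)%:R / phiS D.
Proof.
move=> DQ; have hD := prsetS hQ DQ.
rewrite /lam !normrM normrX normrN1 expr1n mul1r [`|_%:R|]ger0_norm //.
rewrite [`|selG^-1|]ger0_norm ?invr_ge0 ?(ltW selG_gt0) //.
rewrite ger0_norm; last first.
  apply: sumr_ge0 => S /and3P[SQ _ _].
  by rewrite invr_ge0 ltW // phiS_gt0 // (prsetS hQ).
rewrite -mulrA ler_wpM2l // ler_pdivrMl ?selG_gt0 //.
rewrite (reindex_onto (fun E => D :|: E) (fun U => U :\: D)) /=; last first.
  by move=> U /and3P[_ _ DU]; rewrite subsetUD.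
rewrite mulrC /selG mulr_sumr big_mkcond /= [leRHS]big_mkcond /=; apply: ler_sum => E _.
case: ifP => [/andP[/and3P[DEQ le _] /eqP e]|_]; last first.
  by case: ifP => // /andP[EQ _]; rewrite mulr_ge0 // invr_ge0 ltW // phiS_gt0 // (prsetS hQ).
have dDE : [disjoint D & E] by rewrite -e -setI_eq0 setIDA setDIl setDv set0I.
have EQ : E \subset Q by apply: subset_trans DEQ; apply: subsetUr.
rewrite EQ /= (leq_trans _ le); last first.
  by apply: leq_pr; [apply: prsetS hQ DEQ|apply: subsetUr].
rewrite {1}/phiS (eq_bigl (mem [predU D & E])); last by move=> p; rewrite !inE.
by rewrite bigU //= invfM.
Qed.

Lemma pr_sum_phi U : (pr U)%:R = \sum_(S : {set 'I_Y} | S \subset U) phiS S :> R.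
Proof.
rewrite /phiS -prodD1_sum /pr natr_prod; apply: eq_bigr => p _; ring.
Qed.

Lemma prUI D E : (pr (D :|: E) * pr (D :&: E) = pr D * pr E)%N.
Proof.
have eE : pr E = (pr (E :&: D) * pr (E :\: D))%N.
  rewrite -prU ?setID //; apply/pred0P => x /=; rewrite !inE.
  by case: (x \in D); rewrite ?andbF.
have -> : D :|: E = D :|: (E :\: D) by rewrite setDE setUIr setUCr setIT.
rewrite prU; last by rewrite -setI_eq0 setIDA setDIl setDv set0I.
by rewrite eE (setIC E D); ring.
Qed.

(** Diagonalisation: [1 / pr (D :|: E)] equals [pr (D :&: E) / (pr D * pr E)], and [pr_sum_phi]
    expands the numerator over the common subsets [S], which turns the form into the sum of
    [phiS S * b S ^+ 2]. Moebius inversion evaluates [b S] as [(-1) ^+ #|S| / (selG * phiS S)] when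
    [pr S <= z] and as 0 otherwise. *)
Lemma selberg_quad :
  \sum_(D : {set 'I_Y} | D \subset Q) \sum_(E : {set 'I_Y} | E \subset Q)
     lam D * lam E / (pr (D :|: E))%:R = selG^-1.
Proof.
pose a D := lam D / (pr D)%:R.
pose b S := \sum_(D : {set 'I_Y} | D \subset Q) (if S \subset D then a D else 0).
have bE S : S \subset Q -> b S = (if (pr S <= z)%N then (-1) ^+ #|S| / (selG * phiS S) else 0).
  move=> SQ; pose c (S' : {set 'I_Y}) := if (pr S' <= z)%N then (phiS S')^-1 else 0.
  have -> : b S = selG^-1 * \sum_(D : {set 'I_Y} | D \subset Q)
       \sum_(S' : {set 'I_Y} | S' \subset Q)
         (if S \subset D then if D \subset S' then (-1) ^+ #|D| * c S' else 0 else 0).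
    rewrite mulr_sumr; apply: eq_bigr => D DQ; case: ifP => _; last by rewrite big1 ?mulr0.
    rewrite /a /lam; have p0 : (pr D)%:R != 0 :> R.
      by rewrite pnatr_eq0 -lt0n pr_gt0 // (prsetS hQ).
    have -> (x y : R) : (-1) ^+ #|D| * x / selG * y / x = selG^-1 * ((-1) ^+ #|D| * y) * (x / x) by ring.
    rewrite mulfV // mulr1; congr (_ * _); rewrite mulr_sumr big_mkcond [RHS]big_mkcond /=.
    by apply: eq_bigr => S' _; rewrite /c; case: (S' \subset Q) => //=; case: (_ <= z)%N; case: (D \subset S'); rewrite ?mulr0.
  rewrite exchange_big /=.
  rewrite (eq_bigr (fun S' => c S' * (if S == S' then (-1) ^+ #|S| else 0))).
    rewrite (bigD1 S) //= eqxx big1 => [|S' /andP[_ /negPf]]; last first.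
      by rewrite eq_sym => ->; rewrite mulr0.
    rewrite /c addr0; case: ifP => _; last by rewrite mul0r mulr0.
    by rewrite invfM; ring.
  move=> S' S'Q; case: (boolP (S \subset S')) => SS'; last first.
    rewrite big1 => [|D DQ]; last first.
      case: ifP => // SD; case: ifP => // DS'; case/negP: SS'; exact: subset_trans SD DS'.
    case: eqP => [e|]; last by rewrite mulr0.
    by rewrite e subxx in SS'.
  rewrite -sum_sign_between // mulr_sumr big_mkcond [RHS]big_mkcond /=; apply: eq_bigr => D _.
  case: (boolP (D \subset S')) => DS'; last by case: ifP => // _; case: ifP.
  by rewrite (subset_trans DS' S'Q); case: ifP; rewrite ?mulr0 // mulrC.
have -> : (\sum_(D : {set 'I_Y} | D \subset Q) \sum_(E : {set 'I_Y} | E \subset Q)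
     lam D * lam E / (pr (D :|: E))%:R) = \sum_(S : {set 'I_Y} | S \subset Q) phiS S * b S ^+ 2.
  have T D E : D \subset Q -> E \subset Q -> lam D * lam E / (pr (D :|: E))%:R =
    \sum_(S : {set 'I_Y} | S \subset Q)
      phiS S * ((if S \subset D then a D else 0) * (if S \subset E then a E else 0)).
    move=> DQ EQ; have := prUI D E.
    have hDE : prset (D :|: E) by apply: prsetS hQ _; rewrite subUset DQ.
    have nz U : prset U -> (pr U)%:R != 0 :> R by move=> hU; rewrite pnatr_eq0 -lt0n pr_gt0.
    have hD := prsetS hQ DQ; have hE := prsetS hQ EQ.
    have hI : prset (D :&: E) by apply: prsetS hD _; apply: subsetIl.
    move/(congr1 (fun n => n%:R : R)); rewrite !natrM => e.
    have -> : lam D * lam E / (pr (D :|: E))%:R = a D * a E * (pr (D :&: E))%:R.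
      rewrite /a; have -> (x y u v w : R) : x / u * (y / v) * w = x * y * (w / (u * v)) by rewrite invfM; ring.
      rewrite -e; congr (_ * _); rewrite invfM mulrCA mulfV ?mulr1 //; exact: nz.
    rewrite pr_sum_phi mulr_sumr big_mkcond [RHS]big_mkcond /=; apply: eq_bigr => S _.
    rewrite subsetI; case: (boolP (S \subset D)) => SD /=; last by case: ifP; rewrite ?mul0r ?mulr0.
    rewrite (subset_trans SD DQ); case: ifP => _; rewrite ?mulr0 //; ring.
  under eq_bigr => D DQ do under eq_bigr => E EQ do rewrite (T D E DQ EQ).
  under eq_bigr => D DQ do rewrite exchange_big /=.
  rewrite exchange_big /=; apply: eq_bigr => S SQ.
  rewrite expr2 /b mulr_suml mulr_sumr; apply: eq_bigr => D DQ.
  by rewrite mulr_sumr mulr_sumr.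
have -> : selG^-1 = selG^-1 ^+ 2 * selG.
  by rewrite expr2 -mulrA mulVf ?mulr1 // gt_eqF // selG_gt0.
rewrite {2}/selG mulr_sumr [RHS]big_mkcondr /=; apply: eq_bigr => S SQ.
rewrite bE //; case: ifP => _; last by rewrite expr0n mulr0.
have f0 := phiS_gt0 (prsetS hQ SQ); have g0 := selG_gt0.
rewrite expr_div_n sqrr_sign; field.
by rewrite !gt_eqF.
Qed.

(** [1 / (p - 1) <= 2 / p] reduces the sum to [sum_expn_pr] with [c = 2]. *)
Lemma selG_le : selG <= harm R z ^+ 2.
Proof.
apply: le_trans (sum_expn_pr R z 2 hQ); apply: ler_sum => S /andP[SQ _].
have hS := prsetS hQ SQ.
rewrite /phiS /pr natr_prod -prodr_const -!prodfV -big_split /=.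
apply: ler_prod => p pS; have := prime_gt1 (prsetP hS pS).
rewrite -(ltr_nat R) => p1; have p2 : 2 <= p%:R :> R by rewrite ler_nat; exact: prime_gt1 (prsetP hS pS).
rewrite invr_ge0 subr_ge0 (ltW p1) /=.
rewrite -[leLHS]mul1r ler_pdivrMr ?subr_gt0 // mulrAC ler_pdivlMr; last by lra.
lra.
Qed.

End Selberg.

(** * Lower bound for Selberg's normalising sum *)

Section HarmonicBound.
Variables (R : realFieldType) (Y : nat).
Implicit Types (U D E S P : {set 'I_Y}).

Lemma geom_sum_le (x : R) n : 0 <= x < 1 -> \sum_(j < n) x ^+ j <= (1 - x)^-1.
Proof.
case/andP=> x0 x1; rewrite -[(1 - x)^-1]mul1r ler_pdivlMr ?subr_gt0 //.
elim: n => [|n IH]; first by rewrite big_ord0 mul0r.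
suff : (\sum_(j < n) x ^+ j) * (1 - x) = 1 - x ^+ n.
  by rewrite big_ord_recr /= mulrDl => ->; have := exprn_ge0 n x0; nra.
elim: n {IH} => [|n IH]; first by rewrite big_ord0 mul0r expr0 subrr.
by rewrite big_ord_recr /= mulrDl IH exprS; ring.
Qed.

Lemma prod_logn_ord n : (0 < n < Y)%N -> n = (\prod_(p < Y) (if prime p then p ^ logn p n else 1))%N.
Proof.
case/andP => n0 nY; rewrite -big_mkcond /=.
have := @partnT n n0; rewrite (@widen_partn Y.-1 predT n) ?prednK ?(ltn_trans _ nY) //; last by lia.
move=> e; rewrite -{1}e big_mkord big_mkcond [RHS]big_mkcond /=.
apply: eq_bigr => p _; case: ifP => // np.
by rewrite lognE np.
Qed.

(** A truncated Euler product: expanding the product of the local sums gives one nonnegative term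
    for each assignment of exponents, and the integers [n <= z] embed into these by their
    factorisations. *)
Lemma sum_smooth_le P S z : prset (P :|: S) -> [disjoint P & S] -> (z < Y)%N ->
  \sum_(n < z.+1 | (0 < n)%N && [forall p : 'I_Y, (prime p && (p %| n)%N) ==> (p \in P :|: S)]
       && [forall p in S, (p %| n)%N]) n%:R^-1
  <= \prod_(p in P) (p%:R / (p%:R - 1)) * \prod_(p in S) (p%:R - 1)^-1 :> R.
Proof.
move=> hPS dPS zY.
(* Local weight of the exponent [j] at [p]: only positive exponents for [p] in [S], all exponents
   for [p] in [P], and only the exponent 0 elsewhere. *)
pose c (p : 'I_Y) (j : 'I_Y) : R := if p \in S then (if (0 < j)%N then p%:R^-1 ^+ j else 0)
   else if p \in P then p%:R^-1 ^+ j else if (j == 0 :> nat) then 1 else 0.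
have pos (p : 'I_Y) : p \in P :|: S -> 2 <= p%:R :> R.
  by move=> /(prsetP hPS)/prime_gt1; rewrite ler_nat.
have c0 p j : 0 <= c p j.
  by rewrite /c; case: ifP => _; case: ifP => // _; rewrite ?exprn_ge0 ?invr_ge0 //; case: ifP.
have csum p : \sum_j c p j <= (if p \in P then p%:R / (p%:R - 1) else 1) * (if p \in S then (p%:R - 1)^-1 else 1).
  rewrite /c; case: (boolP (p \in S)) => pS.
    rewrite (disjointFl dPS pS) mul1r -big_mkcond /=.
    have p2 := pos p (subsetP (subsetUr P S) _ pS).
    have := @geom_sum_le p%:R^-1 Y; rewrite invr_ge0 ler0n /= invf_lt1; last by lra.
    move/(_ ltac:(lra)); rewrite (bigID (fun j : 'I_Y => (0 < j)%N)) /=.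
    rewrite [X in _ + X](bigD1 (Ordinal (leq_ltn_trans (leq0n z) zY))) //= expr0.
    rewrite [X in _ + (1 + X)]big1 ?addr0; last first.
      by move=> i /andP[]; rewrite lt0n negbK => /eqP i0 /eqP []; apply: val_inj.
    have -> : (1 - p%:R^-1)^-1 = (p%:R - 1)^-1 + 1 :> R.
      by field; rewrite ?gt_eqF //; [lra|lra].
    by rewrite lerD2r.
  rewrite mulr1; case: (boolP (p \in P)) => pP.
    have p2 := pos p (subsetP (subsetUl P S) _ pP).
    apply: le_trans (geom_sum_le Y _) _.
      by rewrite invr_ge0 ler0n /= invf_lt1; lra.
    by rewrite le_eqVlt; apply/orP; left; apply/eqP; field; rewrite ?gt_eqF //; lra.
  rewrite (bigD1 (Ordinal (leq_ltn_trans (leq0n z) zY))) //= big1 ?addr0 // => i ni.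
  by case: eqP => // i0; case/negP: ni; apply/eqP; apply: val_inj.
rewrite [X in _ <= X * _]big_mkcond [X in _ <= _ * X]big_mkcond -big_split /=.
apply: (@le_trans _ _ (\prod_(p < Y) \sum_(j < Y) c p j)); last first.
  by apply: ler_prod => p _; rewrite csum andbT sumr_ge0.
rewrite bigA_distr_bigA /=.
pose A := [pred n : 'I_z.+1 | (0 < n)%N && [forall p : 'I_Y, (prime p && (p %| n)%N) ==> (p \in P :|: S)]
       && [forall p in S, (p %| n)%N]].
have lY (n : 'I_z.+1) (p : nat) : (logn p n < Y)%N.
  apply: leq_ltn_trans zY; apply: leq_trans (_ : n <= z)%N; last by rewrite -ltnS.
  case: (posnP n) => [->|n0]; first by rewrite logn0.
  by apply: ltnW; apply: ltn_logl.
pose h (n : 'I_z.+1) : {ffun 'I_Y -> 'I_Y} := [ffun p : 'I_Y => Ordinal (lY n (if prime p then (p : nat) else 0%N))].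
have hinj : {in A &, injective h}.
  move=> n n' /andP[/andP[n0 _] _] /andP[/andP[n0' _] _] e; apply: val_inj => /=.
  have nY (m : 'I_z.+1) : (m < Y)%N by apply: leq_ltn_trans zY; rewrite -ltnS.
  rewrite [LHS]prod_logn_ord ?n0 ?nY // [RHS]prod_logn_ord ?n0' ?nY //.
  apply: eq_bigr => p _; case: ifP => // pp.
  by have := congr1 (fun f : {ffun 'I_Y -> 'I_Y} => val (f p)) e; rewrite !ffunE /= pp => ->.
have hval n : n \in A -> \prod_p c p (h n p) = n%:R^-1.
  move=> /andP[/andP[n0 /forallP nP] /forall_inP nS].
  have nY : (n < Y)%N by apply: leq_ltn_trans zY; rewrite -ltnS.
  rewrite [in RHS](@prod_logn_ord n) ?n0 // natr_prod -prodfV.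
  apply: eq_bigr => p _; rewrite ffunE /c /=.
  case: (boolP (prime p)) => pp.
    case: (boolP (p \in S)) => pS.
      by rewrite logn_gt0 mem_primes pp n0 nS // natrX exprVn.
    case: (boolP (p \in P)) => pP; first by rewrite natrX exprVn.
    have /negPf pn : ~~ (p %| n)%N.
      by apply/negP => pn; have := nP p; rewrite pp pn /= inE (negPf pP) (negPf pS).
    by rewrite lognE pp n0 pn /= expn0 invr1.
  have nPS : p \notin P :|: S by apply: contra pp; apply: (prsetP hPS).
  move: nPS; rewrite inE negb_or => /andP[/negPf-> /negPf->].
  by rewrite lognE /= invr1.
rewrite (eq_bigl A) //.
rewrite (eq_bigr (fun n => \prod_p c p (h n p))); last by move=> n nA; rewrite hval.
rewrite -(big_imset (fun f : {ffun 'I_Y -> 'I_Y} => \prod_p c p (f p))) //=.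
rewrite [leRHS](bigID (mem (h @: A))) /= lerDl; apply: sumr_ge0 => f _.
exact: prodr_ge0.
Qed.

(** Group the integers [n <= z] by the set [T] of primes of [Q] dividing them; all their other
    primes lie in [P], and [sum_smooth_le] bounds each group by [1 / phiS T] times the Euler factors
    of [P]. *)
Lemma harm_le_selG P Q z : prset P -> prset Q -> [disjoint P & Q] -> (0 < z < Y)%N ->
  (forall p : 'I_Y, prime p -> (p <= z)%N -> p \in P :|: Q) ->
  harm R z <= selG R Q z * \prod_(p in P) (p%:R / (p%:R - 1)).
Proof.
move=> hP hQ dPQ /andP[z0 zY] cov.
pose S (n : nat) := [set p in Q | (p %| n)%N].
have -> : harm R z = \sum_(n < z.+1 | (0 < n)%N) n%:R^-1.
  rewrite big_mkcond big_ord_recl /= add0r /harm.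
  by apply: eq_bigr => i _.
have Spr n : (0 < n)%N -> (pr (S n) <= n)%N.
  move=> n0; apply: dvdn_leq => //.
  rewrite /pr; have : uniq (enum (S n)) by exact: enum_uniq.
  rewrite -big_enum /=; have : all (fun p : 'I_Y => prime p && (p %| n)%N) (enum (S n)).
    by apply/allP => p; rewrite mem_enum inE => /andP[/(prsetP hQ)-> ->].
  elim: (enum _) => [|p s IH] /=; first by rewrite big_nil.
  case/andP=> /andP[pp pn] hs /andP[ps us]; rewrite big_cons Gauss_dvd ?pn ?IH //.
  rewrite coprime_sym -(big_map (fun p : 'I_Y => p : nat) xpredT id).
  apply: coprime_prod_primes => //; first by rewrite mem_map //; apply: val_inj.
  by rewrite all_map; apply: sub_all hs => q /andP[].
rewrite (partition_big (fun n : 'I_z.+1 => S n) (fun T : {set 'I_Y} => (T \subset Q) && (pr T <= z)%N)) /=; last first.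
  move=> n n0; have nz : (n <= z)%N by rewrite -ltnS.
  rewrite (leq_trans (Spr n n0) nz) andbT.
  by apply/subsetP => p; rewrite inE => /andP[].
rewrite /selG mulr_suml; apply: ler_sum => T /andP[TQ Tz].
have dPT : [disjoint P & T] by apply: disjointWr TQ dPQ.
have hPT : prset (P :|: T).
  by apply/forall_inP => p; rewrite inE => /orP[/(prsetP hP)|/(subsetP TQ)/(prsetP hQ)].
apply: le_trans (_ : _ <= \prod_(p in P) (p%:R / (p%:R - 1)) * \prod_(p in T) (p%:R - 1)^-1) _; last first.
  by rewrite mulrC /phiS prodfV.
apply: le_trans (sum_smooth_le hPT dPT zY).
rewrite big_mkcond [leRHS]big_mkcond /=; apply: ler_sum => n _.
case: (posnP n) => [->|n0] //=.
case: eqP => [eT|_]; last by case: ifP => // _; rewrite invr_ge0.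
case: ifP => // /negP []; apply/andP; split; last first.
  by apply/forall_inP => p; rewrite -eT inE => /andP[].
apply/forallP => p; apply/implyP => /andP[pp pn]; have := cov p pp.
have nz : (n <= z)%N by rewrite -ltnS.
rewrite (leq_trans (dvdn_leq n0 pn) nz) => /(_ isT).
by rewrite !inE -eT inE pn andbT.
Qed.

End HarmonicBound.

(** * Correlations of linear forms *)

Section Corners.
Variable R : realFieldType.

(* The corner [w] of the cube with edges [x_i, y_i] listed as [x_1; y_1; x_2; y_2; ...]. *)
Fixpoint csum (w : seq bool) (l : seq nat) : nat :=
  match w, l with
  | b :: w', x :: y :: l' => (if b then y else x) + csum w' l'
  | _, _ => 0
  end.

Lemma csum_modn p w l : csum w (map (modn^~ p) l) = csum w l %[mod p].
Proof.
elim: w l => [|b w IH] [|x [|y l]] //=.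
by rewrite -modnDm IH modnDm; case: b; rewrite modnDml.
Qed.

Lemma avg_Avg n s (F : nat -> seq nat -> R) :
  avg n (fun x => Avg s (F x)) = Avg s (fun l => avg n (fun x => F x l)).
Proof.
elim: s F => //= m s IH F; rewrite avg_exchange; apply: eq_avg => j _.
by rewrite IH.
Qed.

Lemma avg_eqmod p a : (0 < p)%N -> avg p (fun x => (x == a %[mod p])%:R) = p%:R^-1 :> R.
Proof.
move=> p0; rewrite /avg (bigD1 (Ordinal (ltn_pmod a p0))) //= modn_mod eqxx big1 ?addr0 ?mul1r //.
move=> i ni; rewrite (modn_small (ltn_ord i)); case: eqP => // e; case/negP: ni.
by apply/eqP; apply: val_inj.
Qed.

Lemma avg_affine_dvd p a b : prime p -> ~~ (p %| a)%N ->
  avg p (fun x => (p %| a * x + b)%N%:R) = p%:R^-1 :> R.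
Proof.
move=> pp pa; have p0 := prime_gt0 pp; rewrite -(avg_eqmod 0 p0).
rewrite -(@avg_perm _ p b a (fun x => (x == 0 %[mod p])%:R)) //.
- by apply: eq_avg => x _; rewrite mod0n addnC.
- by rewrite coprime_sym prime_coprime.
by move=> x; rewrite modn_mod.
Qed.

Lemma avg_shift_eqmod p a b : (0 < p)%N -> avg p (fun x => (a + x == b %[mod p])%:R) = p%:R^-1 :> R.
Proof.
move=> p0; rewrite -(avg_eqmod b p0).
rewrite -(@avg_perm _ p a 1 (fun x => (x == b %[mod p])%:R)) ?coprime1n //.
  by apply: eq_avg => x _; rewrite mul1n.
by move=> x; rewrite modn_mod.
Qed.

(** Where the words first differ, one side contains [x] and the other [y]; with everything else
    fixed, the average over [y] makes the congruence hold with density exactly [1 / p]. *)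
Lemma Avg_csum_eqmod p (w w' : seq bool) a b : (0 < p)%N -> size w = size w' -> w != w' ->
  Avg (nseq (size w).*2 p) (fun l => (a + csum w l == b + csum w' l %[mod p])%:R) = p%:R^-1 :> R.
Proof.
move=> p0; elim: w w' a b => [|c w IH] [|c' w'] // a b [sw] ne.
rewrite [size _]/= doubleS /=.
have p1 n : all (leq 1) (nseq n p) by apply/allP => x; rewrite mem_nseq => /andP[_ /eqP->].
case: (eqVneq c c') ne => [<-|cc'] ne.
  have {}ne : w != w' by apply: contra ne => /eqP->.
  rewrite (@eq_avg _ _ _ (fun=> p%:R^-1)) ?avg_const // => x _.
  rewrite (@eq_avg _ _ _ (fun=> p%:R^-1)) ?avg_const // => y _.
  by rewrite -(IH w' (a + if c then y else x)%N (b + if c then y else x)%N sw ne); apply: eq_Avg => l _; rewrite !addnA.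
rewrite (@eq_avg _ _ _ (fun=> p%:R^-1)) ?avg_const // => x _.
rewrite avg_Avg (@eq_Avg _ _ _ (fun=> p%:R^-1)) ?Avg_const // => l _.
case: c cc' ne; case: c' => // _ _.
  rewrite -(avg_shift_eqmod (a + csum w l) (b + (x + csum w' l)) p0).
  by apply: eq_avg => y _; rewrite addnCA addnC -addnA addnC addnA addnAC.
rewrite -(avg_shift_eqmod (b + csum w' l) (a + (x + csum w l)) p0).
by apply: eq_avg => y _; rewrite eq_sym addnCA addnC -addnA addnC addnA addnAC.
Qed.

End Corners.

(** * Divisibility of the forms by a single prime *)

Section LocalDensities.
Variables (R : realFieldType) (k q n0 N : nat).
Notation W := (k.-tuple bool).
Implicit Types (w : W) (T : {set W}).

(** The head of [l] is the offset of the base point from [N], its tail the edges of the cube; the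
    corner [w] is then mapped into the progression [n0] mod [q]. *)
Definition form w (l : seq nat) : nat := (q * (N + head 0 l + csum w (behead l)) + n0)%N.

Definition pind (p : nat) w l : R := (p %| form w l)%N%:R.

Lemma pind01 p w l : 0 <= pind p w l <= 1.
Proof. by rewrite /pind; case: (_ %| _)%N; rewrite ?lexx ?ler01. Qed.

Lemma pind_periodic p w : periodicL p (pind p w).
Proof.
move=> l l' ll'; rewrite /pind /form; congr (nat_of_bool _)%:R.
have hd : head 0%N l = head 0%N l' %[mod p] by case: l l' ll' => [|x l] [|x' l'] //= [].
have tl : csum w (behead l) = csum w (behead l') %[mod p].
  rewrite -csum_modn -[RHS]csum_modn; congr (csum _ _ %% _)%N.
  by case: l l' ll' {hd} => [|x l] [|x' l'] //= [].
have e : (N + head 0 l + csum w (behead l) = N + head 0 l' + csum w (behead l') %[mod p])%N.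
  rewrite -[LHS]modnDm -[RHS]modnDm tl; congr ((_ + _) %% _)%N.
  by rewrite -modnDmr hd modnDmr.
by rewrite /dvdn -modnDml -modnMmr e modnMmr modnDml.
Qed.

Variable p : nat.
Hypotheses (pp : prime p) (pq : ~~ (p %| q)%N).
Let p0 := prime_gt0 pp.
Notation loc := (Avg (nseq k.*2.+1 p)).

Lemma nseq_ge1 n : all (leq 1) (nseq n p).
Proof. by apply/allP => x; rewrite mem_nseq => /andP[_ /eqP->]. Qed.

Lemma avg_head_pind w l : avg p (fun x => pind p w (x :: l)) = p%:R^-1.
Proof.
rewrite -(avg_affine_dvd R (q * (N + csum w l) + n0) pp pq); apply: eq_avg => x _.
by rewrite /pind /form /=; congr (nat_of_bool (_ %| _)%N)%:R; ring.
Qed.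

Lemma loc_pind w : loc (pind p w) = p%:R^-1.
Proof.
rewrite /= avg_Avg (@eq_Avg _ _ _ (fun=> p%:R^-1)) ?Avg_const ?nseq_ge1 // => l _.
exact: avg_head_pind.
Qed.

(** If [p] divides both forms, their corner sums agree mod [p], as [p] does not divide [q]. The base
    point gives one factor [1 / p] and the edges, by [Avg_csum_eqmod], a second one. *)
Lemma loc_pind2 w w' : w != w' -> loc (fun l => pind p w l * pind p w' l) <= p%:R^-1 ^+ 2.
Proof.
move=> ne; have sw : size w = size w' by rewrite !size_tuple.
have le l : pind p w l * pind p w' l <=
    pind p w l * (0 + csum w (behead l) == 0 + csum w' (behead l) %[mod p])%:R.
  rewrite /pind; case: (boolP (p %| form w l)%N) => h; rewrite ?mul0r // !mul1r.
  case: (boolP (p %| form w' l)%N) => h'; last by rewrite ler0n.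
  rewrite (_ : (_ == _) = true) ?lexx //.
  have : form w l = form w' l %[mod p] by move: h h'; rewrite /dvdn => /eqP-> /eqP->.
  move/eqP; rewrite /form eqn_modDr !mulnDr eqn_modDl => e.
  have cqp : coprime p q by rewrite prime_coprime.
  rewrite !add0n; move: e; set a := csum _ _; set b := csum _ _.
  case/orP: (leq_total a b) => ab.
    by rewrite eq_sym eqn_mod_dvd ?leq_mul2l ?ab ?orbT // -mulnBr Gauss_dvdr // [in _ -> _]eq_sym -eqn_mod_dvd.
  by rewrite eqn_mod_dvd ?leq_mul2l ?ab ?orbT // -mulnBr Gauss_dvdr // -eqn_mod_dvd.
apply: le_trans (le_Avg (fun l _ => le l)) _.
rewrite /= avg_Avg.
rewrite (@eq_Avg _ _ _ (fun l => p%:R^-1 * (0 + csum w l == 0 + csum w' l %[mod p])%:R)).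
  have := Avg_csum_eqmod R 0 0 p0 sw; rewrite size_tuple => e.
  by rewrite AvgZ e.
move=> l _ /=; rewrite mulrC -(avg_head_pind w l) -avgZ; apply: eq_avg => x _.
by rewrite mulrC.
Qed.

Definition pany T l : R := 1 - \prod_(w in T) (1 - pind p w l).

(** Pointwise Bonferroni inequalities to second order. Ordered pairs count every coincidence twice,
    which the bound by [#|T| ^ 2] pairs still accommodates. *)
Lemma loc_pany T : #|T|%:R / p%:R - (#|T|%:R / p%:R) ^+ 2 <= loc (pany T) <= #|T|%:R / p%:R.
Proof.
have B l : \sum_(w in T) pind p w l - \sum_(w in T) \sum_(w' in T | w' != w) pind p w l * pind p w' l
    <= pany T l <= \sum_(w in T) pind p w l.
  rewrite /pany; apply/andP; split; last first.
    rewrite lerBlDr addrC -lerBlDr; apply: prod1B_ge => w _; exact: pind01.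
  case: (boolP [exists w in T, (p %| form w l)%N]) => [/exists_inP[w wT hw]|no]; last first.
    have z w : w \in T -> pind p w l = 0.
      move=> wT; rewrite /pind; case: (boolP (_ %| _)%N) => // h.
      by case/exists_inP: no; exists w.
    have S0 : \sum_(w in T) pind p w l = 0 by apply: big1.
    have SS0 : \sum_(w in T) \sum_(w' in T | w' != w) pind p w l * pind p w' l = 0.
      by apply: big1 => w wT; apply: big1 => w' _; rewrite z ?mul0r.
    by rewrite S0 SS0 big1 ?subrr // => w wT; rewrite z // subr0.
  have hw1 : pind p w l = 1 by rewrite /pind hw.
  rewrite [X in 1 - X](bigD1 w) //= hw1 subrr mul0r subr0.
  have I2 v : pind p v l * pind p v l = pind p v l.
    by rewrite /pind; case: (_ %| _)%N; rewrite ?mulr0 ?mulr1.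
  rewrite -sumrB (bigD1 w) //= hw1.
  apply: le_trans (_ : 1 + 0 <= _); last by rewrite addr0.
  apply: lerD; first by rewrite lerBlDr lerDl; apply: sumr_ge0 => v _; rewrite mulr_ge0 // ?(andP (pind01 _ _ _)).1.
  apply: sumr_le0 => v /andP[vT vw]; rewrite subr_le0 (bigD1 w) /=; last by rewrite wT eq_sym.
  rewrite hw1 mulr1 lerDl; apply: sumr_ge0 => u _.
  by rewrite mulr_ge0 // ?(andP (pind01 _ _ _)).1.
have S1 : loc (fun l => \sum_(w in T) pind p w l) = #|T|%:R / p%:R.
  rewrite Avg_sum (eq_bigr (fun=> p%:R^-1)); last by move=> w _; rewrite loc_pind.
  by rewrite sumr_const mulr_natl.
apply/andP; split; last first.
  by rewrite -S1; apply: le_Avg => l _; have /andP[] := B l.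
apply: le_trans (le_Avg (fun l _ => (andP (B l)).1)).
rewrite AvgB S1 lerD2l lerN2 Avg_sum expr_div_n -[leRHS]mulrA expr2 -natrM.
apply: le_trans (_ : \sum_(w in T) \sum_(w' in T) p%:R^-1 ^+ 2 <= _); last first.
  by rewrite !sumr_const -mulrnA -[leLHS]mulr_natl !natrM expr2 invfM !mulrA.
apply: ler_sum => w _; rewrite Avg_sum; apply: le_trans (_ : \sum_(w' in T | w' != w) p%:R^-1 ^+ 2 <= _).
  by apply: ler_sum => w' /andP[_ ne]; apply: loc_pind2; rewrite eq_sym.
by rewrite [leRHS](bigID (fun w' => w' != w)) /= lerDl; apply: sumr_ge0 => ? _; rewrite exprn_ge0 ?invr_ge0.
Qed.

End LocalDensities.

(** * Averages of the sieve weights over the corners of cubes *)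

Section FormsEstimate.
Variables (R : realFieldType) (k q n0 N H s y z Y : nat).
Notation W := (k.-tuple bool).
Notation pset := {set 'I_Y}.
Notation form := (@form k q n0 N).
Notation pind := (@pind R k q n0 N).
Notation pany := (@pany R k q n0 N).
Implicit Types (w : W) (T : {set W}) (p : 'I_Y) (D E U : pset) (M : {ffun W -> pset}).
Hypotheses (z0 : (0 < z)%N) (H0 : (0 < H)%N) (HN : (H <= N)%N).
Hypotheses (y0 : (0 < y)%N) (qy : (q <= y)%N) (q0 : (0 < q)%N) (zy : (z <= 2 ^ y./2)%N).

Definition smallP : pset := [set p : 'I_Y | [&& prime p, (p <= y)%N & ~~ (p %| q)%N]].
Definition midP : pset := [set p : 'I_Y | [&& prime p, (y < p)%N & (p <= z)%N]].

Lemma prset_small : prset smallP.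
Proof. by apply/forall_inP => p; rewrite inE => /and3P[]. Qed.

Lemma prset_mid : prset midP.
Proof. by apply/forall_inP => p; rewrite inE => /and3P[]. Qed.

Lemma small_ndvd p : p \in smallP -> ~~ (p %| q)%N.
Proof. by rewrite inE => /and3P[]. Qed.

Lemma mid_ndvd p : p \in midP -> ~~ (p %| q)%N.
Proof.
rewrite inE => /and3P[_ yp _]; apply/negP => /(dvdn_leq q0).
by rewrite leqNgt (leq_ltn_trans qy yp).
Qed.

Lemma disj_small_mid : [disjoint smallP & midP].
Proof.
apply/pred0P => p /=; rewrite !inE; case: (leqP p y) => py; last by rewrite andbF.
by rewrite /= !andbF.
Qed.

Notation lam := (lam R midP z).
Notation G := (selG R midP z).
Notation box := (N :: nseq k.*2 H).

Definition rough T l : R := \prod_(p in smallP) (1 - pany p T l).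
Definition LamR w l : R := \sum_(D : pset | D \subset midP) lam D * \prod_(p in D) pind p w l.

(** Coefficients of the square of Selberg's sum once the pairs [(D, E)] are collected by their
    lcm. *)
Definition beta U : R := \sum_(D : pset | D \subset midP)
  \sum_(E : pset | E \subset midP) if D :|: E == U then lam D * lam E else 0.

Lemma pindX p w l : pind p w l * pind p w l = pind p w l.
Proof. by rewrite /pind; case: (_ %| _)%N; rewrite ?mulr0 ?mulr1. Qed.

Lemma prod_pindU D E w l : \prod_(p in D) pind p w l * \prod_(p in E) pind p w l
  = \prod_(p in D :|: E) pind p w l.
Proof.
rewrite big_mkcond [X in _ * X]big_mkcond [RHS]big_mkcond -big_split /=.
apply: eq_bigr => p _; rewrite inE; case: (p \in D); case: (p \in E);
  by rewrite ?mulr1 ?mul1r ?pindX.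
Qed.

Lemma sqr_LamR w l : LamR w l ^+ 2 =
  \sum_(U : pset | U \subset midP) beta U * \prod_(p in U) pind p w l.
Proof.
rewrite expr2 /LamR mulr_suml.
under [RHS]eq_bigr => U UQ do rewrite /beta mulr_suml.
rewrite [RHS]exchange_big /=; apply: eq_bigr => D DQ.
under [RHS]eq_bigr => U UQ do rewrite mulr_suml.
rewrite mulr_sumr [RHS]exchange_big /=; apply: eq_bigr => E EQ.
rewrite (bigD1 (D :|: E)) /=; last by rewrite subUset DQ.
rewrite eqxx [X in _ + X]big1 => [|U /andP[_ /negPf ne]]; last by rewrite eq_sym ne mul0r.
by rewrite addr0 -prod_pindU; ring.
Qed.

Lemma leq_pr_card D : D \subset midP -> (2 ^ #|D| <= pr D)%N.
Proof.
move=> DQ; rewrite /pr -prod_nat_const; apply: leq_prod => p pD.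
by have /prime_gt1 := prsetP prset_mid (subsetP DQ _ pD).
Qed.

(** [pr D <= z <= 2 ^ y./2] leaves at most [y / 2] primes in [D], all above [y], so [phiS D / pr D]
    is at least [1 - 1/2]. *)
Lemma lam_le2 D : `|lam D| <= 2.
Proof.
case: (boolP ((D \subset midP) && (pr D <= z)%N)) => [/andP[DQ Dz]|h]; last first.
  by rewrite (lam_supp R prset_mid h) normr0.
apply: le_trans (lam_le R prset_mid z0 DQ) _.
have f0 : 0 < phiS R D by apply: phiS_gt0; apply: prsetS prset_mid DQ.
rewrite ler_pdivrMr //.
have cD : (#|D|.*2 <= y)%N.
  have : (2 ^ #|D| <= 2 ^ y./2)%N by apply: leq_trans zy; apply: leq_trans Dz; apply: leq_pr_card.
  by rewrite leq_exp2l // => h; rewrite -(odd_double_half y); lia.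
have yR : 0 < y%:R :> R by rewrite ltr0n.
have py p : p \in D -> y%:R <= p%:R :> R.
  by move/(subsetP DQ); rewrite inE ler_nat => /and3P[_ /ltnW].
have h1 : 1 - \sum_(p in D) (p%:R)^-1 <= \prod_(p in D) (1 - (p : nat)%:R^-1) :> R.
  apply: prod1B_ge => p pD; have := py p pD => yp; have p0 := lt_le_trans yR yp.
  rewrite invr_ge0 ler0n /= invf_le1 //; apply: le_trans yp; by rewrite ler1n.
have h2 : \sum_(p in D) (p%:R)^-1 <= 2^-1 :> R.
  apply: le_trans (_ : \sum_(p in D) y%:R^-1 <= _).
    by apply: ler_sum => p pD; rewrite lef_pV2 ?posrE ?py // (lt_le_trans yR) ?py.
  rewrite sumr_const -[_ *+ #|_|]mulr_natl ler_pdivrMr // mulrC ler_pdivlMr //.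
  by rewrite -natrM ler_nat muln2.
have h3 : phiS R D = (pr D)%:R * \prod_(p in D) (1 - (p : nat)%:R^-1).
  rewrite /phiS /pr natr_prod -big_split /=; apply: eq_bigr => p pD.
  by rewrite mulrBr mulr1 mulfV // gt_eqF // (lt_le_trans yR) ?py.
rewrite h3 mulrCA -[leLHS]mulr1 ler_wpM2l //; lra.
Qed.

(** There are [4 ^ #|U|] pairs of subsets of [U], each contributing at most [2 * 2]. *)
Lemma beta_le U : `|beta U| <= 4 * 4 ^+ #|U|.
Proof.
apply: le_trans (ler_norm_sum _ _ _) _.
apply: le_trans (_ : \sum_(D : pset | D \subset U) \sum_(E : pset | E \subset U) 4 <= _); last first.
  rewrite !sumr_const -mulrnA -[leLHS]mulr_natr ler_wpM2l //.
  have -> : #|[pred D : pset | D \subset U]| = (2 ^ #|U|)%N.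
    by rewrite -card_powerset; apply: eq_card => D; rewrite !inE.
  by rewrite -expnMn natrX.
rewrite [leRHS]big_mkcond [leLHS]big_mkcond /=; apply: ler_sum => D _.
have sum4 : 0 <= \sum_(E : pset | E \subset U) 4 :> R by apply: sumr_ge0.
case: ifP => _; last by case: ifP.
apply: le_trans (ler_norm_sum _ _ _) _.
case: (boolP (D \subset U)) => DU; last first.
  rewrite big1 // => E _; case: eqP => [e|_]; last by rewrite normr0.
  by case/negP: DU; rewrite -e subsetUl.
rewrite [leRHS]big_mkcond [leLHS]big_mkcond /=; apply: ler_sum => E _.
case: ifP => _; last by case: ifP.
case: eqP => [<-|_]; last by rewrite normr0; case: ifP.
rewrite subsetUr normrM; apply: le_trans (_ : 2 * 2 <= _); last by lra.
by apply: ler_pM => //; apply: lam_le2.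
Qed.

Lemma beta_supp U : beta U != 0 -> (U \subset midP) && (pr U <= z ^ 2)%N.
Proof.
apply: contraNT => h; rewrite /beta big1 // => D DQ; apply: big1 => E EQ.
case: eqP => // e.
case: (boolP ((D \subset midP) && (pr D <= z)%N)) => [/andP[_ Dz]|hD]; last by rewrite (lam_supp R prset_mid hD) mul0r.
case: (boolP ((E \subset midP) && (pr E <= z)%N)) => [/andP[_ Ez]|hE]; last by rewrite (lam_supp R prset_mid hE) mulr0.
case/negP: h; rewrite -e subUset DQ EQ /=.
have hI : (0 < pr (D :&: E))%N.
  by apply: pr_gt0; apply: prsetS prset_mid _; apply: subset_trans (subsetIl _ _) DQ.
apply: leq_trans (_ : pr (D :|: E) * pr (D :&: E) <= _)%N; first by rewrite leq_pmulr.
by rewrite prUI -mulnn leq_mul.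
Qed.

Lemma beta_sum : \sum_(U : pset | U \subset midP) beta U / (pr U)%:R = G^-1.
Proof.
rewrite -(selberg_quad R prset_mid z0).
under eq_bigr => U UQ do rewrite /beta mulr_suml.
rewrite exchange_big /=; apply: eq_bigr => D DQ.
under eq_bigr => U UQ do rewrite mulr_suml.
rewrite exchange_big /=; apply: eq_bigr => E EQ.
rewrite (bigD1 (D :|: E)) /=; last by rewrite subUset DQ.
rewrite eqxx big1 ?addr0 // => U /andP[_ ne]; by rewrite eq_sym (negPf ne) mul0r.
Qed.

Definition unionM M : pset := \bigcup_w M w.
(** Indicator that [p] divides every form whose modulus [pr (M w)] contains it. *)
Definition midf M p l : R := \prod_(w | p \in M w) pind p w l.
(** Outside [T] the factor forces [M w] to be empty, so that every [T] is handled with functions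
    defined on all of [W]. *)
Definition coefM T M : R := \prod_w (if w \in T then beta (M w) else (M w == set0)%:R).

Lemma prod_sqr_LamR T l : \prod_(w in T) LamR w l ^+ 2 =
  \sum_(M : {ffun W -> pset} | unionM M \subset midP) coefM T M * \prod_(p in unionM M) midf M p l.
Proof.
have step w : (if w \in T then LamR w l ^+ 2 else 1) = \sum_(U : pset | U \subset midP)
    (if w \in T then beta U else (U == set0)%:R) * \prod_(p in U) pind p w l.
  case: ifP => _; first exact: sqr_LamR.
  rewrite (bigD1 set0) ?sub0set //= eqxx mul1r big_set0 big1 ?addr0 // => U /andP[_ /negPf->].
  by rewrite mul0r.
rewrite big_mkcond /= (eq_bigr _ (fun w _ => step w)) bigA_distr_big /=.
apply: eq_big => [M|M _].
  apply/ffun_onP/idP => [h|h w]; first by apply/bigcupsP => w _; apply: h.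
  by apply: subset_trans h; apply: bigcup_sup.
rewrite big_split /=; congr (_ * _).
rewrite (exchange_big_dep (fun p => p \in unionM M)) /=; last first.
  by move=> w p _ pM; apply/bigcupP; exists w.
by [].
Qed.

Lemma pany01 p T l : 0 <= pany p T l <= 1.
Proof.
rewrite /pany subr_ge0 prodr_ile1 /= ?lerBlDr ?lerDl ?prodr_ge0 // => w _.
  by rewrite subr_ge0; have /andP[] := pind01 R q n0 N p w l.
have /andP[a b] := pind01 R q n0 N p w l.
by rewrite subr_ge0 b lerBlDr lerDl.
Qed.

Lemma midf01 M p l : 0 <= midf M p l <= 1.
Proof.
rewrite prodr_ge0 /=; last by move=> w _; have /andP[] := pind01 R q n0 N p w l.
by apply: prodr_ile1 => w _; apply: pind01.
Qed.

Definition rho T p : R := Avg (nseq k.*2.+1 (p : nat)) (pany p T).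
Definition gam M p : R := Avg (nseq k.*2.+1 (p : nat)) (midf M p).
Definition gM M : R := \prod_(p in unionM M) gam M p.
Definition eta0 : R := N%:R^-1 + k.*2%:R / H%:R.

(** The events at distinct primes factor by [Avg_prod_primes]; the error is the product of all
    primes involved times the sum [eta0] of the reciprocal sides of the box. *)
Lemma box_local T M E : E \subset smallP -> unionM M \subset midP ->
  `|Avg box (fun l => \prod_(p in E) pany p T l * \prod_(p in unionM M) midf M p l)
    - \prod_(p in E) rho T p * gM M| <= (pr E * pr (unionM M))%:R * eta0.
Proof.
move=> EP MQ; set U := unionM M.
have dEU : [disjoint E & U].
  by apply: disjointWl EP _; apply: disjointWr MQ _; exact: disj_small_mid.
pose f (n : nat) (l : seq nat) : R := match insub n : option 'I_Y with
  | Some p => if p \in E then pany p T l else midf M p l | None => 0 end.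
have fv p l : f p l = if p \in E then pany p T l else midf M p l.
  by rewrite /f valK.
pose D := map val (enum (E :|: U)).
have prodD (F : nat -> R) : \prod_(d <- D) F d = \prod_(p in E) F p * \prod_(p in U) F p.
  rewrite big_map big_enum /= -bigU //=.
  by apply: eq_bigl => p; rewrite !inE.
have hEU : prset (E :|: U).
  apply/forall_inP => p; rewrite inE => /orP[/(subsetP EP)|/(subsetP MQ)]; rewrite inE => /andP[] //.
have := @Avg_prod_primes R D box f.
rewrite [size _]/= size_nseq prodD.
have -> : (\prod_(p <- D) p = pr E * pr U)%N by rewrite big_map big_enum /= -prU //.
have -> : \sum_(n <- box) (pr E * pr U)%:R / n%:R = (pr E * pr U)%:R * eta0 :> R.
  rewrite big_cons -mulr_sumr -mulrDr; congr (_ * (_ + _)).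
  elim: (k.*2) => [|j IH]; first by rewrite big_nil mul0r.
  by rewrite /= big_cons IH -natr1 mulrDl mul1r addrC.
have -> : \prod_(p in E) Avg (nseq k.*2.+1 (p : nat)) (f p) = \prod_(p in E) rho T p.
  by apply: eq_bigr => p pE; apply: eq_Avg => l _; rewrite fv pE.
have -> : \prod_(p in U) Avg (nseq k.*2.+1 (p : nat)) (f p) = gM M.
  apply: eq_bigr => p pU; apply: eq_Avg => l _; rewrite fv.
  by rewrite (disjointFl dEU pU).
rewrite (@eq_Avg _ box (fun l => \prod_(p <- D) f p l)
   (fun l => \prod_(p in E) pany p T l * \prod_(p in unionM M) midf M p l)); last first.
  move=> l _; rewrite prodD; congr (_ * _); apply: eq_bigr => p pE; rewrite fv ?pE //.
  by rewrite (disjointFl dEU pE).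
apply.
- by apply/allP => d /mapP[p]; rewrite mem_enum => /(prsetP hEU) ? ->.
- by rewrite map_inj_uniq ?enum_uniq //; apply: val_inj.
- rewrite /= (leq_trans H0 HN); apply/allP => x; rewrite mem_nseq => /andP[_ /eqP->] //.
- move=> d /mapP[p _ ->] l l' ll'; rewrite !fv.
  have P w : pind p w l = pind p w l' by apply: pind_periodic.
  case: ifP => _; rewrite /pany /midf; [congr (1 - _)|]; apply: eq_bigr => w _; by rewrite P.
- move=> d l; rewrite /f; case: insubP => [p _ _|_]; last by rewrite lexx ler01.
  by case: ifP => _; [exact: pany01|exact: midf01].
Qed.

Notation t := #|{: W}|.

Lemma gam_ge0 M p : 0 <= gam M p.
Proof. by apply: Avg_ge0 => l _; have /andP[] := midf01 M p l. Qed.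

Lemma gam_le M p w : p \in midP -> p \in M w -> gam M p <= p%:R^-1.
Proof.
move=> pQ pM; have pp := prsetP prset_mid pQ.
rewrite -(loc_pind R n0 N pp (mid_ndvd pQ) w); apply: le_Avg => l _.
rewrite /midf (bigD1 w) //= ler_piMr ?(andP (pind01 R q n0 N p w l)).1 //.
by apply: prodr_ile1 => v _; apply: pind01.
Qed.

Lemma gam_le2 M p w w' : p \in midP -> p \in M w -> p \in M w' -> w != w' -> gam M p <= p%:R^-1 ^+ 2.
Proof.
move=> pQ pM pM' ne; have pp := prsetP prset_mid pQ.
apply: le_trans (loc_pind2 R n0 N pp (mid_ndvd pQ) ne); apply: le_Avg => l _.
rewrite /midf (bigD1 w) //= (bigD1 w') /=; last by rewrite pM' eq_sym.
rewrite ler_wpM2l ?(andP (pind01 R q n0 N p w l)).1 //.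
rewrite ler_piMr ?(andP (pind01 R q n0 N p w' l)).1 //.
by apply: prodr_ile1 => v _; apply: pind01.
Qed.

Lemma gam_single M p w : p \in midP -> p \in M w -> (forall w', p \in M w' -> w' = w) ->
  gam M p = p%:R^-1.
Proof.
move=> pQ pM uw; have pp := prsetP prset_mid pQ.
rewrite -(loc_pind R n0 N pp (mid_ndvd pQ) w); apply: eq_Avg => l _.
rewrite /midf (big_pred1 w) // => w'; apply/idP/eqP => [/uw|->] //.
Qed.

(** The value [gM M] would have if the forms were independent at every prime. *)
Definition g0 M : R := \prod_w (pr (M w))%:R^-1.

Lemma mid_ge p : p \in midP -> y%:R <= p%:R :> R.
Proof. by rewrite inE ler_nat => /and3P[_ /ltnW]. Qed.

Lemma mid_gt0 p : p \in midP -> 0 < p%:R :> R.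
Proof. by move=> pQ; apply: lt_le_trans (mid_ge pQ); rewrite ltr0n. Qed.

Lemma mid_inv01 p : p \in midP -> 0 <= (p%:R^-1 : R) <= 1.
Proof.
move=> pQ; rewrite invr_ge0 ler0n /= invf_le1 ?mid_gt0 // ler1n.
by have := mid_gt0 pQ; rewrite ltr0n.
Qed.

Lemma g0_union M : g0 M = \prod_(p in unionM M) p%:R^-1 ^+ #|[set w | p \in M w]|.
Proof.
rewrite /g0 (eq_bigr (fun w => \prod_(p in M w) p%:R^-1)); last first.
  by move=> w _; rewrite /pr natr_prod prodfV.
rewrite (exchange_big_dep (fun p => p \in unionM M)) /=; last first.
  by move=> w p _ pM; apply/bigcupP; exists w.
apply: eq_bigr => p _; rewrite -prodr_const; apply: eq_bigl => w.
by rewrite inE.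
Qed.

Lemma gM_le M : unionM M \subset midP -> 0 <= gM M <= (pr (unionM M))%:R^-1.
Proof.
move=> MQ; rewrite prodr_ge0 /=; last by move=> p _; apply: gam_ge0.
rewrite /pr natr_prod -prodfV; apply: ler_prod => p pU; rewrite gam_ge0 /=.
case/bigcupP: (pU) => w _ pM; apply: gam_le pM; exact: (subsetP MQ).
Qed.

(** If no prime is shared by two forms the two sides agree. Otherwise a shared prime [p1] has
    density at most [1 / p1 ^ 2] in both products, a gain of [1 / p1 <= 1 / y] over the trivial
    bound. *)
Lemma gM_g0 M : unionM M \subset midP ->
  `|gM M - g0 M| <= (pr (unionM M))%:R^-1 / y%:R.
Proof.
move=> MQ; have UQ p : p \in unionM M -> p \in midP by apply: (subsetP MQ).
have rhs0 : 0 <= (pr (unionM M))%:R^-1 / y%:R :> R by rewrite divr_ge0 ?invr_ge0.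
have cpos p : p \in unionM M -> (0 < #|[set w | p \in M w]|)%N.
  by case/bigcupP => w _ pM; apply/card_gt0P; exists w; rewrite inE.
case: (boolP [forall p in unionM M, #|[set w | p \in M w]| == 1%N]) => [/forall_inP h|].
  rewrite g0_union /gM (eq_bigr (fun p => p%:R^-1 ^+ #|[set w | p \in M w]|)) ?subrr ?normr0 //.
  move=> p pU; have /cards1P [w e] := h p pU; rewrite e cards1 expr1.
  have ew w' : (p \in M w') = (w' == w) by rewrite -in_set1 -e inE.
  apply: (@gam_single M p w); [exact: UQ|by rewrite ew|].
  by move=> w'; rewrite ew => /eqP.
case/forall_inPn => p1 p1U p1c; have c1 : (1 < #|[set w | p1 \in M w]|)%N.
  by rewrite ltn_neqAle eq_sym p1c cpos.
have p1Q := UQ _ p1U.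
have [w [w' [pw pw' ne]]] : exists w w', [/\ p1 \in M w, p1 \in M w' & w != w'].
  by case/card_gt1P: c1 => w [w' [a b ne]]; exists w, w'; move: a b; rewrite !inE.
have b2 (F : 'I_Y -> R) : (forall p, p \in unionM M -> 0 <= F p <= p%:R^-1) -> F p1 <= p1%:R^-1 ^+ 2 ->
    0 <= \prod_(p in unionM M) F p <= (pr (unionM M))%:R^-1 / y%:R.
  move=> F1 F2; rewrite prodr_ge0 /=; last by move=> p /F1/andP[].
  rewrite /pr natr_prod -prodfV (bigD1 p1) //= [X in _ <= X / _](bigD1 p1) //=.
  rewrite mulrAC; apply: ler_pM.
  - by have /andP[] := F1 _ p1U.
  - by apply: prodr_ge0 => p /andP[/F1/andP[]].
  - apply: le_trans F2 _; rewrite expr2 ler_wpM2l ?invr_ge0 //.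
    by rewrite lef_pV2 ?posrE ?mid_gt0 ?mid_ge // ltr0n.
  by apply: ler_prod => p /andP[/F1].
have /andP[a1 a2] : 0 <= gM M <= (pr (unionM M))%:R^-1 / y%:R.
  apply: b2; last by apply: gam_le2 ne.
  move=> p pU; rewrite gam_ge0 /=; case/bigcupP: (pU) => v _ pM; apply: gam_le pM; exact: UQ.
have /andP[b1 b3] : 0 <= g0 M <= (pr (unionM M))%:R^-1 / y%:R.
  rewrite g0_union; apply: b2.
    move=> p pU; have /andP[i0 i1] := mid_inv01 (UQ p pU); rewrite exprn_ge0 //=.
    by rewrite -[leRHS]expr1; apply: ler_wiXn2l => //; apply: cpos.
  by have /andP[i0 i1] := mid_inv01 p1Q; apply: ler_wiXn2l.
rewrite ler_norml; apply/andP; split; lra.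
Qed.

Definition Zt := ((z ^ 2) ^ t)%N.
(** Total weight of the coefficients in [sum_coefM]: a prime of the union carries a factor at most
    [1 + 4] for each of the [t] forms, hence [5 ^ t], and [sum_expn_pr] turns this into a power of
    [harm Zt], where [Zt] bounds every modulus that occurs. *)
Definition Kt : R := 4 ^+ t * harm R Zt ^+ (5 ^ t).

Lemma Kt_ge0 : 0 <= Kt.
Proof. by rewrite mulr_ge0 ?exprn_ge0 ?harm_ge0. Qed.

Lemma pr_union_le M : (pr (unionM M) <= \prod_w pr (M w))%N.
Proof.
rewrite /pr (exchange_big_dep (fun p => p \in unionM M)) /=; last first.
  by move=> w p _ pM; apply/bigcupP; exists w.
apply: leq_prod => p /bigcupP[w _ pM]; rewrite (bigD1 w) //=.
case: (posnP p) => [-> //|p0]; apply: leq_pmulr.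
by apply: prodn_cond_gt0.
Qed.

Lemma coefM_supp T M : coefM T M != 0 -> (pr (unionM M) <= Zt)%N.
Proof.
move=> h; apply: leq_trans (pr_union_le M) _; rewrite /Zt -prod_nat_const.
apply: leq_prod => w _; move: h; rewrite /coefM (bigD1 w) //= mulf_eq0 negb_or => /andP[+ _].
case: ifP => _; first by move/beta_supp => /andP[].
case: (eqVneq (M w) set0) => [->|_]; last by rewrite eqxx.
by rewrite pr0 expn_gt0 z0.
Qed.

Lemma coefM_le T M : `|coefM T M| <= 4 ^+ t * \prod_w 4 ^+ #|M w|.
Proof.
rewrite /coefM normr_prod -prodr_const -big_split /=; apply: ler_prod => w _.
rewrite normr_ge0 /=; case: ifP => _; first exact: beta_le.
have h1 : 1 <= 4 ^+ #|M w| :> R by apply: exprn_ege1; lra.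
by case: eqP; rewrite ?normr1 ?normr0; lra.
Qed.

Lemma sum_coefM T : \sum_(M : {ffun W -> pset} | unionM M \subset midP)
   `|coefM T M| / (pr (unionM M))%:R <= Kt.
Proof.
have := sum_expn_pr R Zt (5 ^ t)%N prset_mid.
move/(ler_wpM2l (exprn_ge0 t (ler0n R 4))); apply: le_trans.
rewrite (partition_big unionM (fun U => U \subset midP)) //= mulr_sumr [leRHS]big_mkcondr /=.
apply: ler_sum => U UQ; case: (leqP (pr U) Zt) => UZ; last first.
  rewrite big1 // => M /andP[_ /eqP e]; apply/eqP; rewrite mulf_eq0 normr_eq0; apply/orP; left.
  by apply: contraLR UZ => /coefM_supp; rewrite e -leqNgt.
apply: le_trans (_ : \sum_(M : {ffun W -> pset} | M \in ffun_on [pred V : pset | V \subset U])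
    (4 ^+ t * \prod_w 4 ^+ #|M w|) / (pr U)%:R <= _).
  rewrite big_mkcond [leRHS]big_mkcond /=; apply: ler_sum => M _.
  have r0 : 0 <= 4 ^+ t * \prod_w 4 ^+ #|M w| / (pr U)%:R :> R.
    by rewrite divr_ge0 // mulr_ge0 ?exprn_ge0 // prodr_ge0 // => w _; rewrite exprn_ge0.
  case: ifP => [/andP[_ /eqP e]|_]; last by case: ifP.
  rewrite (_ : M \in _); last by apply/ffun_onP => w; rewrite inE -e; apply: bigcup_sup.
  by rewrite e ler_wpM2r ?invr_ge0 // coefM_le.
rewrite -mulr_suml -mulr_sumr -mulrA ler_wpM2l ?exprn_ge0 // ler_wpM2r ?invr_ge0 //.
have -> : \sum_(M : {ffun W -> pset} | M \in ffun_on [pred V : pset | V \subset U]) \prod_(w : W) 4 ^+ #|M w|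
   = \prod_(w : W) \sum_(V : pset | V \subset U) 4 ^+ #|V| :> R.
  by rewrite bigA_distr_big.
rewrite prodr_const natrX -exprM mulnC exprM.
rewrite (eq_bigr (fun V : pset => \prod_(p in V) 4)); last by move=> V _; rewrite prodr_const.
rewrite -(prodD1_sum (fun=> 4)) prodr_const.
by rewrite (_ : 1 + 4 = 5 :> R) //; lra.
Qed.

Lemma sum_g0 T : \sum_(M : {ffun W -> pset} | unionM M \subset midP) coefM T M * g0 M = G^-1 ^+ #|T|.
Proof.
have -> : \sum_(M : {ffun W -> pset} | unionM M \subset midP) coefM T M * g0 M
  = \sum_(M : {ffun W -> pset} | M \in ffun_on [pred V : pset | V \subset midP])
      \prod_w ((if w \in T then beta (M w) else (M w == set0)%:R) / (pr (M w))%:R).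
  apply: eq_big => [M|M _]; last by rewrite /coefM /g0 -big_split.
  apply/idP/ffun_onP => [h w|h]; last by apply/bigcupsP => w _; apply: h.
  by rewrite inE; apply: subset_trans h; apply: bigcup_sup.
rewrite -(bigA_distr_big _ (fun w V => (if w \in T then beta V else (V == set0)%:R) / (pr V)%:R)).
rewrite -prodr_const [RHS]big_mkcond /=; apply: eq_bigr => w _.
case: ifP => _; first exact: beta_sum.
rewrite (bigD1 set0) ?sub0set //= eqxx pr0 divr1 big1 ?addr0 // => V /andP[_ /negPf->].
by rewrite mul0r.
Qed.

(** Rankin's trick: each [pr E <= X] is at most [X ^ 2 / pr E], and the reciprocals add up to at
    most [harm X <= X]. *)
Lemma sum_small_pr : \sum_(E : pset | (E \subset smallP) && (#|E| <= s)%N) (pr E)%:R <= ((y ^ s) ^ 3)%:R :> R.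
Proof.
set X := (y ^ s)%N.
have X0 : (0 < X)%N by rewrite expn_gt0 y0.
have prX E : E \subset smallP -> (#|E| <= s)%N -> (pr E <= X)%N.
  move=> EP Es; apply: leq_trans (_ : y ^ #|E| <= _)%N; last by rewrite leq_pexp2l.
  rewrite /pr -prod_nat_const; apply: leq_prod => p pE.
  by have := subsetP EP _ pE; rewrite inE => /and3P[].
apply: le_trans (_ : \sum_(E : pset | (E \subset smallP) && (pr E <= X)%N) X%:R ^+ 2 * (pr E)%:R^-1 <= _).
  rewrite big_mkcond [leRHS]big_mkcond /=; apply: ler_sum => E _.
  case: ifP => [/andP[EP Es]|_]; last by case: ifP => // _; rewrite mulr_ge0 ?invr_ge0 ?exprn_ge0.
  rewrite EP prX //= ler_pdivlMr; last by rewrite ltr0n pr_gt0 // (prsetS prset_small).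
  by rewrite -expr2 ler_pXn2r ?nnegrE // ler_nat prX.
rewrite -mulr_sumr natrX [leRHS]exprSr ler_wpM2l ?exprn_ge0 //; apply: le_trans (sum_inv_pr R X prset_small) _.
rewrite /harm -[X in _ <= X%:R]card_ord -sumr_const; apply: ler_sum => i _.
by rewrite invf_le1 // ler1n.
Qed.

Definition ET T : R := Avg box (fun l => rough T l * \prod_(w in T) LamR w l ^+ 2).
Definition es T : R := esymm (rho T) s smallP.

Lemma rho01 T p : 0 <= rho T p <= 1.
Proof.
by rewrite Avg_ge0 ?Avg_le1 // => l _; have /andP[] := pany01 p T l.
Qed.

Lemma eta0_ge0 : 0 <= eta0.
Proof. by rewrite addr_ge0 ?invr_ge0 // divr_ge0. Qed.

(** The true average and the product of densities are both compared with the same truncated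
    inclusion-exclusion sum, whose terms [box_local] evaluates; this is why the tail [es] enters
    twice. *)
Lemma term_est T M : unionM M \subset midP ->
  `|Avg box (fun l => rough T l * \prod_(p in unionM M) midf M p l)
     - \prod_(p in smallP) (1 - rho T p) * gM M|
  <= 2 * es T / (pr (unionM M))%:R + ((y ^ s) ^ 3)%:R * (pr (unionM M))%:R * eta0.
Proof.
move=> MQ; set U := unionM M; set F := fun l => \prod_(p in U) midf M p l.
pose u E := Avg box (fun l => \prod_(p in E) pany p T l * F l).
have F01 l : 0 <= F l <= 1.
  rewrite prodr_ge0 /=; last by move=> p _; have /andP[] := midf01 M p l.
  by apply: prodr_ile1 => p _; apply: midf01.
have uE E : E \subset smallP -> `|u E - \prod_(p in E) rho T p * gM M| <= (pr E)%:R * ((pr U)%:R * eta0).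
  by move=> EP; rewrite mulrA -natrM; apply: box_local.
have /andP[g0' gle] := gM_le MQ; rewrite -/U in gle.
pose B := Avg box (fun l => brun (fun p => pany p T l) s smallP * F l).
have BE : B = \sum_(E : pset | (E \subset smallP) && (#|E| < s)%N) (-1) ^+ #|E| * u E.
  rewrite /B /brun; under eq_Avg => l _ do rewrite mulr_suml.
  rewrite Avg_sum; apply: eq_bigr => E _; rewrite -AvgZ; apply: eq_Avg => l _.
  by rewrite prodrN mulrA.
have h1 : `|Avg box (fun l => rough T l * F l) - B| <=
    \sum_(E : pset | (E \subset smallP) && (#|E| == s)) u E.
  rewrite /B -AvgB; apply: le_trans (ler_norm_Avg _ _) _.
  rewrite -Avg_sum; apply: le_Avg => l _; rewrite -mulrBl normrM [`|F l|]ger0_norm ?(andP (F01 l)).1 //.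
  rewrite -mulr_suml ler_wpM2r ?(andP (F01 l)).1 //.
  by apply: bonferroni => p; apply: pany01.
have h2 : `|B - brun (rho T) s smallP * gM M| <=
   \sum_(E : pset | (E \subset smallP) && (#|E| < s)%N) (pr E)%:R * ((pr U)%:R * eta0).
  rewrite BE /brun mulr_suml -sumrB; apply: le_trans (ler_norm_sum _ _ _) _.
  apply: ler_sum => E /andP[EP _]; rewrite prodrN -mulrA -mulrBr normrM normrX normrN1 expr1n mul1r.
  exact: uE.
have h3 : \sum_(E : pset | (E \subset smallP) && (#|E| == s)) u E <=
   es T * gM M + \sum_(E : pset | (E \subset smallP) && (#|E| == s)) (pr E)%:R * ((pr U)%:R * eta0).
  rewrite /es /esymm mulr_suml -big_split /=; apply: ler_sum => E /andP[EP _].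
  by have := uE E EP; rewrite ler_norml => /andP[_]; rewrite lerBlDl.
have h4 : `|brun (rho T) s smallP * gM M - \prod_(p in smallP) (1 - rho T p) * gM M| <= es T * gM M.
  rewrite -mulrBl normrM [`|gM M|]ger0_norm // ler_wpM2r // distrC.
  by apply: bonferroni => p; apply: rho01.
have h5 : \sum_(E : pset | (E \subset smallP) && (#|E| < s)%N) (pr E)%:R * ((pr U)%:R * eta0)
   + \sum_(E : pset | (E \subset smallP) && (#|E| == s)) (pr E)%:R * ((pr U)%:R * eta0)
   <= ((y ^ s) ^ 3)%:R * (pr U)%:R * eta0.
  rewrite -!mulr_suml -mulrDl -mulrA ler_wpM2r ?mulr_ge0 ?eta0_ge0 //.
  apply: le_trans sum_small_pr; rewrite le_eqVlt; apply/orP; left; apply/eqP.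
  rewrite [RHS](bigID (fun E : pset => (#|E| < s)%N)) /=; congr (_ + _); apply: eq_bigl => E;
  by rewrite -andbA; congr (_ && _); case: ltngtP.
have e0 : 0 <= es T by apply: esymm_ge0 => p; have /andP[] := rho01 T p.
have h6 : es T * gM M <= es T / (pr U)%:R by rewrite ler_wpM2l.
move: h1 h2 h3 h4 h5; set a := Avg box _; set b := brun _ _ _ * _; set c := \prod_(p in smallP) _ * _.
set S1 := \sum_(_ | _) u _; set S2 := \sum_(_ | _) _; set S3 := \sum_(_ | _) _.
rewrite !ler_norml => /andP[? ?] /andP[? ?] ? /andP[? ?] ?; rewrite -mulrA.
apply/andP; split; lra.
Qed.

(** After expansion of the squares, [term_est] treats each term; replacing [gM] by [g0] costs the
    factor [1 / y], and [sum_g0] adds the main terms up to the power of [G^-1]. *)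
Lemma ET_est T :
  `|ET T - \prod_(p in smallP) (1 - rho T p) * G^-1 ^+ #|T| |
  <= Kt * (2 * es T + \prod_(p in smallP) (1 - rho T p) / y%:R + ((y ^ s) ^ 3)%:R * Zt%:R ^+ 2 * eta0).
Proof.
set V := \prod_(p in smallP) _.
have V01 : 0 <= V <= 1.
  rewrite prodr_ge0 /=; last by move=> p _; rewrite subr_ge0; have /andP[] := rho01 T p.
  apply: prodr_ile1 => p _; have /andP[a b] := rho01 T p; by rewrite subr_ge0 b lerBlDr lerDl.
have -> : ET T = \sum_(M : {ffun W -> pset} | unionM M \subset midP)
   coefM T M * Avg box (fun l => rough T l * \prod_(p in unionM M) midf M p l).
  rewrite /ET; under eq_Avg => l _ do rewrite prod_sqr_LamR mulr_sumr.
  by rewrite Avg_sum; apply: eq_bigr => M _; rewrite -AvgZ; apply: eq_Avg => l _; ring.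
rewrite -sum_g0 mulr_sumr -sumrB.
set c1 := 2 * es T + _ + _.
apply: le_trans (_ : _ <= \sum_(M : {ffun W -> pset} | unionM M \subset midP)
   `|coefM T M| / (pr (unionM M))%:R * c1) _; last first.
  rewrite -mulr_suml ler_wpM2r ?sum_coefM // /c1.
  have e0 : 0 <= es T by apply: esymm_ge0 => p; have /andP[] := rho01 T p.
  by case/andP: V01 => V0 _; rewrite !addr_ge0 ?mulr_ge0 ?invr_ge0 ?eta0_ge0.
apply: le_trans (ler_norm_sum _ _ _) _; apply: ler_sum => M MQ.
case: (eqVneq (coefM T M) 0) => [->|cM]; first by rewrite !mul0r mulr0 subr0 normr0 !mul0r.
have UZ := coefM_supp cM; set U := unionM M in UZ *.
have U0 : (0 < pr U)%N by apply: pr_gt0; apply: prsetS prset_mid MQ.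
have U0R : 0 < (pr U)%:R :> R by rewrite ltr0n.
rewrite [V * _]mulrCA -mulrBr normrM -mulrA ler_wpM2l //.
have h1 := term_est T MQ; rewrite -/V -/U in h1.
have h2 := gM_g0 MQ; rewrite -/U in h2.
set a := Avg _ _ in h1 *.
have -> : a - V * g0 M = (a - V * gM M) + V * (gM M - g0 M) by ring.
apply: le_trans (ler_normD _ _) _.
have h3 : `|V * (gM M - g0 M)| <= V * ((pr U)%:R^-1 / y%:R).
  by case/andP: V01 => V0 _; rewrite normrM ger0_norm // ler_wpM2l.
apply: le_trans (lerD h1 h3) _; rewrite /c1.
have h4 : ((y ^ s) ^ 3)%:R * (pr U)%:R * eta0 <= (pr U)%:R^-1 * (((y ^ s) ^ 3)%:R * Zt%:R ^+ 2 * eta0).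
  rewrite ler_pdivlMl // -!mulrA ![_ * (((y ^ s) ^ 3)%:R * _)]mulrCA ler_wpM2l //.
  by rewrite !mulrA ler_wpM2r ?eta0_ge0 // ler_pM // ler_nat.
set d := ((y ^ s) ^ 3)%:R * Zt%:R ^+ 2 * eta0 in h4 *.
have -> : (pr U)%:R^-1 * (2 * es T + V / y%:R + d)
   = 2 * es T / (pr U)%:R + (pr U)%:R^-1 * d + V * ((pr U)%:R^-1 / y%:R) by ring.
by rewrite lerD2r lerD2l.
Qed.

End FormsEstimate.

(** * A sieve majorant *)

Section Growth.

Lemma leq_expn2r m n e : (m <= n)%N -> (m ^ e <= n ^ e)%N.
Proof. by case: e => // e mn; rewrite leq_exp2r. Qed.

Lemma polyexp (C d : nat) : exists s0, forall s, (s0 <= s)%N -> (C * s ^ d <= 2 ^ s)%N.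
Proof.
exists (d.+1 * (C * d.+1 ^ d).+1)%N => s hs; set i := (s %/ d.+1)%N.
have si : (s <= d.+1 * i.+1)%N by rewrite mulnC; apply: ltnW; apply: ltn_ceil.
have ih : (C * d.+1 ^ d <= i)%N.
  by rewrite leq_divRL //; apply: leq_trans hs; rewrite mulnC leq_mul2l leqW ?orbT.
apply: leq_trans (_ : C * (d.+1 * i.+1) ^ d <= _)%N; first by rewrite leq_mul2l leq_expn2r ?orbT.
rewrite expnMn mulnA; apply: leq_trans (_ : i.+1 * i.+1 ^ d <= _)%N.
  by rewrite leq_mul2r (leq_trans ih) ?orbT.
rewrite -expnS; apply: leq_trans (_ : (2 ^ i) ^ d.+1 <= _)%N; first by rewrite leq_exp2r // ltn_expl.
by rewrite -expnM leq_exp2l // leq_divM.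
Qed.

(** Guarantees the hypothesis of [expn_fact_le] when [b] is the sum of the small-prime densities,
    which is of order [log s]. *)
Lemma log_sq_le (a : nat) : exists s0, forall s, (s0 <= s)%N -> (16 * (a * (trunc_log 2 s).+1) ^ 2 <= s)%N.
Proof.
have [j0 h] := polyexp (16 * a ^ 2 * 4) 2.
exists (2 ^ j0.+1)%N => s hs; set j := trunc_log 2 s.
have s0 : (0 < s)%N by apply: leq_trans hs; rewrite expn_gt0.
have jj : (j0 < j)%N by apply: trunc_log_max.
apply: leq_trans (trunc_logP (isT : (1 < 2)%N) s0); rewrite -/j.
apply: leq_trans (h j (ltnW jj)); rewrite expnMn -!mulnA leq_mul2l /= leq_mul2l.
apply/orP; right; rewrite leq_mul2l; apply/orP; right; rewrite -(expnMn 2 j 2) leq_exp2r //; lia.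
Qed.

Lemma fact_ge_expn c s : (c ^ (s - c) <= s`!)%N.
Proof.
elim: s => [|s IH]; first by rewrite sub0n.
case: (leqP c s) => cs; last by rewrite (eqP (_ : (s.+1 - c == 0)%N)) ?fact_gt0 //; lia.
by rewrite subSn // expnS factS leq_mul // (leq_trans cs).
Qed.

(** Turns the tail [b ^ s / s!] of the truncated sieve into [2 ^ - s]: [s!] is at least
    [(4 b) ^ (s - 4 b)], and the missing power [(4 b) ^ (4 b)] is at most [2 ^ s]. *)
Lemma expn_fact_le b s : (16 * b ^ 2 <= s)%N -> (b ^ s * 2 ^ s <= s`!)%N.
Proof.
move=> hb; case: (posnP b) => [->|b0].
  case: s hb => [|s] _; first by rewrite !expn0.
  by rewrite exp0n.
have b4 : (4 * b <= s)%N by apply: leq_trans hb; rewrite -mulnn; nia.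
apply: leq_trans (fact_ge_expn (4 * b) s).
rewrite -(leq_pmul2r (_ : 0 < (4 * b) ^ (4 * b))%N); last by rewrite expn_gt0; lia.
rewrite -expnD subnK //.
have h : ((4 * b) ^ (4 * b) <= 2 ^ s)%N.
  apply: leq_trans (_ : (2 ^ (4 * b)) ^ (4 * b) <= _)%N.
    by rewrite leq_exp2r ?muln_gt0 // ltnW // ltn_expl.
  by rewrite -expnM leq_exp2l //; apply: leq_trans hb; rewrite -mulnn; lia.
apply: leq_trans (_ : b ^ s * 2 ^ s * 2 ^ s <= _)%N; first by rewrite leq_mul2l h orbT.
by rewrite -mulnA -expnMn -expnMn mulnC.
Qed.

Variable R : realFieldType.

Lemma harm_pow2 j : harm R (2 ^ j) <= 1 + j%:R.
Proof.
elim: j => [|j IH]; first by rewrite expn0 /harm big_ord1 invr1 addr0.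
rewrite expnS mul2n -addnn /harm big_split_ord /= -natr1 addrA; apply: lerD => //.
apply: le_trans (_ : \sum_(i < 2 ^ j) (2 ^ j)%:R^-1 <= _).
  apply: ler_sum => i _; rewrite lef_pV2 ?posrE ?ltr0n ?expn_gt0 // ler_nat.
  by rewrite leqW // leq_addr.
by rewrite sumr_const card_ord -[_ *+ _]mulr_natl mulfV // pnatr_eq0 -lt0n expn_gt0.
Qed.

(** Cut the range into blocks of length [m]: the first is [harm m], the following ones contribute at
    most [1, 1/2, ..., 1/n]. *)
Lemma harmM m n : (0 < m)%N -> harm R (m * n.+1) <= harm R m + harm R n.
Proof.
move=> m0; have mR : 0 < m%:R :> R by rewrite ltr0n.
elim: n => [|n IH]; first by rewrite muln1 [harm R 0]/harm big_ord0 addr0.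
rewrite mulnS addnC {1}/harm big_split_ord /= -/(harm _ _) [X in _ <= _ + X]/harm big_ord_recr /= addrA.
apply: lerD; first exact: IH.
apply: le_trans (_ : \sum_(i < m) (m%:R * n.+1%:R)^-1 <= _).
  apply: ler_sum => i _; rewrite -natrM lef_pV2 ?posrE ?ltr0n ?muln_gt0 ?m0 // ler_nat.
  by rewrite leqW // leq_addr.
rewrite sumr_const card_ord -[_ *+ _]mulr_natl invfM mulrA mulfV ?mul1r // gt_eqF //.
Qed.

Lemma harmX m e : (0 < m)%N -> harm R (m ^ e) <= 1 + e%:R * harm R m.
Proof.
move=> m0; elim: e => [|e IH]; first by rewrite expn0 mul0r addr0 /harm big_ord1 invr1.
have e0 : (0 < m ^ e)%N by rewrite expn_gt0 m0.
rewrite expnSr -natr1 mulrDl mul1r addrA; case: m m0 IH e0 => // m _ IH e0.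
apply: le_trans (harmM _ e0) _; apply: lerD => //.
exact: harm_le.
Qed.

Lemma sum_inv_sqr w Y : (0 < w)%N -> \sum_(i < Y | (w < i)%N) (i%:R^-1) ^+ 2 <= w%:R^-1 :> R.
Proof.
move=> w0; have wR : 0 < w%:R :> R by rewrite ltr0n.
case: (leqP Y w) => Yw.
  by rewrite big_pred0 ?invr_ge0 // => i; apply/negP => wi; have := ltn_ord i; lia.
rewrite -(subnKC Yw); elim: (Y - w.+1)%N => [|j IH].
  rewrite addn0 big_pred0 ?invr_ge0 // => i; apply/negP => wi; have := ltn_ord i; lia.
suff H : forall j, \sum_(i < w.+1 + j | (w < i)%N) (i%:R^-1) ^+ 2 <= w%:R^-1 - (w + j)%:R^-1 :> R.
  by apply: le_trans (H _) _; rewrite lerBlDr lerDl invr_ge0.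
move=> {IH} {}j; elim: j => [|j IH].
  by rewrite !addn0 subrr big_pred0 // => i; apply/negP => wi; have := ltn_ord i; lia.
rewrite big_mkcond addnS big_ord_recr /= -big_mkcond /= leq_addr.
apply: le_trans (lerD IH (lexx _)) _.
rewrite addSn addnS -natr1; set a := (w + j)%:R.
have a0 : 0 < a :> R by rewrite ltr0n addn_gt0 w0.
rewrite -subr_ge0; have -> : w%:R^-1 - (a + 1)^-1 - (w%:R^-1 - a^-1 + (a + 1)^-1 ^+ 2) =
  (a * (a + 1) ^+ 2)^-1 by field; rewrite ?gt_eqF //; lra.
by rewrite invr_ge0 mulr_ge0 ?exprn_ge0 // ltW //; lra.
Qed.

End Growth.

(** * Comparison of local densities with the independent model *)

Section SmallPrimes.
Variable R : realFieldType.

Lemma expr1B_ge (i : R) j : 0 <= i <= 1 -> 1 - j%:R * i <= (1 - i) ^+ j.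
Proof.
case/andP=> i0 i1; elim: j => [|j IH]; first by rewrite mul0r subr0.
rewrite exprS -natr1; have j0 : 0 <= j%:R :> R by [].
apply: le_trans (ler_wpM2l _ IH); [nra|lra].
Qed.

Lemma expr1B_le (i : R) j : 0 <= i <= 1 -> (1 - i) ^+ j <= 1 - j%:R * i + (j%:R * i) ^+ 2.
Proof.
case/andP=> i0 i1; elim: j => [|j IH]; first by rewrite mul0r subr0 expr0n addr0.
rewrite exprS -natr1; have j0 : 0 <= j%:R :> R by [].
apply: le_trans (ler_wpM2l _ IH) _; first lra.
rewrite -subr_ge0; set X := (X in 0 <= X).
have -> : X = i ^+ 2 * (1 + j%:R + j%:R ^+ 2 * i) by rewrite /X; ring.
by rewrite mulr_ge0 ?sqr_ge0 // !addr_ge0 ?mulr_ge0 ?sqr_ge0.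
Qed.

(* Replaces the true density [r p] of forms divisible by a small prime by the independent model. *)
Lemma prod_ratio (Y w j : nat) (P : {set 'I_Y}) (r : 'I_Y -> R) :
  (4 * j ^ 2 <= w)%N -> (0 < w)%N -> (forall p, p \in P -> (w < p)%N) ->
  (forall p : 'I_Y, p \in P -> j%:R / p%:R - (j%:R / p%:R) ^+ 2 <= r p <= j%:R / p%:R) ->
  `|\prod_(p in P) (1 - r p) - \prod_(p in P) (1 - p%:R^-1) ^+ j|
    <= 4 * j%:R ^+ 2 / w%:R * \prod_(p in P) (1 - p%:R^-1) ^+ j.
Proof.
move=> jw w0 Pw hr; have wR : 0 < w%:R :> R by rewrite ltr0n.
(* Relative error allowed at [p]; it is quadratic in [1 / p], so the sum over all [p > w] is of
   order [j ^ 2 / w]. *)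
pose x (p : 'I_Y) : R := 2 * j%:R ^+ 2 * (p%:R^-1) ^+ 2.
pose v (p : 'I_Y) : R := (1 - p%:R^-1) ^+ j.
have j4 : 4 * j%:R ^+ 2 <= w%:R :> R by rewrite -natrX -natrM ler_nat.
have pw p : p \in P -> w%:R < p%:R :> R by move=> /Pw; rewrite ltr_nat.
have sumx : \sum_(p in P) x p <= 2 * j%:R ^+ 2 / w%:R.
  rewrite -mulr_sumr ler_wpM2l ?mulr_ge0 ?exprn_ge0 //.
  apply: le_trans (sum_inv_sqr R Y w0).
  rewrite big_mkcond [leRHS]big_mkcond /=; apply: ler_sum => p _.
  case: (boolP (p \in P)) => [/Pw->//|_]; case: ifP => // _; by rewrite sqr_ge0.
have x0 p : 0 <= x p by rewrite !mulr_ge0 ?exprn_ge0 ?invr_ge0.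
have key p : p \in P -> [/\ 0 < v p, v p * (1 - x p) <= 1 - r p, 1 - r p <= v p * (1 + x p) & x p <= 1].
  move=> pP; have wp := pw p pP; have p0 : 0 < p%:R :> R by apply: lt_trans wp.
  have /andP[r1 r2] := hr p pP.
  rewrite /x /v; set i := p%:R^-1 : R in r1 r2 *; have i0 : 0 < i by rewrite invr_gt0.
  have iw : i * w%:R < 1 by rewrite mulrC ltr_pdivrMr // mul1r.
  have i1 : i < 1.
    by rewrite /i invf_lt1 //; apply: le_lt_trans wp; rewrite ler1n.
  have jR : 0 <= j%:R :> R by [].
  have jj : j%:R <= j%:R ^+ 2 :> R by rewrite -natrX ler_nat; case: (j) => // n; rewrite -mulnn leq_pmulr.
  have ji : 4 * j%:R ^+ 2 * i <= 1 by apply: le_trans (ltW iw); rewrite [i * _]mulrC ler_wpM2r // ltW.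
  have i01 : 0 <= i <= 1 by rewrite !ltW.
  have B1 := expr1B_ge j i01; have B2 := expr1B_le j i01.
  set J := j%:R in jR jj ji r1 r2 B1 B2 *; set V := (1 - i) ^+ j in B1 B2 *.
  have Ji : J * i <= J ^+ 2 * i by rewrite ler_wpM2r // ltW.
  have Ji2 : J * i <= 4^-1 by lra.
  have V1 : 2^-1 <= V by lra.
  have Q0 : 0 <= J ^+ 2 * i ^+ 2 by rewrite mulr_ge0 ?sqr_ge0.
  have VQ : (J * i) ^+ 2 <= V * (2 * J ^+ 2 * i ^+ 2) by rewrite exprMn; nra.
  have J2i : J ^+ 2 * i ^+ 2 <= J ^+ 2 * i by rewrite expr2 [i ^+ 2]expr2 mulrA ler_piMr // ?mulr_ge0 ?sqr_ge0 // ?ltW.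
  split; [lra| | |lra].
    by rewrite mulrBr mulr1; lra.
  by rewrite mulrDr mulr1; lra.
have -> : \prod_(p in P) (1 - p%:R^-1) ^+ j = \prod_(p in P) v p by [].
set Pv := \prod_(p in P) v p.
have Pv0 : 0 <= Pv by apply: prodr_ge0 => p pP; have [/ltW] := key p pP.
have L1 : Pv * \prod_(p in P) (1 - x p) <= \prod_(p in P) (1 - r p).
  rewrite /Pv -big_split /=; apply: ler_prod => p pP; have [a b _ c] := key p pP.
  by rewrite b mulr_ge0 ?(ltW a) // subr_ge0.
have L2 : \prod_(p in P) (1 - r p) <= Pv * \prod_(p in P) (1 + x p).
  rewrite /Pv -big_split /=; apply: ler_prod => p pP; have [a b c d] := key p pP.
  by rewrite c andbT; apply: le_trans b; rewrite mulr_ge0 ?(ltW a) // subr_ge0.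
have L3 : 1 - \sum_(p in P) x p <= \prod_(p in P) (1 - x p).
  by apply: prod1B_ge => p pP; rewrite x0; have [] := key p pP.
(* Since [(1 + x) (1 - x) <= 1], the lower bound [L3] for one product yields an upper bound for the
   other. *)
have L4 : \prod_(p in P) (1 + x p) * \prod_(p in P) (1 - x p) <= 1.
  rewrite -big_split /=; apply: prodr_ile1 => p pP; have [_ _ _ d] := key p pP.
  by have := x0 p; nra.
set S := \sum_(p in P) x p in L3 sumx; set A := \prod_(p in P) (1 - x p) in L1 L3 L4.
set B := \prod_(p in P) (1 + x p) in L2 L4; set X := \prod_(p in P) (1 - r p) in L1 L2 *.
have B0 : 0 <= B by apply: prodr_ge0 => p _; rewrite addr_ge0.
pose c : R := j%:R ^+ 2 / w%:R; have cE : 4 * j%:R ^+ 2 / w%:R = 4 * c by rewrite /c; ring.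
have c0 : 0 <= c by rewrite divr_ge0 ?exprn_ge0.
have cs : S <= 2 * c by move: sumx; rewrite /c; lra.
have c1 : 4 * c <= 1 by rewrite -cE ler_pdivrMr // mul1r.
have BA : B <= 1 + 4 * c by nra.
rewrite cE ler_norml; apply/andP; split; nra.
Qed.

End SmallPrimes.

(** * Euler factors of the primes dividing the modulus *)

Section TotientDensity.
Variables (R : realFieldType) (q y Y : nat).
Hypotheses (q0 : (0 < q)%N) (qy : (q <= y)%N) (yY : (y < Y)%N).

Lemma totient_prod : (totient q)%:R = q%:R * \prod_(p <- primes q) (1 - p%:R^-1) :> R.
Proof.
have qE : q%:R = \prod_(p <- primes q) (p ^ logn p q)%:R :> R.
  by rewrite {1}(prod_prime_decomp q0) prime_decompE big_map natr_prod.
rewrite totientE // natr_prod qE -big_split /=.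
apply: eq_big_seq => p; rewrite mem_primes => /and3P[pp _ pq].
have e0 : (0 < logn p q)%N by rewrite logn_gt0 mem_primes pp q0.
have p0 : p%:R != 0 :> R by rewrite pnatr_eq0 -lt0n prime_gt0.
rewrite -{2}(prednK e0) expnS mulnC !natrM -mulrA [RHS]mulrCA; congr (_ * _).
by rewrite mulrBr mulr1 mulfV // -subn1 natrB ?prime_gt0.
Qed.

(** All prime factors of [q] are at most [y]; they contribute [q / totient q], and the other primes
    make up [smallP]. *)
Lemma prod_all_primes :
  \prod_(p in [set p : 'I_Y | prime p && (p <= y)%N]) (p%:R / (p%:R - 1)) =
  (\prod_(p in smallP q y Y) (1 - p%:R^-1))^-1 * (q%:R / (totient q)%:R) :> R.
Proof.
pose f (p : nat) : R := p%:R / (p%:R - 1).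
have fE p : prime p -> f p = (1 - p%:R^-1)^-1.
  move=> pp; have p1 : 1 < p%:R :> R by rewrite ltr1n prime_gt1.
  by rewrite /f; field; rewrite ?gt_eqF //; lra.
rewrite (bigID (fun p : 'I_Y => p %| q)%N) /= mulrC; congr (_ * _).
  rewrite -prodfV; apply: eq_big => p; first by rewrite !inE andbA.
  by rewrite inE => /andP[/andP[pp _] _]; rewrite -fE.
have t0 : (totient q)%:R != 0 :> R by rewrite pnatr_eq0 -lt0n totient_gt0.
have qR : q%:R != 0 :> R by rewrite pnatr_eq0 -lt0n.
have := totient_prod; move/(congr1 (fun x => (q%:R / (totient q)%:R) * x)).
rewrite -mulrA mulVf // mulr1 => e; apply: (mulIf qR).
pose P := [set p : 'I_Y | [&& prime p, (p <= y)%N & (p %| q)%N]].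
have eP : perm_eq (map val (enum P)) (primes q).
  apply: uniq_perm; [by rewrite map_inj_uniq ?enum_uniq //; apply: val_inj|exact: primes_uniq|].
  move=> p; rewrite mem_primes q0 /=; apply/mapP/andP => [[p' ]|[pp pq]].
    by rewrite mem_enum inE => /and3P[pp _ pq] ->.
  have py : (p <= y)%N by apply: leq_trans qy; apply: dvdn_leq.
  by exists (Ordinal (leq_ltn_trans py yY)); rewrite // mem_enum inE pp py.
rewrite -(perm_big _ eP) /= big_map big_enum /= in e.
have F0 : \prod_(p in P) (1 - (p : nat)%:R^-1) != 0 :> R.
  apply/prodf_neq0 => p; rewrite inE => /and3P[/prime_gt1 p1 _ _].
  by rewrite subr_eq0 eq_sym invr_eq1 pnatr_eq1 gtn_eqF.
rewrite (eq_bigl (fun p => p \in P)); last by move=> p; rewrite !inE andbA.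
apply: (mulIf F0); rewrite -[RHS]mulrA -e mulrAC -big_split /=.
rewrite big1 ?mul1r; last first.
  move=> p; rewrite inE => /and3P[pp _ _]; rewrite -/(f p) fE // mulVf //.
  by rewrite subr_eq0 eq_sym invr_eq1 pnatr_eq1 gtn_eqF // prime_gt1.
by [].
Qed.

End TotientDensity.

(** * The majorant: size at primes and averages over corners *)

Section Majorant.
Variables (R : realFieldType) (k q n0 N s y z Y : nat).
Hypotheses (z0 : (0 < z)%N) (y0 : (0 < y)%N) (qy : (q <= y)%N) (q0 : (0 < q)%N).
Hypotheses (zN : (z < N)%N) (yN : (y < N)%N) (yY : (y < Y)%N) (zY : (z < Y)%N).
Notation W := (k.-tuple bool).

Definition dl (p L : nat) : R := (p %| q * L + n0)%N%:R.
Definition VV : R := \prod_(p in smallP q y Y) (1 - p%:R^-1).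
(* An exact sieve by the primes up to [y] times a Selberg square over the primes in [(y, z]],
   normalised to mean value close to 1. *)
Definition nu (L : nat) : R := selG R (midP y z Y) z / VV *
  (\prod_(p in smallP q y Y) (1 - dl p L) *
   (\sum_(D : {set 'I_Y} | D \subset midP y z Y) lam R (midP y z Y) z D * \prod_(p in D) dl p L) ^+ 2).

Lemma inv_prime01 p : prime p -> 0 <= (p%:R^-1 : R) <= 2^-1.
Proof.
move=> pp; rewrite invr_ge0 ler0n /= lef_pV2 ?posrE ?ltr0n ?prime_gt0 // ler_nat.
exact: prime_gt1.
Qed.

Lemma VV_gt0 : 0 < VV.
Proof.
apply: prodr_gt0 => p; rewrite inE => /and3P[pp _ _].
by have := inv_prime01 pp; rewrite subr_gt0; lra.
Qed.

(** Extending the product to all integers [2 <= i <= y] only decreases it, and the extended product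
    telescopes to [1 / y]. *)
Lemma VV_ge : y%:R^-1 <= VV.
Proof.
have -> : y%:R^-1 = \prod_(i < Y | (1 < i <= y)%N) (1 - (i : nat)%:R^-1) :> R.
  have -> : \prod_(i < Y | (1 < i <= y)%N) (1 - (i : nat)%:R^-1) =
     \prod_(2 <= i < y.+1) (1 - i%:R^-1) :> R.
    rewrite (big_nat_widen _ _ Y) // big_geq_mkord; apply: eq_bigl => i.
    by rewrite ltnS andbC.
  case: y y0 => // n _; elim: n => [|n IH]; first by rewrite big_geq // invr1.
  rewrite big_nat_recr //= -IH; field.
  by have n0' := ler0n R n; apply/andP; split; rewrite gt_eqF //; lra.
rewrite [leRHS]big_mkcond [leLHS]big_mkcond /=; apply: ler_prod => p _.
case: (boolP (p \in smallP q y Y)) => [|_].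
  rewrite inE => /and3P[pp py _]; rewrite py (prime_gt1 pp) /= lexx.
  by have := inv_prime01 pp; rewrite subr_ge0; lra.
case: ifP => [/andP[p1 _]|_]; last by rewrite ler01 lexx.
have p0 : 0 < p%:R :> R by rewrite ltr0n ltnW.
rewrite subr_ge0 invf_le1 // ler1n ltnW //= lerBlDr lerDl invr_ge0 ltW //.
Qed.

Lemma nu_ge0 L : 0 <= nu L.
Proof.
rewrite /nu mulr_ge0 //.
  by rewrite divr_ge0 ?(ltW VV_gt0) // ltW // selG_gt0 // prset_mid.
rewrite mulr_ge0 ?sqr_ge0 // prodr_ge0 // => p _.
by rewrite /dl subr_ge0; case: (_ %| _)%N.
Qed.

(** A prime above [y] and [z] has no sieved factor, so only [lam set0 = 1] survives and
    [nu L = G / VV]; [harm_le_selG], applied with all primes up to [y], bounds this from below. *)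
Lemma nu_prime L : (N <= L)%N -> prime (q * L + n0) -> harm R z * ((totient q)%:R / q%:R) <= nu L.
Proof.
move=> NL pn; set n := (q * L + n0)%N in pn.
have nn : (N <= n)%N by rewrite /n; apply: leq_trans NL _; apply: leq_trans (leq_addr n0 _); apply: leq_pmull.
have dl0 (p : 'I_Y) : prime p -> (p <= y)%N || (p <= z)%N -> dl p L = 0.
  move=> pp h; rewrite /dl -/n dvdn_prime2 //; case: eqP => // e.
  by move: h; rewrite e; case/orP => h; lia.
rewrite /nu big1 ?mul1r; last first.
  by move=> p; rewrite inE => /and3P[pp py _]; rewrite dl0 ?subr0 ?py.
rewrite (bigD1 set0) ?sub0set //= big_set0 mulr1 lam0 ?prset_mid // big1 ?addr0; last first.
  move=> D /andP[DQ D0]; have /set0Pn [p pD] := D0.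
  have := subsetP DQ _ pD; rewrite inE => /and3P[pp _ pz].
  by rewrite (bigD1 p) //= dl0 ?pz ?orbT // mul0r mulr0.
rewrite expr1n mulr1.
have dis : [disjoint [set p : 'I_Y | prime p && (p <= y)%N] & midP y z Y].
  by apply/pred0P => p /=; rewrite !inE; case: (leqP p y); rewrite ?andbF.
have := @harm_le_selG R Y [set p : 'I_Y | prime p && (p <= y)%N] (midP y z Y) z.
rewrite prset_mid dis z0 zY (prod_all_primes R q0 qy yY).
move=> /(_ _ isT isT isT) H.
have qR : 0 < q%:R :> R by rewrite ltr0n.
have tR : 0 < (totient q)%:R :> R by rewrite ltr0n totient_gt0.
rewrite mulrA ler_pdivrMr // -ler_pdivlMr // -mulrA; apply: le_trans (H _ _) _.
- by apply/forall_inP => p; rewrite inE => /andP[].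
- move=> p pp pz; rewrite !inE pp pz /=.
  by case: (leqP p y).
- by rewrite [leLHS]mulrA.
Qed.

Variable H : nat.
Hypotheses (H0 : (0 < H)%N) (HN : (H <= N)%N) (zy : (z <= 2 ^ y./2)%N).
Notation box := (N :: nseq k.*2 H).
Notation G := (selG R (midP y z Y) z).
Notation ET := (@ET R k q n0 N H y z Y).
Notation t := #|{: W}|.

Definition val_at (w : W) (l : seq nat) : nat := N + head 0 l + csum w (behead l).

Lemma nu_forms (T : {set W}) :
  Avg box (fun l => \prod_(w in T) nu (val_at w l)) = (G / VV) ^+ #|T| * ET T.
Proof.
rewrite /ET -AvgZ; apply: eq_Avg => l _; rewrite big_split /= prodr_const; congr (_ * _).
rewrite big_split /=; congr (_ * _).
rewrite exchange_big /= /rough; apply: eq_bigr => p _.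
by rewrite /pany subKr.
Qed.

(** Three errors: the true local densities against the independent model, the primes shared by
    several forms, and the truncation together with the finite size of the box. The crude bound
    [1 / VV <= y] is spent only on the last, which is exponentially small in the application. *)
Lemma nuT_est w0 (T : {set W}) : (0 < w0)%N -> (4 * t ^ 2 <= w0)%N ->
  (forall p, prime p -> (p <= w0)%N -> (p %| q)%N) ->
  `|(G / VV) ^+ #|T| * ET T - 1| <= 4 * t%:R ^+ 2 / w0%:R +
    2 * (G ^+ t * Kt R k z / y%:R) +
    (y%:R * G) ^+ t * (Kt R k z * (2 * es R q n0 N s y Y T + ((y ^ s) ^ 3)%:R * (Zt k z)%:R ^+ 2 * eta0 R k N H)).
Proof.
move=> w00 tw hw; have wR : 0 < w0%:R :> R by rewrite ltr0n.
have V0 := VV_gt0; have G1 := @selG_ge1 R Y (midP y z Y) z (prset_mid y z Y) z0.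
have yR : 0 < y%:R :> R by rewrite ltr0n.
set j := #|T|; have jt : (j <= t)%N by apply: max_card.
have E := @ET_est R k q n0 N H s y z Y z0 H0 HN y0 qy q0 zy T.
set Vr := \prod_(p in smallP q y Y) _ in E *.
have hr : `|Vr - VV ^+ j| <= 4 * j%:R ^+ 2 / w0%:R * VV ^+ j.
  rewrite /VV -prodrXl; apply: prod_ratio => //.
  - by apply: leq_trans tw; rewrite leq_mul2l leq_exp2r.
  - move=> p; rewrite inE => /and3P[pp _]; rewrite ltnNge; apply: contra; exact: hw.
  - by move=> p pP; apply: loc_pany; [exact: prsetP (prset_small q y Y) pP|exact: small_ndvd pP].
have Vj0 : 0 < VV ^+ j by apply: exprn_gt0.
set th := 4 * t%:R ^+ 2 / w0%:R.
have th1 : th <= 1 by rewrite /th ler_pdivrMr // mul1r -natrX -natrM ler_nat.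
have hth : 4 * j%:R ^+ 2 / w0%:R <= th.
  by rewrite /th ler_wpM2r ?invr_ge0 ?ler0n // ler_wpM2l // ler_pXn2r ?nnegrE // ler_nat.
have hr2 : `|Vr / VV ^+ j - 1| <= th.
  rewrite -[1](mulfV (lt0r_neq0 Vj0)) -mulrBl normrM [`|_^-1|]gtr0_norm ?invr_gt0 //.
  by rewrite ler_pdivrMr //; apply: le_trans hr _; rewrite ler_wpM2r // ltW.
have K0 := Kt_ge0 R k z.
set c2 := 2 * _ + _ * _ * _; have c20 : 0 <= c2.
  rewrite /c2 addr_ge0 ?mulr_ge0 ?eta0_ge0 //.
  by apply: esymm_ge0 => p; have /andP[] := rho01 R q n0 N T p.
have Gj : G ^+ j <= G ^+ t by apply: ler_weXn2l.
have GVj : (G / VV) ^+ j <= (y%:R * G) ^+ t.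
  apply: le_trans (_ : (y%:R * G) ^+ j <= _).
    rewrite lerXn2r ?nnegrE ?divr_ge0 ?mulr_ge0 ?(le_trans ler01 G1) ?(ltW V0) //.
    rewrite mulrC ler_wpM2r ?(le_trans ler01 G1) //.
    by rewrite -[leRHS]invrK lef_pV2 ?posrE ?invr_gt0 //; apply: VV_ge.
  have yG1 : 1 <= y%:R * G by apply: mulr_ege1 => //; rewrite ler1n.
  exact: ler_weXn2l.
have Gj0 : 0 < G ^+ j by apply: exprn_gt0; apply: lt_le_trans G1.
have GV0 : 0 <= (G / VV) ^+ j by rewrite exprn_ge0 // divr_ge0 ?(ltW V0) // (le_trans ler01 G1).
have main : `|(G / VV) ^+ j * ET T - Vr / VV ^+ j| <= (G / VV) ^+ j * (Kt R k z * c2) + (Vr / VV ^+ j) * (G ^+ j * Kt R k z / y%:R).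
  have -> : (G / VV) ^+ j * ET T - Vr / VV ^+ j = (G / VV) ^+ j * (ET T - Vr * G^-1 ^+ j).
    rewrite mulrBr; congr (_ - _); rewrite expr_div_n exprVn; field.
    by rewrite !gt_eqF // exprn_gt0.
  rewrite normrM [`|(G / VV) ^+ j|]ger0_norm //.
  apply: le_trans (ler_wpM2l GV0 E) _.
  rewrite le_eqVlt; apply/orP; left; apply/eqP; rewrite /c2 expr_div_n; field.
  by rewrite !gt_eqF // exprn_gt0.
move: hr2 main; rewrite !ler_norml => /andP[r1 r2] /andP[m1 m2].
have D1 : 0 <= G ^+ j * Kt R k z / y%:R.
  by apply: divr_ge0 => //; apply: mulr_ge0 => //; exact: ltW.
have D2 : G ^+ j * Kt R k z / y%:R <= G ^+ t * Kt R k z / y%:R.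
  by rewrite ler_wpM2r ?invr_ge0 ?ler0n // ler_wpM2r.
have D3 : (G / VV) ^+ j * (Kt R k z * c2) <= (y%:R * G) ^+ t * (Kt R k z * c2).
  by rewrite ler_wpM2r // mulr_ge0.
have D4 : (Vr / VV ^+ j) * (G ^+ j * Kt R k z / y%:R) <= 2 * (G ^+ t * Kt R k z / y%:R).
  apply: le_trans (_ : 2 * (G ^+ j * Kt R k z / y%:R) <= _); last by rewrite ler_wpM2l.
  by rewrite ler_wpM2r //; lra.
apply/andP; split; lra.
Qed.

End Majorant.

Lemma ex_largest (P : pred nat) n : P 0%N -> ~~ P n.+1 -> (forall i, P i.+1 -> P i) ->
  exists2 s, P s & ~~ P s.+1.
Proof.
move=> P0 Pn _; elim: n Pn => [|n IH] Pn; first by exists 0%N.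
by case: (boolP (P n.+1)) => h; [exists n.+1|exact: IH].
Qed.

(** * Choice of the sieve parameters *)

Section SieveMajorant.
Variable R : archiRealFieldType.

(** With [s] about [sqrt (log N)], inclusion-exclusion truncated at order [s] handles the primes up
    to [y = s ^ B], a power of [log N], and Selberg's weights those up to [z], about [N ^ (1 / E)].
    As [E] depends on [k] only, so does [kap]. *)
Lemma sieve_majorant (k : nat) : exists2 kap : R, 0 < kap &
  forall eps : R, 0 < eps -> exists w0 : nat, forall q n0 : nat, (0 < q)%N ->
  (forall p, prime p -> (p <= w0)%N -> (p %| q)%N) -> forall cc : nat,
  exists N1 : nat, forall N H, (N1 <= N)%N -> (0 < H)%N -> (H <= N)%N -> (N <= cc * H)%N ->
  exists nu : nat -> R, [/\ forall L, 0 <= nu L,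
    forall L, (N <= L)%N -> prime (q * L + n0) -> kap * ((totient q)%:R / q%:R) * harm R N <= nu L &
    `|Avg (N :: nseq k.*2 H) (fun l => \prod_(w : k.-tuple bool) (nu (val_at N w l) - 1))| <= eps].
Proof.
pose t := #|{: k.-tuple bool}|.
have t0 : (0 < t)%N by rewrite /t card_tuple card_bool expn_gt0.
(* The moduli enter the error through [Zt ^ 2 = z ^ (4 t)], which [z ^ E <= N] keeps below
   [N ^ (1/4)]. *)
pose E := (16 * t)%N.
have E0 : 0 < 1 + 2 * E%:R :> R by rewrite addr_gt0 ?mulr_gt0 ?ltr0n ?muln_gt0.
(* [harm N <= harm (z.+1 ^ E) <= 1 + E * harm z.+1 <= (1 + 2 E) * harm z], since [harm z >= 1]. *)
exists (1 + 2 * E%:R)^-1; first by rewrite invr_gt0.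
move=> eps eps0.
pose e1 := eps / (2 ^ t)%:R / 3; have tt0 : 0 < (2 ^ t)%:R :> R by rewrite ltr0n expn_gt0.
have e10 : 0 < e1 by rewrite !divr_gt0.
have archi (x : R) : 0 <= x -> exists n : nat, x <= n%:R.
  by move=> x0; exists (Num.bound x); apply/ltW/archi_boundP.
have [m0 hm0] : exists n : nat, 4 * t%:R ^+ 2 / e1 <= n%:R.
  by apply: archi; apply: divr_ge0; [rewrite mulr_ge0 ?exprn_ge0|exact: ltW].
pose w0 := (4 * t ^ 2 + m0).+1.
exists w0 => q n0 q0 hw cc.
(* The exponent of [s] in [G ^ t * Kt]: [G] is of order [s ^ 4] and [Kt] of order [s ^ (2 * 5 ^ t)].
   With [B = d1 + 1] the quotient by [y = s ^ B] is of order [1 / s]. *)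
pose d1 := (4 * t + 2 * 5 ^ t)%N; pose B := (d1.+1)%N.
pose C1 := (25 ^ t * (4 ^ t * 5 ^ (5 ^ t)))%N.
pose C2 := (C1 * (3 + 2 * k * cc))%N.
have [sa ha] := polyexp C2 (d1 + B * t).+1.
have [sb hb] := log_sq_le (t * B.+1).
have [mc hmc] : exists n : nat, (2 * C1 + 1)%:R / e1 <= n%:R.
  by apply: archi; rewrite divr_ge0 // ltW.
pose s0 := (sa + sb + mc + q + 4)%N.
exists (2 ^ (s0 ^ 2))%N => N H N1 H0 HN NH.
have N0 : (0 < N)%N by apply: leq_trans N1; rewrite expn_gt0.
have [s hs hs1] : exists2 s, (2 ^ s ^ 2 <= N)%N & ~~ (2 ^ s.+1 ^ 2 <= N)%N.
  apply: (@ex_largest (fun s => 2 ^ s ^ 2 <= N)%N N) => //.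
    rewrite -ltnNge; apply: leq_trans (_ : 2 ^ N.+1 <= _)%N; first by apply: ltnW; apply: ltn_expl.
    by rewrite leq_exp2l // -mulnn leq_pmulr.
  by move=> i; apply: leq_trans; rewrite leq_exp2l // leq_exp2r.
rewrite -ltnNge in hs1.
have s0s : (s0 <= s)%N.
  have : (2 ^ s0 ^ 2 < 2 ^ s.+1 ^ 2)%N by apply: leq_ltn_trans hs1.
  by rewrite ltn_exp2l // ltn_exp2r // ltnS.
have s4 : (4 <= s)%N by apply: leq_trans s0s; rewrite /s0; lia.
have sg0 : (0 < s)%N by apply: leq_trans s4.
have [z hz hz1] : exists2 z, (z ^ E <= N)%N & ~~ (z.+1 ^ E <= N)%N.
  apply: (@ex_largest (fun z => z ^ E <= N)%N N) => //.
  - by rewrite exp0n // muln_gt0.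
  - rewrite -ltnNge; apply: leq_trans (_ : N.+1 ^ 1 <= _)%N; first by rewrite expn1.
    by rewrite leq_pexp2l // muln_gt0.
  - by move=> i; apply: leq_trans; rewrite leq_expn2r.
rewrite -ltnNge in hz1.
have z0 : (0 < z)%N.
  by case: z hz hz1 => // _; rewrite exp1n ltnNge N0.
pose y := (s ^ B)%N.
have y0 : (0 < y)%N by rewrite expn_gt0 sg0.
have sy : (s <= y)%N by rewrite -[leqLHS]expn1 leq_pexp2l.
have qy : (q <= y)%N by apply: leq_trans sy; apply: leq_trans s0s; rewrite /s0; lia.
have B5 : (5 <= B)%N.
  have h5 : (0 < 5 ^ t)%N by rewrite expn_gt0.
  by rewrite /B /d1; lia.
pose lg := (trunc_log 2 s).+1.
have slg : (s <= 2 ^ lg)%N by apply: ltnW; apply: trunc_log_ltn.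
have hlog : (16 * (t * B.+1 * lg) ^ 2 <= s)%N.
  by apply: hb; apply: leq_trans s0s; rewrite /s0; lia.
have y12 : (y ^ (12 * s) <= N)%N.
  apply: leq_trans hs; rewrite /y -expnM; apply: leq_trans (leq_expn2r _ slg) _.
  rewrite -expnM leq_exp2l //.
  have : (12 * (B * lg) <= s)%N.
    apply: leq_trans hlog; rewrite -mulnn; have : (B * lg <= t * B.+1 * lg)%N.
      by rewrite leq_mul2r; apply/orP; right; rewrite -[B in (B <= _)%N]mul1n leq_mul.
    move: (B * lg)%N (t * B.+1 * lg)%N => a b ab; case: b ab => [|b] ab; [lia|nia].
  move=> h; rewrite -mulnn; apply: leq_trans (_ : 12 * (B * lg) * s <= _)%N; first by rewrite leq_eqVlt; apply/orP; left; apply/eqP; ring.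
  by rewrite leq_mul2r h orbT.
have z16 : (z ^ (16 * t) <= N)%N by [].
have zN : (z < N)%N.
  have N2 : (1 < N)%N by apply: leq_trans hs; apply: leq_trans (_ : 2 ^ 1 <= _)%N => //; rewrite leq_exp2l // expn_gt0 sg0.
  case: (leqP z 1) => z1; first by apply: leq_ltn_trans N2.
  apply: leq_trans z16; apply: leq_trans (_ : z ^ 2 <= _)%N; first by rewrite -mulnn ltn_Pmull // ltnW.
  by rewrite leq_exp2l //; lia.
have y2 : (1 < y)%N by apply: leq_trans sy; lia.
have yN : (y < N)%N.
  apply: leq_trans y12; apply: leq_trans (_ : y ^ 2 <= _)%N; first by rewrite -mulnn ltn_Pmull.
  by rewrite leq_exp2l //; lia.
pose Y := (y + z).+1.
have yY : (y < Y)%N by rewrite /Y; lia.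
have zY : (z < Y)%N by rewrite /Y; lia.
have zy : (z <= 2 ^ y./2)%N.
  apply: leq_trans (ltnW zN) _; apply: leq_trans (ltnW hs1) _; rewrite leq_exp2l //.
  have : (s ^ 5 <= y)%N by rewrite leq_pexp2l.
  have -> : (s ^ 5 = s * s * (s * s * s))%N by rewrite !expnS expn0; ring.
  have h1 : (64 <= s * s * s)%N by rewrite (@leq_mul 16 4) ?(@leq_mul 4 4).
  have h2 : (s * s * 64 <= s * s * (s * s * s))%N by rewrite leq_mul2l h1 orbT.
  have h3 : (4 * s <= s * s)%N by rewrite leq_mul2r s4 orbT.
  rewrite -mulnn => h4; have := odd_double_half y; have : (odd y <= 1)%N by case: odd.
  move: (nat_of_bool (odd y)) (y./2) h4 => o hy; rewrite -muln2; move: h2 h3.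
  by move: (s * s * (s * s * s))%N => P; lia.
have harmN : harm R N <= (5 * s ^ 2)%:R.
  apply: le_trans (_ : harm R (2 ^ s.+1 ^ 2) <= _); first by apply: harm_le; apply: ltnW.
  apply: le_trans (harm_pow2 _ _) _; rewrite addrC natr1 ler_nat -!mulnn.
  have h3 : (4 * s <= s * s)%N by rewrite leq_mul2r s4 orbT.
  lia.
exists (nu R q n0 y z Y); split.
- by move=> L; apply: nu_ge0.
- move=> L NL pL; apply: le_trans (nu_prime R z0 y0 qy q0 zN yN yY zY NL pL).
  rewrite mulrAC ler_wpM2r ?divr_ge0 // ler_pdivrMl //.
  apply: le_trans (_ : harm R (z.+1 ^ E) <= _); first by apply: harm_le; apply: ltnW.
  apply: le_trans (harmX _ _ _) _ => //.
  have h1 := harm_ge1 R z0.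
  have h2 : harm R z.+1 <= harm R z + 1.
    by rewrite /harm big_ord_recr /= lerD2l invf_le1 // ler1n.
  rewrite mulrDl mul1r; have ER : 0 <= E%:R :> R by [].
  by apply: lerD => //; rewrite -mulrA mulrCA ler_wpM2l //; lra.
have HNR : 0 < N%:R :> R by rewrite ltr0n.
set G := selG R (midP y z Y) z.
have hzN : harm R z <= harm R N by apply: harm_le; apply: ltnW.
have hz5 : harm R z <= (5 * s ^ 2)%:R by apply: le_trans harmN.
have G0 : 0 <= G by apply: le_trans ler01 (selG_ge1 _ _ _) => //; apply: prset_mid.
have GB : G <= (25 * s ^ 4)%:R.
  apply: le_trans (_ : harm R z ^+ 2 <= _); first by apply: selG_le => //; apply: prset_mid.
  have -> : (25 * s ^ 4 = (5 * s ^ 2) ^ 2)%N by rewrite expnMn -expnM.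
  by rewrite natrX ler_pXn2r ?nnegrE ?harm_ge0.
have ZN : (Zt k z <= N)%N.
  by rewrite /Zt -expnM; apply: leq_trans z16; rewrite leq_pexp2l // leq_mul2r orbT.
have KB : Kt R k z <= (4 ^ t * (5 * s ^ 2) ^ (5 ^ t))%:R.
  rewrite /Kt natrM !natrX ler_wpM2l ?exprn_ge0 //.
  rewrite -/t lerXn2r ?nnegrE ?harm_ge0 //.
  by apply: le_trans harmN; apply: harm_le.
have K0 := Kt_ge0 R k z.
have GK : G ^+ t * Kt R k z <= (C1 * s ^ d1)%:R.
  have -> : (C1 * s ^ d1 = (25 * s ^ 4) ^ t * (4 ^ t * (5 * s ^ 2) ^ (5 ^ t)))%N.
    rewrite /C1 /d1 expnD (expnM s 4) (expnM s 2) (expnMn 25) (expnMn 5).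
    by rewrite -!mulnA !(mulnCA ((s ^ 4) ^ t)%N).
  by rewrite natrM natrX; apply: ler_pM; rewrite ?exprn_ge0 // ler_pXn2r ?nnegrE.
have sR : 0 < s%:R :> R by rewrite ltr0n.
have p2 : 0 < 2 ^+ s :> R by rewrite exprn_gt0.
have esB (T : {set k.-tuple bool}) : es R q n0 N s y Y T <= 2 ^- s.
  have rho0 p : 0 <= rho R q n0 N T p by have /andP[] := rho01 R q n0 N T p.
  rewrite /es; apply: le_trans; first by apply: esymm_le => p; apply: rho0.
  have hsum : \sum_(p in smallP q y Y) rho R q n0 N T p <= (t * B.+1 * lg)%:R.
    have h1 : \sum_(p in smallP q y Y) rho R q n0 N T p <= t%:R * harm R y.
      apply: le_trans (_ : \sum_(p in smallP q y Y) t%:R * p%:R^-1 <= _).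
        apply: ler_sum => p pP.
        have /andP[_ h] := loc_pany R n0 N (prsetP (prset_small q y Y) pP) (small_ndvd pP) T.
        apply: le_trans h _; rewrite ler_wpM2r ?invr_ge0 // ler_nat; exact: max_card.
      rewrite -mulr_sumr ler_wpM2l //.
      have -> : harm R y = \sum_(i < y.+1 | (0 < i)%N) i%:R^-1.
        by rewrite big_mkcond big_ord_recl /= add0r /harm; apply: eq_bigr => i _.
      have -> : \sum_(i < y.+1 | (0 < i)%N) (i%:R^-1 : R) = \sum_(i < Y | (0 < i <= y)%N) i%:R^-1.
        rewrite (big_ord_widen_cond Y (fun i => 0 < i)%N (fun i => i%:R^-1)) //.
      rewrite big_mkcond [leRHS]big_mkcond /=; apply: ler_sum => p _.
      case: (boolP (p \in smallP q y Y)) => [|_]; last by case: ifP => // _; rewrite invr_ge0.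
      by rewrite inE => /and3P[pp py _]; rewrite prime_gt0 //= py.
    apply: le_trans h1 _; rewrite -mulnA natrM ler_wpM2l //.
    apply: le_trans (_ : harm R (2 ^ (B * lg)) <= _).
      apply: harm_le; rewrite mulnC expnM /y; exact: leq_expn2r.
    apply: le_trans (harm_pow2 _ _) _; rewrite addrC natr1 ler_nat mulSn.
    by rewrite -add1n leq_add2r.
  have b0 : 0 <= \sum_(p in smallP q y Y) rho R q n0 N T p by apply: sumr_ge0.
  have f0 : 0 < s`!%:R :> R by rewrite ltr0n fact_gt0.
  rewrite ler_pdivrMr // -ler_pdivrMl ?invr_gt0 // invrK.
  have := expn_fact_le hlog; rewrite -(ler_nat R) natrM !natrX => h.
  apply: le_trans h; rewrite mulrC ler_wpM2r ?(ltW p2) // ler_pXn2r ?nnegrE //.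
set X0 := ((y ^ s) ^ 3)%:R * (Zt k z)%:R ^+ 2 * eta0 R k N H.
have XB : X0 <= (1 + 2 * k * cc)%:R / 2 ^+ s.
  have etaB : eta0 R k N H <= (1 + 2 * k * cc)%:R / N%:R.
    rewrite /eta0 natrD mulrDl mul1r lerD2l -mul2n -mulnA !natrM -!mulrA.
    rewrite !ler_wpM2l // ler_pdivlMr // mulrC ler_pdivrMr ?ltr0n // -natrM ler_nat //.
  pose u := ((y ^ s) ^ 3 * Zt k z ^ 2)%N.
  have uN : (u * 2 ^ s <= N)%N.
    (* Fourth powers replace fractional exponents: [y ^ (12 s)], [z ^ (16 t)] and [2 ^ (4 s)] are
       each at most [N]. *)
    rewrite -(leq_exp2r _ _ (isT : (0 < 4)%N)).
    have e : ((u * 2 ^ s) ^ 4 = (y ^ (12 * s)) * (z ^ (16 * t)) * (2 ^ (4 * s)))%N.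
      have -> : (y ^ (12 * s) = ((y ^ s) ^ 3) ^ 4)%N by rewrite -!expnM; congr (_ ^ _)%N; ring.
      have -> : (z ^ (16 * t) = (((z ^ 2) ^ t) ^ 2) ^ 4)%N by rewrite -!expnM; congr (_ ^ _)%N; ring.
      have -> : (2 ^ (4 * s) = (2 ^ s) ^ 4)%N by rewrite -!expnM mulnC.
      by rewrite /u /Zt -/t (expnMn (_ * _)) (expnMn (_ ^ 3)).
    rewrite e; have h4 : (2 ^ (4 * s) <= N)%N.
      by apply: leq_trans hs; rewrite leq_exp2l // -mulnn leq_mul2r s4 orbT.
    apply: leq_trans (_ : N * N * N <= _)%N; first by rewrite !leq_mul.
    by rewrite !expnS expn0 muln1 mulnA -[leqLHS]mul1n !mulnA !leq_mul // .
  have X1 : X0 <= u%:R * ((1 + 2 * k * cc)%:R / N%:R).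
    by rewrite /X0 /u natrM [(_ ^ 2)%:R]natrX ler_wpM2l // mulr_ge0 // exprn_ge0.
  apply: le_trans X1 _; rewrite mulrCA ler_wpM2l // ler_pdivrMr // mulrC -ler_pdivrMr ?invr_gt0 // invrK.
  by rewrite -natrX -natrM ler_nat.
have bound (T : {set k.-tuple bool}) : `|(G / VV R q y Y) ^+ #|T| * ET R q n0 N H y z Y T - 1| <= 3 * e1.
  have w00 : (0 < w0)%N by [].
  have tw0 : (4 * t ^ 2 <= w0)%N by rewrite /w0 leqW // leq_addr.
  apply: le_trans (nuT_est R n0 s z0 y0 qy q0 yY H0 HN zy T w00 tw0 hw) _.
  rewrite -/G -/X0 -/t.
  have t1 : 4 * t%:R ^+ 2 / w0%:R <= e1.
    rewrite ler_pdivrMr ?ltr0n // [leRHS]mulrC -ler_pdivrMr //; apply: le_trans hm0 _.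
    by rewrite ler_nat /w0 leqW // leq_addl.
  have sm : (2 * C1 + 1)%:R / s%:R <= e1.
    rewrite ler_pdivrMr // mulrC -ler_pdivrMr //; apply: le_trans hmc _.
    by rewrite ler_nat; apply: leq_trans s0s; rewrite /s0 -!addnA addnA addnCA leq_addr.
  have yR : 0 < y%:R :> R by rewrite ltr0n.
  have t2 : G ^+ t * Kt R k z / y%:R <= C1%:R / s%:R.
    rewrite ler_pdivrMr // mulrAC ler_pdivlMr //.
    apply: le_trans (ler_wpM2r (ltW sR) GK) _.
    by rewrite -!natrM ler_nat /y /B expnSr mulnA.
  have t3 : (y%:R * G) ^+ t * (Kt R k z * (2 * es R q n0 N s y Y T + X0)) <= s%:R^-1.
    have c20 : 2 * es R q n0 N s y Y T + X0 <= (3 + 2 * k * cc)%:R / 2 ^+ s.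
      have -> : (3 + 2 * k * cc)%:R / 2 ^+ s = 2 * 2 ^- s + (1 + 2 * k * cc)%:R / 2 ^+ s :> R.
        by rewrite -mulrDl; congr (_ / _); rewrite !natrD; ring.
      by apply: lerD => //; rewrite ler_wpM2l.
    rewrite exprMn mulrA -(mulrA (y%:R ^+ t)).
    apply: le_trans (_ : y%:R ^+ t * (C1 * s ^ d1)%:R * ((3 + 2 * k * cc)%:R / 2 ^+ s) <= _).
      apply: le_trans (ler_wpM2l _ c20) _; first by apply: mulr_ge0; rewrite ?exprn_ge0 // mulr_ge0 ?exprn_ge0.
      by rewrite ler_wpM2r ?divr_ge0 ?(ltW p2) // ler_wpM2l ?exprn_ge0.
    rewrite mulrA ler_pdivrMr // [leRHS]mulrC ler_pdivlMr // -!natrX -!natrM ler_nat.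
    have -> : (y ^ t * (C1 * s ^ d1) * (3 + 2 * k * cc) * s = C2 * s ^ (d1 + B * t).+1)%N.
      by rewrite /C2 /y -expnM expnSr expnD; ring.
    by apply: ha; apply: leq_trans s0s; rewrite /s0 -!addnA leq_addr.
  have smE : (2 * C1 + 1)%:R / s%:R = 2 * (C1%:R / s%:R) + s%:R^-1 :> R.
    by rewrite natrD natrM mulrDl mul1r mulrA.
  rewrite smE in sm; lra.
(* Expansion over the subsets [T] of corners. The signs add up to zero by [zeroS], so only the
   deviations of the averages from 1 remain. *)
have prodE l : \prod_(w : k.-tuple bool) (nu R q n0 y z Y (val_at N w l) - 1) =
    \sum_(T : {set k.-tuple bool} | T \subset [set: k.-tuple bool])
      (-1) ^+ t * (-1) ^+ #|T| * \prod_(w in T) nu R q n0 y z Y (val_at N w l).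
  have -> : \prod_(w : k.-tuple bool) (nu R q n0 y z Y (val_at N w l) - 1) =
     (-1) ^+ t * \prod_(w in [set: k.-tuple bool]) (1 + - nu R q n0 y z Y (val_at N w l)).
    rewrite (eq_bigl predT); last by move=> w; rewrite inE.
    rewrite /t -prodr_const -big_split /=; apply: eq_bigr => w _; ring.
  rewrite prodD1_sum mulr_sumr; apply: eq_bigr => T _; by rewrite prodrN mulrA.
have zeroS : \sum_(T : {set k.-tuple bool} | T \subset [set: k.-tuple bool]) (-1) ^+ t * (-1) ^+ #|T| = 0 :> R.
  rewrite -mulr_sumr (eq_bigr (fun T : {set k.-tuple bool} => \prod_(w in T) (-1))); last by move=> T _; rewrite prodr_const.
  by rewrite -(prodD1_sum (fun=> -1)) subrr prodr_const cardsT -/t expr0n gtn_eqF // mulr0.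
have AE : Avg (N :: nseq k.*2 H) (fun l => \prod_(w : k.-tuple bool) (nu R q n0 y z Y (val_at N w l) - 1))
   = \sum_(T : {set k.-tuple bool} | T \subset [set: k.-tuple bool])
      (-1) ^+ t * (-1) ^+ #|T| * ((G / VV R q y Y) ^+ #|T| * ET R q n0 N H y z Y T - 1).
  transitivity (\sum_(T : {set k.-tuple bool} | T \subset [set: k.-tuple bool])
      (-1) ^+ t * (-1) ^+ #|T| * ((G / VV R q y Y) ^+ #|T| * ET R q n0 N H y z Y T)).
    rewrite (eq_Avg (fun l _ => prodE l)) Avg_sum; apply: eq_bigr => T _.
    by rewrite AvgZ nu_forms.
  rewrite -[LHS]subr0 -[X in _ - X = _]zeroS -sumrB; apply: eq_bigr => T _; ring.
rewrite AE; apply: le_trans (ler_norm_sum _ _ _) _.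
apply: le_trans (_ : \sum_(T : {set k.-tuple bool} | T \subset [set: k.-tuple bool]) 3 * e1 <= _).
  apply: ler_sum => T _; rewrite !normrM !normrX normrN1 !expr1n !mul1r; exact: bound.
rewrite sumr_const -[_ *+ _]mulr_natr.
have -> : #|[pred T : {set k.-tuple bool} | T \subset [set: k.-tuple bool]]| = (2 ^ t)%N.
  rewrite /t -[in RHS]cardsT -card_powerset; apply: eq_card => T; by rewrite !inE.
by rewrite /e1 le_eqVlt; apply/orP; left; apply/eqP; field; rewrite gt_eqF.
Qed.

End SieveMajorant.

(** * Arithmetic functions and Mertens estimates *)

(** Peels off the full power of the smallest prime factor, which reduces identities between
    multiplicative functions to one prime power at a time. *)
Lemma ppow_ind (P : nat -> Prop) : P 1%N ->
  (forall p e m, prime p -> (0 < e)%N -> ~~ (p %| m)%N -> (0 < m)%N -> P m -> P (p ^ e * m)%N) ->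
  forall n, (0 < n)%N -> P n.
Proof.
move=> P1 PM n; elim/ltn_ind: n => n IH n0.
case: (ltnP 1 n) => n1; last by have -> : n = 1%N by lia.
pose p := pdiv n; have pp : prime p by apply: pdiv_prime.
have pn : (p %| n)%N by apply: pdiv_dvd.
have e0 : (0 < logn p n)%N by rewrite logn_gt0 mem_primes pp n0.
rewrite -(partnC p n0) p_part; apply: PM => //.
- by rewrite -prime_coprime // (pnat_coprime (pnat_id pp)) // part_pnat.
- by apply: IH => //; rewrite -[ltnRHS](partnC p n0) ltn_Pmull // p_part -(expn0 p) ltn_exp2l ?prime_gt1.
Qed.

Lemma divisors_ppow p e m : prime p -> ~~ (p %| m)%N -> (0 < m)%N ->
  perm_eq (divisors (p ^ e * m)) [seq (p ^ i * d)%N | i <- iota 0 e.+1, d <- divisors m].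
Proof.
move=> pp pm m0; have p0 := prime_gt0 pp.
have pe0 j : (0 < p ^ j)%N by rewrite expn_gt0 p0.
have lnd j d : (d %| m)%N -> logn p (p ^ j * d) = j.
  move=> dm; have d0 : (0 < d)%N by apply: dvdn_gt0 dm.
  rewrite lognM // pfactorK // lognE pp d0 /=; case: (boolP (p %| d)%N) => [pd|_]; last by rewrite addn0.
  by case/negP: pm; apply: dvdn_trans dm.
apply: uniq_perm; first exact: divisors_uniq.
  apply: allpairs_uniq; [exact: iota_uniq|exact: divisors_uniq|].
  move=> x y hx hy; case/allpairsP: hx => -[a b] [_ hb ->]; case/allpairsP: hy => -[a' b'] [_ hb' ->] /= E.
  move: hb hb'; rewrite -!dvdn_divisors // => hb hb'.
  have E2 : a = a' by rewrite -(lnd a b hb) -(lnd a' b' hb') E.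
  congr (_, _) => //; move/eqP: E; rewrite E2 eqn_pmul2l //; by move/eqP.
move=> x; rewrite -dvdn_divisors ?muln_gt0 ?pe0 //; apply/idP/allpairsP.
  move=> hx; have x0 : (0 < x)%N by apply: dvdn_gt0 hx; rewrite muln_gt0 pe0.
  exists (logn p x, x`_p^')%N; split.
  - rewrite mem_iota /= add0n ltnS -[leqRHS](lnd e m) //.
    by apply: dvdn_leq_log => //; rewrite muln_gt0 pe0.
  - rewrite /= -dvdn_divisors //; rewrite -(@Gauss_dvdr _ (p ^ e)).
      by apply: dvdn_trans hx; rewrite dvdn_part.
    rewrite coprime_sym; apply: coprimeXl; rewrite prime_coprime // -prime_coprime //.
    by rewrite (pnat_coprime (pnat_id pp)) // part_pnat.
  - by rewrite /= -p_part partnC.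
case=> -[i d] []; rewrite mem_iota /= add0n ltnS -dvdn_divisors // => ie dm ->.
by apply: dvdn_mul => //; apply: dvdn_exp2l.
Qed.

Section DivisorSums.
Variable R : comPzRingType.

Lemma sum_div_ppow (F : nat -> R) p e m : prime p -> ~~ (p %| m)%N -> (0 < m)%N ->
  \sum_(d <- divisors (p ^ e * m)) F d = \sum_(i < e.+1) \sum_(d <- divisors m) F (p ^ i * d)%N.
Proof.
move=> pp pm m0; rewrite (perm_big _ (divisors_ppow e pp pm m0)) big_allpairs_dep.
by rewrite -[iota 0 e.+1]/(index_iota 0 e.+1) big_mkord.
Qed.

Lemma sum_divisors (F : nat -> R) n X : (0 < n <= X)%N ->
  \sum_(d <- divisors n) F d = \sum_(1 <= d < X.+1 | (d %| n)%N) F d.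
Proof.
move=> /andP[n0 nX]; rewrite -[RHS]big_filter; apply: perm_big; apply: uniq_perm.
- exact: divisors_uniq.
- by rewrite filter_uniq // iota_uniq.
move=> d; rewrite mem_filter mem_index_iota -dvdn_divisors //.
case: (boolP (d %| n)%N) => //= dn; rewrite (dvdn_gt0 n0 dn) /= ltnS.
by rewrite (leq_trans (dvdn_leq n0 dn)).
Qed.

Lemma sum_multiples (F : nat -> R) d X : (0 < d)%N ->
  \sum_(1 <= N < X.+1 | (d %| N)%N) F N = \sum_(1 <= m < (X %/ d).+1) F (d * m)%N.
Proof.
move=> d0; rewrite -[LHS]big_filter -[RHS](big_map (fun m => d * m)%N xpredT F); apply: perm_big.
apply: uniq_perm.
- by rewrite filter_uniq // iota_uniq.
- by rewrite map_inj_uniq ?iota_uniq // => a b /eqP; rewrite eqn_pmul2l // => /eqP.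
move=> x; rewrite mem_filter mem_index_iota; apply/andP/mapP.
- case=> /dvdnP[m ->] /andP[x0 xX]; exists m; last by rewrite mulnC.
  rewrite mem_index_iota ltnS leq_divRL // -[(_ * _ <= _)%N]ltnS xX andbT.
  by move: x0; rewrite muln_gt0 => /andP[].
- case=> m; rewrite mem_index_iota ltnS leq_divRL // => /andP[m0 mX] ->.
  by rewrite dvdn_mulr // muln_gt0 d0 m0 ltnS mulnC.
Qed.

Lemma sum_hyperbola (G : nat -> nat -> R) X :
  \sum_(1 <= N < X.+1) \sum_(d <- divisors N) G d (N %/ d)%N =
  \sum_(1 <= d < X.+1) \sum_(1 <= m < (X %/ d).+1) G d m.
Proof.
transitivity (\sum_(1 <= N < X.+1) \sum_(1 <= d < X.+1 | (d %| N)%N) G d (N %/ d)%N).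
  by rewrite !big_nat; apply: eq_bigr => N /andP[N0 NX]; apply: sum_divisors; rewrite N0.
transitivity (\sum_(1 <= N < X.+1) \sum_(1 <= d < X.+1) if (d %| N)%N then G d (N %/ d)%N else 0).
  by apply: eq_bigr => N _; rewrite big_mkcond.
rewrite exchange_big /= !big_nat; apply: eq_bigr => d /andP[d0 _].
rewrite -big_mkcond sum_multiples //; apply: eq_bigr => m _.
by rewrite mulKn.
Qed.

End DivisorSums.

Section Arithmetic.
Variable R : realType.

(** Von Mangoldt's function: the filter keeps [p] only if [n] is a power of [p], so at most one term
    survives. *)
Definition vM n : R := \sum_(p <- primes n | n == (p ^ logn p n)%N) ln p%:R.

Definition mu n : R := if all (fun p => logn p n == 1%N) (primes n) then (-1) ^+ size (primes n) else 0.

Lemma vM_ge0 n : 0 <= vM n.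
Proof.
rewrite /vM big_seq_cond; apply: sumr_ge0 => p /andP[]; rewrite mem_primes => /and3P[pp _ _] _.
by apply: ln_ge0; rewrite ler1n prime_gt0.
Qed.

Lemma vM1 : vM 1 = 0. Proof. by rewrite /vM big_nil. Qed.

Lemma vM_ppow p e : prime p -> (0 < e)%N -> vM (p ^ e) = ln p%:R.
Proof.
move=> pp e0; rewrite /vM primesX // primes_prime // big_mkcond big_seq1 pfactorK // eqxx //.
Qed.

Lemma vM_prime p : prime p -> vM p = ln p%:R.
Proof. by move=> pp; rewrite -[p in vM p]expn1 vM_ppow. Qed.

Lemma logn_ndvd p d : ~~ (p %| d)%N -> logn p d = 0%N.
Proof. by move=> pd; rewrite lognE (negPf pd) andbF /= andbF. Qed.

Lemma vM_mixed p i d : prime p -> ~~ (p %| d)%N -> (1 < d)%N -> (0 < i)%N -> vM (p ^ i * d) = 0.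
Proof.
move=> pp pd d1 i0; rewrite /vM big1_seq // => r /andP[/eqP E].
rewrite mem_primes => /and3P[pr _ _].
have pdp : prime (pdiv d) by apply: pdiv_prime.
have A s : prime s -> (s %| p ^ i * d)%N -> s = r.
  move=> ps; rewrite E Euclid_dvdX //.
  by rewrite dvdn_prime2 // => /andP[/eqP].
have B1 : p = r by apply: A => //; rewrite dvdn_mulr // dvdn_exp.
have B2 : pdiv d = r by apply: A => //; rewrite dvdn_mull // pdiv_dvd.
by case/negP: pd; rewrite B1 -B2 pdiv_dvd.
Qed.

Lemma vM_ppowM p i d : prime p -> ~~ (p %| d)%N -> (0 < d)%N -> (0 < i)%N ->
  vM (p ^ i * d) = if d == 1%N then ln p%:R else 0.
Proof.
move=> pp pd d0 i0; case: eqP => [->|/eqP d1]; first by rewrite muln1 vM_ppow.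
by rewrite vM_mixed // ltn_neqAle eq_sym d1.
Qed.

Lemma divisors_in m d : (0 < m)%N -> d \in divisors m -> (0 < d)%N /\ (d %| m)%N.
Proof. by move=> m0; rewrite -dvdn_divisors // => dm; rewrite (dvdn_gt0 m0 dm). Qed.

Lemma ndvd_divisor p m d : ~~ (p %| m)%N -> (d %| m)%N -> ~~ (p %| d)%N.
Proof. by move=> pm dm; apply: contra pm => pd; apply: dvdn_trans dm. Qed.

Lemma sum_one_divisor m (x : R) : (0 < m)%N -> \sum_(d <- divisors m) (if d == 1%N then x else 0) = x.
Proof.
move=> m0; rewrite -big_mkcond -big_filter.
have -> : [seq d <- divisors m | d == 1%N] = [:: 1%N]; last by rewrite big_seq1.
apply: perm_small_eq => //; apply: uniq_perm => //; first by rewrite filter_uniq // divisors_uniq.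
by move=> d; rewrite mem_filter inE; case: eqP => // ->; rewrite -dvdn_divisors // dvd1n.
Qed.

Lemma ln_nat_ppow p e m : prime p -> (0 < m)%N -> ln (p ^ e * m)%:R = e%:R * ln p%:R + ln m%:R :> R.
Proof.
move=> pp m0; have p0 := prime_gt0 pp; rewrite natrM lnM ?posrE ?ltr0n ?expn_gt0 ?p0 //.
by rewrite natrX lnXn ?ltr0n // mulr_natl.
Qed.

Lemma sum_vM n : (0 < n)%N -> \sum_(d <- divisors n) vM d = ln n%:R.
Proof.
move: n; apply: ppow_ind => [|p e m pp e0 pm m0 IH]; first by rewrite big_seq1 vM1 ln1.
rewrite sum_div_ppow // big_ord_recl /= ln_nat_ppow // addrC; congr (_ + _); last first.
  by rewrite -IH; apply: eq_bigr => d _; rewrite mul1n.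
rewrite (eq_bigr (fun=> ln p%:R)); first by rewrite sumr_const card_ord mulr_natl.
move=> i _; rewrite -[RHS](sum_one_divisor _ m0) !big_seq; apply: eq_bigr => d hd.
have [d0 dm] := divisors_in m0 hd.
by rewrite vM_ppowM // (ndvd_divisor pm).
Qed.

Lemma primes_ppow p i d : prime p -> ~~ (p %| d)%N -> (0 < d)%N -> (0 < i)%N ->
  perm_eq (primes (p ^ i * d)) (p :: primes d).
Proof.
move=> pp pd d0 i0; apply: uniq_perm; first exact: primes_uniq.
  by rewrite /= primes_uniq andbT mem_primes (negPf pd) !andbF.
by move=> x; rewrite primesM ?expn_gt0 ?(prime_gt0 pp) // primesX // primes_prime // !inE.
Qed.

Lemma mu_ppow p i d : prime p -> ~~ (p %| d)%N -> (0 < d)%N -> (0 < i)%N ->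
  mu (p ^ i * d) = if i == 1%N then - mu d else 0.
Proof.
move=> pp pd d0 i0; have pr := primes_ppow pp pd d0 i0.
rewrite /mu (perm_size pr) (perm_all _ pr) /= lognM ?expn_gt0 ?(prime_gt0 pp) // pfactorK // logn_ndvd // addn0.
case: eqP => //= _; rewrite exprS mulN1r.
have -> : all (fun p0 => logn p0 (p ^ i * d) == 1%N) (primes d) = all (fun p0 => logn p0 d == 1%N) (primes d).
  apply: eq_in_all => r; rewrite mem_primes => /and3P[rp _ rd].
  rewrite lognM ?expn_gt0 ?(prime_gt0 pp) // lognX logn_prime //.
  by case: (eqVneq r p) => [E|_]; [case/negP: pd; rewrite -E|rewrite muln0].
by case: ifP => // _; rewrite oppr0.
Qed.

Lemma mu_norm n : `|mu n| <= 1.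
Proof. by rewrite /mu; case: ifP => _; rewrite ?normr0 // normrX normrN1 expr1n. Qed.

Lemma sum_ppow_mu (F : nat -> R) p e m : prime p -> (0 < e)%N -> ~~ (p %| m)%N -> (0 < m)%N ->
  \sum_(d <- divisors (p ^ e * m)) mu d * F d = \sum_(d <- divisors m) mu d * (F d - F (p * d)%N).
Proof.
move=> pp; case: e => // e _ pm m0; rewrite sum_div_ppow // big_ord_recl big_ord_recl /=.
rewrite [X in _ + (_ + X)]big1 ?addr0; last first.
  move=> i _; rewrite big_seq big1 // => d hd; have [d0 dm] := divisors_in m0 hd.
  by rewrite mu_ppow ?(ndvd_divisor pm) // mul0r.
rewrite -big_split !big_seq; apply: eq_bigr => d hd; have [d0 dm] := divisors_in m0 hd.
rewrite mul1n mu_ppow ?(ndvd_divisor pm) //= expn1; ring.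
Qed.

Lemma sum_mu n : (0 < n)%N -> \sum_(d <- divisors n) mu d = (n == 1%N)%:R.
Proof.
move: n; apply: ppow_ind => [|p e m pp e0 pm m0 IH]; first by rewrite big_seq1.
transitivity (\sum_(d <- divisors (p ^ e * m)) mu d * 1); first by apply: eq_bigr => d _; rewrite mulr1.
rewrite sum_ppow_mu // big1; last by move=> d _; rewrite subrr mulr0.
rewrite gtn_eqF //; apply: leq_trans (leq_pmulr _ m0); apply: leq_trans (prime_gt1 pp) _.
by rewrite -[leqLHS]expn1 leq_exp2l ?prime_gt1.
Qed.

Lemma sum_mu_ln n : (0 < n)%N -> \sum_(d <- divisors n) mu d * ln d%:R = - vM n.
Proof.
move: n; apply: ppow_ind => [|p e m pp e0 pm m0 IH]; first by rewrite big_seq1 ln1 mulr0 vM1 oppr0.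
rewrite sum_ppow_mu // vM_ppowM //.
transitivity (\sum_(d <- divisors m) mu d * - ln p%:R).
  rewrite !big_seq; apply: eq_bigr => d hd; have [d0 dm] := divisors_in m0 hd.
  rewrite -[p in X in _ - X]expn1 ln_nat_ppow //; ring.
by rewrite -mulr_suml sum_mu //; case: eqP => _; rewrite ?mul1r ?mul0r ?oppr0.
Qed.

Definition psiC X := \sum_(1 <= n < X.+1) vM n.

Lemma ln_factE X : ln X`!%:R = \sum_(1 <= n < X.+1) ln n%:R :> R.
Proof.
elim: X => [|X IH]; first by rewrite big_nil ln1.
by rewrite big_nat_recr //= -IH factS natrM lnM ?posrE ?ltr0n ?fact_gt0 // addrC.
Qed.

Lemma sum_ln_vM X : ln X`!%:R = \sum_(1 <= n < X.+1) vM n * (X %/ n)%:R.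
Proof.
rewrite ln_factE.
transitivity (\sum_(1 <= N < X.+1) \sum_(d <- divisors N) (fun d (m : nat) => vM d) d (N %/ d)%N).
  by rewrite !big_nat; apply: eq_bigr => n /andP[n0 _]; rewrite sum_vM.
rewrite (sum_hyperbola (fun d m => vM d)); apply: eq_bigr => d _.
by rewrite sumr_const_nat subn1 mulr_natr.
Qed.

Lemma ln_fact_le X : ln X`!%:R <= X%:R * ln X%:R :> R.
Proof.
rewrite ln_factE.
apply: le_trans (_ : \sum_(1 <= n < X.+1) ln X%:R <= _); last first.
  by rewrite sumr_const_nat subn1 mulr_natl.
rewrite !big_nat; apply: ler_sum => n /andP[n0 nX].
by rewrite ler_ln ?posrE ?ltr0n ?ler_nat // (leq_trans n0).
Qed.

Lemma ln_succ_le n : (0 < n)%N -> ln n.+1%:R <= ln n%:R + n%:R^-1 :> R.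
Proof.
move=> n0; have n0' : 0 < n%:R :> R by rewrite ltr0n.
have -> : n.+1%:R = n%:R * (1 + n%:R^-1) :> R by rewrite mulrDr mulr1 mulfV ?gt_eqF // natr1.
have i0 : 0 < n%:R^-1 :> R by rewrite invr_gt0.
rewrite lnM ?posrE ?addr_gt0 // lerD2l le_ln1Dx //; lra.
Qed.

Lemma ln_fact_ge X : X%:R * ln X%:R - X%:R <= ln X`!%:R :> R.
Proof.
elim: X => [|X IH]; first by rewrite mul0r subr0 ln1.
rewrite factS natrM lnM ?posrE ?ltr0n ?fact_gt0 //.
case: X IH => [|X] IH; first by rewrite ln1 mulr0 add0r addr0; lra.
have := ln_succ_le (ltn0Sn X); rewrite -[X.+2%:R]natr1; set l2 := ln (_ + 1); set l1 := ln X.+1%:R in IH *.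
set x := X.+1%:R in IH * => h; have x0 : 0 < x by rewrite ltr0n.
have : x * l2 <= x * l1 + 1 by rewrite -[1](mulfV (lt0r_neq0 x0)) -mulrDr ler_pM2l.
rewrite mulrDl mul1r; lra.
Qed.

Lemma bin_le_expn n k : ('C(n, k) <= 2 ^ n)%N.
Proof.
elim: n k => [|n IH] [|k]; rewrite ?bin0 ?expn_gt0 // binS expnS mul2n -addnn.
by rewrite leq_add.
Qed.

Lemma ln2_le1 : ln 2 <= 1 :> R.
Proof. by have -> : 2 = 1 + 1 :> R by []; apply: le_ln1Dx; lra. Qed.

(** Chebyshev's argument: the central binomial coefficient is at most [4 ^ Y], and in its logarithm
    the multiplicity of [vM n] is never negative and at least 1 for [Y < n <= 2 Y]. *)
Lemma psiC_double Y : psiC Y.*2 <= psiC Y + Y.*2%:R.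
Proof.
rewrite -lerBlDl; apply: le_trans (_ : ln Y.*2`!%:R - 2 * ln Y`!%:R <= _); last first.
  have -> : (Y.*2)`! = ('C(Y.*2, Y) * (Y`! * Y`!))%N.
    by rewrite -(@bin_fact Y.*2 Y) -?addnn ?leq_addr // addnK.
  rewrite !natrM lnM ?posrE ?mulr_gt0 ?ltr0n ?fact_gt0 ?bin_gt0 -?addnn ?leq_addr // lnM ?posrE ?ltr0n ?fact_gt0 //.
  rewrite -mulr2n -[_ *+ 2]mulr_natl addrK.
  apply: le_trans (_ : ln (2 ^ (Y + Y))%:R <= _).
    by rewrite ler_ln ?posrE ?ltr0n ?bin_gt0 ?expn_gt0 ?leq_addr // ler_nat bin_le_expn.
  by rewrite natrX lnXn // -[ln _ *+ _]mulr_natl ler_piMr // ln2_le1.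
rewrite !sum_ln_vM mulr_sumr /psiC.
rewrite (@big_cat_nat _ _ _ Y.+1 1 Y.*2.+1) //=; last by rewrite ltnS -addnn leq_addr.
rewrite [X in X - _]addrC addrK.
rewrite [X in _ <= X - _](@big_cat_nat _ _ _ Y.+1 1 Y.*2.+1) //=; last by rewrite ltnS -addnn leq_addr.
rewrite addrAC -sumrB -[leLHS]add0r; apply: lerD.
  rewrite big_nat; apply: sumr_ge0 => n /andP[n0 _].
  rewrite mulrCA -mulrBr mulr_ge0 ?vM_ge0 // subr_ge0 -natrM ler_nat leq_divRL //.
  by rewrite -mulnA mul2n leq_double leq_divM.
rewrite !big_nat; apply: ler_sum => n /andP[n0 nY]; rewrite ler_peMr ?vM_ge0 // ler1n divn_gt0 //.
by apply: leq_trans n0.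
Qed.

Lemma psiC_le X : psiC X <= 4 * X%:R.
Proof.
have mono a b : (a <= b)%N -> psiC a <= psiC b.
  move=> ab; rewrite /psiC (@big_cat_nat _ _ _ a.+1 1 b.+1) //= lerDl; apply: sumr_ge0 => n _; exact: vM_ge0.
elim/ltn_ind: X => X IH; case: (ltnP 1 X) => X1; last first.
  apply: le_trans (_ : 0 <= _); last by rewrite mulr_ge0.
  by case: X X1 {IH} => [|[]] // _; rewrite /psiC ?big_nil // big_nat1 vM1.
set Y := uphalf X; have hY : (X <= Y.*2)%N /\ (3 * Y <= 2 * X)%N /\ (Y < X)%N.
  rewrite /Y uphalf_half; have := odd_double_half X; case: (odd X) => /=; lia.
case: hY => h1 [h2 h3]; apply: le_trans (mono _ _ h1) _; apply: le_trans (psiC_double Y) _.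
apply: le_trans (lerD (IH _ h3) (lexx _)) _; rewrite -mul2n !natrM.
by move: h2; rewrite -(ler_nat R) !natrM; lra.
Qed.

(** Compare [sum_ln_vM] with [X ln X - X <= ln X! <= X ln X]; dropping the integer parts costs
    between 0 and [psiC X <= 4 X]. Division by [X] gives the constants 1 and 4. *)
Lemma mertens X : (0 < X)%N ->
  ln X%:R - 1 <= \sum_(1 <= n < X.+1) vM n / n%:R <= ln X%:R + 4.
Proof.
move=> X0; have x0 : 0 < X%:R :> R by rewrite ltr0n.
have h : 0 <= X%:R * (\sum_(1 <= n < X.+1) vM n / n%:R) - ln X`!%:R <= psiC X.
  rewrite sum_ln_vM mulr_sumr -sumrB !big_nat; apply/andP; split.
    apply: sumr_ge0 => n /andP[n0 _]; rewrite mulrCA -mulrBr mulr_ge0 ?vM_ge0 // subr_ge0.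
    by rewrite ler_pdivlMr ?ltr0n // -natrM ler_nat leq_divM.
  rewrite /psiC [leRHS]big_nat; apply: ler_sum => n /andP[n0 _]; rewrite mulrCA -mulrBr ler_piMr ?vM_ge0 // lerBlDr.
  by rewrite ler_pdivrMr ?ltr0n // addrC natr1 -natrM ler_nat ltnW // ltn_ceil.
have := psiC_le X; have := ln_fact_le X; have := ln_fact_ge X; case/andP: h.
set S := \sum_(_ <= _ < _) _; set L := ln X%:R; set F := ln _; set P := psiC X.
move=> h1 h2 h3 h4 h5; apply/andP; split; rewrite -(ler_pM2l x0); rewrite ?mulrBr ?mulrDr; lra.
Qed.

End Arithmetic.

(** * Real sequences and normal convolution operators *)

Section RealSequences.
Variable R : realType.

(** The limit is the supremum of the lower ends [s n - g n], all of which lie below every upper end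
    [s m + g m]. *)
Lemma lim_rate (s g : nat -> R) : (forall m n, (m <= n)%N -> `|s n - s m| <= g m) ->
  exists l, forall n, `|s n - l| <= g n.
Proof.
move=> H; have g0 n : 0 <= g n by apply: le_trans (H n n (leqnn n)).
have ub m n : s n - g n <= s m + g m.
  have := g0 m; have := g0 n; case: (leqP m n) => mn.
    by have := H _ _ mn; rewrite ler_norml => /andP[]; lra.
  by have := H _ _ (ltnW mn); rewrite ler_norml => /andP[]; lra.
pose E : classical_sets.set R := fun x => exists n, x = s n - g n.
have Eub m : classical_sets.ubound E (s m + g m) by move=> _ [n ->]; apply: ub.
have hE : classical_sets.has_ubound E by exists (s 0%N + g 0%N).
exists (sup E) => n; have h1 : s n - g n <= sup E by apply: (ub_le_sup hE); exists n.
have h2 : sup E <= s n + g n by apply: ge_sup => //; exists (s n - g n), n.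
rewrite ler_norml; apply/andP; split; lra.
Qed.

(** Summation by parts; [claim] keeps both boundary terms, so that each step of the induction adds
    only [W n.+1 * (F n - F n.+1)]. *)
Lemma abel (w F : nat -> R) B M N : (forall n, `|\sum_(0 <= i < n) w i| <= B) ->
  (forall n, (M <= n)%N -> 0 <= F n) -> (forall n, (M <= n)%N -> F n.+1 <= F n) ->
  `|\sum_(M <= n < N) w n * F n| <= 2 * B * F M.
Proof.
move=> hB F0 Fd; have B0 : 0 <= B by apply: le_trans (hB 0%N).
case: (leqP M N) => MN; last by rewrite big_geq ?(ltnW MN) // normr0 mulr_ge0 ?F0 // mulr_ge0.
pose W n := \sum_(0 <= i < n) w i.
have claim d : `|\sum_(M <= n < M + d) w n * F n - W (M + d)%N * F (M + d)%N + W M * F M| <= B * (F M - F (M + d)%N).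
  elim: d => [|d IH]; first by rewrite addn0 big_geq // sub0r addNr normr0 subrr mulr0.
  rewrite addnS big_nat_recr ?leq_addr //=.
  set S := \sum_(_ <= _ < _) _ in IH *; set n := (M + d)%N in IH *.
  have Wn : W n.+1 = W n + w n by rewrite /W big_nat_recr.
  have -> : S + w n * F n - W n.+1 * F n.+1 + W M * F M = (S - W n * F n + W M * F M) + W n.+1 * (F n - F n.+1).
    by rewrite Wn; ring.
  apply: le_trans (ler_normD _ _) _.
  have -> : B * (F M - F n.+1) = B * (F M - F n) + B * (F n - F n.+1) by ring.
  apply: lerD IH _; have d0 : 0 <= F n - F n.+1 by rewrite subr_ge0 Fd // leq_addr.
  by rewrite normrM [X in _ * X]ger0_norm // ler_wpM2r // /W hB.
have := claim (N - M)%N; rewrite subnKC //; set S := \sum_(_ <= _ < _) _ => h.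
have FN := F0 _ MN; have FM := F0 _ (leqnn M).
have h1 : `|W N * F N| <= B * F N by rewrite normrM [X in _ * X]ger0_norm // ler_wpM2r // /W hB.
have h2 : `|W M * F M| <= B * F M by rewrite normrM [X in _ * X]ger0_norm // ler_wpM2r // /W hB.
move: h h1 h2; rewrite !ler_norml mulrBr => /andP[a1 a2] /andP[b1 b2] /andP[c1 c2].
apply/andP; split; lra.
Qed.

(** Test at powers of 2, where the logarithm grows linearly in the exponent. *)
Lemma lnX_bounded (a C : R) : (forall X, (0 < X)%N -> a * ln X%:R <= C) -> a <= 0.
Proof.
move=> h; rewrite leNgt; apply/negP => a0.
have l2 : 2^-1 <= ln 2 :> R.
  have : ln (1 + - 2^-1) <= - 2^-1 :> R by apply: le_ln1Dx; lra.
  have -> : 1 + - 2^-1 = 2^-1 :> R by lra.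
  rewrite lnV ?posrE //; lra.
have C0 : 0 <= C by have := h 1%N isT; rewrite ln1 mulr0.
have C1 : 0 <= 2 * C / a by rewrite divr_ge0 ?mulr_ge0 // ltW.
have := archi_boundP C1; set n := Num.bound _ => hn.
have := h (2 ^ n)%N; rewrite expn_gt0 => /(_ isT); rewrite natrX lnXn // -[_ *+ _]mulr_natl.
move: hn; rewrite ltr_pdivrMr // => hn hm.
have : a * (n%:R * 2^-1) <= a * (n%:R * ln 2) by rewrite ler_pM2l // ler_wpM2l.
lra.
Qed.

(** [(ln x + 1) / x] has derivative [- ln x / x ^ 2]; the constant 2 in its place leaves room for
    the discretisation and makes the sequence decrease from [n = 1] on. *)
Lemma lnq_step n : (0 < n)%N ->
  ln n.+1%:R / (n%:R * n.+1%:R) <= (ln n%:R + 2) / n%:R - (ln n.+1%:R + 2) / n.+1%:R :> R.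
Proof.
move=> n0; have h := ln_succ_le R n0.
have n0' : 0 < n%:R :> R by rewrite ltr0n.
have n1' : 0 < n.+1%:R :> R by rewrite ltr0n.
have -> : (ln n%:R + 2) / n%:R - (ln n.+1%:R + 2) / n.+1%:R =
  (n.+1%:R * (ln n%:R + 2) - n%:R * (ln n.+1%:R + 2)) / (n%:R * n.+1%:R) :> R.
  by move: (n%:R : R) (n.+1%:R : R) n0' n1' => x y x0 y0; field; rewrite !gt_eqF.
rewrite ler_pM2r ?invr_gt0 ?mulr_gt0 //.
set l2 := ln _ in h *; set l1 := ln _ in h *; rewrite -natr1; set x := n%:R in h n0' *.
have xi : x^-1 <= 1 by rewrite invf_le1 // ler1n.
have : x * l2 <= x * l1 + 1 by rewrite -[1](mulfV (lt0r_neq0 n0')) -mulrDr ler_pM2l.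
rewrite mulrDl mul1r; lra.
Qed.

Lemma lnq_dec n : (0 < n)%N -> (ln n.+1%:R + 2) / n.+1%:R <= (ln n%:R + 2) / n%:R :> R.
Proof.
move=> n0; rewrite -subr_ge0; apply: le_trans (lnq_step n0); rewrite divr_ge0 ?mulr_ge0 //.
by apply: ln_ge0; rewrite ler1n.
Qed.

Lemma ln_le_sum_inv X : ln X.+1%:R <= \sum_(1 <= m < X.+1) m%:R^-1 :> R.
Proof.
elim: X => [|X IH]; first by rewrite big_nil ln1.
rewrite big_nat_recr //=; apply: le_trans (ln_succ_le R (ltn0Sn X)) _; exact: lerD.
Qed.

Lemma sum_squares_le (F : nat -> R) X : (forall n, (0 < n)%N -> 0 <= F n) ->
  \sum_(1 <= m < X.+1) F (m * m)%N <= \sum_(1 <= n < (X * X).+1) F n.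
Proof.
move=> F0; elim: X => [|X IH]; first by rewrite !big_nil.
rewrite big_nat_recr //= (@big_cat_nat _ _ _ (X * X).+1 1 (X.+1 * X.+1).+1) //=; last by lia.
apply: lerD IH _; rewrite big_nat_recr /=; last by lia.
by rewrite lerDr big_nat; apply: sumr_ge0 => n /andP[n0 _]; apply: F0; lia.
Qed.

Definition sq n : R := Num.sqrt n%:R.

Lemma sq_gt0 n : (0 < n)%N -> 0 < sq n. Proof. by move=> n0; rewrite sqrtr_gt0 ltr0n. Qed.
Lemma sq_ge0 n : 0 <= sq n. Proof. exact: sqrtr_ge0. Qed.
Lemma sqK n : sq n * sq n = n%:R. Proof. by rewrite -expr2 sqr_sqrtr. Qed.
Lemma sqM m n : sq (m * n) = sq m * sq n. Proof. by rewrite /sq natrM sqrtrM. Qed.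
Lemma sq_nat m : sq (m * m) = m%:R. Proof. by rewrite sqM sqK. Qed.

Lemma sq_gap (A B : R) : 0 < A -> A <= B -> B * B - A * A <= 1 -> 2 * (B - A) <= A^-1.
Proof.
move=> A0 AB h; rewrite -[A^-1]mul1r ler_pdivlMr //; apply: le_trans h.
have : 0 <= (B - A) * (B - A) by rewrite mulr_ge0 // subr_ge0.
lra.
Qed.

Lemma sq_step n : (0 < n)%N -> (sq n.+1)^-1 <= 2 * (sq n.+1 - sq n) <= (sq n)^-1.
Proof.
move=> n0; have A0 := sq_gt0 n0; have B0 := sq_gt0 (ltn0Sn n).
have AB : sq n <= sq n.+1 by rewrite ler_wsqrtr // ler_nat.
have h : sq n.+1 * sq n.+1 - sq n * sq n = 1 by rewrite !sqK -natr1; ring.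
apply/andP; split; last by apply: sq_gap => //; rewrite h.
rewrite -[_^-1]mul1r ler_pdivrMr //.
have : 0 <= (sq n.+1 - sq n) * (sq n.+1 - sq n) by rewrite mulr_ge0 // subr_ge0.
lra.
Qed.

Definition sumsq Y : R := \sum_(1 <= b < Y.+1) (sq b)^-1.

Lemma sumsq_mono m d : let s n := sumsq n.+1 - 2 * sq n.+1 in
  0 <= s m - s (m + d)%N <= (sq m.+1)^-1 - (sq (m + d).+1)^-1.
Proof.
elim: d => [|d] /=; first by rewrite addn0 !subrr lexx.
rewrite addnS; set n := (m + d)%N => /andP[h1 h2].
have -> : sumsq n.+2 = sumsq n.+1 + (sq n.+2)^-1 by rewrite /sumsq big_nat_recr.
have /andP[a b] := sq_step (ltn0Sn n).
apply/andP; split; lra.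
Qed.

Lemma sumsq_le X : sumsq X <= 2 * sq X.
Proof.
case: X => [|X]; first by rewrite /sumsq big_nil mulr_ge0 ?sq_ge0.
have /= /andP[h _] := sumsq_mono 0 X.
have s1 : sq 1 = 1 by rewrite /sq sqrtr1.
have : sumsq 1 = 1 by rewrite /sumsq big_nat1 s1 invr1.
move: h; rewrite add0n s1; lra.
Qed.

(** The telescoped form of [sq_step] makes the differences Cauchy with an explicit rate; the
    constant is [zeta(1/2)]. *)
Lemma sumsq_asymp : exists kappa, forall Y, (0 < Y)%N -> `|sumsq Y - 2 * sq Y - kappa| <= (sq Y)^-1.
Proof.
have [|l hl] := @lim_rate (fun n => sumsq n.+1 - 2 * sq n.+1) (fun n => (sq n.+1)^-1).
  move=> m n mn; have /= := sumsq_mono m (n - m); rewrite subnKC // => /andP[h1 h2].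
  have : 0 <= (sq n.+1)^-1 by rewrite invr_ge0 sq_ge0.
  by move=> h3; rewrite ler_norml; apply/andP; split; lra.
by exists l => -[] // Y _; apply: hl.
Qed.

End RealSequences.

(** * Convolution operators on a finite abelian group *)

Section NormalOperator.
Variables (R : realFieldType) (G : finGroupType) (a : G -> R).
Hypothesis mulC : forall x y : G, (x * y = y * x)%g.

Let n := #|G|.
Let M : 'M[R]_n := \matrix_(i, j) a ((enum_val j)^-1 * enum_val i)%g.
Let rv (f : G -> R) : 'rV[R]_n := \row_i f (enum_val i).

Lemma row_norm0 (x : 'rV[R]_n) : x *m x^T = 0 -> x = 0.
Proof.
move=> /matrixP /(_ 0 0); rewrite !mxE => h.
have h2 : \sum_i x 0 i ^+ 2 = 0.
  by rewrite -[RHS]h; apply: eq_bigr => i _; rewrite mxE.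
apply/rowP => i; rewrite mxE; apply/eqP; rewrite -sqrf_eq0.
by apply/eqP; apply: (psumr_eq0P _ h2) => // j _; apply: sqr_ge0.
Qed.

Lemma sum_rank (F : 'I_n -> R) : \sum_i F i = \sum_(x : G) F (enum_rank x).
Proof. by rewrite (reindex (@enum_rank G)) //; apply: onW_bij; apply: enum_rank_bij. Qed.

Lemma rvM f j : (rv f *m M) 0 j = \sum_h f (enum_val j * h)%g * a h.
Proof.
rewrite mxE sum_rank (reindex_inj (mulgI (enum_val j))); apply: eq_bigr => h _.
by rewrite !mxE enum_rankK mulKg.
Qed.

(** The reflection [l |-> x y l^-1] exchanges the two sums, thanks to commutativity. *)
Lemma normalM : M *m M^T = M^T *m M.
Proof.
apply/matrixP => i j; rewrite !mxE [LHS]sum_rank [RHS]sum_rank.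
set x := enum_val i; set y := enum_val j.
have inj : injective (fun l : G => x * y * l^-1)%g.
  by move=> l l' /mulgI /invg_inj.
rewrite [RHS](reindex_inj inj); apply: eq_bigr => l _; rewrite !mxE !enum_rankK -/x -/y.
have -> : (x^-1 * (x * y * l^-1) = l^-1 * y)%g by rewrite -mulgA mulKg mulC.
have -> : (y^-1 * (x * y * l^-1) = l^-1 * x)%g by rewrite (mulC x y) -mulgA mulKg mulC.
by rewrite mulrC.
Qed.

Lemma kerT (x : 'rV[R]_n) : x *m M = 0 -> x *m M^T = 0.
Proof.
move=> h; apply: row_norm0; rewrite trmx_mul trmxK -mulmxA (mulmxA M^T) -normalM !mulmxA h !mul0mx //.
Qed.

(* For a normal operator the whole space is the sum of kernel and image. *)
Lemma normal_decomp : exists k v : G -> R,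
  [/\ forall g, \sum_h k (g * h)%g * a h = 0,
      forall g, (g == 1%g)%:R = k g + \sum_h v (g * h)%g * a h
    & forall g, k g = \sum_h k h * k (g * h)%g].
Proof.
have cap0 : (kermx M :&: M = 0)%MS.
  apply/eqP/rowV0P => x; rewrite sub_capmx => /andP[/sub_kermxP hx /submxP[w xw]].
  by apply: row_norm0; rewrite {2}xw trmx_mul mulmxA kerT // mul0mx.
have full : row_full (kermx M + M)%MS.
  by rewrite /row_full mxrank_disjoint_sum // mxrank_ker subnK // rank_leq_row.
pose dl : 'rV[R]_n := rv (fun g => (g == 1%g)%:R).
have /sub_addsmxP[[u1 u2] /= hd] : (dl <= kermx M + M)%MS by apply: submx_full.
set kk := u1 *m kermx M in hd.
have kM : kk *m M = 0 by rewrite /kk -mulmxA mulmx_ker mulmx0.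
pose k g := kk 0 (enum_rank g); pose v g := u2 0 (enum_rank g).
have rk : rv k = kk by apply/rowP => i; rewrite mxE /k enum_valK.
have rvv : rv v = u2 by apply/rowP => i; rewrite mxE /v enum_valK.
have k0 g : \sum_h k (g * h)%g * a h = 0.
  have := rvM k (enum_rank g); by rewrite rk kM mxE enum_rankK => <-.
exists k, v; split=> // g.
  have := congr1 (fun x : 'rV[R]_n => x 0 (enum_rank g)) hd; rewrite mxE enum_rankK => ->.
  by rewrite mxE -[in X in _ + X]rvv rvM enum_rankK.
pose kg := rv (fun h => k (g * h)%g).
have kgM : kg *m M = 0.
  apply/rowP => j; rewrite rvM mxE -[RHS](k0 (g * enum_val j)%g); apply: eq_bigr => h _; by rewrite mulgA.
(* By [kerT] the image is orthogonal to the kernel, so pairing a translate of [k] with the delta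
   function sees only the kernel component; this is the reproducing identity for [k]. *)
have E : kg *m dl^T = kg *m kk^T.
  by rewrite hd linearD /= mulmxDr (trmx_mul u2 M) mulmxA kerT // mul0mx addr0.
have := congr1 (fun x : 'M[R]_1 => x 0 0) E; rewrite !mxE [LHS]sum_rank [RHS]sum_rank.
rewrite (bigD1 1%g) //= big1 ?addr0; last by move=> h /negPf hn; rewrite !mxE enum_rankK hn mulr0.
rewrite !mxE enum_rankK mulg1 eqxx mulr1 => ->; apply: eq_bigr => h _.
by rewrite /kg mxE [X in _ * X]mxE enum_rankK mulrC.
Qed.

End NormalOperator.

(** * Primes in residue classes *)

Section ResidueFunctions.
(** Residue classes in abstract form: [c] stands for coprimality to [q] and [u] for reduction to the
    unit group; [blocks] says that [q] consecutive integers meet each unit class exactly once. *)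
Variables (R : realType) (G : finGroupType) (q : nat) (c : pred nat) (u : nat -> G).
Hypothesis mulC : forall x y : G, (x * y = y * x)%g.
Hypothesis q0 : (0 < q)%N.
Hypothesis cM : forall m n, c (m * n)%N = c m && c n.
Hypothesis uM : forall m n, c m -> c n -> (u (m * n)%N = u m * u n)%g.
Hypothesis c1 : c 1%N.
Hypothesis u1 : u 1%N = 1%g.
Hypothesis blocks : forall h M, (\sum_(M <= n < M + q) (c n && (u n == h)))%N = 1%N.

Let phi : R := #|G|%:R.

Lemma phi_gt0 : 0 < phi.
Proof. by rewrite ltr0n; apply/card_gt0P; exists 1%g. Qed.

Definition ext (f : G -> R) n : R := if c n then f (u n) else 0.
Definition tr (g : G) (f : G -> R) : G -> R := fun h => f (g * h)%g.
Definition l1 (f : G -> R) : R := \sum_h `|f h|.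

Lemma l1_ge0 f : 0 <= l1 f. Proof. by apply: sumr_ge0. Qed.

Lemma le_l1 f h : `|f h| <= l1 f.
Proof. by rewrite /l1 (bigD1 h) //= lerDl; apply: sumr_ge0. Qed.

Lemma l1_tr g f : l1 (tr g f) = l1 f.
Proof. by rewrite /l1 [RHS](reindex_inj (mulgI g)). Qed.

Lemma sum_tr g f : \sum_h tr g f h = \sum_h f h.
Proof. by rewrite [RHS](reindex_inj (mulgI g)). Qed.

Lemma ext_sum f n : ext f n = \sum_h f h * (c n && (u n == h))%:R.
Proof.
rewrite /ext; case: (c n) => /=; last by rewrite big1 // => h _; rewrite mulr0.
rewrite (bigD1 (u n)) //= eqxx mulr1 big1 ?addr0 // => h hn.
by rewrite eq_sym (negPf hn) mulr0.
Qed.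

Lemma ext_block f M : \sum_(M <= n < M + q) ext f n = \sum_h f h.
Proof.
transitivity (\sum_(M <= n < M + q) \sum_h f h * (c n && (u n == h))%:R).
  by apply: eq_bigr => n _; apply: ext_sum.
rewrite exchange_big /=; apply: eq_bigr => h _.
by rewrite -mulr_sumr -natr_sum blocks mulr1.
Qed.

Lemma ext_partial f N : \sum_h f h = 0 -> `|\sum_(0 <= n < N) ext f n| <= q%:R * l1 f.
Proof.
move=> f0; elim/ltn_ind: N => N IH; case: (leqP q N) => qN.
  rewrite -(subnK qN) (@big_cat_nat _ _ _ (N - q) 0 (N - q + q)) ?leq_addr //=.
  by rewrite ext_block f0 addr0; apply: IH; lia.
apply: le_trans (ler_norm_sum _ _ _) _.
apply: le_trans (_ : \sum_(0 <= n < N) l1 f <= _).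
  by apply: ler_sum => n _; rewrite /ext; case: ifP => _; rewrite ?normr0 ?l1_ge0 ?le_l1.
by rewrite sumr_const_nat subn0 -[_ *+ _]mulr_natl ler_wpM2r ?l1_ge0 // ler_nat ltnW.
Qed.

Lemma ext_tail f F M N : \sum_h f h = 0 -> (forall n, (M <= n)%N -> 0 <= F n) ->
  (forall n, (M <= n)%N -> F n.+1 <= F n) ->
  `|\sum_(M <= n < N) ext f n * F n| <= 2 * (q%:R * l1 f) * F M.
Proof. by move=> f0 F0 Fd; apply: abel => // n; apply: ext_partial. Qed.

Lemma inv_dec (n : nat) : (1 <= n)%N -> (n.+1%:R^-1 : R) <= n%:R^-1.
Proof. by move=> n0; rewrite lef_pV2 ?posrE ?ltr0n // ler_nat. Qed.

Definition conv (a : G -> R) (f : G -> R) (g : G) := \sum_h f (g * h)%g * a h.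

(** [b h] is the limit of the series of [ext (d h) n / n], where [d h] is the delta function at [h]
    made of mean zero. A mean-zero [f] is the combination of the [d h] with coefficients [f h], and
    on such [f] subtracting from [b] its mean changes nothing. *)
Lemma conv_exists : exists a : G -> R, \sum_h a h = 0 /\ exists2 C, 0 <= C &
  forall f, \sum_h f h = 0 -> forall X,
  `|\sum_(1 <= n < X.+1) ext f n / n%:R - \sum_h f h * a h| <= C * l1 f / X.+1%:R.
Proof.
pose d (h x : G) : R := (x == h)%:R - phi^-1.
have d0 h : \sum_x d h x = 0.
  rewrite big_split /= sumr_const cardT -cardE mulNrn -[_ *+ _]mulr_natl mulfV ?lt0r_neq0 ?phi_gt0 //.
  by rewrite (bigD1 h) //= eqxx big1 ?addr0 ?subrr // => x /negPf ->.
pose C := \sum_h 2 * (q%:R * l1 (d h)).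
have Ch h : 2 * (q%:R * l1 (d h)) <= C.
  by rewrite /C (bigD1 h) //= lerDl; apply: sumr_ge0 => x _; rewrite !mulr_ge0 ?l1_ge0.
have C0 : 0 <= C by apply: sumr_ge0 => x _; rewrite !mulr_ge0 ?l1_ge0.
have lim h : exists l, forall X, `|\sum_(1 <= n < X.+1) ext (d h) n / n%:R - l| <= C / X.+1%:R.
  apply: (@lim_rate _ (fun X => \sum_(1 <= n < X.+1) ext (d h) n / n%:R) (fun X => C / X.+1%:R)).
  move=> m n mn; rewrite [X in X - _](@big_cat_nat _ _ _ m.+1 1 n.+1) //= [X in X - _]addrC addrK.
  apply: le_trans (ext_tail n.+1 (d0 h) _ _) _.
  - by move=> k _; rewrite invr_ge0.
  - by move=> k mk; apply: inv_dec; apply: leq_trans mk.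
  - by rewrite ler_wpM2r ?invr_ge0.
have [b hb] := choice lim.
pose mb := phi^-1 * \sum_h b h; exists (fun h => b h - mb); split.
  rewrite sumrB sumr_const cardT -cardE /mb -[_ *+ _]mulr_natl mulrA mulfV ?mul1r ?subrr //.
  by rewrite lt0r_neq0 ?phi_gt0.
exists C => // f f0 X.
have -> : \sum_h f h * (b h - mb) = \sum_h f h * b h.
  under eq_bigr do rewrite mulrBr.
  by rewrite sumrB -mulr_suml f0 mul0r subr0.
have E n : ext f n = \sum_h f h * ext (d h) n.
  rewrite /ext; case: ifP => _; last by rewrite big1 // => h _; rewrite mulr0.
  under eq_bigr do rewrite /d mulrBr.
  rewrite sumrB -mulr_suml f0 mul0r subr0 (bigD1 (u n)) //= eqxx mulr1 big1 ?addr0 // => h hn.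
  by rewrite eq_sym (negPf hn) mulr0.
have -> : \sum_(1 <= n < X.+1) ext f n / n%:R = \sum_h f h * \sum_(1 <= n < X.+1) ext (d h) n / n%:R.
  transitivity (\sum_(1 <= n < X.+1) \sum_h f h * (ext (d h) n / n%:R)).
    by apply: eq_bigr => n _; rewrite E mulr_suml; apply: eq_bigr => h _; rewrite mulrA.
  by rewrite exchange_big /=; apply: eq_bigr => h _; rewrite mulr_sumr.
rewrite -sumrB; apply: le_trans (ler_norm_sum _ _ _) _.
rewrite mulrAC [C / _ * _]mulrC /l1 mulr_suml; apply: ler_sum => h _.
by rewrite -mulrBr normrM ler_wpM2l.
Qed.

Lemma ext_tr g f d m : ext (tr g f) (d * m) = (c d)%:R * ext (tr (g * u d)%g f) m.
Proof.
rewrite /ext cM; case: (boolP (c d)) => cd /=; last by rewrite mul0r.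
by rewrite mul1r; case: ifP => cm //; rewrite uM // /tr mulgA.
Qed.

Section Convolution.
Variables (a : G -> R) (C : R).
Hypothesis a0 : \sum_h a h = 0.
Hypothesis C0 : 0 <= C.
Hypothesis aP : forall f, \sum_h f h = 0 -> forall X,
  `|\sum_(1 <= n < X.+1) ext f n / n%:R - \sum_h f h * a h| <= C * l1 f / X.+1%:R.

(** Write [N = d m]: the inner sum over [m] tends to the convolution at [g * u d] with an error of
    order [d / X], whose factor [d] cancels the weight [1 / d]. *)
Lemma conv_est (w : nat -> R) f g X : \sum_h f h = 0 -> (0 < X)%N ->
  `|\sum_(1 <= N < X.+1) ext (tr g f) N / N%:R * \sum_(d <- divisors N) w d
    - \sum_(1 <= d < X.+1) w d / d%:R * ext (tr g (conv a f)) d|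
  <= (\sum_(1 <= d < X.+1) `|w d|) * (C * l1 f / X%:R).
Proof.
move=> f0 X0.
have -> : \sum_(1 <= N < X.+1) ext (tr g f) N / N%:R * \sum_(d <- divisors N) w d =
  \sum_(1 <= d < X.+1) \sum_(1 <= m < (X %/ d).+1) w d * (ext (tr g f) (d * m) / (d * m)%:R).
  rewrite -(sum_hyperbola (fun d m => w d * (ext (tr g f) (d * m) / (d * m)%:R))).
  rewrite !big_nat; apply: eq_bigr => N /andP[N0 _].
  rewrite mulr_sumr !big_seq; apply: eq_bigr => d hd; have [_ dN] := divisors_in N0 hd.
  by rewrite mulrC muln_divA // mulKn // (dvdn_gt0 N0).
rewrite -sumrB; apply: le_trans (ler_norm_sum _ _ _) _.
rewrite mulr_suml !big_nat; apply: ler_sum => d /andP[d0 dX].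
have d0' : 0 < d%:R :> R by rewrite ltr0n.
have -> : \sum_(1 <= m < (X %/ d).+1) w d * (ext (tr g f) (d * m) / (d * m)%:R) =
  w d / d%:R * (c d)%:R * \sum_(1 <= m < (X %/ d).+1) ext (tr (g * u d)%g f) m / m%:R.
  rewrite mulr_sumr !big_nat; apply: eq_bigr => m /andP[m0 _]; rewrite ext_tr natrM invfM; ring.
have -> : w d / d%:R * ext (tr g (conv a f)) d = w d / d%:R * (c d)%:R * \sum_h tr (g * u d)%g f h * a h.
  rewrite /ext; case: ifP => _; rewrite ?mulr1 ?mulr0 ?mul0r //.
rewrite -mulrBr normrM; have f0' : \sum_h tr (g * u d)%g f h = 0 by rewrite sum_tr.
apply: le_trans (ler_wpM2l (normr_ge0 _) (aP f0' _)) _; rewrite l1_tr !normrM -!mulrA ler_wpM2l //.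
rewrite normfV [`|d%:R|]ger0_norm //.
have E : d%:R^-1 / (X %/ d).+1%:R <= X%:R^-1 :> R.
  rewrite -invfM lef_pV2 ?posrE ?mulr_gt0 ?ltr0n // -natrM ler_nat mulnC ltnW // ltn_ceil //.
have c01 : `|(c d)%:R| <= 1 :> R by case: (c d); rewrite ?normr1 ?normr0.
have CL : 0 <= C * l1 f by rewrite mulr_ge0 ?l1_ge0.
rewrite [leLHS](_ : _ = `|(c d)%:R| * ((C * l1 f) * (d%:R^-1 / (X %/ d).+1%:R))); last by ring.
rewrite [leRHS](_ : _ = 1 * (C * l1 f * X%:R^-1)); last by ring.
apply: ler_pM => //; first by rewrite !mulr_ge0 ?invr_ge0 ?l1_ge0.
by rewrite ler_wpM2l.
Qed.

(** Take [w = vM] in [conv_est]: the divisor sums are [ln N], and the sum of [f(N) ln N / N] is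
    bounded by Abel summation, after [ln N] is split as [(ln N + 2) - 2] to have monotone
    weights. *)
Lemma sum_vM_conv f : \sum_h f h = 0 -> exists K : R, forall g X, (0 < X)%N ->
  `|\sum_(1 <= n < X.+1) vM R n / n%:R * ext (tr g (conv a f)) n| <= K.
Proof.
move=> f0; exists (8 * (q%:R * l1 f) + 4 * (C * l1 f)) => g X X0.
have := conv_est (vM R) g f0 X0.
set S := \sum_(_ <= _ < _) _; set T := \sum_(_ <= _ < _) _; set P := \sum_(_ <= _ < _) _ => h.
have PE : P * (C * l1 f / X%:R) <= 4 * (C * l1 f).
  have -> : P = psiC R X by apply: eq_bigr => n _; rewrite ger0_norm ?vM_ge0.
  apply: le_trans (_ : 4 * X%:R * (C * l1 f / X%:R) <= _).
    by rewrite ler_wpM2r ?psiC_le // divr_ge0 // mulr_ge0 ?l1_ge0.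
  by rewrite le_eqVlt; apply/orP; left; apply/eqP; field; rewrite pnatr_eq0 -lt0n.
have f0' : \sum_h tr g f h = 0 by rewrite sum_tr.
have SE : S = \sum_(1 <= N < X.+1) ext (tr g f) N * ((ln N%:R + 2) / N%:R)
   - 2 * \sum_(1 <= N < X.+1) ext (tr g f) N * N%:R^-1.
  rewrite mulr_sumr -sumrB /S !big_nat; apply: eq_bigr => N /andP[N0 _]; rewrite sum_vM //; ring.
have S1 : `|\sum_(1 <= N < X.+1) ext (tr g f) N * ((ln N%:R + 2) / N%:R)| <= 4 * (q%:R * l1 f).
  have := ext_tail X.+1 f0' (F := fun N => (ln N%:R + 2) / N%:R) (M := 1%N) _ _.
  rewrite l1_tr ln1 invr1 add0r mulr1 => H; apply: le_trans (H _ _) _.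
  - by move=> n n1; rewrite divr_ge0 // addr_ge0 // ln_ge0 // ler1n.
  - by move=> n n1; apply: lnq_dec.
  - by rewrite mulrAC -natrM.
have S2 : `|\sum_(1 <= N < X.+1) ext (tr g f) N * N%:R^-1| <= 2 * (q%:R * l1 f).
  have := ext_tail X.+1 f0' (F := fun N => N%:R^-1) (M := 1%N) _ _.
  rewrite l1_tr invr1 mulr1 => H; apply: H => n n1; by rewrite ?invr_ge0 ?inv_dec.
move: h S1 S2; rewrite SE !ler_norml => /andP[x1 x2] /andP[y1 y2] /andP[z1 z2].
apply/andP; split; lra.
Qed.

(** Take [w d = mu d * ln (X / d)] in [conv_est]: the divisor sums are [vM N], plus [ln X] at
    [N = 1], while the convolution side vanishes. So the primes are biased by [- ln X * f g]. *)
Lemma sum_vM_ker f : \sum_h f h = 0 -> (forall g, conv a f g = 0) -> exists K : R, forall g X, (0 < X)%N ->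
  `|\sum_(1 <= n < X.+1) vM R n / n%:R * ext (tr g f) n + ln X%:R * f g| <= K.
Proof.
move=> f0 k0; exists (C * l1 f) => g X X0.
have := conv_est (fun d => mu R d * (ln X%:R - ln d%:R)) g f0 X0.
set S := \sum_(_ <= _ < _) _; set T := \sum_(_ <= _ < _) _; set P := \sum_(_ <= _ < _) _ => h.
have T0 : T = 0.
  by rewrite /T big1 // => d _; rewrite /ext /tr k0 if_same mulr0.
have SE : S = \sum_(1 <= n < X.+1) vM R n / n%:R * ext (tr g f) n + ln X%:R * f g.
  have A N : (0 < N)%N -> \sum_(d <- divisors N) mu R d * (ln X%:R - ln d%:R) = vM R N + ln X%:R * (N == 1%N)%:R.
    move=> N0; under eq_bigr do rewrite mulrBr.
    by rewrite sumrB -mulr_suml sum_mu // sum_mu_ln // opprK addrC mulrC.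
  transitivity (\sum_(1 <= n < X.+1) (vM R n / n%:R * ext (tr g f) n + ext (tr g f) n / n%:R * (ln X%:R * (n == 1%N)%:R))).
    rewrite /S !big_nat; apply: eq_bigr => N /andP[N0 _]; rewrite A //; ring.
  rewrite big_split /=; congr (_ + _); rewrite big_nat_recl //= big_nat big1.
    by rewrite addr0 /ext c1 u1 /tr mulg1; lra.
  by move=> i /andP[i0 _]; rewrite eqSS (gtn_eqF i0) !mulr0.
have PE : P <= X%:R.
  apply: le_trans (_ : \sum_(1 <= d < X.+1) (ln X%:R - ln d%:R) <= _).
    rewrite /P !big_nat; apply: ler_sum => d /andP[d0 dX].
    have hd : 0 <= ln X%:R - ln d%:R :> R by rewrite subr_ge0 ler_ln ?posrE ?ltr0n ?ler_nat.
    by rewrite normrM [X in _ * X]ger0_norm // ler_piMl // mu_norm.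
  rewrite sumrB sumr_const_nat subn1 /= -ln_factE -[_ *+ _]mulr_natl.
  have := ln_fact_ge R X; lra.
rewrite -SE -[S]subr0 -T0; apply: le_trans h _.
apply: le_trans (_ : X%:R * (C * l1 f / X%:R) <= _).
  by rewrite ler_wpM2r // divr_ge0 // mulr_ge0 ?l1_ge0.
by rewrite le_eqVlt; apply/orP; left; apply/eqP; field; rewrite pnatr_eq0 -lt0n.
Qed.

End Convolution.

(** * Nonvanishing of [L(1, chi)] for a real character *)

Section RealCharacter.
Variable chi : G -> R.
Hypothesis chiM : forall x y, chi (x * y)%g = chi x * chi y.
Hypothesis chi2 : forall x, chi x * chi x = 1.
Hypothesis chi0 : \sum_h chi h = 0.

Let x n := ext chi n.
Let r n := \sum_(d <- divisors n) x d.

Lemma extM m n : x (m * n) = x m * x n.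
Proof.
rewrite /x /ext cM; case: (boolP (c m)) => cm /=; last by rewrite mul0r.
by case: (boolP (c n)) => cn; [rewrite uM // chiM|rewrite mulr0].
Qed.

Lemma chi1 : chi 1%g = 1.
Proof. by have := chiM 1%g 1%g; rewrite mulg1 chi2. Qed.

Lemma ext1 : x 1 = 1. Proof. by rewrite /x /ext c1 u1 chi1. Qed.

Lemma ext_cases n : [\/ x n = 0, x n = 1 | x n = -1].
Proof.
rewrite /x /ext; case: (c n); last by constructor 1.
have : (chi (u n) - 1) * (chi (u n) + 1) = 0.
  by rewrite mulrDr mulrBl chi2 mulr1 mul1r addrC; ring.
by move/eqP; rewrite mulf_eq0 => /orP[/eqP h|/eqP h]; [constructor 2|constructor 3]; lra.
Qed.

Lemma extX p i : x (p ^ i) = x p ^+ i.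
Proof. by elim: i => [|i IH]; rewrite ?expn0 ?expr0 ?ext1 // expnS exprS extM IH. Qed.

Lemma geom_sign (t : R) e : [\/ t = 0, t = 1 | t = -1] ->
  0 <= \sum_(i < e.+1) t ^+ i /\ (~~ odd e -> 1 <= \sum_(i < e.+1) t ^+ i).
Proof.
case=> ->.
- by rewrite big_ord_recl expr0 big1 ?addr0 // => i _; rewrite exprS mul0r.
- have -> : \sum_(i < e.+1) 1 ^+ i = e.+1%:R :> R.
    by under eq_bigr do rewrite expr1n; rewrite sumr_const card_ord.
  by rewrite ler0n ler1n.
have -> : \sum_(i < e.+1) (-1) ^+ i = (~~ odd e)%:R :> R.
  elim: e => [|e IH]; first by rewrite big_ord1.
  rewrite big_ord_recr /= IH -signr_odd /=; case: (odd e) => /=; rewrite ?expr0 ?expr1; lra.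
by split=> // ->.
Qed.

Lemma r_ppow p e m : prime p -> ~~ (p %| m)%N -> (0 < m)%N ->
  r (p ^ e * m) = (\sum_(i < e.+1) x p ^+ i) * r m.
Proof.
move=> pp pm m0; rewrite /r sum_div_ppow // mulr_suml; apply: eq_bigr => i _.
by rewrite mulr_sumr; apply: eq_bigr => d _; rewrite extM extX.
Qed.

(** [r] is multiplicative, and its factor at [p ^ e] is a geometric sum of ratio 0, 1 or -1: never
    negative, and at least 1 for even [e]. *)
Lemma r_lower n : (0 < n)%N -> 0 <= r n /\ ((forall p, ~~ odd (logn p n)) -> 1 <= r n).
Proof.
move: n; apply: ppow_ind => [|p e m pp e0 pm m0 [IH1 IH2]].
  by rewrite /r big_seq1 ext1; split => // _.
have [g1 g2] := geom_sign e (ext_cases p).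
rewrite r_ppow //; split; first exact: mulr_ge0.
have pe0 : (0 < p ^ e)%N by rewrite expn_gt0 prime_gt0.
move=> H; rewrite -[1]mulr1; apply: ler_pM => //.
  by apply: g2; have := H p; rewrite lognM // pfactorK // logn_ndvd // addn0.
apply: IH2 => s; case: (eqVneq s p) => [->|sp]; first by rewrite logn_ndvd.
have := H s; rewrite lognM // lognX; case: (boolP (prime s)) => ps.
  by rewrite logn_prime // (negPf sp) muln0.
by rewrite [logn s m]lognE (negPf ps).
Qed.

Lemma r_square m : (0 < m)%N -> 1 <= r (m * m).
Proof.
move=> m0; apply: (proj2 (@r_lower (m * m) _)); first by rewrite muln_gt0 m0.
by move=> p; rewrite lognM // addnn odd_double.
Qed.

Variable C : R.
Hypothesis C0 : 0 <= C.
Hypothesis L0 : forall X, `|\sum_(1 <= n < X.+1) x n / n%:R| <= C / X.+1%:R.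

Lemma sqV_dec n : (1 <= n)%N -> (sq R n.+1)^-1 <= (sq R n)^-1.
Proof. by move=> n0; rewrite lef_pV2 ?posrE ?sq_gt0 // ler_wsqrtr // ler_nat. Qed.

Lemma x_norm n : `|x n| <= 1.
Proof. by case: (ext_cases n) => ->; rewrite ?normr0 ?normrN1 ?normr1. Qed.

Lemma sum_r_sq X : \sum_(1 <= N < (X * X).+1) r N / sq R N =
  \sum_(1 <= a < (X * X).+1) x a / sq R a * sumsq R (X * X %/ a).
Proof.
transitivity (\sum_(1 <= N < (X * X).+1) \sum_(d <- divisors N)
    (fun a b => x a / sq R a * (sq R b)^-1) d (N %/ d)%N).
  rewrite !big_nat; apply: eq_bigr => N /andP[N0 _]; rewrite /r mulr_suml !big_seq.
  apply: eq_bigr => d hd; have [_ dN] := divisors_in N0 hd.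
  by rewrite -{1}(divnK dN) sqM invfM; ring.
rewrite (sum_hyperbola (fun a b => x a / sq R a * (sq R b)^-1)); apply: eq_bigr => a _.
by rewrite -mulr_sumr.
Qed.

(** For [a <= X] the sum over [b] is [2 X / sqrt a + kap] up to [O(sqrt a / X)]. The first term
    meets the partial sums of [L(1, chi) = 0], which are [O(1 / X)], the second a character sum
    bounded by Abel summation. *)
Lemma head_bound : exists K, forall X, (0 < X)%N ->
  `|\sum_(1 <= a < X.+1) x a / sq R a * sumsq R (X * X %/ a)| <= K.
Proof.
have [kap hk] := sumsq_asymp R.
exists (2 * C + `|kap| * (2 * (q%:R * l1 chi)) + 4) => X X0.
have X0' : 0 < X%:R :> R by rewrite ltr0n.
pose E a := sumsq R (X * X %/ a) - 2 * (X%:R / sq R a) - kap.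
have EB a : (0 < a <= X)%N -> `|E a| <= 4 * (sq R a / X%:R).
  move=> /andP[a0 aX]; set Y := (X * X %/ a)%N.
  have Y0 : (0 < Y)%N by rewrite divn_gt0 // (leq_trans aX) // leq_pmulr.
  set A := sq R Y; set B := X%:R / sq R a.
  have A0 : 0 < A by apply: sq_gt0.
  have sa := sq_gt0 R a0; have B0 : 0 < B by apply: divr_gt0.
  have a0' : 0 < a%:R :> R by rewrite ltr0n.
  have BB : B * B = (X * X)%:R / a%:R by rewrite /B mulrACA -invfM sqK natrM.
  have AA : A * A = Y%:R by apply: sqK.
  have h1 : A * A <= B * B by rewrite AA BB ler_pdivlMr // -natrM ler_nat leq_divM.
  have h2 : B * B - A * A <= 1.
    rewrite AA BB lerBlDr addrC natr1 ler_pdivrMr // -natrM ler_nat ltnW // ltn_ceil //.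
  have AB : A <= B.
    rewrite leNgt; apply/negP => BA; have : B * B < A * A by apply: ltr_pM => //; exact: ltW.
    by rewrite ltNge h1.
  have h3 := sq_gap A0 AB h2.
  have h4 : B <= 2 * A.
    have A1 : 1 <= A * A by rewrite AA ler1n.
    rewrite leNgt; apply/negP => BA.
    have : 2 * A * (2 * A) < B * B by apply: ltr_pM => //; rewrite mulr_ge0 // ltW.
    lra.
  have h5 : A^-1 <= 2 * (sq R a / X%:R).
    have -> : sq R a / X%:R = B^-1 by rewrite /B invfM invrK mulrC.
    rewrite -[A^-1]mul1r ler_pdivrMr // mulrAC -[2 * A / B]/(2 * A / B) ler_pdivlMr // mul1r //.
  have := hk _ Y0; rewrite /E -/Y -/A -/B !ler_norml => /andP[k1 k2].
  apply/andP; split; lra.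
have split a : x a / sq R a * sumsq R (X * X %/ a) =
   2 * X%:R * (x a / (sq R a * sq R a)) + kap * (x a * (sq R a)^-1) + x a / sq R a * E a.
  by rewrite /E invfM; ring.
have -> : \sum_(1 <= a < X.+1) x a / sq R a * sumsq R (X * X %/ a) =
  2 * X%:R * (\sum_(1 <= a < X.+1) x a / a%:R) + kap * (\sum_(1 <= a < X.+1) x a * (sq R a)^-1)
  + \sum_(1 <= a < X.+1) x a / sq R a * E a.
  rewrite !mulr_sumr -!big_split /=; apply: eq_bigr => a _; by rewrite split sqK.
apply: le_trans (ler_normD _ _) _; apply: lerD; first apply: le_trans (ler_normD _ _) _; first apply: lerD.
- rewrite normrM [`|2 * _|]ger0_norm ?mulr_ge0 //.
  apply: le_trans (ler_wpM2l _ (L0 X)) _; first by rewrite mulr_ge0.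
  rewrite -mulrA ler_wpM2l // mulrCA ler_piMr // ler_pdivrMr ?ltr0n // mul1r ler_nat; exact: leqnSn.
- rewrite normrM ler_wpM2l //; have := ext_tail X.+1 chi0 (F := fun n => (sq R n)^-1) (M := 1%N) _ _.
  have -> : sq R 1 = 1 by rewrite /sq sqrtr1.
  rewrite invr1 mulr1 => H; apply: H => n n1; by rewrite ?invr_ge0 ?sq_ge0 ?sqV_dec.
- apply: le_trans (ler_norm_sum _ _ _) _.
  apply: le_trans (_ : \sum_(1 <= a < X.+1) 4 / X%:R <= _).
    rewrite !big_nat; apply: ler_sum => a /andP[a0 aX]; rewrite !normrM.
    have sa := sq_gt0 R a0; have E1 := EB a; rewrite a0 -ltnS aX in E1.
    apply: le_trans (_ : 1 * (sq R a)^-1 * (4 * (sq R a / X%:R)) <= _); last first.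
      rewrite le_eqVlt; apply/orP; left; apply/eqP; field; by rewrite !lt0r_neq0.
    apply: ler_pM => //; [by rewrite mulr_ge0| |by apply: E1].
    by apply: ler_pM => //; [exact: x_norm|rewrite normfV gtr0_norm].
  rewrite sumr_const_nat subn1 /= -[_ *+ _]mulr_natl le_eqVlt; apply/orP; left; apply/eqP; field.
  by rewrite lt0r_neq0.
Qed.

(** After exchanging the sums, [a > X] forces [b <= X]; the character sum over [a] is
    [O(1 / sqrt X)] and the sum of [1 / sqrt b] is [O(sqrt X)]. *)
Lemma tail_bound : exists K, forall X, (0 < X)%N ->
  `|\sum_(X.+1 <= a < (X * X).+1) x a / sq R a * sumsq R (X * X %/ a)| <= K.
Proof.
exists (2 * (q%:R * l1 chi) * 2) => X X0.
have X0' : 0 < X%:R :> R by rewrite ltr0n.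
have -> : \sum_(X.+1 <= a < (X * X).+1) x a / sq R a * sumsq R (X * X %/ a) =
  \sum_(X.+1 <= a < (X * X).+1) \sum_(1 <= b < X.+1) if (a * b <= X * X)%N then (sq R b)^-1 * (x a * (sq R a)^-1) else 0.
  rewrite !big_nat; apply: eq_bigr => a /andP[aX a2].
  have a0 : (0 < a)%N by apply: leq_ltn_trans aX.
  rewrite /sumsq (big_nat_widen _ _ X.+1); last first.
    by rewrite ltnS -[leqRHS](mulnK X X0) leq_div2l //; exact: ltnW.
  rewrite mulr_sumr big_mkcond /=; apply: eq_bigr => b _.
  by rewrite ltnS leq_divRL // mulnC; case: ifP => // _; ring.
rewrite exchange_big /=; apply: le_trans (ler_norm_sum _ _ _) _.
apply: le_trans (_ : \sum_(1 <= b < X.+1) (sq R b)^-1 * (2 * (q%:R * l1 chi) * (sq R X.+1)^-1) <= _).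
  rewrite !big_nat; apply: ler_sum => b /andP[b0 bX]; rewrite -big_mkcond -mulr_sumr normrM.
  rewrite [`|_^-1|]ger0_norm ?invr_ge0 ?sq_ge0 // ler_wpM2l ?invr_ge0 ?sq_ge0 //.
  have -> : \sum_(X.+1 <= a < (X * X).+1 | (a * b <= X * X)%N) x a * (sq R a)^-1 =
     \sum_(X.+1 <= a < (X * X %/ b).+1) x a * (sq R a)^-1.
    rewrite [RHS](big_nat_widen _ _ (X * X).+1) /=; last by rewrite ltnS leq_div.
    by apply: eq_bigl => a; rewrite ltnS leq_divRL.
  apply: ext_tail => // n Xn; first by rewrite invr_ge0 sq_ge0.
  by apply: sqV_dec; apply: leq_trans Xn.
rewrite -mulr_suml -/(sumsq R X) mulrCA ler_wpM2l ?mulr_ge0 ?l1_ge0 //.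
rewrite ler_pdivrMr ?sq_gt0 //; apply: le_trans (sumsq_le R X) _.
by rewrite ler_wpM2l // ler_wsqrtr // ler_nat.
Qed.

(* [r = 1 * chi] is nonnegative and at least 1 on squares, so [\sum_(n <= X^2) r n / sqrt n] diverges,
   while [L(1, chi) = 0] bounds it by the hyperbola method. *)
Lemma real_char_nonvanish : False.
Proof.
have [K1 h1] := head_bound; have [K2 h2] := tail_bound.
have : 1 <= 0 :> R; last by rewrite leNgt ltr01.
apply: (@lnX_bounded _ _ (K1 + K2)) => X X0; rewrite mul1r.
apply: le_trans (_ : ln X.+1%:R <= _); first by rewrite ler_ln ?posrE ?ltr0n // ler_nat.
apply: le_trans (ln_le_sum_inv R X) _.
apply: le_trans (_ : \sum_(1 <= m < X.+1) (fun n => r n / sq R n) (m * m)%N <= _).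
  rewrite !big_nat; apply: ler_sum => m /andP[m0 _]; rewrite sq_nat -[leLHS]mul1r.
  by rewrite ler_wpM2r ?invr_ge0 // r_square.
apply: le_trans (@sum_squares_le _ (fun n => r n / sq R n) X _) _.
  by move=> n n0; rewrite divr_ge0 ?sq_ge0 //; case: (r_lower n0).
rewrite sum_r_sq (@big_cat_nat _ _ _ X.+1 1 (X * X).+1) //=; last by rewrite ltnS leq_pmulr.
by apply: lerD; apply: le_trans (ler_norm _) _; auto.
Qed.

End RealCharacter.

(** Decompose the delta function as [k + conv a v]. The convolution contributes [O(1)] by
    [sum_vM_conv], so all depends on [k0 = k - 1 / phi]. If [k0] is not zero, it biases the primes
    by [sum_vM_ker]; since [vM] is nonnegative and [k0] reproduces itself, this forces [phi * k0] to
    be a quadratic character, and the kernel condition says that [L(1, chi) = 0]. *)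
Lemma prog_lower : exists K : R, forall g X, (0 < X)%N ->
  phi^-1 * (\sum_(1 <= n < X.+1) vM R n / n%:R * (c n)%:R) - K <=
  \sum_(1 <= n < X.+1) vM R n / n%:R * (c n && (u n == g))%:R.
Proof.
have p0 := phi_gt0; have pn0 : phi != 0 by rewrite lt0r_neq0.
have [a [a0 [C C0 aP]]] := conv_exists.
have [k [v [kK dE kP]]] := normal_decomp a mulC.
have sconst (z : R) : \sum_(h : G) z = phi * z by rewrite sumr_const cardT -cardE -[_ *+ _]mulr_natl.
have sk : \sum_g k g = 1.
  have : \sum_(g : G) (g == 1%g)%:R = \sum_g k g + \sum_g \sum_h v (g * h)%g * a h.
    by rewrite -big_split; apply: eq_bigr => g _; rewrite dE.
  rewrite (bigD1 1%g) //= eqxx big1 ?addr0; last by move=> g /negPf ->.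
  rewrite exchange_big /= [X in _ + X](_ : _ = 0) ?addr0; first by move=> <-.
  transitivity (\sum_h (\sum_g v g) * a h); last by rewrite -mulr_sumr a0 mulr0.
  apply: eq_bigr => h _; rewrite -mulr_suml; congr (_ * _); rewrite -(sum_tr h v).
  by apply: eq_bigr => g _; rewrite /tr mulC.
pose mv := phi^-1 * \sum_h v h; pose w h := v h - mv; pose k0 h := k h - phi^-1.
have w0 : \sum_h w h = 0 by rewrite sumrB sconst /mv mulrA mulfV // mul1r subrr.
have wE g : conv a w g = conv a v g.
  rewrite /conv; under eq_bigr do rewrite /w mulrBl.
  by rewrite sumrB -mulr_sumr a0 mulr0 subr0.
have k00 : \sum_h k0 h = 0 by rewrite sumrB sconst mulfV // sk subrr.
have k0K g : conv a k0 g = 0.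
  rewrite /conv; under eq_bigr do rewrite /k0 mulrBl.
  by rewrite sumrB -mulr_sumr a0 mulr0 subr0.
have k0P g : k0 g = \sum_h k0 h * k0 (g * h)%g.
  have : \sum_h (k0 h + phi^-1) * (k0 (g * h)%g + phi^-1) = k0 g + phi^-1.
    by rewrite /k0 subrK [RHS]kP; apply: eq_bigr => h _; rewrite !subrK.
  under eq_bigr do rewrite mulrDr mulrDl.
  rewrite 2!big_split /= -mulr_sumr (sum_tr g k0) k00 mulr0 addr0.
  rewrite -mulr_suml big_split /= k00 sconst mulfV // add0r mul1r.
  by move/addIr.
have [K1 h1] := sum_vM_conv C0 aP w0.
have [K2 h2] := @sum_vM_ker a C C0 aP k0 k00 k0K.
have split g n : (c n && (u n == g))%:R = phi^-1 * (c n)%:R + ext (tr g^-1%g k0) n + ext (tr g^-1%g (conv a w)) n.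
  rewrite /ext; case: (c n) => /=; last by rewrite mulr0 !addr0.
  by rewrite eq_sym eq_mulVg1 dE /tr wE /k0 mulr1 /conv; ring.
have sumE g X : \sum_(1 <= n < X.+1) vM R n / n%:R * (c n && (u n == g))%:R =
   phi^-1 * (\sum_(1 <= n < X.+1) vM R n / n%:R * (c n)%:R)
   + \sum_(1 <= n < X.+1) vM R n / n%:R * ext (tr g^-1%g k0) n
   + \sum_(1 <= n < X.+1) vM R n / n%:R * ext (tr g^-1%g (conv a w)) n.
  by rewrite mulr_sumr -!big_split /=; apply: eq_bigr => n _; rewrite split; ring.
suff k0z g : k0 g = 0.
  exists K1 => g X X0; rewrite sumE [X in _ + X + _]big1 ?addr0.
    by have := h1 g^-1%g _ X0; rewrite ler_norml => /andP[b1 b2]; lra.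
  by move=> n _; rewrite /ext /tr k0z if_same mulr0.
(* On the class [y^-1] the sum of [vM n / n] has main term at most [ln X * (phi^-1 - k0 y)] and is
   nonnegative. *)
have k0le y : k0 y <= phi^-1.
  rewrite -subr_le0; apply: (@lnX_bounded _ _ (4 * phi^-1 + K1 + K2)) => X X0.
  have := h1 y _ X0; have := h2 y _ X0; rewrite !ler_norml => /andP[_ b2] /andP[_ b3].
  have : 0 <= \sum_(1 <= n < X.+1) vM R n / n%:R * (c n && (u n == y^-1%g))%:R.
    by apply: sumr_ge0 => n _; rewrite !mulr_ge0 ?invr_ge0 ?vM_ge0.
  rewrite sumE invgK; move: b2 b3; set T1 := \sum_(_ <= _ < _) _; set T2 := \sum_(_ <= _ < _) _; set S := \sum_(_ <= _ < _) _.
  have SM : S <= ln X%:R + 4.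
    have /andP[_ h] := mertens R X0; apply: le_trans h; apply: ler_sum => n _.
    by apply: ler_piMr; [rewrite divr_ge0 ?vM_ge0|case: (c n)].
  have : phi^-1 * S <= phi^-1 * (ln X%:R + 4) by rewrite ler_wpM2l // invr_ge0 ltW.
  lra.
pose s := k0 1%g.
have sE : s = \sum_h k0 h ^+ 2 by rewrite /s k0P; apply: eq_bigr => h _; rewrite mul1g.
have s0 : 0 <= s by rewrite sE; apply: sumr_ge0 => h _; apply: sqr_ge0.
have [sz|sn0] := eqVneq s 0.
  apply/eqP; rewrite -sqrf_eq0; apply/eqP; apply: (psumr_eq0P (P := xpredT) (F := fun h => k0 h ^+ 2)) => //.
    by move=> h _; apply: sqr_ge0.
  by rewrite -sE.
have sp : 0 < s by rewrite lt_neqAle eq_sym sn0.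
(* Cauchy-Schwarz in the identity [k0P], written with [2 x y <= x ^ 2 + y ^ 2]; both sums of squares
   equal [s]. *)
have k0s h : k0 h ^+ 2 <= s ^+ 2.
  have H1 : 2 * k0 h <= 2 * s.
    rewrite (k0P h) mulr_sumr; apply: le_trans (_ : \sum_x (k0 x ^+ 2 + k0 (h * x)%g ^+ 2) <= _).
      apply: ler_sum => x _; have := sqr_ge0 (k0 x - k0 (h * x)%g); rewrite sqrrB; lra.
    by rewrite big_split /= (sum_tr h (fun x => k0 x ^+ 2)) -sE; lra.
  have H2 : - (2 * k0 h) <= 2 * s.
    rewrite (k0P h) mulr_sumr -sumrN; apply: le_trans (_ : \sum_x (k0 x ^+ 2 + k0 (h * x)%g ^+ 2) <= _).
      apply: ler_sum => x _; have := sqr_ge0 (k0 x + k0 (h * x)%g); rewrite sqrrD; lra.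
    by rewrite big_split /= (sum_tr h (fun x => k0 x ^+ 2)) -sE; lra.
  have : 0 <= (s - k0 h) * (s + k0 h) by apply: mulr_ge0; lra.
  rewrite !expr2; lra.
have sle : phi * s <= 1 by rewrite mulrC -ler_pdivlMr // mul1r; apply: k0le.
(* The nonnegative terms [s ^ 2 - k0 h ^ 2] add up to [s * (phi * s - 1) <= 0], so all of them
   vanish. *)
have sqE h : k0 h ^+ 2 = s ^+ 2.
  have S0 : \sum_h (s ^+ 2 - k0 h ^+ 2) = 0.
    apply/eqP; rewrite eq_le; apply/andP; split; last by apply: sumr_ge0 => x _; rewrite subr_ge0.
    rewrite sumrB sconst -sE; have : s * (phi * s) <= s * 1 by rewrite ler_pM2l.
    rewrite expr2; lra.
  apply/esym/eqP; rewrite -subr_eq0; apply/eqP.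
  by apply: (psumr_eq0P (P := xpredT) (F := fun h => s ^+ 2 - k0 h ^+ 2)) => // x _; rewrite subr_ge0.
have sphi : phi * s = 1.
  have : s = phi * s ^+ 2 by rewrite {1}sE (eq_bigr (fun=> s ^+ 2)) ?sconst.
  by rewrite expr2 mulrA -{1}[s]mul1r => /(mulIf sn0) <-.
pose chi h := phi * k0 h.
have chi2 x : chi x * chi x = 1.
  by rewrite /chi mulrACA -!expr2 sqE -exprMn sphi expr1n.
(* The products [chi x * chi h * chi (x * h)] have absolute value 1, and by [k0P] their sum over [h]
   is the order of the group, so each of them equals 1. *)
have chiM x y : chi (x * y)%g = chi x * chi y.
  have S0 : \sum_h (1 - chi x * (chi h * chi (x * h)%g)) = 0.
    rewrite sumrB sconst -mulr_sumr mulr1.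
    have -> : \sum_h chi h * chi (x * h)%g = phi * chi x.
      rewrite /chi (k0P x) !mulr_sumr; apply: eq_bigr => h _; ring.
    by rewrite mulrCA chi2 mulr1 subrr.
  have n1 h : `|chi h| = 1.
    by apply/eqP; rewrite -(@eqrXn2 _ 2) // ?normr_ge0 // expr1n -normrX expr2 chi2 normr1.
  have h0 : chi x * (chi y * chi (x * y)%g) = 1.
    apply/esym/eqP; rewrite -subr_eq0; apply/eqP.
    apply: (psumr_eq0P (P := xpredT) (F := fun h => 1 - chi x * (chi h * chi (x * h)%g))) => // h _.
    have n3 : `|chi x * (chi h * chi (x * h)%g)| = 1 by rewrite normrM [`|chi h * _|]normrM !n1 !mulr1.
    by rewrite subr_ge0 -[X in _ <= X]n3 ler_norm.
  have : chi x * chi y * (chi x * (chi y * chi (x * y)%g)) = (chi x * chi x) * (chi y * chi y) * chi (x * y)%g by ring.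
  by rewrite h0 !chi2 !mul1r mulr1.
have chi0 : \sum_h chi h = 0 by rewrite -mulr_sumr k00 mulr0.
exfalso; apply: (real_char_nonvanish chiM chi2 chi0 (C := C * l1 chi)); first by rewrite mulr_ge0 ?l1_ge0.
move=> X; have := aP _ chi0 X.
have -> : \sum_h chi h * a h = 0.
  transitivity (phi * conv a k0 1%g); last by rewrite k0K mulr0.
  by rewrite /conv mulr_sumr; apply: eq_bigr => h _; rewrite mul1g mulrA.
by rewrite subr0.
Qed.

End ResidueFunctions.

(** * Prime powers and sums over progressions *)

Section PrimeSums.
Variable R : realType.

Lemma sum_modn F q n0 a b : (0 < q)%N -> (a <= b)%N ->
  \sum_(q * a + n0 <= n < q * b + n0 | (n == n0 %[mod q])%N) F n = \sum_(a <= z < b) F (q * z + n0)%N :> R.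
Proof.
move=> q0; elim: b => [|b IH]; first by rewrite leqn0 => /eqP ->; rewrite !big_geq.
rewrite leq_eqVlt => /predU1P[->|]; first by rewrite !big_geq.
rewrite ltnS => ab; rewrite (@big_cat_nat _ _ _ (q * b + n0)) /=; last 2 first.
- by rewrite leq_add2r leq_mul2l ab orbT.
- by rewrite leq_add2r leq_mul2l leqnSn orbT.
rewrite IH // big_nat_recr //=; congr (_ + _).
rewrite big_nat_cond (eq_bigl (fun n => (q * b + n0 <= n < q * b.+1 + n0)%N && (n == q * b + n0)%N)); last first.
  move=> n; case: (boolP (q * b + n0 <= n < q * b.+1 + n0)%N) => //= /andP[h1 h2].
  rewrite -(subnKC h1); set d := (n - _)%N.
  have dq : (d < q)%N by rewrite /d; move: h1 h2; rewrite mulnS; lia.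
  rewrite -addnA mulnC modnMDl -[X in (_ == X %[mod _])%N]addn0 eqn_modDl mod0n modn_small //.
  by rewrite addnA -[X in _ = (_ == X)]addn0 eqn_add2l.
rewrite -big_nat_cond big_nat1_eq leqnn /= ltn_add2r ltn_mul2l q0 ltnSn //.
Qed.

Lemma geom_tail (p n : nat) : (1 < p)%N -> \sum_(j < n) (p%:R ^- j.+2 : R) <= (p.-1%:R * p%:R)^-1.
Proof.
move=> p1; have p0 : 0 < p%:R :> R by rewrite ltr0n ltnW.
have pE : p.-1%:R = p%:R - 1 :> R by rewrite -[p in RHS](prednK (ltnW p1)) -natr1 addrK.
have pp : 0 < p.-1%:R :> R by rewrite ltr0n -ltnS prednK // ltnW.
have E : p.-1%:R * \sum_(j < n) (p%:R ^- j.+2 : R) = p%:R^-1 - p%:R ^- n.+1.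
  elim: n => [|n IH]; first by rewrite big_ord0 mulr0 expr1 subrr.
  rewrite big_ord_recr /= mulrDr IH pE !exprS; field.
  by rewrite !lt0r_neq0 // exprn_gt0.
rewrite invfM -(ler_pM2l pp) E mulrA mulfV ?mul1r ?lt0r_neq0 // gerBl.
by rewrite invr_ge0 exprn_ge0 // ltW.
Qed.

Lemma vM_nonprime n X : (n <= X)%N -> ~~ prime n ->
  vM R n <= \sum_(p < X) \sum_(j < X) (n == p.+1 ^ j.+2)%N%:R * ln p.+1%:R.
Proof.
move=> nX np; have t0 (p j : nat) : 0 <= (n == p.+1 ^ j.+2)%N%:R * ln p.+1%:R :> R.
  by rewrite mulr_ge0 // ln_ge0 // ler1n.
have [/hasP[p hp /eqP E]|/hasPn hn] := boolP (has (fun p => n == p ^ logn p n)%N (primes n)); last first.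
  rewrite /vM big1_seq; last by move=> p /andP[h1 h2]; case/negP: (hn p h2).
  by apply: sumr_ge0 => p _; apply: sumr_ge0.
move: hp; rewrite mem_primes => /and3P[pp n0 pn]; set j := logn p n in E.
have j1 : (1 < j)%N.
  rewrite ltnNge leq_eqVlt ltnS leqn0; apply/negP => /orP[/eqP j1|/eqP j0].
    by move: np; rewrite E j1 expn1 pp.
  by move: pn; rewrite E j0 dvdn1 => /eqP h; rewrite h in pp.
have [j' jE] : exists j', j = j'.+2 by exists j.-2; lia.
have [p' pE] : exists p', p = p'.+1 by exists p.-1; rewrite prednK // prime_gt0.
have p'X : (p' < X)%N by rewrite -pE; apply: leq_trans nX; apply: dvdn_leq.
have j'X : (j' < X)%N.
  apply: leq_trans nX; rewrite E jE; apply: ltn_trans (ltn_expl j'.+2 (prime_gt1 pp)); lia.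
rewrite {1}E vM_ppow //; last by lia.
rewrite (bigD1 (Ordinal p'X)) //= (bigD1 (Ordinal j'X)) //= -pE -jE -E eqxx mul1r -!addrA lerDl.
apply: addr_ge0; first by rewrite pE; apply: sumr_ge0.
by apply: sumr_ge0 => i _; apply: sumr_ge0.
Qed.

(** The bases of the proper powers are relaxed to all integers [p]; the geometric series in the
    exponent leaves [ln p / (p (p - 1))], which telescopes by [lnq_step]. The bound 2 is the initial
    value [(ln 1 + 2) / 1]. *)
Lemma vM_nonprime_sum X : \sum_(1 <= n < X.+1 | ~~ prime n) vM R n / n%:R <= 2.
Proof.
apply: le_trans (_ : \sum_(1 <= n < X.+1) \sum_(p < X) \sum_(j < X) (n == p.+1 ^ j.+2)%N%:R * ln p.+1%:R / n%:R <= _).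
  rewrite big_mkcond !big_nat; apply: ler_sum => n /andP[n0]; rewrite ltnS => nX.
  have t0 : 0 <= \sum_(p < X) \sum_(j < X) (n == p.+1 ^ j.+2)%N%:R * ln p.+1%:R / n%:R :> R.
    by apply: sumr_ge0 => p _; apply: sumr_ge0 => j _; rewrite !mulr_ge0 ?invr_ge0 // ln_ge0 // ler1n.
  case: ifP => // np; apply: le_trans (ler_wpM2r _ (vM_nonprime nX np)) _; first by rewrite invr_ge0.
  rewrite mulr_suml; apply: ler_sum => p _; by rewrite mulr_suml.
rewrite exchange_big /=.
apply: le_trans (_ : \sum_(p < X) ((ln p.+1%:R + 2) / p.+1%:R - (ln p.+2%:R + 2) / p.+2%:R) <= _); last first.
  apply: le_trans (_ : (ln 1%:R + 2) / 1%:R - (ln X.+1%:R + 2) / X.+1%:R <= _).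
    elim: X => [|X IH]; first by rewrite big_ord0 subrr.
    by rewrite big_ord_recr /=; apply: le_trans (lerD IH (lexx _)) _; rewrite addrA subrK.
  rewrite ln1 add0r divr1 gerBl divr_ge0 // addr_ge0 // ln_ge0 // ler1n //.
case: X => [|X]; first by rewrite !big_ord0.
rewrite big_ord_recl /= big1 ?add0r; last by move=> n _; rewrite big1 // => j _; rewrite ln1 mulr0 mul0r.
rewrite [leRHS]big_ord_recr /= -[leLHS]addr0; apply: lerD; last by rewrite subr_ge0 lnq_dec.
apply: ler_sum => p _; rewrite exchange_big /= /bump /= add1n.
apply: le_trans (lnq_step R (ltn0Sn p)).
apply: le_trans (_ : \sum_(j < X.+1) ln p.+2%:R * p.+2%:R ^- j.+2 <= _); last first.
  by rewrite -mulr_sumr ler_wpM2l ?ln_ge0 ?ler1n //; apply: geom_tail.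
apply: ler_sum => j _.
have -> : \sum_(1 <= n < X.+2) (n == p.+2 ^ j.+2)%N%:R * ln p.+2%:R / n%:R =
   \sum_(1 <= n < X.+2 | (n == p.+2 ^ j.+2)%N) ln p.+2%:R / n%:R :> R.
  by rewrite [RHS]big_mkcond; apply: eq_bigr => n _; case: eqP; rewrite ?mul1r ?mul0r.
rewrite big_nat1_eq natrX; case: ifP => // _; rewrite mulr_ge0 ?ln_ge0 ?ler1n //.
by rewrite invr_ge0 exprn_ge0.
Qed.

Lemma sum_inv_le_ln Y : (0 < Y)%N -> \sum_(1 <= m < Y.+1) m%:R^-1 <= 1 + ln Y%:R :> R.
Proof.
elim: Y => // -[|Y] IH _; first by rewrite big_nat1 invr1 ln1 addr0.
rewrite big_nat_recr //=; apply: le_trans (lerD (IH isT) (lexx _)) _; rewrite -addrA lerD2l.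
rewrite addrC -lerBrDr -[leLHS]opprK lerNl opprB.
have y1 : 0 < Y.+1%:R :> R by rewrite ltr0n.
have y2 : 0 < Y.+2%:R :> R by rewrite ltr0n.
rewrite -ln_div ?posrE //.
have -> : Y.+1%:R / Y.+2%:R = 1 + - Y.+2%:R^-1 :> R.
  apply: (mulIf (lt0r_neq0 y2)); rewrite divfK ?lt0r_neq0 // mulrBl mulVf ?lt0r_neq0 // mul1r.
  by rewrite -[Y.+2%:R in RHS]natr1 addrK.
apply: le_ln1Dx; rewrite ltrNl opprK invf_lt1 // ltr1n //.
Qed.

Lemma ln_le_harm n : (0 < n)%N -> ln n%:R <= harm R n.
Proof.
move=> n0; apply: le_trans (_ : ln n.+1%:R <= _); first by rewrite ler_ln ?posrE ?ltr0n // ler_nat.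
apply: le_trans (ln_le_sum_inv R n) _; rewrite /harm big_add1 /= big_mkord //.
Qed.

End PrimeSums.

(** * Primes in the class [n0] mod [q] *)

Section ArithmeticProgressions.
Variables (R : realType) (q : nat).
Hypothesis q1 : (1 < q)%N.

(** Non-units get the default value 1, which the coprimality test in [zunit_eq] filters out. *)
Definition zunit n : {unit 'Z_q} := insubd (1%g : {unit 'Z_q}) (n%:R : 'Z_q).

Lemma zunitE n : coprime q n -> val (zunit n) = n%:R.
Proof. by move=> h; rewrite /zunit val_insubd unitZpE // h. Qed.

Lemma zunit_eq n h : coprime q n && (zunit n == h) = (n == (val (val h)) %[mod q])%N.
Proof.
have hq : (val (val h) < q)%N by rewrite -[X in (_ < X)%N](Zp_cast q1) ltn_ord.
have E : (n == (val (val h)) %[mod q])%N = (n%:R == val h :> 'Z_q).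
  by rewrite -val_eqE /= val_Zp_nat // [in RHS]eq_sym eq_sym modn_small.
rewrite E; apply/andP/eqP => [[cn /eqP <-]|nh]; first by rewrite zunitE.
have cn : coprime q n by rewrite -unitZpE // nh; apply: (valP h).
by split=> //; apply/eqP; apply: val_inj; rewrite zunitE.
Qed.

Lemma window_mod r M : (r < q)%N -> (\sum_(M <= n < M + q) (n == r %[mod q]))%N = 1%N.
Proof.
move=> rq; have q0 : (0 < q)%N by apply: ltnW.
elim: M => [|M IH].
  rewrite add0n big_mkord (bigD1 (Ordinal rq)) //= eqxx big1 // => i.
  by rewrite -val_eqE /= !modn_small // => /negPf ->.
apply: etrans IH; symmetry; rewrite big_ltn; last by rewrite -[ltnLHS]addn0 ltn_add2l.
rewrite addSn big_nat_recr /=; first by rewrite modnDr [LHS]addnC.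
by rewrite -[ltnLHS]addn0 ltn_add2l.
Qed.

(** In passing from all [n] to those prime to [q], Mertens' sum loses at most 2 for the proper prime
    powers and [Kq] for the primes dividing [q]; another 2 restricts the final sum to primes. *)
Lemma prime_sum_lower n0 : coprime q n0 -> exists K : R, forall X, (0 < X)%N ->
  (totient q)%:R^-1 * ln X%:R - K <=
  \sum_(1 <= n < X.+1 | prime n && (n == n0 %[mod q])%N) ln n%:R / n%:R.
Proof.
move=> cn0.
have q0 : (0 < q)%N by apply: ltnW.
have cM m n : coprime q (m * n) = coprime q m && coprime q n by rewrite coprimeMr.
have uM m n : coprime q m -> coprime q n -> (zunit (m * n)%N = zunit m * zunit n)%g.
  move=> hm hn; apply: val_inj; rewrite zunitE ?cM ?hm // FinRing.val_unitM !zunitE // natrM //.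
have u1 : zunit 1 = 1%g by apply: val_inj; rewrite zunitE ?coprimen1.
have mulC (x y : {unit 'Z_q}) : (x * y = y * x)%g.
  by apply: val_inj; rewrite !FinRing.val_unitM mulrC.
have blocks h M : (\sum_(M <= n < M + q) (coprime q n && (zunit n == h)))%N = 1%N.
  have hq : (val (val h) < q)%N by rewrite -[X in (_ < X)%N](Zp_cast q1) ltn_ord.
  by rewrite -[RHS](window_mod M hq); apply: eq_bigr => n _; rewrite zunit_eq.
have [K hK] := prog_lower R mulC q0 cM uM (coprimen1 q) u1 blocks.
have cardG : #|[set: {unit 'Z_q}]| = totient q := card_units_Zp q0.
have t0 : 0 < (totient q)%:R :> R by rewrite ltr0n totient_gt0.
pose Kq : R := \sum_(1 <= n < q.+1) vM R n / n%:R.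
exists ((totient q)%:R^-1 * (3 + Kq) + K + 2) => X X0.
have v0 n : 0 <= vM R n / n%:R by rewrite divr_ge0 ?vM_ge0.
have hS := vM_nonprime_sum R X.
have lower : ln X%:R - 1 - 2 - Kq <= \sum_(1 <= n < X.+1) vM R n / n%:R * (coprime q n)%:R.
  have /andP[h _] := mertens R X0.
  have : \sum_(1 <= n < X.+1) vM R n / n%:R <= \sum_(1 <= n < X.+1) vM R n / n%:R * (coprime q n)%:R
     + \sum_(1 <= n < X.+1 | ~~ prime n) vM R n / n%:R + \sum_(1 <= n < X.+1) (if (n <= q)%N then vM R n / n%:R else 0).
    rewrite [X in _ + X + _]big_mkcond -!big_split /= !big_nat; apply: ler_sum => n /andP[n1 _].
    have := v0 n; case: (boolP (coprime q n)) => cn /=; first by case: ifP => _; case: ifP => _; lra.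
    case: (boolP (prime n)) => pn /=; last by case: ifP => _; lra.
    have -> : (n <= q)%N; last by lra.
    by apply: dvdn_leq => //; move: cn; rewrite coprime_sym prime_coprime // negbK.
  have : \sum_(1 <= n < X.+1) (if (n <= q)%N then vM R n / n%:R else 0) <= Kq.
    rewrite -big_mkcond /Kq.
    apply: le_trans (_ : \sum_(1 <= n < (maxn X q).+1 | (n <= q)%N) vM R n / n%:R <= _).
      rewrite (@big_cat_nat _ _ _ X.+1 1 (maxn X q).+1) //=; last by rewrite ltnS leq_maxl.
      by rewrite lerDl; apply: sumr_ge0.
    by rewrite [leRHS](big_nat_widen _ _ (maxn X q).+1) //= ltnS leq_maxr.
  lra.
have := hK (zunit n0) X X0; rewrite -[#|_|]cardsT cardG => h.
have upper : \sum_(1 <= n < X.+1) vM R n / n%:R * (coprime q n && (zunit n == zunit n0))%:R <=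
   \sum_(1 <= n < X.+1 | prime n && (n == n0 %[mod q])%N) ln n%:R / n%:R
   + \sum_(1 <= n < X.+1 | ~~ prime n) vM R n / n%:R.
  rewrite [X in _ <= X + _]big_mkcond [X in _ <= _ + X]big_mkcond -big_split /=.
  have E0 : val (val (zunit n0)) = (n0 %% q)%N by rewrite zunitE //= val_Zp_nat.
  apply: ler_sum => n _; rewrite zunit_eq E0 modn_mod.
  have := v0 n; case: (boolP (prime n)) => pn /=.
    by rewrite vM_prime // addr0; case: (n == n0 %[mod q])%N => /=; lra.
  by case: (n == n0 %[mod q])%N => /=; lra.
have : (totient q)%:R^-1 * (ln X%:R - 1 - 2 - Kq) <= (totient q)%:R^-1 * (\sum_(1 <= n < X.+1) vM R n / n%:R * (coprime q n)%:R).
  by rewrite ler_wpM2l // invr_ge0 ltW.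
set A := (totient q)%:R^-1 in h *; set B := ln X%:R.
have -> : A * (B - 1 - 2 - Kq) = A * B - A * (3 + Kq) by ring.
lra.
Qed.

(** If all large [T] failed, summation over [T] with weight [T ^- 2] would give every [z] a total
    weight of at least [1 / z] and leave at most half of the growth [ln X / totient q] that
    [prime_sum_lower] guarantees. The window [[5 T, 8 T)] is the part of [[4 T, 8 T)] that survives
    shifts by up to [T]. *)
Lemma prime_count_scales n0 N0 : coprime q n0 -> exists T, [/\ (N0 <= T)%N, (0 < T)%N &
  16^-1 * (q * (4 * T))%:R <= (totient q)%:R * harm R (4 * T) * (\sum_(5 * T <= z < 8 * T) prime (q * z + n0))%N%:R].
Proof.
move=> cn0; have q0 : (0 < q)%N by apply: ltnW.
have [K hK] := prime_sum_lower cn0.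
set ph : R := (totient q)%:R; have p0 : 0 < ph by rewrite ltr0n totient_gt0.
case: (pselect (exists T, [/\ (N0 <= T)%N, (0 < T)%N &
  16^-1 * (q * (4 * T))%:R <= ph * harm R (4 * T) * (\sum_(5 * T <= z < 8 * T) prime (q * z + n0))%N%:R])) => // nex.
exfalso.
pose T1 := (N0 + q + n0).+1.
pose b z : R := (prime (q * z + n0))%:R * ln (q * z + n0)%:R.
have qz0 z : (0 < z)%N -> (0 < q * z + n0)%N by move=> z0; rewrite addn_gt0 muln_gt0 q0 z0.
have b0 z : (0 < z)%N -> 0 <= b z by move=> z0; rewrite mulr_ge0 // ln_ge0 // ler1n qz0.
(* At a failing scale [ln (q z + n0) <= 2 ln (4 T)] yields the factor [2 * 16^-1 * 4 = 2^-1], below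
   the density 1 of the true count. *)
have few T : (T1 <= T)%N -> \sum_(5 * T <= z < 8 * T) b z <= 2^-1 * ph^-1 * (q * T)%:R.
  move=> hT; have T0 : (0 < T)%N by apply: leq_trans hT.
  have lt : ph * harm R (4 * T) * (\sum_(5 * T <= z < 8 * T) prime (q * z + n0))%N%:R < 16^-1 * (q * (4 * T))%:R.
    rewrite ltNge; apply/negP => h; apply: nex; exists T; split=> //; apply: leq_trans hT; rewrite /T1; lia.
  have h1 : \sum_(5 * T <= z < 8 * T) b z <= 2 * harm R (4 * T) * (\sum_(5 * T <= z < 8 * T) prime (q * z + n0))%N%:R.
    rewrite natr_sum mulr_sumr !big_nat; apply: ler_sum => z /andP[z1 z2].
    rewrite /b mulrC ler_wpM2r //.
    have zp : (0 < z)%N by lia.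
    apply: le_trans (_ : ln ((4 * T) ^ 2)%:R <= _).
      rewrite ler_ln ?posrE ?ltr0n ?qz0 // ?expn_gt0 ?muln_gt0 ?T0 // ler_nat -mulnn.
      have : (q * z <= T * (8 * T))%N by apply: leq_mul; [rewrite /T1 in hT; lia|apply: ltnW].
      have : (n0 <= T * T)%N.
        by apply: leq_trans (_ : T <= _)%N; [rewrite /T1 in hT; lia|rewrite leq_pmulr].
      move: (q * z)%N => A h2 h3; have -> : (4 * T * (4 * T) = 16 * (T * T))%N by ring.
      by move: h3; rewrite mulnCA; lia.
    by rewrite natrX lnXn ?ltr0n ?muln_gt0 ?T0 // -[_ *+ _]mulr_natl ler_wpM2l // ln_le_harm // muln_gt0 T0.
  apply: le_trans h1 _; rewrite -(ler_pM2l p0).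
  have -> : ph * (2^-1 / ph * (q * T)%:R) = 2 * (16^-1 * (q * (4 * T))%:R).
    rewrite mulnCA natrM; field; exact: lt0r_neq0.
  move: lt; set A := harm _ _; set B := _%:R; lra.
pose Z1 := (8 * T1 + 40)%N.
pose K' : R := \sum_(1 <= n < q * Z1 + n0) ln n%:R / n%:R.
have : 2^-1 <= 0 :> R; last by lra.
apply: (@lnX_bounded _ _ (ph * (K + K') + 2^-1)) => Y0 Y00.
pose Y := (Y0 + Z1)%N; have Yp : (0 < Y)%N by rewrite /Y; lia.
have Z1p : (0 < Z1)%N by rewrite /Z1; lia.
have ZY : (Z1 <= (5 * Y).+1)%N by rewrite /Y; lia.
have q0' : 0 < q%:R :> R by rewrite ltr0n.
have up : \sum_(T1 <= T < Y.+1) (T%:R ^- 2) * \sum_(5 * T <= z < 8 * T) b z <= 2^-1 / ph * q%:R * (1 + ln Y%:R).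
  apply: le_trans (_ : \sum_(T1 <= T < Y.+1) (2^-1 / ph * q%:R) * T%:R^-1 <= _).
    rewrite !big_nat; apply: ler_sum => T /andP[h1 h2].
    have T0 : 0 < T%:R :> R by rewrite ltr0n; apply: leq_trans h1.
    apply: le_trans (ler_wpM2l _ (few T h1)) _; first by rewrite invr_ge0 exprn_ge0 // ltW.
    rewrite natrM le_eqVlt; apply/orP; left; apply/eqP; field; by rewrite !lt0r_neq0.
  rewrite -mulr_sumr ler_wpM2l ?mulr_ge0 ?invr_ge0 ?(ltW p0) //; apply: le_trans (sum_inv_le_ln R Yp).
  have T1Y : (T1 <= Y.+1)%N by rewrite /Y /Z1; lia.
  by rewrite [leRHS](@big_cat_nat _ _ _ T1 1 Y.+1) //= lerDr; apply: sumr_ge0 => T _; rewrite invr_ge0.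
have exch : \sum_(T1 <= T < Y.+1) (T%:R ^- 2) * \sum_(5 * T <= z < 8 * T) b z =
   \sum_(1 <= z < (8 * Y).+1) b z * \sum_(T1 <= T < Y.+1) (if (5 * T <= z < 8 * T)%N then T%:R ^- 2 else 0).
  transitivity (\sum_(T1 <= T < Y.+1) \sum_(1 <= z < (8 * Y).+1) b z * (if (5 * T <= z < 8 * T)%N then T%:R ^- 2 else 0)).
    rewrite !big_nat; apply: eq_bigr => T /andP[h1 h2].
    have T0 : (0 < T)%N by apply: leq_trans h1.
    rewrite mulr_sumr (big_nat_widenl _ 1) /=; last by rewrite muln_gt0 T0.
    rewrite (big_nat_widen _ _ (8 * Y).+1) /=; last by apply: leqW; rewrite leq_mul2l /= -ltnS.
    rewrite big_mkcond; apply: eq_bigr => z _; case: ifP => h; last by rewrite mulr0.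
    by rewrite mulrC.
  by rewrite exchange_big /=; apply: eq_bigr => z _; rewrite mulr_sumr.
(* The [T] with [5 T <= z < 8 T] fill the interval from [z / 8] to [z / 5]: about [3 z / 40] of
   them, at least [z / 25] once [z >= Z1], each of weight at least [25 / z ^ 2]. *)
have inner z : (Z1 <= z <= 5 * Y)%N -> z%:R^-1 <= \sum_(T1 <= T < Y.+1) (if (5 * T <= z < 8 * T)%N then T%:R ^- 2 else 0) :> R.
  move=> /andP[z1 z2].
  have F0 T : 0 <= (if (5 * T <= z < 8 * T)%N then T%:R ^- 2 else 0 : R) by case: ifP => // _; rewrite invr_ge0 exprn_ge0.
  have z0 : (0 < z)%N by apply: leq_trans z1.
  have z0' : 0 < z%:R :> R by rewrite ltr0n.
  have a1 : (T1 <= (z %/ 8).+1)%N by rewrite /Z1 in z1; lia.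
  have a2 : ((z %/ 8).+1 <= (z %/ 5).+1)%N by lia.
  have a3 : ((z %/ 5).+1 <= Y.+1)%N by lia.
  rewrite (@big_cat_nat _ _ _ (z %/ 8).+1 T1 Y.+1) //=; last by apply: leq_trans a3.
  rewrite (@big_cat_nat _ _ _ (z %/ 5).+1 (z %/ 8).+1 Y.+1) //=.
  apply: le_trans (_ : \sum_((z %/ 8).+1 <= T < (z %/ 5).+1) 25 / z%:R ^+ 2 <= _).
    rewrite sumr_const_nat -[25 / _ *+ _]mulr_natr.
    have : z%:R <= (25 * ((z %/ 5).+1 - (z %/ 8).+1))%:R :> R by rewrite ler_nat; rewrite /Z1 in z1; lia.
    rewrite natrM => h.
    have -> : z%:R^-1 = z%:R / z%:R ^+ 2 :> R by field; rewrite lt0r_neq0.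
    by rewrite mulrAC ler_pM2r // invr_gt0 exprn_gt0.
  apply: le_trans (_ : \sum_((z %/ 8).+1 <= T < (z %/ 5).+1) (if (5 * T <= z < 8 * T)%N then T%:R ^- 2 else 0) <= _).
    rewrite !big_nat; apply: ler_sum => T /andP[h1 h2].
    have -> : (5 * T <= z < 8 * T)%N by apply/andP; split; lia.
    have T0 : 0 < T%:R :> R by rewrite ltr0n; lia.
    have : (5 * T)%:R <= z%:R :> R by rewrite ler_nat; lia.
    rewrite natrM => h5; rewrite -[25 / _]invrK lef_pV2 ?posrE ?invr_gt0 ?divr_gt0 ?exprn_gt0 //.
    rewrite invfM invrK ler_pdivlMl // ; apply: le_trans (_ : (5 * T%:R) ^+ 2 <= _).
      by rewrite exprMn; lra.
    by rewrite ler_sqr ?nnegrE ?mulr_ge0 // ltW.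
  by rewrite addrCA lerDl; apply: addr_ge0; apply: sumr_ge0.
have low : q%:R * \sum_(q * Z1 + n0 <= n < q * (5 * Y).+1 + n0 | prime n && (n == n0 %[mod q])%N) ln n%:R / n%:R
   <= \sum_(1 <= z < (8 * Y).+1) b z * \sum_(T1 <= T < Y.+1) (if (5 * T <= z < 8 * T)%N then T%:R ^- 2 else 0).
  have -> : \sum_(q * Z1 + n0 <= n < q * (5 * Y).+1 + n0 | prime n && (n == n0 %[mod q])%N) ln n%:R / n%:R =
     \sum_(Z1 <= z < (5 * Y).+1) b z / (q * z + n0)%:R.
    rewrite big_mkcondl sum_modn //; apply: eq_bigr => z _; rewrite /b; case: ifP; by rewrite ?mul1r ?mul0r.
  have t0 z : 0 <= \sum_(T1 <= T < Y.+1) (if (5 * T <= z < 8 * T)%N then T%:R ^- 2 else 0 : R).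
    by apply: sumr_ge0 => T _; case: ifP => // _; rewrite invr_ge0 exprn_ge0.
  have bb z : 0 <= b z.
    rewrite /b; case: (boolP (prime _)) => [pz|_]; last by rewrite mul0r.
    by rewrite mul1r ln_ge0 // ler1n prime_gt0.
  rewrite mulr_sumr (@big_cat_nat _ _ _ Z1 1 (8 * Y).+1) //=; last by lia.
  rewrite -[leLHS]add0r; apply: lerD; first by apply: sumr_ge0 => z _; rewrite mulr_ge0.
  rewrite (@big_cat_nat _ _ _ (5 * Y).+1 Z1 (8 * Y).+1) //=; last by lia.
  rewrite -[leLHS]addr0; apply: lerD; last by apply: sumr_ge0 => z _; rewrite mulr_ge0.
  rewrite !big_nat; apply: ler_sum => z /andP[z1 z2]; rewrite mulrCA ler_wpM2l //.
  apply: le_trans (inner z _); last by rewrite z1 -ltnS.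
  have z0 : (0 < z)%N by apply: leq_trans z1.
  by rewrite ler_pdivrMr ?ltr0n ?qz0 // mulrC ler_pdivlMr ?ltr0n // -natrM ler_nat leq_addr.
pose X := (q * (5 * Y).+1 + n0).-1.
have XE : X.+1 = (q * (5 * Y).+1 + n0)%N by rewrite /X prednK // addn_gt0 muln_gt0 q0.
have YX : (Y <= X)%N.
  by rewrite -ltnS XE; apply: leq_trans (leq_addr _ _); apply: leq_trans (leq_pmull _ q0); lia.
have X0 : (0 < X)%N by apply: leq_trans YX.
have := hK X X0; rewrite XE (@big_cat_nat _ _ _ (q * Z1 + n0)) /=; last 2 first.
- by rewrite addn_gt0 muln_gt0 q0 Z1p.
- by rewrite leq_add2r leq_mul2l ZY orbT.
have K'E : \sum_(1 <= n < q * Z1 + n0 | prime n && (n == n0 %[mod q])%N) ln n%:R / n%:R <= K'.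
  rewrite /K' big_mkcond !big_nat; apply: ler_sum => n /andP[n1 _]; case: ifP => // _.
  by rewrite divr_ge0 // ln_ge0 // ler1n.
move: low; rewrite -exch => low; have := le_trans low up.
set S := \sum_(_ <= _ < _ | _) _; set S1 := \sum_(_ <= _ < _ | _) _ in K'E * => h1 h2.
have h3 : S <= 2^-1 / ph * (1 + ln Y%:R).
  rewrite -(ler_pM2l q0'); apply: le_trans h1 _; rewrite le_eqVlt; apply/orP; left; apply/eqP; ring.
have lXY : ln Y%:R <= ln X%:R :> R by rewrite ler_ln ?posrE ?ltr0n // ler_nat.
have lY : ln Y0%:R <= ln Y%:R :> R by rewrite ler_ln ?posrE ?ltr0n // ler_nat /Y leq_addr.
have h4 : ph^-1 * ln X%:R <= K + K' + 2^-1 / ph * (1 + ln Y%:R) by lra.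
have : ph * (ph^-1 * ln X%:R) <= ph * (K + K' + 2^-1 / ph * (1 + ln Y%:R)) by rewrite ler_pM2l.
have -> : ph * (K + K' + 2^-1 / ph * (1 + ln Y%:R)) = ph * (K + K') + 2^-1 * (1 + ln Y%:R).
  by field; rewrite lt0r_neq0.
rewrite mulVKf ?lt0r_neq0 //; lra.
Qed.

End ArithmeticProgressions.

(** * Polynomial phases and box norms *)

Section MoreAverages.
Variable R : realFieldType.

Lemma Avg_sqr s (F : seq nat -> R) : Avg s F ^+ 2 <= Avg s (fun l => F l ^+ 2).
Proof.
elim: s F => //= n s IH F; apply: le_trans (sqr_avg _ _) _; apply: le_avg => x _; exact: IH.
Qed.

Lemma avgM n m (F G : nat -> R) : avg n F * avg m G = avg n (fun x => avg m (fun y => F x * G y)).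
Proof.
transitivity (avg n (fun x => avg m G * F x)); first by rewrite avgZ mulrC.
by apply: eq_avg => x _; rewrite mulrC -avgZ.
Qed.

End MoreAverages.

(** * Cosine phases and their differences *)

Section Phases.
Variable R : realType.

Definition tp : R := pi *+ 2.
(** Cosines with an arbitrary constant term in the phase stand in for complex exponentials: a shift
    by a quarter turns [co] into [si]. *)
Definition co (x : R) : R := cos (tp * x).
Definition si (x : R) : R := sin (tp * x).

Lemma tp_gt0 : 0 < tp. Proof. by rewrite mulrn_wgt0 // pi_gt0. Qed.

Lemma coB x y : co (x - y) = co x * co y + si x * si y.
Proof. by rewrite /co mulrBr cosB. Qed.

Lemma coD x y : co (x + y) = co x * co y - si x * si y.
Proof. by rewrite /co mulrDr cosD. Qed.

Lemma co0 : co 0 = 1. Proof. by rewrite /co mulr0 cos0. Qed.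
Lemma co_max x : `|co x| <= 1. Proof. exact: cos_max. Qed.
Lemma co2si2 x : co x ^+ 2 + si x ^+ 2 = 1. Proof. exact: cos2Dsin2. Qed.

Lemma co_addn x n : co (x + n%:R) = co x.
Proof. by rewrite /co mulrDr mulr_natr periodicn //; apply: cosD2pi. Qed.

Lemma co_addz x (a : int) : co (x + a%:~R) = co x.
Proof.
case: a => n; first by rewrite -pmulrn co_addn.
by rewrite NegzE mulrNz -[in RHS](subrK n.+1%:R x) co_addn.
Qed.

Lemma si_co x : si x = co (x - 4^-1).
Proof.
rewrite /si /co mulrBr -cosBpihalf; by congr (cos (_ - _)); rewrite /tp -mulr_natr; field.
Qed.

Lemma cos_lip (a b : R) : `|cos a - cos b| <= `|a - b|.
Proof.
wlog ab : a b / b <= a.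
  move=> H; case: (leP b a) => [|/ltW] h; first exact: H.
  by rewrite distrC [leRHS]distrC; apply: H.
have [|c _ ->] := @MVT_segment R cos (fun x => - sin x) b a ab (fun x _ => is_derive_cos x).
  by apply: continuous_subspaceT; apply: continuous_cos.
by rewrite normrM normrN ler_piMl // sin_max.
Qed.

Lemma co_lip x y : `|co x - co y| <= tp * `|x - y|.
Proof.
apply: le_trans (cos_lip _ _) _.
by rewrite -mulrBr normrM [`|tp|]gtr0_norm ?tp_gt0.
Qed.

(** For angles up to 1 the mean value theorem gives slope at least [cos 1]; between 1 and [pi / 2]
    monotonicity gives [sin 1 >= cos 1], which is enough as [x <= 1/2]. *)
Lemma sin_lower : exists2 c : R, 0 < c & forall x, 0 <= x <= 2^-1 -> c * x <= sin (pi * x).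
Proof.
have c1 : 0 < cos 1 :> R by apply: cos1_gt0.
have pi2 : 1 <= pi / 2 :> R by apply: pihalf_ge1.
have pi4 : pi / 2 < 2 :> R by apply: pihalf_lt2.
have small (y : R) : 0 <= y <= 1 -> cos 1 * y <= sin y.
  move=> /andP[y0 y1]; have [|c] := @MVT_segment R sin cos 0 y y0 (fun x _ => is_derive_sin x).
    by apply: continuous_subspaceT; apply: continuous_sin.
  rewrite in_itv /= => /andP[c0 cy]; rewrite sin0 !subr0 => ->; rewrite ler_wpM2r //.
  rewrite leNgt; apply/negP => h; have : c > 1; last by lra.
  by rewrite -ltr_cos // in_itv /=; apply/andP; split; lra.
exists (cos 1) => // x /andP[x0 x1]; set y := pi * x.
have y0 : 0 <= y by rewrite mulr_ge0 // pi_ge0.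
have y1 : y <= pi / 2 by rewrite /y ler_wpM2l // pi_ge0.
have xy : 2 * x <= y by rewrite /y ler_wpM2r // pi_ge2.
have cx : cos 1 * (2 * x) <= cos 1 * y by rewrite ler_pM2l.
have cx0 : 0 <= cos 1 * x by rewrite mulr_ge0 // ltW.
case: (leP y 1) => h; first by have := small y; rewrite y0 h => /(_ isT); lra.
have s1 : cos 1 * 1 <= sin 1 :> R by apply: small; rewrite ler01 lexx.
have : sin 1 < sin y by rewrite ltr_sin // in_itv /=; apply/andP; split; lra.
have : cos 1 * (2 * x) <= cos 1 * 1 by rewrite ler_pM2l //; lra.
lra.
Qed.

Lemma near_int (x : R) : exists a : int, `|x - a%:~R| <= 2^-1.
Proof.
exists (Num.floor (x + 2^-1)); have h1 := floor_le (x + 2^-1); have h2 := floorD1_gt (x + 2^-1).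
move: h2; rewrite intrD => h2; rewrite ler_norml; apply/andP; split; lra.
Qed.

Lemma si_addz x (a : int) : si (x + a%:~R) = si x.
Proof. by rewrite !si_co addrAC co_addz. Qed.

(** Multiplication by [2 sin (pi al)] makes the sum telescope. *)
Lemma geometric_phaseE (al be : R) H :
  2 * (\sum_(h < H) co (al * h%:R + be) * sin (pi * al)) =
  si (al * H%:R + be - al / 2) - si (be - al / 2).
Proof.
have pE : pi * al = tp * (al / 2) by rewrite /tp -mulr_natr; field.
elim: H => [|H IH]; first by rewrite big_ord0 mulr0 mulr0 add0r subrr.
rewrite big_ord_recr /= mulrDr IH pE.
have -> : al * H.+1%:R + be - al / 2 = al * H%:R + be + al / 2 by rewrite -natr1; field.
have hs u v : si (u - v) + 2 * (co u * sin (tp * v)) = si (u + v).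
  by rewrite /si /co mulrBr mulrDr sinB sinD; ring.
by rewrite -(hs (al * H%:R + be) (al / 2)); ring.
Qed.

Lemma geometric_phase (al be : R) H :
  `|\sum_(h < H) co (al * h%:R + be)| * `|sin (pi * al)| <= 1.
Proof.
rewrite -normrM mulr_suml -(ler_pM2l (ltr0n R 2)) -[2 in leLHS](@ger0_norm _ (2%:R)) // -normrM geometric_phaseE.
apply: le_trans (ler_normB _ _) _; rewrite mulr1.
by apply: le_trans (lerD (sin_max _) (sin_max _)) _.
Qed.

(* The [D]-th differences of [p] with increments [d_i] are [b * \prod d_i]; a polynomial of degree
   [D] with leading coefficient [al] has [b = D! * al]. *)
Fixpoint ldeg (D : nat) (b : R) (p : nat -> R) : Prop :=
  if D is D'.+1 then forall x x', ldeg D' (b * (x%:R - x'%:R)) (fun t => p (x + t)%N - p (x' + t)%N)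
  else forall t, p t = b.

Lemma ldeg_ext D b p p' : p =1 p' -> ldeg D b p -> ldeg D b p'.
Proof.
elim: D b p p' => [|D IH] b p p' pp' /=; first by move=> H t; rewrite -pp'.
by move=> H x x'; apply: IH (H x x') => t /=; rewrite !pp'.
Qed.

Lemma ldegD D b b' p p' : ldeg D b p -> ldeg D b' p' -> ldeg D (b + b') (fun t => p t + p' t).
Proof.
elim: D b b' p p' => [|D IH] b b' p p' /= H H'; first by move=> t; rewrite H H'.
move=> x x'; rewrite mulrDl; apply: ldeg_ext (IH _ _ _ _ (H x x') (H' x x')) => t /=; ring.
Qed.

Lemma ldegZ D b c p : ldeg D b p -> ldeg D (c * b) (fun t => c * p t).
Proof.
elim: D b p => [|D IH] b p /= H; first by move=> t; rewrite H.
move=> x x'; rewrite -mulrA; apply: ldeg_ext (IH _ _ (H x x')) => t /=; ring.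
Qed.

Lemma ldegS D b p : ldeg D b p -> ldeg D.+1 0 p.
Proof.
elim: D b p => [|D IH] b p H x x' /=; first by move=> t; rewrite !H subrr mul0r.
by rewrite mul0r; apply: IH (H x x').
Qed.

Lemma ldeg_sum D (I : Type) (r : seq I) (b : I -> R) (p : I -> nat -> R) :
  (forall i, ldeg D (b i) (p i)) -> ldeg D (\sum_(i <- r) b i) (fun t => \sum_(i <- r) p i t).
Proof.
move=> H; elim: r => [|i r IH].
  have z : ldeg D 0 (fun=> 0 : R).
    elim: D {H} => [|D IHD] /=; first by [].
    by move=> x x'; rewrite mul0r; apply: ldeg_ext IHD => t; rewrite subrr.
  by rewrite big_nil; apply: ldeg_ext z => t; rewrite big_nil.
rewrite big_cons; apply: ldeg_ext (ldegD (H i) IH) => t; by rewrite big_cons.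
Qed.

Lemma ldeg_shift D b p z : ldeg D b p -> ldeg D b (fun t => p (z + t)%N).
Proof.
elim: D b p => [|D IH] b p /= H; first by move=> t; rewrite H.
move=> x x'; have := H (z + x)%N (z + x')%N.
have -> : (z + x)%:R - (z + x')%:R = x%:R - x'%:R :> R by rewrite !natrD; ring.
by apply: ldeg_ext => t; rewrite !addnA.
Qed.

(** In the difference of two shifted powers the top terms cancel, the coefficient of [t ^ D] is
    [D.+1 * (x - x')], and the lower terms fall under the first half of the induction hypothesis. *)
Lemma ldeg_pow D : (forall j, (j < D)%N -> ldeg D 0 (fun t => t%:R ^+ j)) /\
  ldeg D D`!%:R (fun t => t%:R ^+ D).
Proof.
elim: D => [|D [IH1 IH2]]; first by split => // t.
have low j : (j < D.+1)%N -> ldeg D.+1 0 (fun t => t%:R ^+ j).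
  rewrite ltnS leq_eqVlt => /predU1P[->|jD]; first exact: ldegS IH2.
  exact: ldegS (IH1 _ jD).
split => // x x' /=.
pose F (i : 'I_D.+1) t : R := ((x%:R ^+ (D.+1 - i) - x'%:R ^+ (D.+1 - i)) *+ 'C(D.+1, i)) * t%:R ^+ i.
pose b (i : 'I_D.+1) : R := if i == ord_max then D.+1`!%:R * (x%:R - x'%:R) else 0.
have FE i : ldeg D (b i) (F i).
  rewrite /b; case: eqP => [->|/eqP iD].
    rewrite /F /= subSnn !expr1 binSn factS.
    have -> : (D.+1 * D`!)%:R * (x%:R - x'%:R) = ((x%:R - x'%:R) *+ D.+1) * D`!%:R :> R.
      by rewrite natrM -mulr_natr; ring.
    exact: ldegZ IH2.
  have iD' : (i < D)%N by move: (ltn_ord i); rewrite ltnS leq_eqVlt => /predU1P[h|//]; case/eqP: iD; apply: val_inj.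
  by have := ldegZ ((x%:R ^+ (D.+1 - i) - x'%:R ^+ (D.+1 - i)) *+ 'C(D.+1, i)) (IH1 _ iD'); rewrite mulr0.
have := ldeg_sum (index_enum 'I_D.+1) FE.
rewrite -big_mkcond big_pred1_eq; apply: ldeg_ext => t.
rewrite !natrD !exprDn ![\sum_(i < D.+2) _]big_ord_recr /= !subnn !expr0 !mul1r.
rewrite opprD addrACA subrr addr0 -sumrB; apply: eq_bigr => i _.
by rewrite /F mulrnAl -mulrnBl -mulrBl.
Qed.

Lemma ldeg_poly D (P : {poly R}) : (size P <= D.+1)%N -> ldeg D (D`!%:R * P`_D) (fun t => P.[t%:R]).
Proof.
move=> sP; have [h1 h2] := ldeg_pow D.
pose b (i : 'I_D.+1) : R := if i == ord_max then D`!%:R * P`_D else 0.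
have FE (i : 'I_D.+1) : ldeg D (b i) (fun t => P`_i * t%:R ^+ i).
  rewrite /b; case: eqP => [->|/eqP iD] /=; first by rewrite mulrC; apply: ldegZ.
  have iD' : (i < D)%N by move: (ltn_ord i); rewrite ltnS leq_eqVlt => /predU1P[h|//]; case/eqP: iD; apply: val_inj.
  by have := ldegZ P`_i (h1 _ iD'); rewrite mulr0.
have := ldeg_sum (index_enum 'I_D.+1) FE.
rewrite -big_mkcond big_pred1_eq; apply: ldeg_ext => t.
by rewrite (horner_coef_wide _ sP).
Qed.

(** Adding the squared sine average completes the squared cosine average to the square of a complex
    modulus, and its expansion contains only cosines of phase differences. *)
Lemma vdc s H (f : nat -> R) (p : nat -> R) :
  Avg (H :: s) (fun l => f (sumn l) * co (p (sumn l))) ^+ 2 <=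
  avg H (fun x => avg H (fun x' => Avg s (fun l =>
    f (x + sumn l)%N * f (x' + sumn l)%N * co (p (x + sumn l)%N - p (x' + sumn l)%N)))).
Proof.
rewrite /= avg_Avg; apply: le_trans (Avg_sqr _ _) _.
rewrite [leRHS](_ : _ = Avg s (fun l => avg H (fun x => f (x + sumn l)%N * co (p (x + sumn l)%N)) ^+ 2
   + avg H (fun x => f (x + sumn l)%N * si (p (x + sumn l)%N)) ^+ 2)).
  by apply: le_Avg => l _; rewrite lerDl sqr_ge0.
under eq_avg do rewrite avg_Avg.
rewrite avg_Avg; apply: eq_Avg => l _; rewrite !expr2 !avgM -avgD; apply: eq_avg => x _.
by rewrite -avgD; apply: eq_avg => y _; rewrite coB; ring.
Qed.

(* The [2 ^ k]-th power of a Gowers box norm, see [UnormE]. *)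
Fixpoint Unorm (k H : nat) (f : nat -> R) : R :=
  if k is k'.+1 then avg H (fun x => avg H (fun x' => Unorm k' H (fun t => f (x + t)%N * f (x' + t)%N)))
  else f 0%N.

Lemma prod_tuple_cons k (G : k.+1.-tuple bool -> R) :
  \prod_(w : k.+1.-tuple bool) G w =
  \prod_(w : k.-tuple bool) (G [tuple of false :: w] * G [tuple of true :: w]).
Proof.
rewrite (bigID (fun w : k.+1.-tuple bool => thead w)) /= mulrC big_split /=; congr (_ * _).
- rewrite (reindex_onto (fun w : k.-tuple bool => [tuple of false :: w]) (fun w => [tuple of behead w])) /=; last first.
    by move=> w; case/tupleP: w => b w; rewrite theadE => /negPf ->; apply: val_inj.
  by apply: eq_bigl => w; apply/eqP/val_inj.
- rewrite (reindex_onto (fun w : k.-tuple bool => [tuple of true :: w]) (fun w => [tuple of behead w])) /=; last first.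
    by move=> w; case/tupleP: w => b w; rewrite theadE => ->; apply: val_inj.
  by apply: eq_bigl => w; apply/eqP/val_inj.
Qed.

Lemma UnormE k H f : Unorm k H f = Avg (nseq k.*2 H) (fun l => \prod_(w : k.-tuple bool) f (csum w l)).
Proof.
elim: k f => [|k IH] f /=.
  rewrite (eq_bigr (fun=> f 0%N)); last by move=> w _; rewrite tuple0.
  by rewrite prodr_const card_tuple expn0 expr1.
apply: eq_avg => x _; apply: eq_avg => y _; rewrite IH; apply: eq_Avg => l _.
by rewrite prod_tuple_cons.
Qed.

(** Each use of [vdc] lowers the degree of the phase by one and doubles the number of factors [f].
    As the [k.+1]-st differences vanish, the phase is constant at the end and drops out. *)
Lemma box_bound k H f p : (0 < H)%N -> ldeg k.+1 0 p ->
  `|Avg (nseq k.+1 H) (fun l => f (sumn l) * co (p (sumn l)))| ^+ (2 ^ k.+1) <= Unorm k.+1 H f.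
Proof.
move=> H0; elim: k f p => [|k IH] f p dp.
  have pc t : p t = p 0%N.
    by have := dp t 0%N 0%N; rewrite addn0 mul0r => /eqP; rewrite subr_eq0 => /eqP.
  rewrite expn1 real_normK ?num_real //= (@eq_avg _ _ _ (fun x => co (p 0%N) * f x)); last first.
    by move=> x _; rewrite addn0 pc mulrC.
  rewrite avgZ exprMn; apply: le_trans (_ : 1 * avg H f ^+ 2 <= _).
    by rewrite ler_wpM2r ?sqr_ge0 // -(co2si2 (p 0%N)) lerDl sqr_ge0.
  rewrite mul1r expr2 avgM le_eqVlt; apply/orP; left; apply/eqP.
  by apply: eq_avg => x _; apply: eq_avg => y _; rewrite !addn0.
rewrite expnS exprM real_normK ?num_real //.
pose g x x' := Avg (nseq k.+1 H) (fun l =>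
    f (x + sumn l)%N * f (x' + sumn l)%N * co (p (x + sumn l)%N - p (x' + sumn l)%N)).
have v := vdc (nseq k.+1 H) H f p.
apply: le_trans (_ : avg H (fun x => avg H (fun x' => `|g x x'|)) ^+ (2 ^ k.+1) <= _).
  rewrite lerXn2r ?nnegrE ?sqr_ge0 //.
    by apply: avg_ge0 => x _; apply: avg_ge0.
  by apply: le_trans v _; apply: le_avg => x _; apply: le_avg => x' _; apply: ler_norm.
apply: le_trans (expn2_avg _ _) _; first by move=> x _; apply: avg_ge0.
apply: le_avg => x _; apply: le_trans (expn2_avg _ _) _ => //.
apply: le_avg => x' _; apply: (IH (fun t => f (x + t)%N * f (x' + t)%N) (fun t => p (x + t)%N - p (x' + t)%N)).
by have := dp x x'; rewrite mul0r.
Qed.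

End Phases.

(** * Weyl's inequality *)

Section Pigeonhole.

Lemma pigeon_fiber (T : finType) (S : {set T}) n (c : T -> 'I_n) : (0 < n)%N ->
  exists r, (#|S| <= n * #|[set x in S | c x == r]|)%N.
Proof.
move=> n0; case: (boolP [exists r, (#|S| <= n * #|[set x in S | c x == r]|)%N]) => [/existsP//|].
rewrite negb_exists => /forallP H; exfalso.
have E : #|S| = (\sum_(r < n) #|[set x in S | c x == r]|)%N.
  rewrite -sum1_card (partition_big c xpredT) //=; apply: eq_bigr => r _.
  by rewrite -sum1_card; apply: eq_bigl => x; rewrite inE.
have : (\sum_(r < n) n * #|[set x in S | c x == r]| < \sum_(r < n) #|S|)%N.
  have h r : (n * #|[set x in S | c x == r]| < #|S|)%N by rewrite ltnNge H.
  rewrite (bigD1 (Ordinal n0)) //= [ltnRHS](bigD1 (Ordinal n0)) //= -addSn.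
  by apply: leq_add => //; apply: leq_sum => i _; apply: ltnW.
by rewrite -big_distrr /= -E sum_nat_const card_ord ltnn.
Qed.

Lemma card_diameter (T : finType) (S : {set T}) (g : T -> nat) : {in S &, injective g} -> (0 < #|S|)%N ->
  exists x y, [/\ x \in S, y \in S, (g x <= g y)%N & (#|S| <= (g y - g x).+1)%N].
Proof.
move=> inj /card_gt0P[x0 Sx0].
case: (arg_minnP g Sx0) => x Sx xmin; case: (arg_maxnP g Sx0) => y Sy ymax.
exists x, y; split=> //; first exact: xmin.
rewrite -(@card_in_imset _ _ (fun z => inord (g z - g x) : 'I_(g y - g x).+1)).
  by rewrite -[leqRHS]card_ord; apply: max_card.
move=> z z' Sz Sz' /(congr1 val) /=; have h w : w \in S -> (g w - g x < (g y - g x).+1)%N.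
  by move=> Sw; rewrite ltnS leq_sub2r //; apply: ymax.
rewrite !inordK ?h // => E; apply: inj => //.
by rewrite -(subnK (xmin _ Sz)) -(subnK (xmin _ Sz')) E.
Qed.

End Pigeonhole.

Section Weyl.
Variable R : realType.

Lemma int_gtN1 (z : int) : (-1)%:~R < z%:~R :> R -> 0 <= z.
Proof. by rewrite ltr_int; lia. Qed.

Lemma int_lt1 (z : int) : z%:~R < 1%:~R :> R -> z <= 0.
Proof. by rewrite ltr_int; lia. Qed.

(** Two close elements of [S] give [q] with [q ga] within [2 kap] of an integer. To gain the factor
    [1 / H], restrict to one class mod [q] and one value of the nearest integer: there the phase is
    linear with slope [de] per step of length [q] but varies by at most [2 kap], over many steps
    because the restriction keeps a large part of [S]. *)
Lemma diophantine (eta : R) : 0 < eta <= 1 -> exists2 C : nat, (0 < C)%N &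
  forall H (kap ga be : R) (S : {set 'I_H}), (C <= H)%N -> 0 <= kap -> kap * C%:R <= 1 ->
  (forall h, h \in S -> exists a : int, `|be + ga * h%:R - a%:~R| <= kap) ->
  eta * H%:R <= #|S|%:R ->
  exists (q : nat) (a : int), (0 < q <= C)%N /\ `|q%:R * ga - a%:~R| <= C%:R * kap / H%:R.
Proof.
move=> /andP[e0 e1]; have he : 0 <= 2 / eta by rewrite divr_ge0 // ltW.
pose b := (Num.bound (2 / eta)).+1.
have hb : 2 <= eta * b%:R.
  rewrite mulrC -ler_pdivrMr //; apply: le_trans (ltW (archi_boundP he)) _; by rewrite ler_nat.
have b2 : (2 <= b)%N.
  rewrite -(ler_nat R); apply: le_trans hb _; by rewrite ler_piMl.
exists (8 * b * b)%N; first by rewrite !muln_gt0 /= (ltnW b2).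
move=> H kap ga be S CH k0 kC near SH.
have b0 : (0 < b)%N by apply: ltnW.
have b0' : 0 < b%:R :> R by rewrite ltr0n.
have H0 : (0 < H)%N by apply: leq_trans CH; rewrite !muln_gt0 b0.
have H0' : 0 < H%:R :> R by rewrite ltr0n.
have HC : 8 * b%:R * b%:R <= H%:R :> R by rewrite -!natrM ler_nat.
have eH : 16 * b%:R <= eta * H%:R.
  apply: le_trans (_ : eta * (8 * b%:R * b%:R) <= _); last by rewrite ler_pM2l.
  have : 2 * (8 * b%:R) <= (eta * b%:R) * (8 * b%:R) by rewrite ler_wpM2r // mulr_ge0 // ltW.
  lra.
have kb : 4 * kap <= eta / 4.
  have h1 : kap * (8 * b%:R * b%:R) <= 1 by move: kC; rewrite !natrM.
  have h2 : 2 * b%:R <= eta * b%:R * b%:R by rewrite ler_wpM2r // ltW.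
  have b2' : 2 <= b%:R :> R by rewrite ler_nat.
  have h3 : (4 * kap) * (2 * b%:R * b%:R) <= 1 by lra.
  have h4 : 1 <= eta / 4 * (2 * b%:R * b%:R) by lra.
  have bb : 0 < 2 * b%:R * b%:R :> R by rewrite !mulr_gt0.
  by rewrite -(ler_pM2r bb); lra.
have [j hj] : exists j : 'I_H -> int, forall h, h \in S -> `|be + ga * h%:R - (j h)%:~R| <= kap.
  have H1 h : exists a : int, h \in S -> `|be + ga * h%:R - a%:~R| <= kap.
    by case: (boolP (h \in S)) => [/near[a ha]|_]; [exists a|exists 0].
  by have [j hj] := choice H1; exists j.
(* Cut [[0, H)] into intervals of length [b], about [2 / eta]: [S] has more elements than there are
   intervals, so two share one, and [q] is their difference. *)
have [q [a [q0 qb hq]]] : exists (q : nat) (a : int), [/\ (0 < q)%N, (q <= b)%N & `|q%:R * ga - a%:~R| <= 2 * kap].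
  pose f (h : 'I_H) : 'I_(H %/ b).+1 := inord (h %/ b).
  have fE h : f h = (h %/ b)%N :> nat by rewrite inordK // ltnS leq_div2r // ltnW.
  case: (boolP (dinjectiveb f S)) => [/dinjectiveP inj|/dinjectivePn[x Sx [y]]].
    have : (#|S| <= (H %/ b).+1)%N.
      by rewrite -(card_in_imset inj) -[leqRHS]card_ord max_card.
    rewrite -(ler_nat R) -natr1 => hS; have hd : (H %/ b)%:R * b%:R <= H%:R :> R by rewrite -natrM ler_nat leq_divM.
    have : 2 * (H %/ b)%:R <= eta * H%:R.
      apply: le_trans (_ : eta * b%:R * (H %/ b)%:R <= _); first by rewrite ler_wpM2r.
      by rewrite -mulrA ler_pM2l // mulrC.
    have b2' : 2 <= b%:R :> R by rewrite ler_nat.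
    lra.
  rewrite !inE => /andP[yx Sy] /(congr1 val) /=; rewrite !fE => E.
  have D (u v : 'I_H) : u \in S -> v \in S -> (u < v)%N -> (u %/ b = v %/ b)%N ->
    exists (q : nat) (a : int), [/\ (0 < q)%N, (q <= b)%N & `|q%:R * ga - a%:~R| <= 2 * kap].
    move=> Su Sv uv Euv; exists (v - u)%N, (j v - j u); split; first by rewrite subn_gt0.
      have h1 : (v <= u %/ b * b + b)%N by rewrite {1}(divn_eq v b) -Euv leq_add2l ltnW // ltn_pmod.
      by rewrite leq_subLR; apply: leq_trans h1 _; rewrite leq_add2r leq_divM.
    rewrite natrB ?(ltnW uv) // intrD intrN; have := hj _ Su; have := hj _ Sv.
    rewrite !ler_norml => /andP[v1 v2] /andP[u1 u2]; apply/andP; split; lra.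
  case: (ltngtP x y) => xy; [exact: (D x y)|exact: (D y x)|].
  by case/eqP: yx; apply: val_inj.
have qR : 0 < q%:R :> R by rewrite ltr0n.
have qbR : q%:R <= b%:R :> R by rewrite ler_nat.
set de := q%:R * ga - a%:~R in hq.
exists q, a; split.
  by rewrite q0 /=; apply: leq_trans qb _; rewrite -[leqLHS]mul1n leq_mul2r muln_gt0 b0 orbT.
rewrite -/de; have [d0|dn0] := eqVneq de 0.
  by rewrite d0 normr0 !mulr_ge0 ?invr_ge0.
have dp : 0 < `|de| by rewrite normr_gt0.
have [r hr] := pigeon_fiber S (fun h : 'I_H => Ordinal (ltn_pmod h q0)) q0.
set T := [set x in S | _] in hr.
have TS h : h \in T -> h \in S /\ (h %% q = r)%N.
  by rewrite inE => /andP[Sh /eqP <-].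
have T0 : (0 < #|T|)%N.
  have : 0 < #|S|%:R :> R by apply: lt_le_trans SH; rewrite mulr_gt0.
  rewrite ltr0n => s0; have := leq_trans s0 hr; by rewrite muln_gt0 => /andP[].
pose t (h : 'I_H) := (h %/ q)%N.
have [h0x [h1x [Th0 _ _ _]]] : exists x y, [/\ x \in T, y \in T, (t x <= t y)%N & (#|T| <= (t y - t x).+1)%N].
  apply: card_diameter => // x y Tx Ty; have [_ hx] := TS _ Tx; have [_ hy] := TS _ Ty.
  by rewrite /t => E; apply: ord_inj; rewrite (divn_eq x q) (divn_eq y q) E hx hy.
case: (arg_minnP t Th0) => h0 {}Th0 hmin.
pose J h := j h - (t h)%:Z * a.
have Jd h h' : h \in T -> h' \in T -> `|(J h - J h')%:~R - ((t h)%:R - (t h')%:R) * de| <= 2 * kap.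
  move=> /TS[Sh hh] /TS[Sh' hh'].
  have E x : (x %% q = r)%N -> x%:R = (x %/ q)%:R * q%:R + r%:R :> R.
    by move=> xr; rewrite {1}(divn_eq x q) xr natrD natrM.
  have := hj _ Sh; have := hj _ Sh'; rewrite (E _ hh) (E _ hh') /J /de /t.
  rewrite !(intrD, intrN, intrM) -!pmulrn !ler_norml => /andP[u1 u2] /andP[v1 v2].
  apply/andP; split; lra.
have k14 : 4 * kap <= 1 / 4 by move: kb e1; clear; lra.
have tH h : (t h)%:R <= H%:R / q%:R :> R.
  by rewrite ler_pdivlMr // -natrM ler_nat; apply: leq_trans (leq_divM _ _) _; apply: ltnW.
(* Over the whole class the phase travels at most [|de| * H / q], so the nearest integer, corrected
   by [t h * a], takes fewer than this many distances from its value at [h0]. *)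
pose I := (Num.truncn (`|de| * (H%:R / q%:R) + 1)).+1.
have I0 : 0 <= `|de| * (H%:R / q%:R) + 1 by rewrite addr_ge0 // mulr_ge0 // divr_ge0.
have IE : I%:R <= `|de| * (H%:R / q%:R) + 2.
  by rewrite /I -natr1; have := truncn_le (`|de| * (H%:R / q%:R) + 1); rewrite I0; lra.
have tpos h : h \in T -> 0 <= (t h)%:R - (t h0)%:R :> R by move=> Th; rewrite subr_ge0 ler_nat hmin.
have Jsmall h : h \in T -> (`|J h - J h0|%N < I)%N.
  move=> Th; rewrite /I ltnS.
  have h1 := Jd _ _ Th Th0; have h2 := tpos _ Th; have h3 := tH h.
  have h4 : ((t h)%:R - (t h0)%:R) * `|de| <= H%:R / q%:R * `|de|.
    by rewrite ler_wpM2r //; apply: le_trans h3; rewrite gerBl.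
  have h5 := ler_normD ((J h - J h0)%:~R - ((t h)%:R - (t h0)%:R) * de) (((t h)%:R - (t h0)%:R) * de).
  rewrite subrK [X in _ <= _ + X]normrM [`|_%:R - _|]ger0_norm // in h5.
  have h6 : `|(J h - J h0)%:~R : R| <= `|de| * (H%:R / q%:R) + 1 by move: h1 h4 h5 k14 k0; clear; lra.
  have /andP[_ hI] := truncn_itv I0.
  rewrite -ltnS -(ltr_nat R); apply: le_lt_trans hI; apply: le_trans h6.
  by rewrite -intr_norm -abszE -pmulrn.
pose c (h : 'I_H) : 'I_I := inord `|J h - J h0|%N.
have [i hi] := pigeon_fiber T c (ltn0Sn _ : (0 < I)%N).
set U := [set x in T | _] in hi.
have UT h : h \in U -> h \in T by rewrite inE => /andP[].
(* Equal distances mean equal integers: as [t h0] is minimal, the differences [J x - J h0] all have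
   the sign of [de]. *)
have UJ h h' : h \in U -> h' \in U -> J h = J h'.
  move=> Uh Uh'; have Th := UT _ Uh; have Th' := UT _ Uh'.
  have ch : c h = i by move: Uh; rewrite inE => /andP[_ /eqP].
  have ch' : c h' = i by move: Uh'; rewrite inE => /andP[_ /eqP].
  have E : `|J h - J h0|%N = `|J h' - J h0|%N.
    by have := congr1 val (etrans ch (esym ch')); rewrite /c /= !inordK ?Jsmall.
  have sgn x : x \in T -> if 0 < de then 0 <= J x - J h0 else J x - J h0 <= 0.
    move=> Tx; have := Jd _ _ Tx Th0; have := tpos _ Tx; set dt := _ - _ => dt0.
    rewrite ler_norml => /andP[l1 l2]; case: ifP => sde.
      have : 0 <= dt * de by rewrite mulr_ge0 // ltW.
      have := @int_gtN1 (J x - J h0).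
      by move=> Z nn; apply: Z; move: l1 nn k14 k0; clear; rewrite intrN; lra.
    have : dt * de <= 0 by rewrite mulr_ge0_le0 // leNgt sde.
    have := @int_lt1 (J x - J h0).
    by move=> Z nn; apply: Z; move: l2 nn k14 k0; clear; lra.
  by move: (sgn _ Th) (sgn _ Th') E; clear; case: ifP => _; lia.
have U0 : (0 < #|U|)%N by have := leq_trans T0 hi; rewrite muln_gt0 => /andP[].
have [x [y [Ux Uy txy hU]]] : exists x y, [/\ x \in U, y \in U, (t x <= t y)%N & (#|U| <= (t y - t x).+1)%N].
  apply: card_diameter => // x y Ux Uy; have [_ hx] := TS _ (UT _ Ux); have [_ hy] := TS _ (UT _ Uy).
  by rewrite /t => E; apply: ord_inj; rewrite (divn_eq x q) (divn_eq y q) E hx hy.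
have hU2 : #|U|%:R * `|de| <= 2 * kap + `|de|.
  have := Jd _ _ (UT _ Uy) (UT _ Ux); rewrite (UJ _ _ Uy Ux) subrr sub0r normrN normrM.
  rewrite -natrB // ger0_norm // => h1.
  apply: le_trans (_ : (t y - t x).+1%:R * `|de| <= _); first by rewrite ler_wpM2r // ler_nat.
  by rewrite -natr1 mulrDl mul1r lerD2r.
have SU : eta * H%:R <= q%:R * (I%:R * #|U|%:R).
  apply: le_trans SH _; rewrite -!natrM ler_nat; apply: leq_trans hr _; by rewrite leq_mul2l hi orbT.
(* Combines the lower bound [SU] for the size of [U] with the upper bound [hU2]; with [IE] for [I],
   what remains is an inequality for [de] alone. *)
have big : eta * H%:R * `|de| <= (`|de| * H%:R + 2 * q%:R) * (2 * kap + `|de|).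
  apply: le_trans (_ : q%:R * (I%:R * #|U|%:R) * `|de| <= _); first by rewrite ler_wpM2r.
  apply: le_trans (_ : q%:R * I%:R * (2 * kap + `|de|) <= _).
    by rewrite mulrA -[X in X <= _]mulrA ler_wpM2l // mulr_ge0.
  rewrite ler_wpM2r ?addr_ge0 ?mulr_ge0 //.
  apply: le_trans (_ : q%:R * (`|de| * (H%:R / q%:R) + 2) <= _); first by rewrite ler_wpM2l.
  rewrite le_eqVlt; apply/orP; left; apply/eqP; field; by rewrite lt0r_neq0.
set d := `|de| in dp hq big *; set h := H%:R in H0' eH big *; set Q := q%:R in qR qbR big.
have dh : 0 < d * h by rewrite mulr_gt0.
have e3 : d * h * (4 * kap) <= d * h * (eta / 4) by rewrite ler_pM2l.
have e4 : d * h * d <= d * h * (2 * kap) by rewrite ler_pM2l.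
have e5 : d * Q <= d * b%:R by rewrite ler_pM2l.
have e6 : kap * Q <= kap * b%:R by rewrite ler_wpM2l.
have e7 : d * (16 * b%:R) <= d * (eta * h) by rewrite ler_pM2l.
have bk : 0 <= b%:R * kap by rewrite mulr_ge0.
have e8 : eta * h * d <= 8 * b%:R * kap by move: big e3 e4 e5 e6 e7 bk; clear; lra.
have e9 : (2 * d * h) <= 8 * b%:R * b%:R * kap.
  apply: le_trans (_ : eta * b%:R * (d * h) <= _); first by rewrite -mulrA ler_pM2r.
  have : b%:R * (eta * h * d) <= b%:R * (8 * b%:R * kap) by rewrite ler_pM2l.
  by clear; lra.
rewrite ler_pdivlMr // !natrM; move: e9 dh; clear; lra.
Qed.

Lemma avg_exists n c (F : nat -> R) : (0 < n)%N -> c <= avg n F -> exists2 i, (i < n)%N & c <= F i.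
Proof.
move=> n0 h; case: (boolP [exists i : 'I_n, c <= F i]) => [/existsP[i hi]|]; first by exists i.
rewrite negb_exists => /forallP H; exfalso.
have Hlt (i : 'I_n) : F i < c by rewrite ltNge H.
have : avg n F < c; last by rewrite ltNge h.
rewrite /avg ltr_pdivrMr ?ltr0n // mulr_natr.
have -> : c *+ n = \sum_(i < n) c by rewrite sumr_const card_ord.
rewrite (bigD1 (Ordinal n0)) //= [ltRHS](bigD1 (Ordinal n0)) //=; apply: ltr_leD; first exact: (Hlt (Ordinal n0)).
by apply: ler_sum => i _; apply: ltW.
Qed.

Lemma avg_many n c (F : nat -> R) : (0 < n)%N -> 0 <= c -> 2 * c <= avg n F -> (forall i, (i < n)%N -> F i <= 1) ->
  c * n%:R <= #|[set i : 'I_n | c <= F i]|%:R.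
Proof.
move=> n0 c0 h F1; have n0' : 0 < n%:R :> R by rewrite ltr0n.
have : avg n F * n%:R <= #|[set i : 'I_n | c <= F i]|%:R + c * n%:R; last first.
  have : 2 * c * n%:R <= avg n F * n%:R by rewrite ler_pM2r.
  by clear; lra.
have -> : #|[set i : 'I_n | c <= F i]|%:R = \sum_(i < n) (if c <= F i then 1 else 0) :> R.
  by rewrite -sum1_card natr_sum big_mkcond; apply: eq_bigr => i _; rewrite inE.
rewrite /avg divfK ?lt0r_neq0 //.
have -> : c * n%:R = \sum_(i < n) c by rewrite sumr_const card_ord mulr_natr.
rewrite -big_split /=; apply: ler_sum => i _; case: (leP c (F i)) => h2.
  by rewrite (le_trans (F1 _ (ltn_ord i))) // lerDl.
by rewrite add0r ltW.
Qed.

(** Degree 1 is a geometric sum. In the induction [vdc] yields some [x'] and a positive proportion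
    of [x] for which the differenced phase is large, hence [q b (x - x')] is near an integer for
    some [q <= Q'] depending on [x]. Multiplication by [Q'!] makes the denominator uniform, and
    [diophantine] removes the factor [x - x']. *)
Lemma weyl D (eps : R) : 0 < eps -> exists2 Q : nat, (0 < Q)%N &
  forall H p b, (Q <= H)%N -> ldeg D.+1 b p ->
  eps <= `|Avg (nseq D.+1 H) (fun l => co (p (sumn l)))| ->
  exists (q : nat) (a : int), (0 < q <= Q)%N /\ `|q%:R * b - a%:~R| <= Q%:R / H%:R ^+ D.+1.
Proof.
elim: D eps => [|D IH] eps eps0.
  have [c c0 hc] := sin_lower R.
  have x0 : 0 <= (c * eps)^-1 by rewrite invr_ge0 mulr_ge0 // ltW.
  exists (Num.bound (c * eps)^-1).+1 => // H p b QH dp hA.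
  have H0 : (0 < H)%N by apply: leq_trans QH.
  have H0' : 0 < H%:R :> R by rewrite ltr0n.
  have [a ha] := near_int b; exists 1%N, a; split=> //; rewrite mul1r expr1.
  have pE t : p t = b * t%:R + p 0%N.
    by have := dp t 0%N 0%N; rewrite addn0 subr0 => <-; rewrite subrK.
  have geo := geometric_phase (b - a%:~R) (p 0%N) H.
  have SE : \sum_(h < H) co ((b - a%:~R) * h%:R + p 0%N) = H%:R * Avg (nseq 1 H) (fun l => co (p (sumn l))).
    rewrite /= /avg mulrC divfK ?lt0r_neq0 //; apply: eq_bigr => h _.
    rewrite addn0 [p h]pE -(co_addz _ (a * h%:Z)); congr co; rewrite intrM -pmulrn; ring.
  have sinE : `|sin (pi * (b - a%:~R))| = sin (pi * `|b - a%:~R|).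
    have s0 : 0 <= sin (pi * `|b - a%:~R|) by apply: le_trans (hc _ _); [rewrite mulr_ge0 // ltW|rewrite normr_ge0].
    case: (leP 0 (b - a%:~R)) => sg; first by rewrite ger0_norm // in s0 *; rewrite ger0_norm.
    by rewrite ltr0_norm // in s0 *; rewrite mulrN sinN in s0 *; rewrite ler0_norm // -oppr_ge0.
  have lb : c * `|b - a%:~R| <= sin (pi * `|b - a%:~R|) by apply: hc; rewrite normr_ge0.
  rewrite SE sinE normrM [`|H%:R|]ger0_norm // in geo.
  have g2 : H%:R * eps * (c * `|b - a%:~R|) <= 1.
    apply: le_trans geo; apply: ler_pM; [by rewrite mulr_ge0 // ltW|by rewrite mulr_ge0 // ltW|by rewrite ler_pM2l|exact: lb].
  rewrite ler_pdivlMr //; apply: le_trans (_ : (c * eps)^-1 <= _); last first.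
    by apply: le_trans (ltW (archi_boundP x0)) _; rewrite ler_nat.
  rewrite -[leRHS]mul1r ler_pdivlMr ?mulr_gt0 //; move: g2; clear; lra.
pose e := Num.min eps 1; have e0 : 0 < e by rewrite lt_min eps0 ltr01.
have e1 : e <= 1 by rewrite ge_min lexx orbT.
have eeps : e <= eps by rewrite ge_min lexx.
pose eta := e ^+ 2 / 2; have eta0 : 0 < eta by rewrite divr_gt0 // exprn_gt0.
have eta1 : eta <= 1.
  have : e ^+ 2 <= 1 by rewrite expr_le1 // ltW.
  by rewrite /eta; lra.
have [Q' Q'0 IHQ] := IH eta eta0; have [|C C0 hC] := @diophantine eta; first by rewrite eta0.
pose F := Q'`!; have F0 : (0 < F)%N by apply: fact_gt0.
exists (F * Q' * C)%N; first by rewrite !muln_gt0 F0 Q'0.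
move=> H p b QH dp hA.
have H0 : (0 < H)%N by apply: leq_trans QH; rewrite !muln_gt0 F0 Q'0.
have H0' : 0 < H%:R :> R by rewrite ltr0n.
have CH : (C <= H)%N by apply: leq_trans QH; rewrite leq_pmull // muln_gt0 F0.
have Q'H : (Q' <= H)%N by apply: leq_trans QH; rewrite mulnAC leq_pmull // muln_gt0 F0.
pose g x x' := Avg (nseq D.+1 H) (fun l => co (p (x + sumn l)%N - p (x' + sumn l)%N)).
have g1 x x' : g x x' <= 1.
  by apply: Avg_le1 => l _; apply: le_trans (ler_norm _) (co_max _).
have h2 : 2 * eta <= avg H (fun x' => avg H (fun x => g x x')).
  have -> : 2 * eta = e ^+ 2 by rewrite /eta; field.
  apply: le_trans (_ : `|Avg (nseq D.+2 H) (fun l => co (p (sumn l)))| ^+ 2 <= _).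
    by rewrite lerXn2r ?nnegrE ?normr_ge0 // ?(ltW e0) // (le_trans eeps).
  rewrite real_normK ?num_real // avg_exchange.
  have := vdc (nseq D.+1 H) H (fun=> 1) p.
  rewrite (@eq_Avg _ _ _ (fun l => co (p (sumn l)))); last by move=> l _; rewrite mul1r.
  move=> v; apply: le_trans v _; apply: le_avg => x _; apply: le_avg => x' _.
  by apply: le_Avg => l _; rewrite !mul1r.
have [x' x'H hx'] := avg_exists H0 h2.
have many := avg_many H0 (ltW eta0) hx' (fun i _ => g1 i x').
set S := [set i : 'I_H | _] in many.
pose kap : R := (F * Q')%:R / H%:R ^+ D.+1.
have HD : 0 < H%:R ^+ D.+1 :> R by rewrite exprn_gt0.
have near h : h \in S -> exists a : int, `|- (F%:R * b * x'%:R) + F%:R * b * h%:R - a%:~R| <= kap.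
  rewrite inE => hg; have [q [a [/andP[q0 qQ] hq]]] := IHQ H _ _ Q'H (dp h x') (le_trans hg (ler_norm _)).
  have qF : (q %| F)%N by apply: dvdn_fact; rewrite q0.
  exists ((F %/ q)%:Z * a).
  have -> : - (F%:R * b * x'%:R) + F%:R * b * h%:R - ((F %/ q)%:Z * a)%:~R =
     (F %/ q)%:R * (q%:R * (b * (h%:R - x'%:R)) - a%:~R).
    rewrite intrM -pmulrn -{1 2}(divnK qF) natrM; ring.
  rewrite normrM ger0_norm // /kap natrM -mulrA; apply: ler_pM => //.
  by rewrite ler_nat leq_div.
have k0 : 0 <= kap by rewrite divr_ge0 // ltW.
have kC : kap * C%:R <= 1.
  rewrite /kap mulrAC ler_pdivrMr // mul1r -natrM -natrX ler_nat.
  by apply: leq_trans QH _; rewrite -[leqLHS]expn1 leq_pexp2l.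
have [q [a [/andP[q0 qC] hq]]] := hC H kap (F%:R * b) _ S CH k0 kC near many.
exists (q * F)%N, a; split.
  rewrite muln_gt0 q0 F0 /= mulnC mulnAC; apply: leq_trans (leq_pmulr _ Q'0); by rewrite leq_mul2l qC orbT.
rewrite natrM -mulrA; apply: le_trans hq _; rewrite /kap le_eqVlt; apply/orP; left; apply/eqP.
rewrite [_ ^+ D.+2]exprS !natrM; move: (H%:R ^+ D.+1) HD => X X0; field; by rewrite !lt0r_neq0.
Qed.

End Weyl.

(** * Monochromatic representations *)

Section Representations.
Variables (R : realType) (m M : nat) (col : nat -> 'I_m).

Let M' := (4 * M).+1.

(* The modulus [M' = 4 M + 1] exceeds every [|x + y - 2 n|] that occurs, so additive characters
   mod [M'] detect the equation exactly. *)
Definition rep (n : nat) : R :=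
  (\sum_(x < (2 * M).+1) \sum_(y < (2 * M).+1)
    [&& (0 < x)%N, (0 < y)%N, col x == col y & (x + y == n.*2)%N]%:R) / M'%:R.

Lemma M'_gt0 : 0 < M'%:R :> R. Proof. by rewrite ltr0n. Qed.

Lemma rep_ge0 n : 0 <= rep n.
Proof. by rewrite divr_ge0 // sumr_ge0 // => x _; rewrite sumr_ge0. Qed.

Lemma rep_le1 n : rep n <= 1.
Proof.
rewrite ler_pdivrMr ?M'_gt0 // mul1r.
apply: le_trans (_ : \sum_(x < (2 * M).+1) 1 <= _); last first.
  by rewrite sumr_const card_ord ler_nat /M' ltnS leq_mul2r orbT.
apply: ler_sum => x _; case: (ltnP (n.*2 - x) (2 * M).+1) => h; last first.
  rewrite big1 // => y _; case: (x + y =P n.*2)%N => E; rewrite ?andbF //.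
  by move: h; rewrite -E addKn ltnNge -ltnS ltn_ord.
rewrite (bigD1 (Ordinal h)) //= big1 ?addr0; first by rewrite lern1 leq_b1.
move=> y yn; case: (x + y =P n.*2)%N => E; rewrite ?andbF //.
by case/eqP: yn; apply: val_inj; rewrite /= -E addKn.
Qed.

Definition cls (c : 'I_m) (x : nat) := (0 < x)%N && (col x == c).
(** With [cB], the real and imaginary parts of the exponential sum over the colour class [c]. *)
Definition cA (th : R) c := \sum_(x < (2 * M).+1 | cls c x) co (th * x%:R).
Definition cB (th : R) c := \sum_(x < (2 * M).+1 | cls c x) si (th * x%:R).

Lemma phase_orth (z : int) : (`|z| < M')%N ->
  \sum_(xi < M') co (z%:~R / M'%:R * xi%:R) = M'%:R * (z == 0)%:R :> R.
Proof.
move=> zM; have [->|z0] := eqVneq z 0.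
  rewrite mulr1; under eq_bigr do rewrite mul0r mul0r co0.
  by rewrite sumr_const card_ord.
rewrite mulr0; set al := z%:~R / M'%:R.
have E := geometric_phaseE al 0 M'; move: E.
have -> : al * M'%:R + 0 - al / 2 = (0 - al / 2) + z%:~R.
  by rewrite /al divfK ?lt0r_neq0 ?M'_gt0 //; ring.
rewrite si_addz subrr -mulr_suml => /eqP; rewrite mulf_eq0 pnatr_eq0 /= mulf_eq0.
under eq_bigr do rewrite addr0.
case/orP => /eqP // s0; exfalso.
have al0 : al != 0 by apply: mulf_neq0; [rewrite intr_eq0|rewrite invr_eq0 pnatr_eq0].
have a1 : 0 < `|al| < 1.
  rewrite normr_gt0 al0 andTb.
  rewrite /al normrM [`|_^-1|]ger0_norm ?invr_ge0 // ltr_pdivrMr ?M'_gt0 // mul1r -intr_norm.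
  by rewrite -abszE -pmulrn ltr_nat.
have : 0 < sin (pi * `|al|).
  case/andP: a1 => a0 a1; apply: sin_gt0_pi; rewrite mulr_gt0 ?pi_gt0 //=.
  by rewrite -[ltRHS]mulr1 ltr_pM2l ?pi_gt0.
case: (leP 0 al) => sg; [rewrite ger0_norm //|rewrite ltr0_norm // mulrN sinN]; by rewrite s0 ?oppr0 ltxx.
Qed.

Lemma co_expand (u v w : R) : co (u + v - w) =
  (co u * co v - si u * si v) * co w + (si u * co v + co u * si v) * si w.
Proof. by rewrite coB coD [si (u + v)]/si mulrDr sinD /co /si; ring. Qed.

(** The square of the exponential sum of a class encodes its sums [x + y]; [cA ^ 2 - cB ^ 2] and
    [2 cA cB] are the two parts of this square. The bound on [n] keeps [|x + y - 2 n|] below the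
    modulus. *)
Lemma rep_fourier n : (n <= 2 * M)%N -> rep n = (M'%:R ^+ 2)^-1 * \sum_(xi < M') \sum_(c < m)
  let th := xi%:R / M'%:R in
  ((cA th c ^+ 2 - cB th c ^+ 2) * co (th * 2 * n%:R) + (2 * cA th c * cB th c) * si (th * 2 * n%:R)).
Proof.
move=> nM; have M0 := M'_gt0.
have E (xi : nat) c : let th := xi%:R / M'%:R in
   (cA th c ^+ 2 - cB th c ^+ 2) * co (th * 2 * n%:R) + (2 * cA th c * cB th c) * si (th * 2 * n%:R) =
   \sum_(x < (2 * M).+1 | cls c x) \sum_(y < (2 * M).+1 | cls c y) co (th * x%:R + th * y%:R - th * 2 * n%:R).
  move=> th /=; under eq_bigr do under eq_bigr do rewrite co_expand.
  set w := th * 2 * n%:R; set A := cA th c; set B := cB th c.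
  transitivity (\sum_(x < (2 * M).+1 | cls c x) ((co (th * x%:R) * A - si (th * x%:R) * B) * co w
     + (si (th * x%:R) * A + co (th * x%:R) * B) * si w)).
    rewrite big_split /= -!mulr_suml sumrB big_split /= -!mulr_suml -/(cA th c) -/(cB th c) -/A -/B; ring.
  apply: eq_bigr => x _; rewrite big_split /= -!mulr_suml sumrB big_split /= -!mulr_sumr.
  by rewrite -/(cA th c) -/(cB th c) -/A -/B.
have xyE (xi x y : nat) : co (xi%:R / M'%:R * x%:R + xi%:R / M'%:R * y%:R - xi%:R / M'%:R * 2 * n%:R) =
    co (((x + y)%N%:Z - n.*2%:Z)%:~R / M'%:R * xi%:R).
  congr co; rewrite intrD intrN -!pmulrn natrD -mul2n natrM; ring.
transitivity ((M'%:R ^+ 2)^-1 * \sum_(c < m) \sum_(x < (2 * M).+1 | cls c x) \sum_(y < (2 * M).+1 | cls c y)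
   M'%:R * ((x + y)%N == n.*2)%:R : R).
  have -> : \sum_(c < m) \sum_(x < (2 * M).+1 | cls c x) \sum_(y < (2 * M).+1 | cls c y) M'%:R * ((x + y)%N == n.*2)%:R
     = M'%:R * \sum_(c < m) \sum_(x < (2 * M).+1 | cls c x) \sum_(y < (2 * M).+1 | cls c y) ((x + y)%N == n.*2)%:R :> R.
    rewrite mulr_sumr; apply: eq_bigr => c _; rewrite mulr_sumr; apply: eq_bigr => x _; by rewrite mulr_sumr.
  rewrite /rep expr2 invfM -mulrA mulKf ?lt0r_neq0 // mulrC; congr (_ * _).
  rewrite [RHS](eq_bigr (fun c => \sum_(x < (2 * M).+1) if cls c x then
    \sum_(y < (2 * M).+1 | cls c y) ((x + y)%N == n.*2)%:R else 0)); last by move=> c _; rewrite big_mkcond.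
  rewrite [RHS]exchange_big /=; apply: eq_bigr => x _; rewrite -big_mkcond /cls /=.
  case: (posnP x) => [x0|x0].
    by rewrite [RHS]big_pred0 ?big1 // => i; rewrite ?x0 ?ltnn.
  rewrite [RHS](eq_bigl (fun c => c == col x)); last by move=> c; rewrite /= eq_sym.
  rewrite big_pred1_eq [RHS]big_mkcond; apply: eq_bigr => y _.
  by case: (0 < y)%N => //=; rewrite eq_sym; case: eqP.
congr (_ * _); rewrite exchange_big /=; apply: eq_bigr => c _.
under [RHS]eq_bigr do rewrite E.
rewrite [RHS]exchange_big /=; apply: eq_bigr => x _; rewrite [RHS]exchange_big /=; apply: eq_bigr => y _.
under [RHS]eq_bigr do rewrite xyE.
rewrite phase_orth.
  by rewrite subr_eq0 -eqz_nat.
have hx := ltn_ord x; have hy := ltn_ord y; rewrite /M' -mul2n; move: hx hy nM; clear.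
by move: (nat_of_ord x) (nat_of_ord y) => a b; lia.
Qed.

Lemma parseval c : \sum_(xi < M') (cA (xi%:R / M'%:R) c ^+ 2 + cB (xi%:R / M'%:R) c ^+ 2) =
  M'%:R * #|[set x : 'I_(2 * M).+1 | cls c x]|%:R :> R.
Proof.
have M0 := M'_gt0.
transitivity (\sum_(xi < M') \sum_(x < (2 * M).+1 | cls c x) \sum_(y < (2 * M).+1 | cls c y)
    co ((x%:Z - y%:Z)%:~R / M'%:R * xi%:R) : R).
  apply: eq_bigr => xi _; set th := xi%:R / M'%:R.
  rewrite !expr2 {2}/cA {2}/cB !mulr_sumr -big_split /=.
  transitivity (\sum_(x < (2 * M).+1 | cls c x) \sum_(y < (2 * M).+1 | cls c y) co (th * x%:R - th * y%:R)).
    under [RHS]eq_bigr do under eq_bigr do rewrite coB.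
    under [RHS]eq_bigr do rewrite big_split /= -!mulr_sumr.
    by apply: eq_bigr => x _; rewrite mulrC [si _ * _]mulrC -/(cA th c) -/(cB th c) mulrC [cB _ _ * _]mulrC.
  apply: eq_bigr => x _; apply: eq_bigr => y _; congr co.
  by rewrite intrD intrN -!pmulrn /th; ring.
rewrite exchange_big /=; under eq_bigr do rewrite exchange_big /=.
have -> : #|[set x : 'I_(2 * M).+1 | cls c x]|%:R = \sum_(x < (2 * M).+1 | cls c x) 1 :> R.
  by rewrite -sum1_card natr_sum; apply: eq_bigl => x; rewrite inE.
rewrite mulr_sumr.
apply: eq_bigr => x cx; rewrite (bigD1 x) //= phase_orth ?subrr // eqxx big1 ?addr0 ?mulr1 //.
move=> y /andP[_ yx]; rewrite phase_orth.
  rewrite subr_eq0 eqz_nat (_ : (x == y :> nat) = false) ?mulr0 //; apply/eqP => E.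
  by case/eqP: yx; apply: val_inj.
have hx := ltn_ord x; have hy := ltn_ord y; rewrite /M'; move: hx hy; clear.
by move: (nat_of_ord x) (nat_of_ord y) => a b; lia.
Qed.

Section Functional.
(** An abstract linear functional, so that the same argument serves the majorant and the shifts. It
    may depend only on values up to [2 M], where [rep_fourier] holds. *)
Variable L : (nat -> R) -> R.
Hypothesis LD : forall F G, L (fun n => F n + G n) = L F + L G.
Hypothesis LZ : forall c F, L (fun n => c * F n) = c * L F.
Hypothesis Lext : forall F G, (forall n, (n <= 2 * M)%N -> F n = G n) -> L F = L G.

Lemma L_sum (I : Type) (r : seq I) (F : I -> nat -> R) :
  L (fun n => \sum_(i <- r) F i n) = \sum_(i <- r) L (F i).
Proof.
elim: r => [|i r IH].
  rewrite big_nil -[RHS](mul0r (L (fun=> 0))) -LZ; apply: Lext => n _; by rewrite big_nil mul0r.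
by rewrite big_cons -IH -LD; apply: Lext => n _; rewrite big_cons.
Qed.

(** Product-to-sum formulas merge every Fourier phase of [rep] into the test phase. The coefficients
    satisfy [|A^2 - B^2| + |2 A B| <= 2 (A^2 + B^2)], and by Parseval these bounds sum to at most
    [2 M'^2], which the normalisation of [rep] cancels up to the factor 2. *)
Lemma rep_test_step eps G : (forall th be, `|L (fun n => G n * co (th * n%:R + be))| <= eps) ->
  forall th be, `|L (fun n => G n * rep n * co (th * n%:R + be))| <= 2 * eps.
Proof.
move=> H th be; have M0 := M'_gt0.
have eps0 : 0 <= eps by apply: le_trans (H 0 0).
have Hco w v : `|L (fun n => G n * (co (w * n%:R + v) * co (th * n%:R + be)))| <= eps.
  have -> : L (fun n => G n * (co (w * n%:R + v) * co (th * n%:R + be))) =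
     2^-1 * L (fun n => G n * co ((th + w) * n%:R + (be + v))) + 2^-1 * L (fun n => G n * co ((th - w) * n%:R + (be - v))).
    rewrite -!LZ -LD; apply: Lext => n _.
    have -> : (th + w) * n%:R + (be + v) = (th * n%:R + be) + (w * n%:R + v) by ring.
    have -> : (th - w) * n%:R + (be - v) = (th * n%:R + be) - (w * n%:R + v) by ring.
    by rewrite (coB (th * n%:R + be)) (coD (th * n%:R + be)); field.
  apply: le_trans (ler_normD _ _) _; rewrite !normrM [`|2^-1|]ger0_norm ?invr_ge0 //.
  have := H (th + w) (be + v); have := H (th - w) (be - v); lra.
pose T (xi : 'I_M') (c : 'I_m) := let w := xi%:R / M'%:R in
  (cA w c ^+ 2 - cB w c ^+ 2) * L (fun n => G n * (co (w * 2 * n%:R + 0) * co (th * n%:R + be)))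
  + 2 * cA w c * cB w c * L (fun n => G n * (co (w * 2 * n%:R + - 4^-1) * co (th * n%:R + be))).
have LE : L (fun n => G n * rep n * co (th * n%:R + be)) = (M'%:R ^+ 2)^-1 * \sum_(xi < M') \sum_(c < m) T xi c.
  transitivity (L (fun n => (M'%:R ^+ 2)^-1 * \sum_(xi < M') \sum_(c < m)
    let w := xi%:R / M'%:R in
    ((cA w c ^+ 2 - cB w c ^+ 2) * (G n * (co (w * 2 * n%:R + 0) * co (th * n%:R + be)))
     + 2 * cA w c * cB w c * (G n * (co (w * 2 * n%:R + - 4^-1) * co (th * n%:R + be)))))).
    apply: Lext => n nM; rewrite rep_fourier // [G n * _]mulrCA -mulrA; congr (_ * _).
    rewrite mulr_sumr mulr_suml; apply: eq_bigr => xi _; rewrite mulr_sumr mulr_suml; apply: eq_bigr => c _ /=.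
    rewrite addr0 si_co; ring.
  apply: etrans (LZ _ _) _; congr (_ * _); apply: etrans (L_sum _ _) _; apply: eq_bigr => xi _.
  apply: etrans (L_sum _ _) _; apply: eq_bigr => c _; apply: etrans (LD _ _) _.
  by rewrite /T /=; congr (_ + _); apply: LZ.
rewrite LE normrM [`|_^-1|]ger0_norm ?invr_ge0 ?exprn_ge0 // ler_pdivrMl ?exprn_gt0 //.
apply: le_trans (_ : \sum_(xi < M') \sum_(c < m) 2 * eps * (cA (xi%:R / M'%:R) c ^+ 2 + cB (xi%:R / M'%:R) c ^+ 2) <= _).
  apply: le_trans (ler_norm_sum _ _ _) _; apply: ler_sum => xi _.
  apply: le_trans (ler_norm_sum _ _ _) _; apply: ler_sum => c _; rewrite /T /=.
  set A := cA _ _; set B := cB _ _; set X := L _; set Y := L _.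
  have hX : `|X| <= eps by apply: Hco.
  have hY : `|Y| <= eps by apply: Hco.
  apply: le_trans (ler_normD _ _) _; rewrite !normrM.
  have a1 : `|A ^+ 2 - B ^+ 2| <= A ^+ 2 + B ^+ 2.
    have := sqr_ge0 A; have := sqr_ge0 B => b0 a0; rewrite ler_norml; apply/andP; split; lra.
  have a2 : `|2| * `|A| * `|B| <= A ^+ 2 + B ^+ 2.
    rewrite -(real_normK (num_real A)) -(real_normK (num_real B)) [`|2|]ger0_norm //.
    by have := sqr_ge0 (`|A| - `|B|); rewrite sqrrB; lra.
  have s0 : 0 <= A ^+ 2 + B ^+ 2 by rewrite addr_ge0 ?sqr_ge0.
  have p1 : `|A ^+ 2 - B ^+ 2| * `|X| <= (A ^+ 2 + B ^+ 2) * eps by apply: ler_pM.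
  have p2 : `|2| * `|A| * `|B| * `|Y| <= (A ^+ 2 + B ^+ 2) * eps by apply: ler_pM => //; rewrite !mulr_ge0.
  lra.
have -> : \sum_(xi < M') \sum_(c < m) 2 * eps * (cA (xi%:R / M'%:R) c ^+ 2 + cB (xi%:R / M'%:R) c ^+ 2) =
   2 * eps * (M'%:R * \sum_(c < m) #|[set x : 'I_(2 * M).+1 | cls c x]|%:R).
  rewrite exchange_big /= mulr_sumr mulr_sumr; apply: eq_bigr => c _.
  by rewrite -mulr_sumr parseval.
rewrite mulrC ler_wpM2r ?mulr_ge0 // expr2 ler_pM2l // -natr_sum ler_nat.
apply: leq_trans (_ : (\sum_(x < (2 * M).+1) 1 <= _)%N); last first.
  by rewrite sum_nat_const card_ord muln1 /M' ltnS leq_mul2r orbT.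
have -> : (\sum_(c < m) #|[set x : 'I_(2 * M).+1 | cls c x]|)%N = (\sum_(c < m) \sum_(x < (2 * M).+1) cls c x)%N.
  apply: eq_bigr => c _; rewrite -sum1_card big_mkcond; apply: eq_bigr => x _.
  by rewrite inE; case: (cls c x).
rewrite exchange_big /=; apply: leq_sum => x _; rewrite (bigD1 (col x)) //= big1 ?addn0 ?leq_b1 //.
by move=> c cx; rewrite /cls [_ == c]eq_sym (negPf cx) andbF.
Qed.

(* By Fourier inversion and Parseval, multiplying a phase by [rep] costs at most a factor 2. *)
Lemma rep_test eps K : (forall th be, `|L (fun n => co (th * n%:R + be))| <= eps) ->
  `|L (fun n => (1 - rep n) ^+ K)| <= 3 ^+ K * eps.
Proof.
move=> H; suff S : forall th be, `|L (fun n => (1 - rep n) ^+ K * co (th * n%:R + be))| <= 3 ^+ K * eps.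
  have := S 0 0; rewrite (_ : L _ = L (fun n => (1 - rep n) ^+ K)) //; apply: Lext => n _.
  by rewrite mul0r addr0 co0 mulr1.
elim: K => [|K IH] th be.
  rewrite expr0 mul1r (_ : L _ = L (fun n => co (th * n%:R + be))) //; apply: Lext => n _; by rewrite expr0 mul1r.
have -> : L (fun n => (1 - rep n) ^+ K.+1 * co (th * n%:R + be)) =
   L (fun n => (1 - rep n) ^+ K * co (th * n%:R + be)) + (-1) * L (fun n => (1 - rep n) ^+ K * rep n * co (th * n%:R + be)).
  by rewrite -LZ -LD; apply: Lext => n _; rewrite exprSr; ring.
apply: le_trans (ler_normD _ _) _; rewrite mulN1r normrN exprS -mulrA.
have := IH th be; have := rep_test_step IH th be; move: (3 ^+ K * eps) => E.
by lra.
Qed.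

End Functional.

Lemma csum_sum (w : seq bool) (l : seq nat) : size l = (size w).*2 ->
  csum w l = (\sum_(t < size w) nth 0 l (t.*2 + nth false w t))%N.
Proof.
elim: w l => [|b w IH] l /=; first by rewrite big_ord0.
case: l => [|x [|y l]] //= [sl]; rewrite big_ord_recl /= IH //; congr (_ + _)%N.
by case: b.
Qed.

Lemma sum_inj_le (F : nat -> R) (g : nat -> nat) H Y : (forall y, 0 <= F y) -> (forall y, (Y <= y)%N -> F y = 0) ->
  injective g -> \sum_(h < H) F (g h) <= \sum_(y < Y) F y.
Proof.
move=> F0 FY gi.
have -> : \sum_(h < H) F (g h) = \sum_(h < H) \sum_(y < Y) (y == g h :> nat)%:R * F y.
  apply: eq_bigr => h _; case: (ltnP (g h) Y) => hY; last first.
    rewrite FY // big1 // => y _; case: eqP; rewrite ?mul0r // => E.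
    by move: (ltn_ord y); rewrite E ltnNge hY.
  rewrite (bigD1 (Ordinal hY)) //= eqxx mul1r big1 ?addr0 // => y.
  by rewrite -val_eqE /= => /negPf ->; rewrite mul0r.
rewrite exchange_big /=; apply: ler_sum => y _; rewrite -mulr_suml ler_piMl // -natr_sum lern1.
case: (boolP [exists h : 'I_H, y == g h :> nat]) => [/existsP[h /eqP yh]|]; last first.
  by rewrite negb_exists => /forallP N; rewrite big1 // => h _; rewrite (negPf (N h)).
rewrite (bigD1 h) //= big1 ?addn0 ?leq_b1 // => h' hh; rewrite yh.
by case: eqP => // /gi E; case/eqP: hh; apply: val_inj.
Qed.

End Representations.

Section Insert.
Variable R : realFieldType.

Lemma Avg_insert n H p (F : seq nat -> R) : (p <= n)%N ->
  Avg (nseq n.+1 H) F = Avg (nseq n H) (fun l => avg H (fun h => F (take p l ++ h :: drop p l))).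
Proof.
elim: n p F => [|n IH] p F pn; first by move: pn; rewrite leqn0 => /eqP ->.
case: p pn => [|p] pn; first by rewrite -avg_Avg.
rewrite -[nseq n.+2 H]/(H :: nseq n.+1 H) -[nseq n.+1 H in RHS]/(H :: nseq n H).
transitivity (avg H (fun x => Avg (nseq n.+1 H) (fun l => F (x :: l)))) => //.
by apply: eq_avg => x _; rewrite (IH p).
Qed.

End Insert.

(** * Integers with few monochromatic representations are rare *)

Section Cubes.
Variable R : realType.

Definition pairword k (i j : 'I_k) : k.-tuple bool := [tuple (t == i) || (t == j) | t < k].
Definition zeroword k : k.-tuple bool := [tuple false | t < k].

Lemma csum_tuple k (w : k.-tuple bool) l : size l = k.*2 ->
  csum w l = (\sum_(t < k) nth 0 l (t.*2 + tnth w t))%N.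
Proof.
move=> sl; rewrite csum_sum ?size_tuple //; apply: eq_bigr => t _.
by rewrite (tnth_nth false).
Qed.

Lemma csum_zero k l : size l = k.*2 -> csum (zeroword k) l = (\sum_(t < k) nth 0 l t.*2)%N.
Proof. by move=> sl; rewrite csum_tuple //; apply: eq_bigr => t _; rewrite tnth_mktuple addn0. Qed.

(** Stated additively to avoid truncated subtraction; it makes twice the corner [pairword i j] a sum
    of two edges. *)
Lemma csum_pair k (i j : 'I_k) l : size l = k.*2 -> i != j ->
  (csum (pairword i j) l + nth 0 l i.*2 + nth 0 l j.*2 =
   csum (zeroword k) l + nth 0 l i.*2.+1 + nth 0 l j.*2.+1)%N.
Proof.
move=> sl ij; rewrite csum_zero // csum_tuple // (bigD1 i) //= (bigD1 j) 1?eq_sym //=.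
rewrite [in RHS](bigD1 i) //= [in RHS](bigD1 j) 1?eq_sym //=.
rewrite !tnth_mktuple !eqxx orbT /= !addn1.
rewrite (eq_bigr (fun t : 'I_k => nth 0%N l t.*2)); first by ring.
by move=> t /andP[/negPf ti /negPf tj]; rewrite tnth_mktuple ti tj addn0.
Qed.

Variable m : nat.
Let k := m.+1.

Section OneScale.
Variables (M H : nat) (col : nat -> 'I_m) (eta : R).

Definition bad (n : nat) : R := ((n <= M)%N && (rep R M col n < eta))%:R.

Lemma bad01 n : 0 <= bad n <= 1.
Proof. by rewrite ler0n lern1 leq_b1. Qed.

(** Detects monochromatic pairs with a bad midpoint; as a sum over midpoints it gives back [rep]
    when summed over all pairs. *)
Definition badpair (x y : nat) : R :=
  \sum_(n < M.+1) bad n * [&& (0 < x)%N, (0 < y)%N, col x == col y & (x + y == n.*2)%N]%:R.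

Lemma badpair_ge0 x y : 0 <= badpair x y.
Proof. by apply: sumr_ge0 => n _; case/andP: (bad01 n) => b0 _; rewrite mulr_ge0. Qed.

Lemma badpair_range x y : ((2 * M).+1 <= x)%N || ((2 * M).+1 <= y)%N -> badpair x y = 0.
Proof.
move=> h; rewrite /badpair big1 // => n _; case: (x + y =P n.*2)%N => E; rewrite ?andbF ?mulr0 //.
by exfalso; have := ltn_ord n; move: h E; rewrite -mul2n; clear; move: (nat_of_ord n) => a; lia.
Qed.

Lemma badpair_sum : 0 <= eta -> \sum_(x < (2 * M).+1) \sum_(y < (2 * M).+1) badpair x y
  <= M.+1%:R * (4 * M).+1%:R * eta.
Proof.
move=> e0; have E : \sum_(x < (2 * M).+1) \sum_(y < (2 * M).+1) badpair x y =
   \sum_(n < M.+1) bad n * ((4 * M).+1%:R * rep R M col n).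
  under eq_bigr do rewrite exchange_big /=.
  rewrite exchange_big /=; apply: eq_bigr => n _; rewrite /rep [_ * (_ / _)]mulrCA mulfV ?pnatr_eq0 // mulr1.
  by rewrite mulr_sumr; apply: eq_bigr => x _; rewrite mulr_sumr.
rewrite E; apply: le_trans (_ : \sum_(n < M.+1) (4 * M).+1%:R * eta <= _).
  apply: ler_sum => n _; rewrite /bad; case: (boolP (_ && _)) => [/andP[_ h]|_]; last by rewrite mul0r mulr_ge0.
  by rewrite mul1r ler_wpM2l // ltW.
by rewrite sumr_const card_ord -[_ *+ _]mulr_natl mulrA.
Qed.

(* [edge a l i + edge a l j] is twice the corner [pairword i j]; the shift by [2 H] keeps the
   subtraction from truncating. *)
Definition edge (a : nat) (l : seq nat) (i : nat) : nat :=
  (2 * H + a + csum (zeroword k) l + 2 * nth 0 l i.*2.+1 - 2 * nth 0 l i.*2)%N.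

Lemma inbox_nseq n l : inbox (nseq n H) l -> size l = n /\ forall i, (i < n)%N -> (nth 0 l i < H)%N.
Proof.
elim: n l => [|n IH] [|x l] //= /andP[xH /IH[sl hl]]; split; first by rewrite sl.
by case=> // i; rewrite ltnS; apply: hl.
Qed.

(** If all corners are bad, two of the [m + 1] edges share a colour, and half their sum is the
    corner [pairword i j]: they form a bad pair. *)
Lemma corners_le a l : inbox (nseq k.*2 H) l ->
  \prod_(w : k.-tuple bool) bad (2 * H + a + csum w l)%N <=
  \sum_(i < k) \sum_(j < k | i != j) badpair (edge a l i) (edge a l j).
Proof.
move=> /inbox_nseq[sl hl].
have nn : 0 <= \sum_(i < k) \sum_(j < k | i != j) badpair (edge a l i) (edge a l j).
  by apply: sumr_ge0 => i _; apply: sumr_ge0 => j _; apply: badpair_ge0.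
have [/forallP allbad|] := boolP [forall w : k.-tuple bool, ((2 * H + a + csum w l)%N <= M)%N &&
    (rep R M col (2 * H + a + csum w l)%N < eta)]; last first.
  rewrite negb_forall => /existsP[w hw]; rewrite (bigD1 w) //= {1}/bad (negPf hw) mul0r //.
rewrite big1; last by move=> w _; rewrite /bad (allbad w).
have [/injectiveP inj|] := boolP (injectiveb (fun i : 'I_k => col (edge a l i))).
  by have := leq_card _ inj; rewrite !card_ord ltnn.
move=> /injectivePn[i [j ij cij]].
rewrite (bigD1 i) //= (bigD1 j) //= -addrA -[leLHS]addr0; apply: lerD; last first.
  by apply: addr_ge0; apply: sumr_ge0 => i' _; [|apply: sumr_ge0 => j' _]; apply: badpair_ge0.
have H2 t : (t < k)%N -> (nth 0 l t.*2 < H)%N /\ (nth 0 l t.*2.+1 < H)%N.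
  by move=> tk; split; apply: hl; rewrite ?ltn_double // -doubleS leq_double.
have [i0 i1] := H2 _ (ltn_ord i); have [j0 j1] := H2 _ (ltn_ord j).
have Eij := csum_pair sl ij.
pose n := (2 * H + a + csum (pairword i j) l)%N.
have /andP[nM nb] := allbad (pairword i j).
have nM1 : (n < M.+1)%N by [].
rewrite /badpair (bigD1 (Ordinal nM1)) //= /bad nM nb mul1r.
have -> : [&& (0 < edge a l i)%N, (0 < edge a l j)%N, col (edge a l i) == col (edge a l j) & (edge a l i + edge a l j == n.*2)%N].
  rewrite cij eqxx /=; move: Eij i0 i1 j0 j1; rewrite /edge /n -mul2n.
  move: (csum _ _) (csum _ _) (nth _ _ _) (nth _ _ _) (nth _ _ _) (nth _ _ _); clear => A B C D E F.
  by move=> *; apply/and3P; split; lia.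
rewrite lerDl; apply: sumr_ge0 => t _; case/andP: (bad01 t) => b0 _; rewrite mulr_ge0 //.
Qed.

Lemma pair_fiber (c1 c2 : nat) : \sum_(a < M) \sum_(h < H) badpair (a + c1) (a + c2 + 2 * h) <=
  \sum_(x < (2 * M).+1) \sum_(y < (2 * M).+1) badpair x y.
Proof.
apply: le_trans (_ : \sum_(a < M) \sum_(y < (2 * M).+1) badpair (a + c1) y <= _).
  apply: ler_sum => a _; apply: (@sum_inj_le R (badpair (a + c1)) (fun h => a + c2 + 2 * h)%N) => [y|y hy|x y].
  - exact: badpair_ge0.
  - by apply: badpair_range; rewrite hy orbT.
  - by move/addnI/eqP; rewrite eqn_mul2l => /eqP.
apply: (@sum_inj_le R (fun x => \sum_(y < (2 * M).+1) badpair x y) (fun a => a + c1)%N) => [x|x hx|x y /addIn//].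
- by apply: sumr_ge0 => y _; apply: badpair_ge0.
- by rewrite big1 // => y _; apply: badpair_range; rewrite hx.
Qed.

Lemma nth_insert p h (l : seq nat) t : (p <= size l)%N ->
  nth 0%N (take p l ++ h :: drop p l) t =
  if (t < p)%N then nth 0%N l t else if t == p then h else nth 0%N l t.-1.
Proof.
move=> pl; rewrite nth_cat size_takel //; case: (ltnP t p) => tp; first by rewrite nth_take.
case: eqP => [->|/eqP tn]; first by rewrite subnn.
have tp' : (p < t)%N by rewrite ltn_neqAle eq_sym tn.
have -> : (t - p)%N = (t - p.+1).+1 by rewrite subnSK.
by rewrite /= nth_drop -subn1; congr (nth _ _ _); rewrite -[in RHS](subnKC tp') addSn subn1.
Qed.

(** Freeze everything except the base [a] and the second endpoint [h] in direction [j]: the two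
    edges become [a + c1] and [a + c2 + 2 h], an injective image of [(a, h)], so the total number of
    bad pairs bounds the sum. *)
Lemma edges_avg (i j : 'I_k) : i != j -> (0 < H)%N -> (0 < M)%N -> 0 <= eta ->
  avg M (fun a => Avg (nseq k.*2 H) (fun l => badpair (edge a l i) (edge a l j))) <=
  (M%:R * H%:R)^-1 * (M.+1%:R * (4 * M).+1%:R * eta).
Proof.
move=> ij H0 M0 e0; have jk := ltn_ord j; have ik := ltn_ord i.
have p1 : (j.*2.+1 <= k.*2.-1)%N by move: jk; clear; rewrite /k; move: (nat_of_ord j) => t; lia.
have kE : k.*2 = (k.*2.-1).+1 by rewrite /k doubleS.
set n := k.*2.-1 in p1 kE *; set p := j.*2.+1 in p1 *.
set C := _ * (_ * eta).
rewrite kE; rewrite (@eq_avg _ _ _ (fun a => Avg (nseq n H) (fun l => avg H (fun h =>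
   badpair (edge a (take p l ++ h :: drop p l) i) (edge a (take p l ++ h :: drop p l) j))))); last first.
  by move=> a _; rewrite (Avg_insert H _ p1).
rewrite avg_Avg; apply: le_trans (_ : Avg (nseq n H) (fun _ => C) <= _); last first.
  by rewrite Avg_const // all_nseq H0 orbT.
apply: le_Avg => l /inbox_nseq[sl hl].
have pl : (p <= size l)%N by rewrite sl.
pose L h := take p l ++ h :: drop p l.
have sL h : size (L h) = k.*2.
  by rewrite /L size_cat /= size_takel // size_drop sl addnS subnKC.
have nL h t : t != p -> nth 0%N (L h) t = nth 0%N (L 0%N) t.
  by move=> tp; rewrite /L !nth_insert // (negPf tp).
have bL t : (t < k.*2)%N -> (nth 0 (L 0%N) t < H)%N.
  rewrite kE ltnS => tn; rewrite /L nth_insert //; case: (ltnP t p) => [tp|pt]; first by apply: hl; apply: leq_trans p1.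
  case: eqP => [//|/eqP tp]; apply: hl; have t0 : (0 < t)%N by apply: leq_trans pt.
  by rewrite prednK.
have sLE h : csum (zeroword k) (L h) = csum (zeroword k) (L 0%N).
  rewrite !csum_zero //; apply: eq_bigr => t _; apply: nL.
  by apply/eqP => /(congr1 odd); rewrite /p /= !odd_double.
pose s0 := csum (zeroword k) (L 0%N).
have i2 : (i.*2.+1 < k.*2)%N by move: ik; clear; move: (nat_of_ord i) => t; lia.
have ip : (i.*2.+1 != p)%N.
  by rewrite /p eqSS -!muln2 eqn_mul2r /=; apply: contra ij => /eqP e; apply/eqP/val_inj.
have ev t : (t.*2 != p)%N by apply/eqP => /(congr1 odd); rewrite /p /= !odd_double.
pose c1 := (2 * H + s0 + 2 * nth 0 (L 0%N) i.*2.+1 - 2 * nth 0 (L 0%N) i.*2)%N.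
pose c2 := (2 * H + s0 - 2 * nth 0 (L 0%N) j.*2)%N.
have E1 a h : edge a (L h) i = (a + c1)%N.
  rewrite /edge sLE (nL h i.*2.+1 ip) (nL h i.*2 (ev i)) /c1 -/s0.
  have := bL i.*2 (ltnW i2); clear; move: (nth _ _ _) (nth _ _ _) => x y; lia.
have E2 a h : edge a (L h) j = (a + c2 + 2 * h)%N.
  have nh : nth 0%N (L h) j.*2.+1 = h by rewrite /L nth_insert // ltnn eqxx.
  rewrite /edge sLE (nL h j.*2 (ev j)) nh /c2 -/s0.
  have j2 : (j.*2 < k.*2)%N by rewrite ltn_double.
  have := bL j.*2 j2; clear; move: (nth _ _ _) => x; lia.
rewrite (@eq_avg _ _ _ (fun a => avg H (fun h => badpair (a + c1) (a + c2 + 2 * h)))); last first.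
  by move=> a _; apply: eq_avg => h _; rewrite -/(L h) E1 E2.
rewrite /avg -mulr_suml -mulrA -invfM mulrC [(H%:R * _)]mulrC /C.
rewrite ler_wpM2l ?invr_ge0 ?mulr_ge0 //.
exact: le_trans (pair_fiber c1 c2) (badpair_sum e0).
Qed.

End OneScale.

Lemma ldeg0 D : ldeg D 0 (fun=> 0 : R).
Proof.
elim: D => [|D IH] //= x x'; rewrite mul0r; apply: ldeg_ext IH => t; by rewrite subrr.
Qed.

Lemma inbox_sumn n H l : inbox (nseq n H) l -> (sumn l <= n * H)%N.
Proof.
elim: n l => [|n IH] [|x l] //= /andP[xH /IH h]; rewrite mulSn leq_add // ltnW //.
Qed.

(** [box_bound] with zero phase shows that a dense bad set contains a positive proportion of all
    cubes. By [corners_le] each of them contains a bad pair, yet bad pairs are scarce, as each bad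
    integer has few representations. *)
Lemma cube_density (del : R) : 0 < del <= 1 -> exists2 eta, 0 < eta <= 1 & exists M0 : nat,
  forall M, (M0 <= M)%N -> forall col, \sum_(n < M.+1) bad M col eta n <= del * M%:R.
Proof.
move=> /andP[d0 d1]; pose K2 := (2 ^ k)%N.
have kR : 1 <= k%:R :> R by rewrite ler1n.
have k0 : 0 < k%:R :> R by rewrite ltr0n.
pose rho := (del / 2) ^+ K2; have rho0 : 0 < rho by rewrite exprn_gt0 // divr_gt0.
(* Chosen so that the final upper bound for [A ^+ K2] is [rho / 4], against the lower bound
   [rho]. *)
pose w : R := 160 * k%:R ^+ 2 * (k%:R + 2).
have w0 : 0 < w by rewrite !mulr_gt0 ?exprn_gt0 ?addr_gt0.
pose eta := rho * del / w; have eta0 : 0 < eta by rewrite !mulr_gt0 ?invr_gt0.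
have w1 : 1 <= w.
  have a1 : 1 <= k%:R ^+ 2 :> R by rewrite exprn_ege1.
  have a2 : 1 * 1 <= k%:R ^+ 2 * (k%:R + 2) :> R by apply: ler_pM => //; lra.
  by rewrite /w -mulrA; lra.
have eta1 : eta <= 1.
  rewrite ler_pdivrMr // mul1r; apply: le_trans w1.
  have r1 : rho <= 1 by rewrite exprn_ile1 ?divr_ge0 ?(ltW d0) // ler_pdivrMr //; lra.
  by rewrite -[1]mulr1; apply: ler_pM => //; exact: ltW.
exists eta; first by rewrite eta0.
have x0 : 0 <= 4 * (k%:R + 2) / del by rewrite divr_ge0 ?mulr_ge0 ?addr_ge0 ?ltW.
exists (Num.bound (4 * (k%:R + 2) / del)).+1 => M hM col.
rewrite leNgt; apply/negP => many.
have M0 : (0 < M)%N by apply: leq_trans hM.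
have M0' : 0 < M%:R :> R by rewrite ltr0n.
have M1 : 1 <= M%:R :> R by rewrite ler1n.
have big : 4 * (k%:R + 2) <= del * M%:R.
  rewrite [leRHS]mulrC -ler_pdivrMr //; apply: le_trans (ltW (archi_boundP x0)) _; rewrite ler_nat; exact: ltnW.
have k2 : 0 < k%:R + 2 :> R by rewrite addr_gt0.
(* The shifts [2 H + sumn l] are at most [(k + 2) H <= del M / 2], so shifting loses at most half of
   the bad set. *)
pose z := del * M%:R / (2 * (k%:R + 2)).
have z0 : 0 <= z by rewrite divr_ge0 ?mulr_ge0 // ltW.
pose H := Num.truncn z; have /andP[h1 h2] := truncn_itv z0; rewrite -/H in h1 h2.
have zE : z * (2 * (k%:R + 2)) = del * M%:R by rewrite /z divfK // lt0r_neq0 // mulr_gt0.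
have z2 : 2 <= z by rewrite ler_pdivlMr ?mulr_gt0 //; lra.
have hz : z / 2 <= H%:R by move: h2; rewrite -natr1; lra.
have H0 : (0 < H)%N by rewrite -(ltr_nat R); lra.
have H0' : 0 < H%:R :> R by rewrite ltr0n.
have HM : (k%:R + 2) * H%:R <= del * M%:R / 2.
  have : H%:R * (2 * (k%:R + 2)) <= z * (2 * (k%:R + 2)) by rewrite ler_wpM2r // mulr_ge0 // ltW.
  rewrite zE; lra.
pose f := bad M col eta; have f01 n : 0 <= f n <= 1 by apply: bad01.
have f0 n : 0 <= f n by case/andP: (f01 n).
have f1 n : f n <= 1 by case/andP: (f01 n).
pose A := avg M (fun a => Avg (nseq k H) (fun l => f (2 * H + a + sumn l)%N)).
have Alow : del / 2 <= A.
  rewrite /A avg_Avg -[leLHS](@Avg_const R (nseq k H)) ?all_nseq ?H0 ?orbT //.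
  apply: le_Avg => l /inbox_sumn hl; rewrite /avg ler_pdivlMr //.
  set c := (2 * H + sumn l)%N.
  have cR : c%:R <= del * M%:R / 2 :> R.
    apply: le_trans HM; rewrite -natrD -natrM ler_nat /c addnC mulnDl leq_add2r //.
  have cM : (c <= M)%N.
    rewrite -(ler_nat R); apply: le_trans cR _; have : del * M%:R <= 1 * M%:R by rewrite ler_pM2r.
    lra.
  have E : \sum_(n < M.+1) f n <= c%:R + \sum_(a < M) f (2 * H + a + sumn l)%N.
    rewrite -(big_mkord xpredT f) (@big_cat_nat _ _ _ c) //=; last exact: leqW.
    apply: lerD.
      apply: le_trans (_ : \sum_(0 <= n < c) 1 <= _); first exact: ler_sum.
      by rewrite sumr_const_nat subn0.
    rewrite -[c in \sum_(c <= _ < _) _]add0n big_addn.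
    apply: le_trans (_ : \sum_(0 <= a < M) f (a + c)%N <= _); last first.
      by rewrite big_mkord; apply: ler_sum => a _; rewrite addnC /c addnAC.
    have cM2 : (M.+1 - c <= M)%N.
      have c0 : (0 < c)%N by rewrite /c addn_gt0 muln_gt0 H0.
      by case: (c) c0 => // c' _; rewrite subSS leq_subr.
    by rewrite [leRHS](@big_cat_nat _ _ _ (M.+1 - c)) //= lerDl; apply: sumr_ge0.
  move: many; rewrite -/f; lra.
have Aup : A ^+ K2 <= \sum_(i < k) \sum_(j < k | i != j) (M%:R * H%:R)^-1 * (M.+1%:R * (4 * M).+1%:R * eta).
  apply: le_trans (expn2_avg _ _) _; first by move=> a _; apply: Avg_ge0.
  apply: le_trans (_ : avg M (fun a => \sum_(i < k) \sum_(j < k | i != j)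
     Avg (nseq k.*2 H) (fun l => badpair M col eta (edge H a l i) (edge H a l j))) <= _); last first.
    rewrite avg_sum; apply: ler_sum => i _; rewrite avg_sum; apply: ler_sum => j ij.
    by apply: edges_avg => //; exact: ltW.
  apply: le_avg => a _.
  have := @box_bound R m H (fun t => f (2 * H + a + t)%N) (fun=> 0) H0 (ldeg0 _).
  rewrite (@eq_Avg _ _ _ (fun l => f (2 * H + a + sumn l)%N)); last by move=> l _; rewrite co0 mulr1.
  rewrite ger0_norm; last exact: Avg_ge0.
  move=> h; apply: le_trans h _; rewrite UnormE.
  apply: le_trans (le_Avg (fun l hl => @corners_le M H col eta a l hl)) _.
  rewrite Avg_sum; apply: ler_sum => i _; by rewrite Avg_sum.
have Cle : (M%:R * H%:R)^-1 * (M.+1%:R * (4 * M).+1%:R * eta) <= 40 * (k%:R + 2) / del * eta.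
  rewrite ler_pdivrMl ?mulr_gt0 //.
  have b1 : M.+1%:R * (4 * M).+1%:R <= 10 * M%:R ^+ 2 :> R.
    rewrite -[M.+1%:R]natr1 -[(4 * M).+1%:R]natr1 natrM expr2.
    have : M%:R * 1 <= M%:R * M%:R :> R by rewrite ler_pM2l.
    lra.
  have b2 : M%:R <= H%:R * (4 * (k%:R + 2) / del).
    have : z * (4 * (k%:R + 2) / del) <= 2 * H%:R * (4 * (k%:R + 2) / del).
      by rewrite ler_wpM2r ?divr_ge0 ?mulr_ge0 ?(ltW d0) ?(ltW k2) //; lra.
    have -> : z * (4 * (k%:R + 2) / del) = 2 * M%:R by rewrite /z; field; rewrite !lt0r_neq0.
    lra.
  apply: le_trans (_ : 10 * M%:R ^+ 2 * eta <= _); first by rewrite ler_wpM2r // ltW.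
  have b3 : M%:R * M%:R * (10 * eta) <= M%:R * (H%:R * (4 * (k%:R + 2) / del)) * (10 * eta).
    have p10 : 0 < 10 * eta by rewrite mulr_gt0.
    by rewrite (ler_pM2r p10) ler_pM2l.
  rewrite expr2; move: b3.
  have -> : M%:R * (H%:R * (4 * (k%:R + 2) / del)) * (10 * eta) = M%:R * H%:R * (40 * (k%:R + 2) / del * eta) by ring.
  lra.
have tot : rho <= k%:R ^+ 2 * (40 * (k%:R + 2) / del * eta).
  apply: le_trans (_ : A ^+ K2 <= _).
    have A0 : 0 <= A by apply: avg_ge0 => a _; apply: Avg_ge0.
    have d20 : 0 <= del / 2 by rewrite divr_ge0 // ltW.
    by rewrite lerXn2r.
  apply: le_trans Aup _; set C := _ * (_ * eta) in Cle *.
  have C0 : 0 <= C by rewrite !mulr_ge0 ?invr_ge0 ?mulr_ge0 // ltW.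
  apply: le_trans (_ : \sum_(i < k) \sum_(j < k) C <= _).
    by apply: ler_sum => i _; rewrite big_mkcond; apply: ler_sum => j _; case: ifP.
  rewrite !sumr_const !card_ord -mulrnA -[_ *+ _]mulr_natl natrM expr2 ler_wpM2l ?mulr_ge0 //.
have : k%:R ^+ 2 * (40 * (k%:R + 2) / del * eta) = rho / 4.
  by rewrite /eta /w; field; rewrite !lt0r_neq0.
move=> E; rewrite E in tot; lra.
Qed.

(** Where [rep] is at least [eta] the power is at most [(1 - eta) ^ K <= 1 / (1 + K eta)]; the bad
    integers contribute at most their number. *)
Lemma rep_power_small (del : R) : 0 < del <= 1 -> exists K M0 : nat, forall M, (M0 <= M)%N -> forall col : nat -> 'I_m,
  \sum_(n < M.+1) (1 - rep R M col n) ^+ K <= del * M%:R.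
Proof.
move=> /andP[d0 d1]; have [|eta /andP[e0 e1] [M0 hM0]] := @cube_density (del / 2).
  by apply/andP; split; lra.
have x0 : 0 <= 4 / (del * eta) by rewrite divr_ge0 // mulr_ge0 // ltW.
pose K := Num.bound (4 / (del * eta)); exists K, M0.+1 => M hM col.
have M0' : 1 <= M%:R :> R by rewrite ler1n; apply: leq_trans hM.
have e1' : 0 <= 1 - eta by rewrite subr_ge0.
have bern j : (1 - eta) ^+ j * (1 + j%:R * eta) <= 1.
  elim: j => [|j IH]; first by rewrite expr0 mul0r addr0 mulr1.
  apply: le_trans IH; rewrite exprSr -mulrA ler_wpM2l ?exprn_ge0 // -natr1.
  have : 0 <= j%:R * eta * eta by rewrite !mulr_ge0 // ltW.
  have : 0 <= eta * eta by rewrite mulr_ge0 // ltW.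
  lra.
have Ke : (1 - eta) ^+ K <= del / 4.
  have hK : 4 <= K%:R * eta * del.
    have := ltW (archi_boundP x0); rewrite -/K ler_pdivrMr ?mulr_gt0 //; lra.
  have := bern K; set E := (1 - eta) ^+ K => hE.
  have E0 : 0 <= E by rewrite exprn_ge0.
  have : E * (K%:R * eta * del) <= del.
    have : E * (1 + K%:R * eta) * del <= 1 * del by rewrite ler_pM2r.
    have : 0 <= E * del by rewrite mulr_ge0 // ltW.
    lra.
  have : E * 4 <= E * (K%:R * eta * del) by rewrite ler_wpM2l.
  lra.
apply: le_trans (_ : \sum_(n < M.+1) (bad M col eta n + del / 4) <= _).
  apply: ler_sum => n _; have r0 := rep_ge0 R M col n; have r1 := rep_le1 R M col n.
  rewrite /bad -ltnS ltn_ord /=; case: (ltP (rep R M col n) eta) => h.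
    apply: le_trans (_ : 1 <= _); last by rewrite lerDl divr_ge0 // ltW.
    by rewrite exprn_ile1 //; lra.
  rewrite add0r; apply: le_trans Ke; rewrite lerXn2r ?nnegrE //; lra.
rewrite big_split /= sumr_const card_ord -[_ *+ _]mulr_natl.
have := hM0 M (ltnW hM) col; rewrite -[M.+1%:R]natr1.
have : del * 1 <= del * M%:R by rewrite ler_pM2l.
lra.
Qed.

End Cubes.

(** * Reduction to a polynomial injective modulo small-prime numbers *)

Section IntegerPolynomials.

Definition phin (f : nat -> nat) (D z : nat) : nat := (\sum_(i < D.+1) f i * z ^ i)%N.

Lemma dvdz_horner_sub (G : {poly int}) (a b : int) : (a - b %| G.[a] - G.[b])%Z.
Proof.
elim/poly_ind: G => [|p c IH]; first by rewrite !horner0 subrr dvdz0.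
rewrite !hornerMXaddC.
have -> : p.[a] * a + c - (p.[b] * b + c) = (p.[a] - p.[b]) * a + p.[b] * (a - b) by ring.
by rewrite rpredD //; [apply: dvdz_mulr|apply: dvdz_mull].
Qed.

Lemma horner_eventually_gt0 (p : {poly int}) : 0 < lead_coef p ->
  exists B : nat, forall z : nat, (B <= z)%N -> 0 < p.[z%:Z].
Proof.
elim/poly_ind: p => [|p c IH]; first by rewrite lead_coef0 ltxx.
have [->|p0] := eqVneq p 0.
  by rewrite mul0r add0r lead_coefC => c0; exists 0%N => z _; rewrite hornerC.
rewrite lead_coefDl ?size_polyC ?size_mulX //; last first.
  by case: (c == 0) => //=; rewrite ltnS size_poly_gt0.
rewrite lead_coefMX => /IH[B hB]; exists (B + `|c|).+1 => z hz.
rewrite hornerMXaddC; have : 0 < p.[z%:Z] by apply: hB; lia.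
move: (p.[_]) => y y0; have : z%:Z <= y * z%:Z by rewrite ler_peMl //; lia.
lia.
Qed.

Lemma nderivn_eventually_gt0 (p : {poly int}) : 0 < lead_coef p -> exists B : nat,
  forall z : nat, (B <= z)%N -> forall i, (i < size p)%N -> 0 < p^`N(i).[z%:Z].
Proof.
move=> lp; have one i : (i < size p)%N -> exists B : nat, forall z : nat, (B <= z)%N -> 0 < p^`N(i).[z%:Z].
  move=> ip; apply: horner_eventually_gt0.
  have E : (p^`N(i))`_((size p).-1 - i) = lead_coef p *+ 'C((size p).-1, i).
    by rewrite coef_nderivn subnKC // -ltnS prednK // (leq_ltn_trans _ ip).
  have top : 0 < (p^`N(i))`_((size p).-1 - i).
    by rewrite E pmulrn_lgt0 // bin_gt0 -ltnS prednK // (leq_ltn_trans _ ip).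
  have sz : size p^`N(i) = ((size p).-1 - i).+1.
    apply/eqP; rewrite eqn_leq; apply/andP; split.
      apply/leq_sizeP => j hj; rewrite coef_nderivn nth_default ?mul0rn //.
      move: ip hj; case: (size p) => // s ip hj.
      by apply: (@leq_trans (i + (s - i).+1)%N); rewrite ?leq_add2l // addnS subnKC.
    rewrite ltnNge; apply/negP => h; move: top; rewrite nth_default ?ltxx //.
  by rewrite lead_coefE sz.
suff H n : (n <= size p)%N -> exists B : nat, forall z : nat, (B <= z)%N -> forall i, (i < n)%N -> 0 < p^`N(i).[z%:Z].
  exact: (H (size p) (leqnn _)).
elim: n => [|n IH] hn; first by exists 0%N.
have [B1 h1] := IH (ltnW hn); have [B2 h2] := one n hn.
exists (B1 + B2)%N => z hz i; rewrite ltnS leq_eqVlt => /predU1P[->|hi].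
  by apply: h2; apply: leq_trans hz; apply: leq_addl.
by apply: h1 => //; apply: leq_trans hz; apply: leq_addr.
Qed.

Lemma prime_dvdn_fact p n : prime p -> (p %| n`!)%N = (p <= n)%N.
Proof.
move=> pp; apply/idP/idP => [|pn]; last by apply: dvdn_fact; rewrite prime_gt0.
elim: n => [|n IH]; first by rewrite fact0 dvdn1 => /eqP p1; rewrite p1 in pp.
by rewrite factS Euclid_dvdM // => /orP[/dvdn_leq->//|/IH/leqW].
Qed.

Lemma phin_add f D z d : exists g, phin f D (z + d) = (phin f D z + d * g)%N.
Proof.
have pw i : exists g, ((z + d) ^ i = z ^ i + d * g)%N.
  elim: i => [|i [g hg]]; first by exists 0%N; rewrite muln0.
  by exists (z ^ i + (z + d) * g)%N; rewrite !expnS hg; ring.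
rewrite /phin; elim: D => [|D [g hg]]; first by exists 0%N; rewrite !big_ord1 !expn0 muln0 addn0.
have [g' hg'] := pw D.+1; exists (g + f D.+1 * g')%N.
by rewrite big_ord_recr [in RHS]big_ord_recr /= hg hg'; ring.
Qed.

(** Every prime factor of [L] divides [C g] but not [u], so [u + C g] is a unit mod [L]. *)
Lemma eqmod_coprime_cancel u C g d L : (0 < L)%N -> (forall p, prime p -> (p %| L)%N -> (p %| C)%N && ~~ (p %| u)%N) ->
  (L %| d * (u + C * g))%N -> (L %| d)%N.
Proof.
move=> L0 h; rewrite Gauss_dvdl //; apply/negPn/negP => nc.
have g1 : (1 < gcdn L (u + C * g))%N by rewrite ltn_neqAle eq_sym nc gcdn_gt0 L0.
have pp := pdiv_prime g1; have pg := pdiv_dvd (gcdn L (u + C * g)).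
have pL := dvdn_trans pg (dvdn_gcdl _ _); have pu := dvdn_trans pg (dvdn_gcdr _ _).
have /andP[pC /negP[]] := h _ pp pL.
by rewrite -(@dvdn_addl (C * g)%N) // dvdn_mulr.
Qed.

Variables (b0 W0 : nat) (psi : {poly int}).
Hypotheses (hb0 : (0 < b0)%N) (hW0 : (0 < W0)%N) (hgcd : gcdn b0 W0 = 1%N).
Hypotheses (hdeg : (1 < size psi)%N) (hlead : 0 < lead_coef psi).
Hypothesis heven : (2 %| W0)%N -> (2 %| psi.[1])%Z \/ (2 %| psi.[0])%Z.
Hypothesis hodd : ~~ (2 %| W0)%N -> (2 %| psi.[b0%:Z - 1])%Z.

Lemma prime_ndvd_shift p z : prime p -> (p %| W0)%N -> ~~ (p %| W0 * z + b0)%N.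
Proof.
move=> pp pW; rewrite dvdn_addr ?dvdn_mulr //; apply/negP => pb.
have : (p %| gcdn b0 W0)%N by rewrite dvdn_gcd pb pW.
by rewrite hgcd dvdn1 => /eqP p1; rewrite p1 in pp.
Qed.

(* [z0] comes from the Chinese remainder theorem: [W0 z0 + b0] is 1 modulo every small prime not
   dividing [W0], and the parity hypotheses on [psi] settle the residue of [z0] mod 2. *)
Lemma base_point w B : (2 <= w)%N -> exists2 z0, (B <= z0)%N &
  (2 %| psi.[z0%:Z])%Z /\ forall p, prime p -> (p <= w)%N -> ~~ (p %| W0 * z0 + b0)%N.
Proof.
move=> w2; pose P := (\prod_(p < w.+1 | prime p && ~~ (p %| W0)%N) p)%N.
have PP p : prime p -> (p <= w)%N -> ~~ (p %| W0)%N -> (p %| P)%N.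
  move=> pp pw pW; have pw' : (p < w.+1)%N by [].
  by rewrite /P (bigD1 (Ordinal pw')) /= ?pp //; apply: dvdn_mulr.
have copr x : (forall p, prime p -> ~~ (p %| W0)%N -> ~~ (p %| x)%N) -> coprime x P.
  move=> h; rewrite /P; apply: (big_ind (coprime x)) => [|a b ha hb|p /andP[pp pW]]; first exact: coprimen1.
    by rewrite coprimeMr ha hb.
  by rewrite coprime_sym prime_coprime // h.
have fin z0 : W0 * z0 + b0 = 1 %[mod P] -> forall p, prime p -> (p <= w)%N -> ~~ (p %| W0 * z0 + b0)%N.
  move=> E p pp pw; case: (boolP (p %| W0)%N) => pW; first exact: prime_ndvd_shift.
  apply/negP => h; have : (p %| 1)%N.
    have pP := PP _ pp pw pW.
    by rewrite /dvdn -(modn_dvdm 1 pP) -E modn_dvdm.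
  by rewrite dvdn1 => /eqP p1; rewrite p1 in pp.
have P0 : (0 < P)%N by apply: prodn_cond_gt0 => p /andP[pp _]; apply: prime_gt0.
(* For even [W0], the parity of [z0] is prescribed by [e] through the modulus [2 W0]. For odd [W0],
   2 divides [P], hence [W0 z0 + b0] is odd and [z0] has the parity of [b0 - 1]. *)
have [e [Wm [Wm0 WW [cop par]]]] : exists e Wm, [/\ (0 < Wm)%N, (W0 %| Wm)%N &
   coprime Wm P /\ forall z0, W0 * z0 + b0 = b0 + W0 * e %[mod Wm] -> W0 * z0 + b0 = 1 %[mod P] -> (2 %| psi.[z0%:Z])%Z].
  have trans (x y : int) : (2 %| x - y)%Z -> (2 %| psi.[y])%Z -> (2 %| psi.[x])%Z.
    move=> h1 h2; rewrite -(subrK psi.[y] psi.[x]) rpredD //.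
    by apply: dvdz_trans h1 (dvdz_horner_sub _ _ _).
  case: (boolP (2 %| W0)%N) => W2.
    have [e he] : exists e : nat, (2 %| psi.[e%:Z])%Z by case: (heven W2) => h; [exists 1%N|exists 0%N].
    exists e, (2 * W0)%N; rewrite muln_gt0 hW0 dvdn_mull //; split=> //; split.
      by apply: copr => p pp pW; rewrite Euclid_dvdM // negb_or pW andbT dvdn_prime2 //; apply: contra pW => /eqP ->.
    move=> z0 E _; apply: trans he.
    have : z0 = e %[mod 2].
      move/eqP: E; rewrite [X in _ == X %[mod _]]addnC eqn_modDr [(2 * W0)%N]mulnC -!muln_modr.
      by rewrite eqn_pmul2l // => /eqP.
    by move=> h; move: h; clear; lia.
  exists 0%N, W0; split=> //; split; first by apply: copr => p _.
  move=> z0 _ E; apply: trans (hodd W2).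
  have P2 : (2 %| P)%N by apply: PP.
  have : W0 * z0 + b0 = 1 %[mod 2] by rewrite -(modn_dvdm _ P2) E modn_dvdm.
  have : odd W0 by move: W2; rewrite dvdn2 negbK.
  by lia.
pose x := chinese Wm P (b0 + W0 * e) 1.
(* A multiple of both moduli is added to bring [z0] above [B]. *)
pose n0 := (x + Wm * P * (b0 + W0 * B))%N.
have n1 : n0 = b0 + W0 * e %[mod Wm] by rewrite /n0 -mulnA mulnC -modnDm modnMl addn0 modn_mod (chinese_modl cop).
have n2 : n0 = 1 %[mod P] by rewrite /n0 mulnAC -modnDm modnMl addn0 modn_mod (chinese_modr cop).
have nB : (b0 + W0 * B <= n0)%N.
  by rewrite /n0; apply: leq_trans (leq_addl _ _); rewrite leq_pmull // muln_gt0 Wm0.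
have nW : (W0 %| n0 - b0)%N.
  rewrite -eqn_mod_dvd; last by apply: leq_trans nB; apply: leq_addr.
  by rewrite -(modn_dvdm n0 WW) n1 modn_dvdm // addnC mulnC modnMDl.
have [z0 nE] := dvdnP nW.
have n0E : n0 = (W0 * z0 + b0)%N by rewrite mulnC -nE subnK //; apply: leq_trans nB; apply: leq_addr.
exists z0; first by move: nB; rewrite n0E addnC leq_add2r leq_pmul2l.
by rewrite n0E in n1 n2; split; [apply: par|apply: fin].
Qed.

(* Only the part [u] of [psi'(z0)] prime to the small primes is left in the linear coefficient of
   [phin f], the other coefficients being divisible by every small prime: this makes [phin f]
   injective modulo every small-prime number [L]. *)
Lemma reduction w : (2 <= w)%N -> (`|lead_coef psi| <= w)%N -> let D := (size psi).-1 in
  exists (z0 Q S E : nat) (f : nat -> nat),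
  [/\ (0 < E)%N, (0 < Q)%N & forall z : nat, psi.[(Q * z + z0)%:Z] = (2 * S + 2 * E * phin f D z)%:Z] /\
  [/\ (1 < W0 * Q)%N, coprime (W0 * Q) (W0 * z0 + b0)
    & forall p, prime p -> (p <= w)%N -> (p %| W0 * Q)%N] /\
  [/\ (0 < f D)%N, (forall p, prime p -> (p %| f D)%N -> (p <= w)%N), f 0 = 0%N &
    forall L, (0 < L)%N -> (forall p, prime p -> (p %| L)%N -> (p <= w)%N) ->
      forall z d, phin f D (z + d) = phin f D z %[mod L] -> (L %| d)%N].
Proof.
move=> w2 lw D; have [B hB] := nderivn_eventually_gt0 hlead.
have [z0 Bz [ev cop]] := base_point B w2.
have sD : size psi = D.+1 by rewrite /D prednK // ltnW.
have D0 : (0 < D)%N by rewrite -ltnS -sD.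
pose ch i : nat := `|psi^`N(i).[z0%:Z]|%N.
have chE i : (i < size psi)%N -> psi^`N(i).[z0%:Z] = (ch i)%:Z.
  by move=> ip; rewrite /ch gez0_abs // ltW // hB.
have ch0 i : (i < size psi)%N -> (0 < ch i)%N.
  by move=> ip; rewrite /ch absz_gt0 gt_eqF // hB.
pose d := ch 1%N; have d0 : (0 < d)%N by apply: ch0.
pose pi : nat_pred := [pred p | (p <= w)%N].
pose c := (d`_pi)%N; pose u := (d`_pi^')%N; have cu : (c * u = d)%N by apply: partnC.
have c0 : (0 < c)%N by apply: part_gt0. 
have cp p : prime p -> (p %| c)%N -> (p <= w)%N.
  move=> pp pc; have /pnatP := part_pnat pi d; rewrite part_gt0 => /(_ isT) /(_ p pp pc) //.
have up p : prime p -> (p <= w)%N -> ~~ (p %| u)%N.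
  move=> pp pw; apply/negP => pu; have /pnatP := part_pnat pi^' d; rewrite part_gt0 => /(_ isT) /(_ p pp pu).
  by rewrite inE /= inE /= pw.
have wp p (pp : prime p) := prime_dvdn_fact w pp.
(* With this [Q], [Q ^ 2] is [c * Q] times [c * w!]: after division by [2 E = c Q], the linear
   coefficient [c u Q] becomes [u], and all higher ones stay divisible by [c * w!]. *)
pose Q := (c * c * w`!)%N; have Q0 : (0 < Q)%N by rewrite !muln_gt0 c0 fact_gt0.
have w2f : (2 %| w`!)%N by apply: dvdn_fact.
pose E := (c * c * c * (w`! %/ 2))%N.
have E2 : (2 * E = c * Q)%N by rewrite /E /Q mulnC -mulnA divnK //; ring.
have E0 : (0 < E)%N.
  have : (0 < 2 * E)%N by rewrite E2 muln_gt0 c0.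
  by rewrite muln_gt0.
pose g i := ((2 <= i) * (ch i * Q ^ (i - 2)))%N.
pose f i := ((i == 1) * u + c * w`! * g i)%N.
have fE z : phin f D z = (u * z + c * w`! * phin g D z)%N.
  rewrite /phin big_distrr /=.
  have -> : (u * z = \sum_(i < D.+1) (i == 1 :> nat) * u * z ^ i)%N.
    have D1 : (1 < D.+1)%N by [].
    rewrite (bigD1 (Ordinal D1)) //= big1 ?addn0 ?mul1n ?expn1 // => i /eqP hi.
    by case: eqP => // i1; case: hi; apply: ord_inj.
  by rewrite -big_split; apply: eq_bigr => i _; rewrite /f /= mulnDl mulnA.
have ev0 : ch 0%N = (2 * (ch 0 %/ 2))%N.
  by rewrite mulnC divnK //; move: ev; rewrite /ch nderivn0.
have termE i z : (ch i * (Q * z) ^ i = (i == 0) * ch 0 + c * Q * (f i * z ^ i))%N.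
  rewrite /f /g expnMn; case: i => [|[|i]] /=; first by rewrite !expn0; ring.
    by rewrite !expn1 !mul0n muln0 addn0 mul1n add0n -/d -cu; ring.
  by rewrite !mul0n !mul1n !add0n subn2 /= [(Q ^ i.+2)%N]expnS [(Q ^ i.+1)%N]expnS {1}/Q; ring.
have topE : ch D = `|lead_coef psi|%N.
  rewrite /ch; congr (absz _).
  rewrite (size1_polyC (_ : size psi^`N(D) <= 1)%N) ?hornerC ?coef_nderivn ?addn0 ?binn ?lead_coefE //.
  by apply/leq_sizeP => j hj; rewrite coef_nderivn nth_default ?mul0rn // sD -addn1 leq_add2l.
have ld p : (p %| ch D)%N -> (p <= w)%N.
  move=> pd; apply: leq_trans lw; rewrite -topE; apply: dvdn_leq => //; apply: ch0.
  by rewrite sD.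
exists z0, Q, (ch 0 %/ 2)%N, E, f; split; last split.
- split=> // z; rewrite PoszD PoszM addrC nderiv_taylor; last by rewrite /GRing.comm mulrC.
  rewrite sD E2 -ev0 /phin big_distrr /= -PoszM.
  transitivity ((\sum_(i < D.+1) ch i * (Q * z) ^ i)%N%:Z).
    rewrite -[RHS]natz natr_sum; apply: eq_bigr => i _.
    by rewrite chE ?sD // natrM natrX !natz.
  apply: (congr1 Posz); rewrite (eq_bigr _ (fun i _ => termE (nat_of_ord i) z)).
  rewrite big_split /= big_ord_recl /= big1 ?addn0 ?mul1n //.
- split.
  + have : (2 %| W0 * Q)%N by rewrite dvdn_mull // dvdn_mull.
    by move/dvdn_leq => -> //; rewrite muln_gt0 hW0.
  + have [//|nc] := boolP (coprime (W0 * Q) (W0 * z0 + b0)).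
    have g0 : (0 < gcdn (W0 * Q) (W0 * z0 + b0))%N by rewrite gcdn_gt0 muln_gt0 hW0 Q0.
    have g1 : (1 < gcdn (W0 * Q) (W0 * z0 + b0))%N.
      by rewrite ltn_neqAle eq_sym g0 andbT.
    have pp := pdiv_prime g1; have pg := pdiv_dvd (gcdn (W0 * Q) (W0 * z0 + b0)).
    have := dvdn_trans pg (dvdn_gcdl _ _); have := dvdn_trans pg (dvdn_gcdr _ _).
    set p := pdiv _ in pp * => pn; rewrite Euclid_dvdM // => /orP[pW|pQ].
      by have := prime_ndvd_shift z0 pp pW; rewrite pn.
    have pw : (p <= w)%N.
      by move: pQ; rewrite /Q !Euclid_dvdM // wp // => /orP[/orP[]|//]; apply: cp.
    by have := cop p pp pw; rewrite pn.
  + by move=> p pp pw; rewrite dvdn_mull // /Q dvdn_mull // wp.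
split.
- rewrite /f /g; case: (ltngtP D 1%N) => [|D2|D1]; first by rewrite ltnNge D0.
    by rewrite add0n !muln_gt0 c0 fact_gt0 expn_gt0 Q0 ch0 ?sD.
  rewrite D1 /= mul1n muln0 addn0; apply: part_gt0.
- move=> p pp; rewrite /f /g; case: (ltngtP D 1%N) => [|D2|D1]; first by rewrite ltnNge D0.
    rewrite add0n mul1n !Euclid_dvdM // wp // => /orP[/orP[|//]|/orP[]]; [exact: cp|exact: ld|].
    rewrite Euclid_dvdX // => /andP[+ _]; rewrite /Q !Euclid_dvdM // wp // => /orP[/orP[]|//]; exact: cp.
  rewrite D1 /= mul1n muln0 addn0 => pu; apply: ld; rewrite D1 -/d -cu; exact: dvdn_mull.
- by rewrite /f /g /= muln0.
move=> L L0 Lp z e; rewrite !fE; have [g' ->] := phin_add g D z e.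
have -> : (u * (z + e) + c * w`! * (phin g D z + e * g') = e * (u + (c * w`!) * g') + (u * z + c * w`! * phin g D z))%N by ring.
move=> h; apply: (@eqmod_coprime_cancel u (c * w`!)%N g' e L L0).
  move=> p pp pL; have pw := Lp p pp pL; rewrite up // andbT dvdn_mull // wp //.
by rewrite /dvdn -(mod0n L) -(eqn_modDr (u * z + c * w`! * phin g D z)) add0n h.
Qed.

End IntegerPolynomials.

(** * Transference to the primes *)

Section Smear.

Variable R : realType.
Implicit Types (G : nat -> R) (f : nat -> nat).

(** The mean over [[N, 2 N)], smoothed by [k] further shifts below [H]; these supply the box
    variables for [box_bound] and [weyl]. *)
Definition smear N k H G : R := avg N (fun z => Avg (nseq k H) (fun l => G (N + z + sumn l)%N)).

Lemma smearD N k H G G' : smear N k H (fun t => G t + G' t) = smear N k H G + smear N k H G'.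
Proof. by rewrite /smear -avgD; apply: eq_avg => z _; rewrite -AvgD. Qed.

Lemma smearZ N k H c G : smear N k H (fun t => c * G t) = c * smear N k H G.
Proof. by rewrite /smear -avgZ; apply: eq_avg => z _; rewrite -AvgZ. Qed.

Lemma eq_smear N k H G G' : (forall t, (N <= t < 2 * N + k * H)%N -> G t = G' t) -> smear N k H G = smear N k H G'.
Proof.
move=> GG; apply: eq_avg => z zN; apply: eq_Avg => l /inbox_sumn hl; apply: GG.
by move: (sumn l) (k * H)%N hl zN => s K; clear; lia.
Qed.

Lemma le_smear N k H G G' : (forall t, (N <= t < 2 * N + k * H)%N -> G t <= G' t) -> smear N k H G <= smear N k H G'.
Proof.
move=> GG; apply: le_avg => z zN; apply: le_Avg => l /inbox_sumn hl; apply: GG.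
by move: (sumn l) (k * H)%N hl zN => s K; clear; lia.
Qed.

Lemma ler_norm_smear N k H G : `|smear N k H G| <= smear N k H (fun t => `|G t|).
Proof.
apply: le_trans (ler_norm_avg _ _) _; apply: le_avg => z _; exact: ler_norm_Avg.
Qed.

Lemma smear_const N k H c : (0 < N)%N -> (0 < H)%N -> smear N k H (fun=> c) = c.
Proof.
move=> N0 H0; rewrite /smear Avg_const ?avg_const //.
by apply/allP => x /nseqP[-> _].
Qed.

Lemma smear_phase N k H G (p : nat -> R) : (0 < H)%N -> ldeg k.+1 0 p ->
  `|smear N k.+1 H (fun t => G t * co (p t))| ^+ (2 ^ k.+1) <=
  `|Avg (N :: nseq k.+1.*2 H) (fun l => \prod_(w : k.+1.-tuple bool) G (val_at N w l))|.
Proof.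
move=> H0 hp; apply: le_trans (ler_norm _).
apply: le_trans (_ : avg N (fun z => `|Avg (nseq k.+1 H) (fun l => G (N + z + sumn l)%N * co (p (N + z + sumn l)%N))|) ^+ (2 ^ k.+1) <= _).
  by rewrite lerXn2r ?nnegrE ?avg_ge0 // ler_norm_avg.
apply: le_trans (expn2_avg _ _) _ => //; apply: le_avg => z _.
apply: le_trans (box_bound (fun t => G (N + z + t)%N) H0 (ldeg_shift (N + z) hp)) _.
by rewrite UnormE.
Qed.

Lemma ldeg_phin f D th be :
  ldeg D.+1 (th * (D.+1`!%:R * (f D.+1)%:R)) (fun t => th * (phin f D.+1 t)%:R + be : R).
Proof.
pose P : {poly R} := (\poly_(i < D.+2) (f i)%:R).
have hP : ldeg D.+1 (D.+1`!%:R * (f D.+1)%:R) (fun t => (phin f D.+1 t)%:R : R).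
  have := @ldeg_poly R D.+1 P (size_poly _ _).
  rewrite coef_poly ltnSn; apply: ldeg_ext => t.
  by rewrite horner_poly /phin natr_sum; apply: eq_bigr => i _; rewrite natrM natrX.
have hb : ldeg D.+1 0 (fun=> be).
  by have [h _] := ldeg_pow R D.+1; have := ldegZ be (h 0%N isT); rewrite mulr0; apply: ldeg_ext => t; rewrite expr0 mulr1.
by have := ldegD (ldegZ th hP) hb; rewrite addr0.
Qed.

(* If the phase has a large Weyl sum then [th * L] is nearly an integer and the shifts are harmless;
   otherwise both averages are small. *)
Lemma smear_weyl D eps : 0 < eps -> exists2 Q : nat, (0 < Q)%N & forall N H A f, (0 < N)%N -> (0 < A)%N -> (Q <= H)%N ->
  A%:R * (tp R * (Q`! * Q)%:R) <= eps * H%:R ^+ D.+1 ->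
  forall th be, `|smear N D.+2 H (fun t => co (th * (phin f D.+1 t)%:R + be)) -
    avg A (fun kk => smear N D.+2 H (fun t => co (th * (phin f D.+1 t + f D.+1 * D.+1`! * Q`! * kk)%:R + be)))| <= 2 * eps.
Proof.
move=> e0; have [Q Q0 hQ] := weyl D e0; exists Q => // N H A f N0 A0 QH hA th be.
have H0 : (0 < H)%N by apply: leq_trans QH.
have H0' : 0 < H%:R ^+ D.+1 :> R by rewrite exprn_gt0 // ltr0n.
set L := (f D.+1 * D.+1`! * Q`!)%N.
have [[z [c hz]]|no] := pselect (exists z, exists c, eps <= `|Avg (nseq D.+1 H) (fun l => co (th * (phin f D.+1 (z + sumn l))%:R + c))|).
  have := hQ H (fun t => th * (phin f D.+1 (z + t))%:R + c) _ QH (ldeg_shift z (ldeg_phin f D th c)) hz.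
  move=> [q [a [/andP[q0 qQ] hqa]]].
  have [r hr] : exists r, (Q`! = r * q)%N by apply/dvdnP/dvdn_fact; rewrite q0.
  pose a' : int := a * r%:Z; set b := th * _ in hqa.
  have hL : `|th * L%:R - a'%:~R| <= (Q`! * Q)%:R / H%:R ^+ D.+1.
    have -> : th * L%:R - a'%:~R = r%:R * (q%:R * b - a%:~R).
      by rewrite /L /a' hr /b intrM !natrM -pmulrn; ring.
    rewrite normrM normr_nat natrM -mulrA ler_pM // ler_nat hr.
    by rewrite leq_pmulr.
  have -> : smear N D.+2 H (fun t => co (th * (phin f D.+1 t)%:R + be)) -
    avg A (fun kk => smear N D.+2 H (fun t => co (th * (phin f D.+1 t + L * kk)%:R + be))) =
    avg A (fun kk => smear N D.+2 H (fun t => co (th * (phin f D.+1 t)%:R + be) - co (th * (phin f D.+1 t + L * kk)%:R + be))).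
    rewrite -{1}[smear _ _ _ _](avg_const _ A0) -avgB; apply: eq_avg => kk _.
    rewrite -[X in _ - X]mul1r -mulNr -smearZ -smearD; apply: eq_smear => t _; ring.
  apply: le_trans (ler_norm_avg _ _) _; rewrite -(avg_const (2 * eps) A0); apply: le_avg => kk kA.
  apply: le_trans (ler_norm_smear _ _ _ _) _; rewrite -(smear_const D.+2 (2 * eps) N0 H0); apply: le_smear => t _.
  have -> : co (th * (phin f D.+1 t + L * kk)%:R + be) = co (th * (phin f D.+1 t)%:R + be + kk%:R * (th * L%:R - a'%:~R)).
    rewrite -[RHS](co_addz _ (a' * kk%:Z)); congr co; rewrite natrD natrM intrM -pmulrn; ring.
  apply: le_trans (co_lip _ _) _; rewrite opprD addrA subrr sub0r normrN normrM normr_nat.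
  apply: (@le_trans _ _ eps); last by lra.
  apply: le_trans (_ : tp R * (A%:R * ((Q`! * Q)%:R / H%:R ^+ D.+1)) <= _).
    by rewrite ler_pM2l ?tp_gt0 // ler_pM // ler_nat ltnW.
  by rewrite !mulrA ler_pdivrMr // [tp R * _]mulrC -mulrA.
have small c : `|smear N D.+2 H (fun t => co (th * (phin f D.+1 t)%:R + c))| <= eps.
  apply: le_trans (ler_norm_avg _ _) _; rewrite -(avg_const eps N0); apply: le_avg => z _.
  apply: le_trans (ler_norm_avg _ _) _; rewrite -(avg_const eps H0); apply: le_avg => x _.
  apply: ltW; rewrite ltNge; apply/negP => h; apply: no; exists (N + z + x)%N, c.
  have E : Avg (nseq D.+1 H) (fun l => co (th * (phin f D.+1 (N + z + x + sumn l))%:R + c)) =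
    Avg (nseq D.+1 H) (fun l => co (th * (phin f D.+1 (N + z + sumn (x :: l)))%:R + c)).
    by apply: eq_Avg => l _; rewrite /= addnA.
  by rewrite E; exact: h.
apply: le_trans (ler_normB _ _) _; rewrite mulr2n mulrDl mul1r lerD //.
apply: le_trans (ler_norm_avg _ _) _; rewrite -(avg_const eps A0); apply: le_avg => kk _.
apply: le_trans (small (th * (L * kk)%:R + be)); rewrite le_eqVlt; apply/orP; left; apply/eqP; apply: congr1.
by apply: eq_smear => t _; congr co; rewrite natrD; ring.
Qed.

Lemma phin_increment f D t d : (phin f D.+1 t + f D.+1 * t ^ D * d <= phin f D.+1 (t + d))%N.
Proof.
have pw i : (t ^ i <= (t + d) ^ i)%N by case: i => // i; rewrite leq_exp2r // leq_addr.
rewrite /phin [X in (X + _ <= _)%N]big_ord_recr [X in (_ <= X)%N]big_ord_recr /= -addnA leq_add //.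
  by apply: leq_sum => i _; rewrite leq_mul2l pw orbT.
rewrite -mulnA -mulnDr leq_mul2l expnSr -mulnDr expnSr; apply/orP; right.
by rewrite leq_mul2r pw orbT.
Qed.

Lemma phin_upper f D t : (\sum_(i < D.+1) f i <= t)%N -> (0 < f D.+1)%N ->
  (phin f D.+1 t <= 2 * f D.+1 * t ^ D.+1)%N.
Proof.
move=> ht f0; rewrite /phin big_ord_recr /= mul2n -addnn mulnDl leq_add2r.
case: t ht => [|t] ht.
  rewrite (eq_bigr (fun=> 0%N)) ?big1 // => i _.
  have : (f i <= 0)%N by apply: leq_trans ht; rewrite (bigD1 i) //= leq_addr.
  by rewrite leqn0 => /eqP ->; rewrite mul0n.
apply: leq_trans (_ : (\sum_(i < D.+1) f i) * t.+1 ^ D <= _)%N.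
  rewrite big_distrl /=; apply: leq_sum => i _.
  by rewrite leq_mul2l leq_pexp2l ?orbT // -ltnS.
by rewrite expnS mulnA leq_mul // (leq_trans ht) // leq_pmull.
Qed.

Lemma sum_injective_le (I : finType) M (h : I -> nat) (F : nat -> R) : injective h ->
  (forall i, (h i <= M)%N) -> (forall n, 0 <= F n) -> \sum_i F (h i) <= \sum_(n < M.+1) F n.
Proof.
move=> hi hM F0; pose h' i : 'I_M.+1 := inord (h i).
have h'E i : h' i = h i :> nat by rewrite inordK // ltnS.
have h'i : injective h' by move=> i j /(congr1 val) /=; rewrite !h'E => /hi.
have -> : \sum_i F (h i) = \sum_(n in h' @: [set: I]) F n.
  by rewrite big_imset /=; [apply: eq_big => i; rewrite ?inE // h'E|move=> i j _ _; apply: h'i].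
by rewrite big_mkcond; apply: ler_sum => n _; case: ifP.
Qed.

Lemma smear_shifts N k H G : smear N k H G = Avg (nseq k H) (fun l => avg N (fun z => G (N + z + sumn l)%N)).
Proof. exact: avg_Avg. Qed.

Lemma phin_range N D f L t kk : (0 < f D.+1)%N ->
  (\sum_(i < D.+1) f i <= N)%N -> (L <= N)%N -> (N <= t <= 3 * N)%N -> (kk < f D.+1 * N ^ D)%N ->
  (phin f D.+1 t + L * kk <= f D.+1 * N ^ D.+1 * (2 * 3 ^ D.+1 + 1))%N.
Proof.
move=> f0 sN LN /andP[Nt tN] kA; rewrite mulnDr muln1 leq_add //.
  apply: leq_trans (phin_upper (leq_trans sN Nt) f0) _.
  apply: leq_trans (_ : 2 * f D.+1 * (3 * N) ^ D.+1 <= _)%N; first by rewrite leq_mul2l leq_exp2r // tN orbT.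
  by rewrite expnMn leq_eqVlt; apply/orP; left; apply/eqP; ring.
by rewrite expnS mulnCA leq_mul // ltnW.
Qed.

(* The values [phi t + L kk] are distinct: [phi] is injective mod [L], and if [L] divides [d > 0] then
   [phi (t + d) - phi t >= (f_D N^(D-1)) d >= L * (number of shifts kk)]. *)
Lemma smear_count N k H D f L G : (0 < N)%N -> (0 < H)%N -> (k * H <= N)%N -> (0 < f D.+1)%N ->
  (\sum_(i < D.+1) f i <= N)%N -> (0 < L <= N)%N ->
  (forall z d, phin f D.+1 (z + d) = phin f D.+1 z %[mod L] -> (L %| d)%N) -> (forall n, 0 <= G n) ->
  avg (f D.+1 * N ^ D) (fun kk => smear N k H (fun t => G (phin f D.+1 t + L * kk)%N)) <=
  (f D.+1 * N ^ D.+1)%:R^-1 * \sum_(n < (f D.+1 * N ^ D.+1 * (2 * 3 ^ D.+1 + 1)).+1) G n.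
Proof.
move=> N0 H0 kHN f0 sN /andP[L0 LN] inj G0; set A := (f D.+1 * N ^ D)%N.
set M := (_ * (_ + 1))%N; set c := (X in _ <= X).
rewrite (eq_avg (fun i _ => smear_shifts N k H _)) avg_Avg.
have c1 : all (leq 1) (nseq k H) by apply/allP => x /nseqP[-> _].
rewrite -(Avg_const c c1); apply: le_Avg => l /inbox_sumn hl.
set s := sumn l in hl *; have sN' : (s <= N)%N := leq_trans hl kHN.
have AN : (A * N = f D.+1 * N ^ D.+1)%N by rewrite /A -mulnA -expnSr.
rewrite /avg -[X in X / _]mulr_suml -mulrA -invfM -natrM mulnC AN mulrC ler_wpM2l ?invr_ge0 //.
rewrite pair_big /=.
pose h (u : 'I_A * 'I_N) := (phin f D.+1 (N + u.2 + s) + L * u.1)%N.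
apply: (@sum_injective_le _ M h) => // [[kk z] [kk' z']|[kk z]]; last first.
  apply: phin_range => //=; have := ltn_ord z; move: (nat_of_ord z) => z' z'N.
  by move: sN' z'N; clear; lia.
rewrite /h /=; wlog zz : kk z kk' z' / (z' <= z)%N.
  move=> W E; case: (leqP z' z) => [zz|/ltnW zz]; [exact: W zz E|exact/esym/(W _ _ _ _ zz (esym E))].
move=> E; pose d := (z - z')%N.
have tE : (N + z + s = N + z' + s + d)%N by rewrite /d; move: zz; move: (nat_of_ord z) (nat_of_ord z'); clear; lia.
rewrite tE in E; have Ld : (L %| d)%N.
  apply: (inj (N + z' + s)%N); apply/eqP; rewrite -(eqn_modDr (L * kk)) E.
  by rewrite eqn_modDl !modnMr.
have [j dj] := dvdnP Ld.
have inc := phin_increment f D (N + z' + s) d.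
have j0 : j = 0%N.
  have hA : (A <= f D.+1 * (N + z' + s) ^ D)%N.
    by rewrite leq_mul2l; apply/orP; right; case: (D) => // i; rewrite leq_exp2r // -addnA leq_addr.
  have : (A * d + L * kk <= L * kk')%N.
    rewrite -(leq_add2l (phin f D.+1 (N + z' + s))) -E addnA leq_add2r; apply: leq_trans inc.
    by rewrite leq_add2l leq_mul2r hA orbT.
  have -> : (A * d + L * kk = L * (A * j + kk))%N by rewrite dj; ring.
  rewrite leq_pmul2l // => h1; have := leq_ltn_trans h1 (ltn_ord kk').
  rewrite ltnNge; case: (j) => // i /negP[]; apply: leq_trans (leq_addr _ _); exact: leq_pmulr.
have d0 : d = 0%N by rewrite dj j0.
have zE : z = z'.
  apply: ord_inj; move: d0 zz; rewrite /d; move: (nat_of_ord z) (nat_of_ord z'); clear; lia.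
rewrite d0 addn0 in E; congr pair => //; apply: ord_inj; apply/eqP.
by rewrite -(eqn_pmul2l L0) -(eqn_add2l (phin f D.+1 (N + z' + s))) E.
Qed.

(** For every total shift [s <= T], the interval [[4 T + s, 8 T + s)] contains [[5 T, 8 T)]. *)
Lemma smear_window T k H G : (0 < T)%N -> (0 < H)%N -> (k * H <= T)%N -> (forall n, 0 <= G n) ->
  (4 * T)%:R^-1 * \sum_(5 * T <= t < 8 * T) G t <= smear (4 * T) k H G.
Proof.
move=> T0 H0 kH G0; rewrite smear_shifts; set c := (X in X <= _).
have c1 : all (leq 1) (nseq k H) by apply/allP => x /nseqP[-> _].
rewrite -(Avg_const c c1); apply: le_Avg => l /inbox_sumn hl.
set s := sumn l in hl *; have sT : (s <= T)%N := leq_trans hl kH.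
rewrite /avg /c [leRHS]mulrC ler_wpM2l ?invr_ge0 //.
have -> : \sum_(i < 4 * T) G (4 * T + i + s)%N = \sum_(4 * T + s <= t < 8 * T + s) G t.
  rewrite -{1}[(4 * T + s)%N]add0n big_addn big_mkord.
  have -> : (8 * T + s - (4 * T + s) = 4 * T)%N by clear; lia.
  by apply: eq_bigr => i _; congr G; move: (nat_of_ord i); clear; lia.
rewrite (@big_cat_nat _ _ _ (5 * T) (4 * T + s) (8 * T + s)) /=; [|by move: sT; clear; lia|by move: sT; clear; lia].
rewrite (@big_cat_nat _ _ _ (8 * T) (5 * T) (8 * T + s)) /=; [|by move: sT; clear; lia|by move: sT; clear; lia].
have p1 : 0 <= \sum_(4 * T + s <= t < 5 * T) G t by apply: sumr_ge0.
have p2 : 0 <= \sum_(8 * T <= t < 8 * T + s) G t by apply: sumr_ge0.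
by move: p1 p2; clear; lra.
Qed.

(** Only the pair [x = y = n] is left to be counted. *)
Lemma rep_diag m M (col : nat -> 'I_m) n :
  (forall x y, (0 < x)%N -> (0 < y)%N -> col x = col y -> (x + y = 2 * n)%N -> x = y) ->
  rep R M col n <= (4 * M).+1%:R^-1.
Proof.
move=> h; have ind P : (\sum_(x < P) (x == n :> nat) = (n < P) :> nat)%N.
  elim: P => [|P IH]; first by rewrite big_ord0.
  by rewrite big_ord_recr /= IH ltnS; case: (ltngtP n P).
rewrite /rep -[leRHS]mul1r ler_wpM2r ?invr_ge0 //.
apply: le_trans (_ : \sum_(x < (2 * M).+1) \sum_(y < (2 * M).+1) ((x == n :> nat) * (y == n :> nat))%:R <= _).
  apply: ler_sum => x _; apply: ler_sum => y _; rewrite ler_nat.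
  case: and4P => //= [[x0 y0 /eqP hc /eqP hn]].
  have e := h _ _ x0 y0 hc (etrans hn (esym (mul2n n))).
  have -> : (x == n :> nat) by move: e hn; move: (nat_of_ord x) (nat_of_ord y); clear; lia.
  by have -> : (y == n :> nat) by move: e hn; move: (nat_of_ord x) (nat_of_ord y); clear; lia.
under eq_bigr => x _ do rewrite -natr_sum -big_distrr /= ind.
have -> : \sum_(x < (2 * M).+1) ((x == n :> nat) * (n < (2 * M).+1))%:R = (\sum_(x < (2 * M).+1) (x == n :> nat) * (n < (2 * M).+1))%N%:R :> R.
  by rewrite natr_sum.
rewrite -big_distrl /= ind lern1.
by case: (n < _)%N.
Qed.

(** The mean of [nu t * Phi (phi t)] splits into the error of replacing [nu] by 1, the error of
    replacing [phi t] by the values [phi t + L kk], and a mean over distinct integers. The first two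
    are linear in [Phi], so [rep_test] reduces them to phases. *)
Lemma prime_value_sum (m D : nat) : exists w1 : nat, forall w q n0 (f : nat -> nat), (w1 <= w)%N ->
  (1 < q)%N -> coprime q n0 -> (forall p, prime p -> (p <= w)%N -> (p %| q)%N) ->
  (0 < f D.+1)%N -> (forall p, prime p -> (p %| f D.+1)%N -> (p <= w)%N) ->
  (forall L, (0 < L)%N -> (forall p, prime p -> (p %| L)%N -> (p <= w)%N) ->
    forall z d, phin f D.+1 (z + d) = phin f D.+1 z %[mod L] -> (L %| d)%N) ->
  forall col : nat -> 'I_m, exists t x y,
    [/\ prime (q * t + n0), (0 < x)%N, (0 < y)%N & [/\ x <> y, col x = col y & (x + y = 2 * phin f D.+1 t)%N]].
Proof.
set k := D.+2; have [kap kap0 hsieve] := sieve_majorant R k.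
(* The length [M] of the range of the values [phi t + L kk], divided by the number
   [f_(D+1) * N ^ (D+1)] of pairs [(t, kk)] in an unshifted window. *)
pose C : R := (2 * 3 ^ D.+1 + 1)%:R; have C0 : 0 < C by rewrite ltr0n addn1.
pose del := Num.min 1 (kap / (128 * C)).
have del01 : 0 < del <= 1.
  by rewrite lt_min ltr01 divr_gt0 ?mulr_gt0 //= ge_min lexx.
have delC : C * del <= kap / 128.
  apply: (@le_trans _ _ (C * (kap / (128 * C)))); first by rewrite ler_pM2l // ge_min lexx orbT.
  by rewrite le_eqVlt; apply/orP; left; apply/eqP; move: C0; clear; move: (C) => x x0; field; exact: lt0r_neq0.
have [K [M0 hrep]] := rep_power_small m del01.
(* The two phase errors total [3 * 3 ^ K * eps = kap / 128] and the mean over distinct integers is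
   at most [C * del <= kap / 128], together below the mass [kap / 32] found on the primes. *)
pose eps := kap / (384 * 3 ^+ K); have eps0 : 0 < eps by rewrite divr_gt0 // mulr_gt0 // exprn_gt0.
have epsK : 3 ^+ K * eps + 3 ^+ K * (2 * eps) = kap / 128.
  have : 0 < 3 ^+ K :> R by rewrite exprn_gt0.
  by rewrite /eps; move: (3 ^+ K) => x x0; field; exact: lt0r_neq0.
(* The power [2 ^ k] is the one to which [smear_phase] raises the correlation. *)
have [w0 {}hsieve] := hsieve _ (exprn_gt0 (2 ^ k) eps0).
have [Qw Qw0 hweyl] := smear_weyl D eps0.
exists (w0 + Qw + D.+1)%N => w q n0 f w1w q1 cop hq f0 fp inj col.
have w0w : (w0 <= w)%N by apply: leq_trans w1w; rewrite -addnA leq_addr.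
have [N1 {}hsieve] := hsieve q n0 (ltnW q1) (fun p pp pw => hq p pp (leq_trans pw w0w)) (8 * k)%N.
pose L := (f D.+1 * D.+1`! * Qw`!)%N.
have L0 : (0 < L)%N by rewrite !muln_gt0 f0 !fact_gt0.
have {}inj : forall z d, phin f D.+1 (z + d) = phin f D.+1 z %[mod L] -> (L %| d)%N.
  apply: inj => // p pp; rewrite /L (Euclid_dvdM _ _ pp) (Euclid_dvdM _ _ pp) !(prime_dvdn_fact _ pp) => /orP[/orP[h|h]|h]; first exact: fp.
    exact: leq_trans h (leq_trans (leq_addl _ _) w1w).
  exact: leq_trans h (leq_trans (leq_trans (leq_addl _ _) (leq_addr _ _)) w1w).
(* Makes the hypothesis of [smear_weyl] on [A] hold as soon as [H >= B]: by [N <= 8 k H], the number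
   [A] of shifts has order [H ^ D], one power of [H] less than allowed. *)
pose B : R := (f D.+1 * (8 * k) ^ D)%:R * (tp R * (Qw`! * Qw)%:R) / eps.
have Bpos : 0 <= B by rewrite !mulr_ge0 ?invr_ge0 // ltW ?tp_gt0.
pose B1 := Num.bound B; have hB1 : B < B1%:R := archi_boundP Bpos.
pose N0 := (k * (Qw + B1 + 1) + N1 + \sum_(i < D.+1) f i + L + M0 + K)%N.
have [T [N0T T0 hT]] := prime_count_scales R q1 N0 cop.
set N := (4 * T)%N in hT; pose H := (T %/ k)%N.
have TN : (T <= N)%N by rewrite leq_pmull.
have kH : (k * H <= T)%N by rewrite mulnC leq_divM.
have HB : (Qw + B1 + 1 <= H)%N.
  rewrite leq_divRL //; apply: leq_trans N0T; rewrite /N0 [(_ * k)%N]mulnC.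
  by move: (k * _)%N (\sum_(_ < _) _)%N => x y; clear; lia.
have H0 : (0 < H)%N by apply: leq_trans HB; rewrite addn1.
have N8 : (N <= 8 * k * H)%N.
  have : (T < H.+1 * k)%N by apply: ltn_ceil.
  have : (k <= k * H)%N by rewrite leq_pmulr.
  by rewrite /N -mulnA mulSn [(H * k)%N]mulnC; move: (k * H)%N (k) => kk k'; clear; lia.
have N00 : (0 < N)%N by rewrite muln_gt0.
pose M := (f D.+1 * N ^ D.+1 * (2 * 3 ^ D.+1 + 1))%N.
have NM : (N <= M)%N.
  rewrite /M expnS -mulnA -mulnA mulnCA leq_pmulr // !muln_gt0 f0 expn_gt0 N00 addn1 //.
have TN0 (x : nat) : (x <= N0)%N -> (x <= N)%N by move=> h; apply: leq_trans h (leq_trans N0T TN).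
have N1N : (N1 <= N)%N by apply: TN0; rewrite /N0; clear; lia.
have sN : (\sum_(i < D.+1) f i <= N)%N by apply: TN0; rewrite /N0; move: (\sum_(i < _) _)%N => x; clear; lia.
have LN : (L <= N)%N by apply: TN0; rewrite /N0; clear; lia.
have MM : (M0 <= M)%N by apply: leq_trans NM; apply: TN0; rewrite /N0; clear; lia.
have KM : (K <= M)%N by apply: leq_trans NM; apply: TN0; rewrite /N0; clear; lia.
have HN : (H <= N)%N by apply: leq_trans TN; apply: leq_trans kH; rewrite leq_pmull.
have [nu [nu0 nup nuU]] := hsieve N H N1N H0 HN N8.
apply: contrapT => no.
pose r n := rep R M col n; pose Phi n := (1 - r n) ^+ K.
have Phi0 n : 0 <= Phi n by rewrite exprn_ge0 // subr_ge0 rep_le1.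
have rdiag t : prime (q * t + n0) -> r (phin f D.+1 t) <= (4 * M).+1%:R^-1.
  move=> pt; apply: rep_diag => x y x0 y0 hc hs; apply: contrapT => xy.
  by apply: no; exists t, x, y; split.
have PhiP t : prime (q * t + n0) -> 2^-1 <= Phi (phin f D.+1 t).
  move=> /rdiag h; set n := phin _ _ _ in h *.
  have r01 : 0 <= r n <= 1 by rewrite rep_ge0 rep_le1.
  apply: le_trans (expr1B_ge K r01).
  have : K%:R * r n <= K%:R * (4 * M).+1%:R^-1 by rewrite ler_wpM2l.
  have : K%:R * (4 * M).+1%:R^-1 <= 2^-1 :> R.
    rewrite ler_pdivrMr ?ltr0n // mulrC ler_pdivlMr // -natrM ler_nat.
    by move: KM; move: (M) => M'; clear; lia.
  by move: (K%:R * _) (K%:R * r n) => a b; clear; lra.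
pose A := (f D.+1 * N ^ D)%N; have A0 : (0 < A)%N by rewrite muln_gt0 f0 expn_gt0 N00.
have hA : A%:R * (tp R * (Qw`! * Qw)%:R) <= eps * H%:R ^+ D.+1.
  have hc : 0 <= tp R * (Qw`! * Qw)%:R by rewrite mulr_ge0 // ltW ?tp_gt0.
  apply: le_trans (_ : (f D.+1 * (8 * k * H) ^ D)%:R * (tp R * (Qw`! * Qw)%:R) <= _).
    rewrite ler_wpM2r // ler_nat leq_mul2l; apply/orP; right.
    by case: (D) => // i; rewrite leq_exp2r.
  have -> : (f D.+1 * (8 * k * H) ^ D)%:R * (tp R * (Qw`! * Qw)%:R) = B * eps * H%:R ^+ D.
    rewrite /B expnMn !natrM -!natrX; field; exact: lt0r_neq0.
  rewrite exprS mulrA [B * eps]mulrC ler_wpM2r ?exprn_ge0 // ler_pM2l //.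
  apply: le_trans (ltW hB1) _; rewrite ler_nat; apply: leq_trans HB; clear; lia.
pose L1 G := smear N k H (fun t => (nu t - 1) * G (phin f D.+1 t)).
pose L2 G := smear N k H (fun t => G (phin f D.+1 t)) -
  avg A (fun kk => smear N k H (fun t => G (phin f D.+1 t + L * kk)%N)).
have rng t kk : (N <= t < 2 * N + k * H)%N -> (kk < A)%N -> (phin f D.+1 t + L * kk <= 2 * M)%N.
  move=> /andP[Nt tN] kA; apply: leq_trans (_ : M <= _)%N; last by rewrite leq_pmull.
  apply: phin_range => //; rewrite Nt /=; apply: leq_trans (ltnW tN) _.
  by move: kH TN; clear; lia.
have rng0 t : (N <= t < 2 * N + k * H)%N -> (phin f D.+1 t <= 2 * M)%N.
  by move=> h; have := rng t 0%N h A0; rewrite muln0 addn0.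
have T1 : `|L1 Phi| <= 3 ^+ K * eps.
  apply: (rep_test col (M := M) (L := L1)).
  - by move=> F G; rewrite /L1 -smearD; apply: eq_smear => t _; rewrite mulrDr.
  - by move=> c F; rewrite /L1 -smearZ; apply: eq_smear => t _; rewrite mulrCA.
  - by move=> F G FG; apply: eq_smear => t /rng0 /FG ->.
  move=> th be; have hp := ldegS (ldeg_phin f D th be).
  have := smear_phase N (fun t => nu t - 1) H0 hp => h.
  rewrite -(ler_pXn2r (n := (2 ^ k)%N)) ?nnegrE ?expn_gt0 ?normr_ge0 ?(ltW eps0) //.
  exact: le_trans h nuU.
have T2 : `|L2 Phi| <= 3 ^+ K * (2 * eps).
  apply: (rep_test col (M := M) (L := L2)).
  - move=> F G; rewrite /L2 smearD (eq_avg (fun kk _ => smearD N k H _ _)) avgD; ring.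
  - move=> c F; rewrite /L2 smearZ (eq_avg (fun kk _ => smearZ N k H c _)) avgZ; ring.
  - move=> F G FG; rewrite /L2; congr (_ - _); first by apply: eq_smear => t /rng0 /FG.
    by apply: eq_avg => kk kA; apply: eq_smear => t ht; apply/FG/rng.
  move=> th be; apply: hweyl => //; apply: leq_trans HB; clear; lia.
have T3 : avg A (fun kk => smear N k H (fun t => Phi (phin f D.+1 t + L * kk)%N)) <= C * del.
  apply: le_trans (smear_count N00 H0 (leq_trans kH TN) f0 sN _ inj Phi0) _; first by rewrite L0.
  have fN : 0 < (f D.+1 * N ^ D.+1)%:R :> R by rewrite ltr0n muln_gt0 f0 expn_gt0 N00.
  rewrite mulrC ler_pdivrMr //; apply: le_trans (hrep M MM col) _.
  by rewrite /M natrM -/C; move: (_%:R : R) => x; rewrite le_eqVlt; apply/orP; left; apply/eqP; ring.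
have T4 : kap / 32 <= smear N k H (fun t => nu t * Phi (phin f D.+1 t)).
  apply: le_trans (smear_window T0 H0 kH _); last by move=> n; rewrite mulr_ge0.
  set c := kap * ((totient q)%:R / q%:R) * harm R N.
  have c0 : 0 <= c by rewrite !mulr_ge0 ?invr_ge0 ?harm_ge0 // ltW.
  apply: le_trans (_ : (4 * T)%:R^-1 * (\sum_(5 * T <= t < 8 * T) prime (q * t + n0)%N)%N%:R * (c / 2) <= _).
    have q0 : 0 < q%:R :> R by rewrite ltr0n ltnW.
    have N0' : 0 < N%:R :> R by rewrite ltr0n.
    have -> : kap / 32 = (kap / 2 / q%:R / N%:R) * (16^-1 * (q * N)%:R) by rewrite natrM; field; rewrite !gt_eqF.
    apply: le_trans (ler_wpM2l _ hT) _; first by rewrite !mulr_ge0 ?invr_ge0 // ltW.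
    by rewrite le_eqVlt; apply/orP; left; apply/eqP; rewrite /c -/N; field; rewrite !gt_eqF.
  rewrite -mulrA ler_wpM2l ?invr_ge0 // natr_sum mulr_suml big_seq_cond [leRHS]big_seq_cond; apply: ler_sum => t.
  rewrite mem_index_iota andbT => /andP[t5 _]; case: (boolP (prime _)) => pt; last by rewrite mul0r mulr_ge0.
  rewrite mul1r; apply: ler_pM => //; [by rewrite invr_ge0| |exact: PhiP].
  by apply: nup => //; rewrite /N; apply: leq_trans t5; rewrite leq_mul2r orbT.
have E1 : smear N k H (fun t => nu t * Phi (phin f D.+1 t)) = L1 Phi + L2 Phi +
  avg A (fun kk => smear N k H (fun t => Phi (phin f D.+1 t + L * kk)%N)).
  rewrite /L2 -addrA subrK /L1 -smearD; apply: eq_smear => t _; ring.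
move: T1 T2 T3 T4 delC epsK kap0; rewrite E1 !ler_norml.
move: (L1 Phi) (L2 Phi) (avg _ _) (C * del) (3 ^+ K * eps) (3 ^+ K * (2 * eps)) => a b c d e g.
by clear; lra.
Qed.

End Smear.

(** * Return to the given polynomial and colouring *)

Theorem theorem1p2 (m b0 W0 : nat)
    (hm : (0 < m)%N) (hb0 : (0 < b0)%N) (hW0 : (0 < W0)%N)
    (hbW : (b0 <= W0)%N) (hgcd : gcdn b0 W0 = 1%N)
    (psi : {poly int}) (hdeg : (1 < size psi)%N) (hlead : 0 < lead_coef psi)
    (heven : (2 %| W0)%N -> (2 %| psi.[1])%Z \/ (2 %| psi.[0])%Z)
    (hodd : ~~ (2 %| W0)%N -> (2 %| psi.[b0%:Z - 1])%Z)
    (color : {n : nat | (0 < n)%N} -> 'I_m) :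
  exists (x y : {n : nat | (0 < n)%N}) (z : int),
    [/\ x <> y, color x = color y, Lambda b0 W0 z
      & (val x)%:Z + (val y)%:Z = psi.[z]].
Proof.
have [D sD] : exists D, (size psi).-1 = D.+1.
  by exists (size psi).-2; rewrite prednK // -ltnS prednK // ltnW.
have [w1 hsum] := prime_value_sum Rdefinitions.R m D.
pose w := (w1 + 2 + `|lead_coef psi|)%N.
have w2 : (2 <= w)%N by rewrite /w -addnA addnCA leq_addr.
have lw : (`|lead_coef psi| <= w)%N by rewrite leq_addl.
have := reduction hb0 hW0 hgcd hdeg hlead heven hodd w2 lw; rewrite sD /=.
move=> [z0 [Q [S [E [f [[E0 Q0 psiE] [[q1 cop hq] [f0 fp _ inj]]]]]]]].
(* The form [.-1.+1] makes positivity hold by computation for every [x]; for positive [x] it leaves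
   the value [S + E x] unchanged. *)
pose col x := color (exist _ (S + E * x).-1.+1 isT).
have w1w : (w1 <= w)%N by rewrite /w -addnA leq_addr.
have [t [x [y [pt x0 y0 [xy hc hs]]]]] := hsum w _ _ f w1w q1 cop hq f0 fp inj col.
have val_pos z : (0 < z)%N -> ((S + E * z).-1.+1 = S + E * z)%N.
  by move=> z_gt0; rewrite prednK // addn_gt0 muln_gt0 E0 z_gt0 orbT.
exists (exist _ (S + E * x).-1.+1 isT), (exist _ (S + E * y).-1.+1 isT), (Q * t + z0)%N%:Z; split=> //.
- move=> /(congr1 val); rewrite /= !val_pos // => /eqP.
  by rewrite eqn_add2l eqn_pmul2l // => /eqP.
- exists (W0 * Q * t + (W0 * z0 + b0))%N => //.
  by rewrite -!PoszM -!PoszD; congr Posz; ring.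
rewrite psiE /= !val_pos // -PoszD; congr Posz.
by rewrite -mulnA mulnCA -hs; ring.
Qed.
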